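(* Let $\mu$ be a critical offspring distribution on $\mathbb{Z}_+$ with finite variance $\sigma^2>0$ whose support is non-lattice, and for $n\ge1$ (large enough) let $\mathcal{T}_n$ be a $\mu$-Galton–Watson tree conditioned to have exactly $n$ vertices. Let $\mathcal{A}\subset\mathbb{Z}_+$ be such that $\mu_{\mathcal{A}}>0$, and set $$\gamma_{\mathcal{A}}=\sqrt{\mu_{\mathcal{A}}(1-\mu_{\mathcal{A}})-\frac{1}{\sigma^2}\Big(\sum_{i\in\mathcal{A}}(i-1)\mu_i\Big)^2}.$$ Let $\mathbbm{e}$ be a normalized Brownian excursion and $B$ a standard Brownian motion independent of $\mathbbm{e}$. Then: (i) in distribution in $\mathbb{D}([0,1],\mathbb{R}^2)$, $$\left(\frac{W_{nt}(\mathcal{T}_n)}{\sqrt n},\frac{K^{\mathcal{A}}_{nt}(\mathcal{T}_n)-nt\mu_{\mathcal{A}}}{\sqrt n}\right)_{0\le t\le1}\longrightarrow\left(\sigma\mathbbm{e}_t,\ \frac{\sum_{i\in\mathcal{A}}(i-1)\mu_i}{\sigma}\mathbbm{e}_t+\gamma_{\mathcal{A}}B_t\right)_{0\le t\le1};$$ (ii) jointly with the convergence in (i), in distribution, $$\left(\frac{C_{2nt}(\mathcal{T}_n)}{\sqrt n},\frac{N^{\mathcal{A}}_{2nt}(\mathcal{T}_n)-nt\mu_{\mathcal{A}}}{\sqrt n}\right)_{0\le t\le1}\longrightarrow\left(\frac{2}{\sigma}\mathbbm{e}_t,\ \frac{\sum_{i\in\mathcal{A}}i\mu_i}{\sigma}\mathbbm{e}_t+\gamma_{\mathcal{A}}B_t\right)_{0\le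 t\le1}.$$
   Context: A plane tree $T$ is a finite subset of the set of finite words on $\{1,2,\dots\}$ containing the empty word $\emptyset$ (the root), closed under taking prefixes (the prefixes of $u$ are its ancestors), and such that for every $u\in T$ there is $k_u(T)\ge0$ (the outdegree of $u$) with $ui\in T$ iff $1\le i\le k_u(T)$. For an offspring distribution $\mu$ on $\mathbb{Z}_+$ (write $\mu_i=\mu(\{i\})$), a $\mu$-Galton–Watson tree is a random plane tree $\mathcal{T}$ with $\mathbb{P}(\mathcal{T}=T)=\prod_{u\in T}\mu_{k_u(T)}$; $\mu$ is critical if it has mean $1$. A set is non-lattice if it is not contained in $b+d\mathbb{Z}$ for any $b\in\mathbb{Z}$, $d\ge2$. For $\mathcal{A}\subset\mathbb{Z}_+$, $\mu_{\mathcal{A}}=\sum_{i\in\mathcal{A}}\mu_i$, and an $\mathcal{A}$-vertex is a vertex whose outdegree lies in $\mathcal{A}$. For a plane tree $T$ with $n$ vertices, let $v_0,\dots,v_{n-1}$ be its vertices in lexicographical (depth-first) order; the Lukasiewicz path is $W_0(T)=0$, $W_i(T)-W_{i-1}(T)=k_{v_{i-1}}(T)-1$ for $1\le i\le n$, and $W_t(T)=W_{\lfloor t\rfloor}(T)$; $K^{\mathcal{A}}_{nt}(T)$ is the number of $\mathcal{A}$-vertices among the first $\lfloor nt\rfloor$ vertices $v_0,\dots,v_{\lfloor nt\rfloor-1}$. The contour function $(C_t(T))_{0\le t\le 2n}$: a particle explores $T$ from left to right starting from the root, moving at unit speed along edges (each edge of length 1); for $0\le t\le2(n-1)$, $C_t(T)$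 is the distance to the root of the particle at time $t$, and $C_t(T)=0$ on $[2(n-1),2n]$. $N^{\mathcal{A}}_{2nt}(T)$ is the number of distinct $\mathcal{A}$-vertices visited by the contour exploration up to time $\lfloor 2nt\rfloor$. $\mathbb{D}([0,1],\mathbb{R}^2)$ carries the Skorokhod $J_1$ topology. *)

(* Defs.v *)
From HB Require Import structures.
From mathcomp Require Import all_boot all_order all_algebra finmap.
From mathcomp Require Import all_classical all_reals all_analysis.
Set Implicit Arguments. Unset Strict Implicit. Unset Printing Implicit Defensive.
Import Order.TTheory GRing.Theory Num.Def Num.Theory.
Import numFieldNormedType.Exports.
Local Open Scope classical_set_scope.
Local Open Scope ring_scope.

(* words on {1,2,...}: letters are positive naturals *)
Definition word := seq nat.

Definition is_plane_tree (T : {fset word}) : Prop :=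
  [::] \in T /\
  (forall u, u \in T -> all (fun i => 0 < i)%N u) /\
  (forall u k, u \in T -> take k u \in T) /\
  (forall u, u \in T -> exists k : nat,
       forall i : nat, (rcons u i \in T) <-> (1 <= i <= k)%N).

Definition nvert (T : {fset word}) : nat := #|` T|.

Definition outdeg (T : {fset word}) (u : word) : nat :=
  count (fun v : word => (size v == (size u).+1) && (take (size u) v == u))
        (enum_fset T).

Fixpoint lexle (u v : word) : bool :=
  match u, v with
  | [::], _ => true
  | _ :: _, [::] => false
  | a :: u', b :: v' => (a < b)%N || ((a == b) && lexle u' v')
  end.

Definition lex_vertices (T : {fset word}) : seq word := sort lexle (enum_fset T).
Definition vtx (T : {fset word}) (i : nat) : word := nth [::] (lex_vertices T) i.

Definition gw_weight {R : realType} (mu : nat -> R) (T : {fset word}) : R :=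
  \prod_(u <- enum_fset T) mu (outdeg T u).

Definition luka {R : realType} (T : {fset word}) (i : nat) : R :=
  \sum_(j < i) ((outdeg T (vtx T j))%:R - 1).

Definition Kcount (A : set nat) (T : {fset word}) (m : nat) : nat :=
  count (fun j => outdeg T (vtx T j) \in A) (iota 0 m).

(* contour exploration: state = (current vertex, number of children already
   explored); a step goes to the next unexplored child, or back to the parent *)
Definition contour_step (T : {fset word}) (s : word * nat) : word * nat :=
  let: (u, j) := s in
  if (j < outdeg T u)%N then (rcons u j.+1, 0%N)
  else (take (size u).-1 u, last 0%N u).

Definition contour_vtx (T : {fset word}) (k : nat) : word :=
  (iter k (contour_step T) ([::], 0%N)).1.

Definition contour_ht {R : realType} (T : {fset word}) (k : nat) : R :=
  (size (contour_vtx T k))%:R.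

Definition contour {R : realType} (T : {fset word}) (s : R) : R :=
  if s <= (2 * (nvert T).-1)%:R then
    let k := Num.truncn s in
    contour_ht T k + (s - k%:R) * (contour_ht T k.+1 - contour_ht T k)
  else 0.

(* N^A_m(T): number of distinct A-vertices visited by the contour exploration
   up to integer time m (the exploration ends at time 2(n-1)) *)
Definition Ncount (A : set nat) (T : {fset word}) (m : nat) : nat :=
  size (undup [seq v <- map (contour_vtx T) (iota 0 (minn m (2 * (nvert T).-1)).+1)
              | outdeg T v \in A]).

Definition sumA {R : realType} (A : set nat) (f : nat -> R) : R :=
  limn (series (fun i => if i \in A then f i else 0)).

Definition nonlattice (S : set nat) : Prop :=
  forall (b : int) (d : nat), (2 <= d)%N ->
    ~ (forall i, S i -> (d%:Z %| (i%:Z - b))%Z).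

Definition dist2 {R : realType} (p q : R * R) : R :=
  Num.max `|p.1 - q.1| `|p.2 - q.2|.

Definition cadlag {R : realType} (x : R -> R * R) : Prop :=
  (forall t : R, 0 <= t < 1 -> x s @[s --> t^'+] --> x t) /\
  (forall t : R, 0 < t <= 1 -> exists l : R * R, x s @[s --> t^'-] --> l).

(* x and y are within J1-distance delta (up to the non-strict boundary, which
   does not affect the induced topology) *)
Definition j1_close {R : realType} (delta : R) (x y : R -> R * R) : Prop :=
  exists lam : R -> R,
    [/\ lam 0 = 0, lam 1 = 1, {within `[0, 1], continuous lam},
        {in `[0, 1] &, forall s t, s < t -> lam s < lam t} &
        forall t, 0 <= t <= 1 -> `|lam t - t| < delta /\ dist2 (x t) (y (lam t)) < delta].

Definition bdd_cont_D {R : realType} (F : (R -> R * R) -> R) : Prop :=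
  (exists M : R, forall x, cadlag x -> `|F x| <= M) /\
  (forall x, cadlag x -> forall eps : R, 0 < eps -> exists2 delta : R, 0 < delta &
     forall y, cadlag y -> j1_close delta x y -> `|F x - F y| < eps).

Definition bdd_cont_DD {R : realType} (F : (R -> R * R) -> (R -> R * R) -> R) : Prop :=
  (exists M : R, forall x1 x2, cadlag x1 -> cadlag x2 -> `|F x1 x2| <= M) /\
  (forall x1 x2, cadlag x1 -> cadlag x2 -> forall eps : R, 0 < eps ->
     exists2 delta : R, 0 < delta &
     forall y1 y2, cadlag y1 -> cadlag y2 -> j1_close delta x1 y1 ->
       j1_close delta x2 y2 -> `|F x1 x2 - F y1 y2| < eps).

Definition WK_proc {R : realType} (A : set nat) (muA : R) (n : nat)
  (T : {fset word}) (t : R) : R * R :=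
  (luka T (Num.truncn (n%:R * t)) / Num.sqrt n%:R,
   ((Kcount A T (Num.truncn (n%:R * t)))%:R - n%:R * t * muA) / Num.sqrt n%:R).

Definition CN_proc {R : realType} (A : set nat) (muA : R) (n : nat)
  (T : {fset word}) (t : R) : R * R :=
  (contour T (2 * n%:R * t) / Num.sqrt n%:R,
   ((Ncount A T (Num.truncn (2 * n%:R * t)))%:R - n%:R * t * muA) / Num.sqrt n%:R).

Definition cyl {Omega : Type} {R : realType} (X : Omega -> R -> R)
  (us : seq (R * set R)) : set Omega :=
  [set w | foldr (fun p acc => p.2 (X w p.1) /\ acc) True us].

Definition borel_specs {R : realType} (us : seq (R * set R)) : Prop :=
  foldr (fun p acc => measurable p.2 /\ acc) True us.

Definition times_in {R : realType} (D : set R) (us : seq (R * set R)) : Prop :=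
  foldr (fun p acc => D p.1 /\ acc) True us.

Definition is_std_BM {R : realType} {d : measure_display} {Omega : measurableType d}
  (P : probability Omega R) (B : Omega -> R -> R) : Prop :=
  [/\ (forall t, measurable_fun setT (fun w => B w t)),
      (forall w, B w 0 = 0),
      (forall w, {within `[0, +oo[, continuous (B w)}),
      (forall s t : R, 0 <= s < t -> forall A : set R, measurable A ->
          P [set w | A (B w t - B w s)] = normal_prob 0 (Num.sqrt (t - s)) A) &
      (forall s t : R, 0 <= s < t -> forall A : set R, measurable A ->
        forall us, borel_specs us -> times_in `[0, s] us ->
          P ([set w | A (B w t - B w s)] `&` cyl B us) =
          (P [set w | A (B w t - B w s)%R] * P (cyl B us))%E)].

Definition exc_q {R : realType} (t x : R) : R :=
  x / Num.sqrt (2 * pi * t ^+ 3) * expR (- x ^+ 2 / (2 * t)).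

(* killed heat kernel p*_t(x,y) *)
Definition exc_p {R : realType} (t x y : R) : R :=
  (Num.sqrt (2 * pi * t))^-1 *
  (expR (- (x - y) ^+ 2 / (2 * t)) - expR (- (x + y) ^+ 2 / (2 * t))).

Fixpoint exc_aux {R : realType} (tp xp : R) (us : seq (R * set R)) : \bar R :=
  match us with
  | [::] => (exc_q (1 - tp) xp)%:E
  | p :: us' =>
      (\int[@lebesgue_measure R]_(x in p.2 `&` [set x : R | (0 < x)%R])
          ((exc_p (p.1 - tp) xp x)%:E * exc_aux p.1 x us'))%E
  end.

(* P(e_{t_1} in A_1, ..., e_{t_k} in A_k) for 0 < t_1 < ... < t_k < 1:
   the density is 2 sqrt(2 pi) q_{t_1}(x_1) prod p*_{t_{i+1}-t_i}(x_i,x_{i+1})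
   q_{1-t_k}(x_k) on (0,oo)^k *)
Definition exc_fdd {R : realType} (us : seq (R * set R)) : \bar R :=
  match us with
  | [::] => 1%E
  | p :: us' =>
      ((2 * Num.sqrt (2 * pi))%:E *
       \int[@lebesgue_measure R]_(x in p.2 `&` [set x : R | (0 < x)%R])
          ((exc_q p.1 x)%:E * exc_aux p.1 x us'))%E
  end.

Definition is_norm_excursion {R : realType} {d : measure_display}
  {Omega : measurableType d} (P : probability Omega R) (e : Omega -> R -> R) : Prop :=
  [/\ (forall t, measurable_fun setT (fun w => e w t)),
      (forall w, e w 0 = 0 /\ e w 1 = 0),
      (forall w, {within `[0, 1], continuous (e w)}) &
      (forall us : seq (R * set R), borel_specs us -> times_in `]0, 1[ us ->
         sorted (fun p q => p.1 < q.1) us ->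
         P (cyl e us) = exc_fdd us)].

Definition indep_processes {R : realType} {d : measure_display}
  {Omega : measurableType d} (P : probability Omega R) (e B : Omega -> R -> R) : Prop :=
  forall us vs : seq (R * set R), borel_specs us -> borel_specs vs ->
    P (cyl e us `&` cyl B vs) = (P (cyl e us) * P (cyl B vs))%E.

(* Main.v *)
(** The degrees of the vertices of a plane tree in depth-first order are the increments (plus one)
    of its Lukasiewicz path, so that a conditioned Galton-Watson tree is a random walk conditioned to
    hit -1 for the first time at time n.  By the cycle lemma the probability of this event is
    1/n times a bridge probability, which the local limit theorem evaluates.  The pair of the walk
    and of the centred A-count minus its projection on the walk has, by Fourier inversion, finite-dimensional
    transforms converging to those of an excursion and of an independent Brownian motion; these are
    identified through the Chapman-Kolmogorov recursion for the transforms of both sides.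
    Tightness of the walks follows from that of bridges by rotation and from exponential tilting.
    The height of a vertex is the length of the stack of its ancestors with unvisited children, and the
    walk is the sum of this stack, whose entries behave like independent variables of mean
    sigma^2/2: a Green function bound makes deviations from this law of large numbers negligible.
    The contour function visits vertex p near time 2p minus the height of p, which transfers
    the convergence from the depth-first to the contour order. *)

From HB Require Import structures.
From mathcomp Require Import all_boot all_order all_algebra finmap.
From mathcomp Require Import all_classical all_reals all_analysis.
From mathcomp Require Import measurable_realfun ring lra zify.
Require Import Defs.
Set Implicit Arguments. Unset Strict Implicit. Unset Printing Implicit Defensive.
Import Order.TTheory GRing.Theory Num.Def Num.Theory.
Import numFieldNormedType.Exports.
Local Open Scope classical_set_scope.
Local Open Scope ring_scope.

(** * Path sums and the cycle lemma *)

(** Discrete laws are finite weighted sums over degree words, and Fourier identities are kept real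
    by a free phase inside the cosine. The test functionals mix a Gaussian weight exp(-lam x^2) in
    each height with a cosine in the additive functional: such a weight only changes the time
    parameter of the first-passage kernel, 1/tau' = 1/tau + 2 sigma^2 lam, so the recursions for the
    tree and for the excursion stay within one family of kernels and match term by term. The
    projection removed from the A-count has slope a = m1/sigma^2; the rest is uncorrelated with the
    walk, which gives independence in the limit, and has variance gamma_A^2. Only two moments of the
    offspring are available, hence one moment for the entries of the stack. Heights too large for
    the walk are exponentially unlikely at every time, but heights too small are not; the lower
    bound is obtained at some nearby time and carried over. Continuous functionals of paths are
    approached from below by Lipschitz inf-convolutions evaluated on finitely many samples. The
    slope m2 = m1 + mu_A appears because at contour time 2nt about half the height more than nt
    vertices have been seen. *)

Notation mfunT f := (measurable_fun setT f) (only parsing).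
Notation sqn n := (Num.sqrt n%:R) (only parsing).
Notation le_via y := (@le_trans _ _ y) (only parsing).
Ltac derive_eq := apply: is_derive_eq; rewrite /GRing.scale/=.

Lemma eq_le_val {R : realType} (x y : R) : x = y -> x <= y.
Proof. by move=> ->. Qed.

Lemma sqrt_nat_unbounded {R : realType} (x : R) : \forall n \near \oo, x <= sqn n.
near=> n;have h: `|x|^+2 <= n%:R by near: n;exact: nbhs_infty_ger.
by apply: (le_trans (ler_norm x));rewrite -sqrtr_sqr ler_sqrt// -(real_normK (num_real x)).
Unshelve. all: end_near. Qed.

Ltac near_nat n := near: n; first [exact: nbhs_infty_gt | exact: nbhs_infty_ger
  | exact: nbhs_infty_ge | exact: sqrt_nat_unbounded].

Section PathSums.
Context {R : realType}.
Implicit Types (w : nat -> R) (N m : nat) (F G : seq nat -> R).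

(** Unnormalised expectation over [m] independent letters below [N] with weights [w]. A tree with
    [n] vertices has all its degrees below [n], so the cutoff [N = n.+1] used later loses no
    tree. *)
Fixpoint psum w N m F : R :=
  if m is m'.+1 then \sum_(k < N) w k * psum w N m' (fun s => F (nat_of_ord k :: s))
  else F [::].

Lemma eq_psum w N m F G :
  (forall s, size s = m -> all (fun k => k < N)%N s -> F s = G s) ->
  psum w N m F = psum w N m G.
elim: m F G=> [|m IH] F G h /=;first exact: h.
by apply: eq_bigr=> k _;congr (_ * _);apply: IH=> s ss sN;apply: h;rewrite /= ?ss ?ltn_ord.
Qed.

Lemma psumD w N m F G :
  psum w N m (fun s => F s + G s) = psum w N m F + psum w N m G.
elim: m F G=> [//|m IH] F G /=;rewrite -big_split/=.
by apply: eq_bigr=> k _;rewrite IH mulrDr.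
Qed.

Lemma psumZ w N m c F : psum w N m (fun s => c * F s) = c * psum w N m F.
elim: m F=> [//|m IH] F /=;rewrite mulr_sumr.
by apply: eq_bigr=> k _;rewrite IH mulrCA.
Qed.

Lemma psumZr w N m c F : psum w N m (fun s => F s * c) = psum w N m F * c.
Proof. by rewrite mulrC -psumZ;apply: eq_psum=> s _ _;rewrite mulrC. Qed.

Lemma psumN w N m F : psum w N m (fun s => - F s) = - psum w N m F.
Proof. by rewrite -mulN1r -psumZ;apply: eq_psum=> s _ _;rewrite mulN1r. Qed.

Lemma psumB w N m F G :
  psum w N m (fun s => F s - G s) = psum w N m F - psum w N m G.
Proof. by rewrite psumD psumN. Qed.

Lemma psum0 w N m : psum w N m (fun=> 0) = 0.
Proof. by elim: m=> [//|m IH] /=;rewrite big1// => k _;rewrite IH mulr0. Qed.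

Lemma psum_sum w N m (I : Type) (r : seq I) (P : pred I) (F : I -> seq nat -> R) :
  psum w N m (fun s => \sum_(i <- r | P i) F i s) = \sum_(i <- r | P i) psum w N m (F i).
elim: r=> [|i r IH].
 by rewrite big_nil -[RHS](psum0 w N m);apply: eq_psum=> s;rewrite big_nil.
rewrite big_cons -IH;case: ifP=> Pi;[rewrite -psumD|];
 by apply: eq_psum=> s _ _;rewrite big_cons Pi.
Qed.

Lemma psum_ler w N m F G : (forall k, 0 <= w k) ->
  (forall s, size s = m -> all (fun k => k < N)%N s -> F s <= G s) ->
  psum w N m F <= psum w N m G.
move=> w0;elim: m F G=> [|m IH] F G h /=;first exact: h.
apply: ler_sum=> k _;apply: ler_wpM2l=> //.
by apply: IH=> s ss sN;apply: h;rewrite /= ?ss ?ltn_ord.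
Qed.

Lemma psum_ge0 w N m F : (forall k, 0 <= w k) ->
  (forall s, size s = m -> all (fun k => k < N)%N s -> 0 <= F s) -> 0 <= psum w N m F.
Proof. by move=> w0 h;rewrite -[leLHS](psum0 w N m);exact: psum_ler. Qed.

Lemma psum_norm w N m F : (forall k, 0 <= w k) ->
  `|psum w N m F| <= psum w N m (fun s => `|F s|).
move=> w0;rewrite ler_norml -psumN;apply/andP;split;apply: psum_ler=> // s _ _.
 by rewrite lerNl -normrN ler_norm.
exact: ler_norm.
Qed.

Lemma psum_prod w N m (g : nat -> R) :
  psum w N m (fun s => \prod_(k <- s) g k) = (\sum_(k < N) w k * g k) ^+ m.
elim: m=> [|m IH] /=;first by rewrite big_nil expr0.
rewrite exprS mulr_suml;apply: eq_bigr=> k _;rewrite -mulrA -IH -[in RHS]psumZ.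
by congr (_ * _);apply: eq_psum=> s _ _;rewrite big_cons.
Qed.

Lemma psum_cst w N m c : psum w N m (fun=> c) = (\sum_(k < N) w k) ^+ m * c.
transitivity (psum w N m (fun s=> (\prod_(k <- s) 1) * c)).
 by apply: eq_psum=> s _ _;rewrite big1 ?mul1r.
by rewrite psumZr psum_prod;under eq_bigr do rewrite mulr1.
Qed.

Lemma psum_cat w N a b F :
  psum w N (a + b) F = psum w N a (fun s => psum w N b (fun t => F (s ++ t))).
Proof. by elim: a F=> [//|a IH] F;rewrite addSn /=;apply: eq_bigr=> k _;rewrite IH. Qed.

Lemma psum_exchange w w' N N' a b (F : seq nat -> seq nat -> R) :
  psum w N a (fun s => psum w' N' b (fun t => F s t)) =
  psum w' N' b (fun t => psum w N a (fun s => F s t)).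
elim: a F=> [//|a IH] F /=;rewrite psum_sum;apply: eq_bigr=> k _.
by rewrite IH -psumZ.
Qed.

Lemma psum_rot w N m i F : (i <= m)%N ->
  psum w N m (fun s => F (rot i s)) = psum w N m F.
move=> im;rewrite -[in LHS](subnKC im) psum_cat.
rewrite -[in RHS](subnK im) psum_cat psum_exchange.
by apply: eq_psum=> t ti _;apply: eq_psum=> s si _;rewrite -si rot_size_cat.
Qed.

Lemma psum_rcons w N m F :
  psum w N m.+1 F = psum w N m (fun s => \sum_(k < N) w k * F (rcons s k)).
rewrite -addn1 psum_cat;apply: eq_psum=> s _ _ /=.
by apply: eq_bigr=> k _;rewrite cats1.
Qed.

Lemma psum_le1 w N m F : (forall k, 0 <= w k) -> \sum_(k < N) w k <= 1 ->
  (forall s, size s = m -> all (fun k => k < N)%N s -> F s <= 1) -> psum w N m F <= 1.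
move=> w0 w1 F1;apply: (le_via (psum w N m (fun=> 1)));first exact: psum_ler.
by rewrite psum_cst mulr1 exprn_ile1// sumr_ge0.
Qed.

(** The forgotten letters carry total mass at most 1; truncated weights are only sub-probabilities,
    whence an inequality. *)
Lemma psum_take w N a b F : (forall k, 0 <= w k) -> \sum_(k < N) w k <= 1 ->
  (forall s, 0 <= F s) ->
  psum w N (a + b) (fun s => F (take a s)) <= psum w N a F.
move=> w0 w1 F0;rewrite psum_cat;apply: psum_ler=> // s sa _.
rewrite -[leRHS]mul1r.
rewrite (@eq_psum _ _ _ _ (fun=> F s));last by move=> t _ _;rewrite -sa take_size_cat.
by rewrite psum_cst ler_wpM2r// exprn_ile1// sumr_ge0.
Qed.

(** A rotation brings any position to the front, so each of the [m.+1] letters has the same weighted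
    sum; added together they give [sumn]. *)
Lemma psum_head w N m F : (forall i s, F (rot i s) = F s) ->
  m.+1%:R * psum w N m.+1 (fun s => (head 0%N s)%:R * F s) =
  psum w N m.+1 (fun s => (sumn s)%:R * F s).
move=> Frot.
transitivity (psum w N m.+1 (fun s=> \sum_(i < m.+1) (nth 0%N s i)%:R*F s));last first.
 apply: eq_psum=> s sm _;rewrite -mulr_suml -natr_sum;congr (_%:R * _).
 by rewrite sumnE (big_nth 0%N) sm big_mkord.
rewrite psum_sum;transitivity (\sum_(i < m.+1) psum w N m.+1 (fun s=> (head 0%N s)%:R*F s)).
 by rewrite sumr_const card_ord mulr_natl.
apply: eq_bigr=> i _;rewrite -(@psum_rot _ _ _ i) 1?ltnW//.
apply: eq_psum=> s sm _;rewrite Frot;congr (_%:R * _).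
by rewrite /rot (drop_nth 0%N) ?sm.
Qed.

End PathSums.

(** * First passage of walks that go down by at most one *)

Section Hits.

(** The walk starts at [p], moves by [k - 1] for each letter [k], and must reach 0 for the first
    time with the last letter. With [p = 1] it counts the vertices discovered but not yet explored,
    so [hits 1] singles out the depth-first degree words of trees. *)
Fixpoint hits (p : nat) (s : seq nat) : bool :=
  if s is k :: s' then (0 < p)%N && hits (p.-1 + k) s' else p == 0%N.

Fixpoint alive (p : nat) (s : seq nat) : bool :=
  (0 < p)%N && (if s is k :: s' then alive (p.-1 + k) s' else true).

Definition pend (p : nat) (s : seq nat) := foldl (fun p k => (p.-1 + k)%N) p s.

Lemma hits_sum p s : hits p s -> (sumn s + p = size s)%N.
Proof. by elim: s p=> [|k s IH] p /=;[move/eqP|case/andP=> p0 /IH;lia]. Qed.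

Lemma pend_alive p s : alive p s -> (pend p s + size s = p + sumn s)%N.
elim: s p=> [|k s IH] p /=;first by rewrite /pend/= !addn0.
by case/andP=> p0 /IH;rewrite /pend /=;lia.
Qed.

Lemma alive_pend p s : alive p s -> (0 < pend p s)%N.
Proof. by elim: s p=> [|k s IH] p /= /andP[]// _ /IH. Qed.

Lemma hits_cat p s t : (0 < size t)%N -> hits p (s ++ t) = alive p s && hits (pend p s) t.
case: t=> [//|b t] _;elim: s p=> [|k s IH] p /=;last by rewrite IH andbA.
by rewrite /pend /= andbT;case: (0 < p)%N.
Qed.

(** Cut the word into blocks [u] and [v]. As first block of a hitting word, [v] satisfies
    [sumn v >= size v]; as last block, started from a positive level, it satisfies
    [sumn v < size v]. *)
Lemma hits_rot s i : (0 < i < size s)%N -> hits 1 s -> hits 1 (rot i s) -> False.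
move=> /andP[i0 is_] hs;rewrite /rot;move: hs;rewrite -{1}(cat_take_drop i s).
rewrite !hits_cat ?size_drop ?size_take ?is_ ?subn_gt0//.
move=> /andP[/[dup] /pend_alive e1 /alive_pend p1 /hits_sum e2].
move=> /andP[/[dup] /pend_alive e3 /alive_pend p3 /hits_sum e4].
lia.
Qed.

Context {R : realType}.

(* Kemperman's formula, by conditioning on the first step: the mean first step of a
   path ending at given height is forced by exchangeability.  Quantifying over all
   symmetric functionals makes the induction go through. *)
Lemma kemperman (w : nat -> R) N m p (F : seq nat -> R) :
  (forall s t, perm_eq s t -> F s = F t) ->
  m%:R * psum w N m (fun s => (hits p s)%:R * F s) =
  p%:R * psum w N m (fun s => (sumn s + p == m)%:R * F s).
elim: m p F=> [|m IH] p F Fp;first by case: p=> [|p];rewrite ?mul0r//= mul0r mulr0.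
case: p=> [|p].
 rewrite mul0r (_ : psum _ _ _ _ = 0) ?mulr0// -[RHS](psum0 w N m.+1).
 by apply: eq_psum=> -[|k s]//= _ _;rewrite mul0r.
have Frot i s: (sumn (rot i s)+p.+1 == m.+1)%:R*F (rot i s) =
        (sumn s+p.+1 == m.+1)%:R*F s.
 have rs: perm_eq (rot i s) s by rewrite perm_rot.
 by rewrite (perm_sumn rs) (Fp _ _ rs).
set B:= psum w N m.+1 (fun s=> (sumn s+p.+1 == m.+1)%:R*F s).
have n0: m.+1%:R != 0 :> R by rewrite pnatr_eq0.
set A:= psum w N m.+1 (fun s=> (head 0%N s)%:R*((sumn s+p.+1 == m.+1)%:R*F s)).
(* The indicator forces [sumn s = m - p], and symmetry shares this total equally among the letters:
   this is the mean first step. *)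
have eA: m.+1%:R*A = (m%:R-p%:R)*B.
 rewrite psum_head// -psumZ;apply: eq_psum=> s _ _.
 case: eqP=> [e|];last by rewrite !mul0r !mulr0.
 by congr (_ * _);have ->: m = (sumn s+p)%N by [lia];rewrite natrD addrK.
rewrite /=;set X:= \sum_(k < N) _.
have key: m%:R*X = p%:R*B+A.
 rewrite -psumZ -psumD mulr_sumr /=;apply: eq_bigr=> k _.
 rewrite mulrCA;congr (_ * _);rewrite IH;last first.
  by move=> s t st;apply: Fp;rewrite perm_cons.
 rewrite -psumZ;apply: eq_psum=> s _ _ /=.
 rewrite natrD -mulrDl;congr (_*((nat_of_bool _)%:R * _)).
 by apply/idP/idP=> /eqP ?;apply/eqP;lia.
(* The factor [m] in [key] has to be cancelled, so words of a single letter are checked by hand. *)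
case: m=> [|m] in X B A n0 eA key IH Frot *.
 rewrite mul1r /X /B /= mulr_sumr;apply: eq_bigr=> k _.
 rewrite addn0;case: p {Frot eA key X B A}=> [|p].
  rewrite mul1r;congr (_*((nat_of_bool _)%:R * _)).
  by apply/idP/idP=> /eqP ?;apply/eqP;lia.
 have ->: (k+p.+2 == 1)%N = false by apply/eqP;lia.
 by rewrite !mul0r !mulr0.
have m0: m.+1%:R != 0 :> R by rewrite pnatr_eq0.
apply: (mulfI m0);rewrite mulrCA key mulrDr eA -[p.+1%:R]natr1 -[m.+2%:R]natr1.
by ring.
Qed.

Lemma hits_rot_sum s (m := size s) : (0 < m)%N ->
  (\sum_(i < m) (hits 1 (rot i s))%:R : R) <= (sumn s + 1 == m)%:R.
move=> m0;case: (pickP (fun i : 'I_m=> hits 1 (rot i s)))=> [i hi|h0];last first.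
 by rewrite big1 ?ler0n// => i _;rewrite h0.
have ->: (sumn s+1 == m)%N.
 have rs: perm_eq (rot i s) s by rewrite perm_rot.
 by move/hits_sum: hi;rewrite size_rot (perm_sumn rs)=> ->.
rewrite (bigD1 i)//= hi big1 ?addr0// => j ji;case: (boolP (hits 1 _))=> // hj;exfalso.
wlog ij: i j hi hj ji/(i < j)%N.
 move=> W;case: (ltngtP i j)=> [/W|/W|/val_inj e];last by rewrite e eqxx in ji.
  exact.
 by apply=> //;rewrite eq_sym.
apply: (@hits_rot (rot i s) (j-i))=> //;first by rewrite size_rot subn_gt0 ij/=;have:= ltn_ord j;rewrite /m;lia.
have ->: rot (j-i) (rot i s) = rot j s;last exact: hj.
by rewrite -rotD ?subnK ?(ltnW ij)// -/m ltnW.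
Qed.

(** Kemperman's identity asks for invariance under all permutations, whereas oscillation events are
    only invariant under rotations. For these, at most one rotation of a word hits, and averaging
    over rotations gives the upper bound. *)
Lemma cycle_ineq (w : nat -> R) N m (F : seq nat -> R) : (forall k, 0 <= w k) ->
  (forall i s, F (rot i s) = F s) -> (forall s, 0 <= F s) ->
  m%:R * psum w N m (fun s => (hits 1 s)%:R * F s) <=
  psum w N m (fun s => (sumn s + 1 == m)%:R * F s).
move=> w0 Frot F0;case: m=> [|m].
 by rewrite mul0r;apply: psum_ge0=> // s _ _;rewrite mulr_ge0.
apply: (le_via (psum w N m.+1 (fun s=> (\sum_(i < m.+1) (hits 1 (rot i s))%:R)*F s))).
 apply: eq_le_val.
 rewrite [RHS](@eq_psum _ _ _ _ _ (fun s=> \sum_(i < m.+1) (hits 1 (rot i s))%:R*F s));last first.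
  by move=> s _ _;rewrite mulr_suml.
 rewrite psum_sum.
 transitivity (\sum_(i < m.+1) psum w N m.+1 (fun s=> (hits 1 s)%:R*F s)).
  by rewrite sumr_const card_ord mulr_natl.
 apply: eq_bigr=> i _;rewrite -(@psum_rot _ _ _ _ i) 1?ltnW//.
 by apply: eq_psum=> s _ _;rewrite Frot.
apply: psum_ler=> // s sm _;apply: ler_wpM2r=> //.
by rewrite -sm;apply: hits_rot_sum;rewrite sm.
Qed.

End Hits.

(** * Gaussian integrals *)

Section SegmentIntegral.
Context {R : realType}.
Implicit Types (f g F : R -> R) (a b c : R).
Notation leb := (@lebesgue_measure R).

Definition sint a b f : R := \int[leb]_(x in `[a, b]) f x.

Lemma sintegrable a b f : continuous f -> leb.-integrable `[a, b] (EFin \o f).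
move=> cf;apply: continuous_compact_integrable;first exact: segment_compact.
exact: continuous_subspaceT.
Qed.

Lemma sintD a b f g : continuous f -> continuous g ->
  sint a b (fun x => f x + g x) = sint a b f + sint a b g.
Proof. by move=> cf cg;apply: RintegralD=> //;exact: sintegrable. Qed.

Lemma sintB a b f g : continuous f -> continuous g ->
  sint a b (fun x => f x - g x) = sint a b f - sint a b g.
Proof. by move=> cf cg;apply: RintegralB=> //;exact: sintegrable. Qed.

Lemma sintZ a b k f : continuous f -> sint a b (fun x => k * f x) = k * sint a b f.
Proof. by move=> cf;apply: RintegralZl=> //;exact: sintegrable. Qed.

Lemma sint_cst a b k : a <= b -> sint a b (fun=> k) = k * (b - a).
rewrite le_eqVlt=> /predU1P[->|ab];rewrite /sint Rintegral_cst//= lebesgue_measure_itv/= lte_fin.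
 by rewrite ltxx subrr.
by rewrite ab.
Qed.

Lemma le_sint a b f g : continuous f -> continuous g ->
  (forall x, a <= x <= b -> f x <= g x) -> sint a b f <= sint a b g.
by move=> cf cg fg;apply: le_Rintegral=> //;exact: sintegrable.
Qed.

Lemma eq_sint a b f g : (forall x, a <= x <= b -> f x = g x) -> sint a b f = sint a b g.
Proof. by move=> fg;apply: eq_Rintegral=> x;rewrite inE/= in_itv/=;exact: fg. Qed.

Lemma continuous_norm f : continuous f -> continuous (fun x => `|f x|).
Proof. by move=> cf x;apply: continuous_comp;[exact: cf|exact: norm_continuous]. Qed.

Lemma norm_sint a b f : continuous f -> `|sint a b f| <= sint a b (fun x => `|f x|).
Proof. by move=> cf;apply: le_normr_Rintegral=> //;exact: sintegrable. Qed.

Lemma norm_sintB_le a b f g h : continuous f -> continuous g -> continuous h ->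
  (forall x, a <= x <= b -> `|f x - g x| <= h x) -> `|sint a b f - sint a b g| <= sint a b h.
move=> cf cg ch fgh;have cfg: continuous (fun x=> f x-g x).
 by move=> x;apply: continuousB;[exact: cf|exact: cg].
rewrite -sintB//;apply: (le_trans (norm_sint a b cfg)).
by apply: le_sint=> //;exact: continuous_norm.
Qed.

Lemma sint_split a b c f : a <= c -> c <= b -> continuous f ->
  sint a b f = sint a c f + sint c b f.
move=> ac cb cf;apply/eqP;rewrite addrC -subr_eq;apply/eqP;rewrite /sint.
rewrite Rintegral_itvB ?bnd_simp//;last exact: sintegrable.
rewrite Rintegral_itv_obnd_cbnd//.
apply: integrableS (sintegrable c b cf)=> //.
by apply: subset_itvr;rewrite bnd_simp.
Qed.

Lemma sint_FTC F f a b : a <= b -> continuous f -> (forall x : R, is_derive x (1:R) F (f x)) ->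
  sint a b f = F b - F a.
rewrite le_eqVlt=> /predU1P[->|ab] cf dF.
 by rewrite subrr /sint set_itv1 Rintegral_set1.
rewrite /sint /Rintegral (@continuous_FTC2 _ f F) -?EFinB//.
- exact: continuous_subspaceT.
- have cF: continuous F.
  by move=> x;apply: differentiable_continuous;apply/derivable1_diffP;have []:= dF x.
 split.
 + by move=> x _;have []:= dF x.
 + by apply: cvg_at_right_filter;exact: cF.
 + by apply: cvg_at_left_filter;exact: cF.
- by move=> x _;rewrite derive1E;have []:= dF x.
Qed.

Lemma continuous_sumr (I : Type) (r : seq I) (F : I -> R -> R) :
  (forall i, continuous (F i)) -> continuous (fun v => \sum_(i <- r) F i v).
move=> cF;elim: r=> [|i r IH].
 by under eq_fun do rewrite big_nil;move=> x;exact: cst_continuous.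
by under eq_fun do rewrite big_cons;move=> x;apply: continuousD;[exact: cF|exact: IH].
Qed.

Lemma continuous_psum w N m (F : R -> seq nat -> R) :
  (forall s, continuous (F ^~ s)) -> continuous (fun v => psum w N m (F v)).
elim: m F=> [|m IH] F cF /=;first exact: cF.
apply: continuous_sumr=> k x;apply: continuousM;first exact: cst_continuous.
exact: IH.
Qed.

Lemma sint_sum (I : Type) (r : seq I) (F : I -> R -> R) a b :
  (forall i, continuous (F i)) ->
  sint a b (fun v => \sum_(i <- r) F i v) = \sum_(i <- r) sint a b (F i).
move=> cF;elim: r=> [|i r IH].
 rewrite big_nil (@eq_sint _ _ _ (fun=> 0))=> [|x _];last by rewrite big_nil.
 by rewrite /sint Rintegral_cst// mul0r.
rewrite big_cons -IH -sintD//;last exact: continuous_sumr.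
by apply: eq_sint=> x _;rewrite big_cons.
Qed.

Lemma sint_psum w N m a b (F : R -> seq nat -> R) :
  (forall s, continuous (F ^~ s)) ->
  sint a b (fun v => psum w N m (F v)) = psum w N m (fun s => sint a b (F ^~ s)).
elim: m F=> [//|m IH] F cF /=.
have cp (k : 'I_N) : continuous (fun v=> psum w N m (fun s=> F v (nat_of_ord k :: s))).
 by apply: continuous_psum=> s;exact: cF.
rewrite sint_sum;last by move=> k x;apply: continuousM;[exact: cst_continuous|exact: cp].
by apply: eq_bigr=> k _;rewrite sintZ// IH.
Qed.

End SegmentIntegral.

(** * Fourier transform of the Gaussian on a bounded window *)

Section GaussFourier.
Context {R : realType}.
Notation leb := (@lebesgue_measure R).

Variable (t : R).
Hypothesis t0 : 0 < t.

Definition gker (v : R) : R := expR (- (t * v ^+ 2 / 2)).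
Definition gfour (M z : R) : R := sint (- M) M (fun v => gker v * cos (v * z)).

Lemma is_derive_gker (v : R) : is_derive v 1 gker (- (t * v) * gker v).
have h: is_derive v 1 (fun v : R=> - (t * v^+2/2)) (- (t * v)).
 by derive_eq;field.
by apply: is_derive_eq;rewrite /GRing.scale/= mulrC.
Qed.

Lemma continuous_gker : continuous gker.
move=> v;apply: differentiable_continuous;apply/derivable1_diffP.
by have []:= is_derive_gker v.
Qed.

Lemma gker_le1 (v : R) : gker v <= 1.
Proof. by rewrite expR_le1 oppr_le0 divr_ge0// mulr_ge0 ?sqr_ge0 ?ltW. Qed.

Lemma gker_ge0 (v : R) : 0 <= gker v. Proof. exact: expR_ge0. Qed.

Lemma continuous_gker_cos (z : R) : continuous (fun v => gker v * cos (v * z)).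
move=> v;apply: continuousM;first exact: continuous_gker.
apply: continuous_comp;last exact: continuous_cos.
by apply: continuousM;[exact: id|exact: cst_continuous].
Qed.

(** Differentiation under the integral, then integration by parts against [gker]; the boundary
    values at [- M] and [M] combine into the sine term. *)
Lemma gfour_derive (M z : R) : 0 <= M ->
  is_derive z (1 : R) (gfour M) ((2 * gker M * sin (M * z) - z * gfour M z) / t).
move=> M0.
pose f (z v : R):= gker v * cos (v * z).
have df (x v : R) : is_derive x (1 : R) (f ^~ v) (gker v*(- v * sin (v * x))).
 by derive_eq;ring.
have Iz: (`]z-1, z+1[%classic : set R) z by rewrite /= in_itv/=;lra.
have intf (x : R) : (`]z-1, z+1[%classic : set R) x ->
  leb.-integrable (`[- M, M]%classic : set R) (EFin \o f x).
 by move=> _;apply: sintegrable;exact: continuous_gker_cos.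
have derf (x v : R) : (`]z-1, z+1[%classic : set R) x -> (`[- M, M]%classic : set R) v ->
  derivable (f ^~ v) x 1 by move=> _ _;have []:= df x v.
have intG: leb.-integrable (`[- M, M]%classic : set R) (EFin \o (fun=> M)).
 by apply: sintegrable=> x;exact: cst_continuous.
have Gub (x v : R) : (`]z-1, z+1[%classic : set R) x -> (`[- M, M]%classic : set R) v ->
  `|partial1of2 f x v| <= M.
 move=> _;rewrite /= in_itv/= => /andP[v1 v2];rewrite partial1of2E.
 have ->: 'D_1 (f ^~ v) x = gker v*(- v * sin (v * x)) by have []:= df x v.
 rewrite !normrM normrN (ger0_norm (gker_ge0 v)).
 have vM: `|v| <= M by rewrite ler_norml v1.
 rewrite -[leRHS]mul1r -[leRHS]mulr1 -mulrA;apply: ler_pM;rewrite ?gker_ge0 ?gker_le1 ?mulr_ge0//.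
 by apply: ler_pM=> //;exact: sin_max.
have mB: measurable (`[- M, M]%classic : set R) by [].
have D1:= @derivable_under_integral R _ _ leb f _ mB z (z-1) (z+1) Iz intf derf _ (fun=> M0) intG Gub.
have D2:= @differentiation_under_integral R _ _ leb f _ mB z (z-1) (z+1) Iz intf derf _ (fun=> M0) intG Gub.
apply: DeriveDef;first exact: D1.
rewrite -derive1E {}D2.
have dv (v : R) : is_derive v (1 : R) (fun v=> gker v * sin (v * z))
  (gker v*(- (t * v) * sin (v * z))+z*(gker v * cos (v * z))).
 have h: is_derive v (1 : R) (fun v : R=> v * z) z.
  by derive_eq;ring.
 have hs: is_derive v (1 : R) (sin \o (fun v : R=> v * z)) (cos (v * z) * z).
  exact: (is_derive1_comp (is_derive_sin _) h).
 by apply: (is_derive_eq (is_deriveM (is_derive_gker v) hs));rewrite /GRing.scale/=;ring.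
have c1: continuous (fun v=> gker v*(- v * sin (v * z))).
 move=> v;apply: continuousM;first exact: continuous_gker.
 apply: continuousM;first exact: oppr_continuous.
 apply: continuous_comp;last exact: continuous_sin.
 by apply: continuousM;[exact: id|exact: cst_continuous].
have ct1: continuous (fun v=> t*(gker v*(- v * sin (v * z)))).
 by move=> v;apply: cvgMr;exact: c1.
have c2: continuous (fun v=> z*(gker v * cos (v * z))).
 by move=> v;apply: cvgMr;exact: continuous_gker_cos.
have MM: - M <= M by lra.
have c12: continuous (fun v=> t*(gker v*(- v * sin (v * z)))+z*(gker v * cos (v * z))).
 by move=> v;apply: cvgD;[exact: ct1|exact: c2].
have dv' (v : R) : is_derive v (1 : R) (fun v=> gker v * sin (v * z))
  (t*(gker v*(- v * sin (v * z)))+z*(gker v * cos (v * z))).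
 by apply: (is_derive_eq (dv v));ring.
have:= sint_FTC MM c12 dv'.
rewrite sintD// !sintZ//;last exact: continuous_gker_cos.
rewrite -/(gfour M z) mulNr sinN.
have ->: gker (- M) = gker M by rewrite /gker sqrrN.
move=> e;transitivity (sint (- M) M (fun v=> gker v*(- v * sin (v * z)))).
 by apply: eq_sint=> v _;rewrite partial1of2E;have []:= df z v.
apply: (mulfI (lt0r_neq0 t0));rewrite [RHS]mulrCA divff ?lt0r_neq0// mulr1.
by lra.
Qed.

Lemma gfourN (M z : R) : gfour M (- z) = gfour M z.
Proof. by apply: eq_sint=> v _;rewrite mulrN cosN. Qed.

(** The differential equation becomes exact after multiplication by exp(z^2/(2t)). The mean value
    theorem then bounds the boundary term, since the exponential at the intermediate point is at
    most the one at [z]. *)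
Lemma gfour_gauss (M z : R) : 0 <= M ->
  `|gfour M z - expR (- (z ^+ 2 / (2 * t))) * gfour M 0| <= 2 * gker M / t * `|z|.
have tn0:= lt0r_neq0 t0.
move=> M0;wlog z0: z/0 <= z.
 move=> W;case: (leP 0 z)=> [/W//|/ltW z0].
 by rewrite -gfourN -(normrN z) -[z^+2]sqrrN W ?oppr_ge0.
move: z0;rewrite le_eqVlt=> /predU1P[<-|z0].
 by rewrite expr0n/= mul0r oppr0 expR0 ?mul1r ?subrr ?normr0 ?mulr0.
pose h (x : R):= gfour M x * expR (x^+2/(2 * t)).
have dh (x : R) : is_derive x (1 : R) h (2 * gker M/t * sin (M * x) * expR (x^+2/(2 * t))).
 have h1:= gfour_derive x M0.
 have h2: is_derive x (1 : R) (fun x : R=> x^+2/(2 * t)) (x/t).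
  by derive_eq;field.
 by derive_eq;ring.
have ch: {within `[0, z], continuous h}.
 apply: continuous_subspaceT=> x;apply: differentiable_continuous.
 by apply/derivable1_diffP;have []:= dh x.
have [c /[!in_itv]/= /andP[c0 cz] e]:= MVT z0 (fun x _=> dh x) ch.
set gz:= expR (- _).
have gz0: 0 <= gz by exact: expR_ge0.
have e2: gz * expR (z^+2/(2 * t)) = 1 by rewrite /gz mulrC expRxMexpNx_1.
have ->: gfour M z-gz * gfour M 0 = gz*(h z-h 0).
 by rewrite /h expr0n/= mul0r expR0 mulr1 mulrBr [gfour M z * _]mulrC mulrA e2 mul1r.
have K0: 0 <= 2 * gker M/t by rewrite divr_ge0 ?mulr_ge0 ?gker_ge0 ?ltW.
rewrite e subr0 normrM (ger0_norm gz0) 3!normrM (ger0_norm K0) (ger0_norm (ltW z0)).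
rewrite (ger0_norm (expR_ge0 _)) mulrA ler_wpM2r//;first exact: ltW.
move: (2 * gker M/t) K0=> K K0.
have ->: gz*(K * `|sin (M * c)| * expR (c^+2/(2 * t))) =
 K*(`|sin (M * c)| * (expR (c^+2/(2 * t)) * gz)) by ring.
apply: ler_piMr=> //.
rewrite -[leRHS]mul1r;apply: ler_pM;rewrite ?mulr_ge0 ?expR_ge0 ?sin_max//.
apply: (le_via (gz * expR (z^+2/(2 * t))));last by rewrite e2.
rewrite mulrC;apply: ler_wpM2l=> //;rewrite ler_expR;apply: ler_wpM2r.
 by rewrite invr_ge0 mulr_ge0 ?ltW.
by rewrite ler_sqr ?nnegrE;lra.
Qed.

Lemma continuous_gauss (c : R) : continuous (fun v : R => expR (- (c * v ^+ 2))).
move=> v;apply: continuous_comp;last exact: continuous_expR.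
apply: continuousN;apply: continuousM;first exact: cst_continuous.
exact: exprn_continuous.
Qed.

Lemma sint_gauss_tail (c a b : R) : 0 < c -> 0 < a -> a <= b ->
  sint a b (fun v => expR (- (c * v ^+ 2))) <= (c * a)^-1.
move=> c0 a0 ab;have ca0: 0 < c * a by rewrite mulr_gt0.
have cl: continuous (fun v : R=> expR (- (c * a * v))).
 move=> v;apply: continuous_comp;last exact: continuous_expR.
 by apply: continuousN;apply: continuousM;[exact: cst_continuous|exact: id].
apply: (le_via (sint a b (fun v=> expR (- (c * a * v))))).
 apply: le_sint;rewrite //;first exact: continuous_gauss.
 by move=> x /andP[ax xb];rewrite ler_expR lerN2 -mulrA ler_pM2l// expr2 ler_pM2r//;lra.
have dF (x : R) : is_derive x (1 : R) (fun v=> - (c * a)^-1 * expR (- (c * a * v))) (expR (- (c * a * x))).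
 have h: is_derive x (1 : R) (fun v : R=> - (c * a * v)) (- (c * a)).
  by derive_eq;ring.
 by derive_eq;field;lra.
rewrite (sint_FTC ab cl dF).
have h1:= expR_ge0 (- (c * a * b)).
have h2: expR (- (c * a * a)) <= 1 by rewrite expR_le1 oppr_le0 mulr_ge0 ?ltW.
have i0: 0 <= (c * a)^-1 by rewrite invr_ge0 ltW.
by rewrite !mulNr;nra.
Qed.

Lemma sint_gauss_tailN (c a b : R) : 0 < c -> 0 < a -> a <= b ->
  sint (- b) (- a) (fun v => expR (- (c * v ^+ 2))) <= (c * a)^-1.
move=> c0 a0 ab;have ca0: 0 < c * a by rewrite mulr_gt0.
have ab': - b <= - a by rewrite lerN2.
have cl: continuous (fun v : R=> expR (c * a * v)).
 move=> v;apply: continuous_comp;last exact: continuous_expR.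
 by apply: continuousM;[exact: cst_continuous|exact: id].
apply: (le_via (sint (- b) (- a) (fun v=> expR (c * a * v)))).
 apply: le_sint;rewrite //;first exact: continuous_gauss.
 by move=> x /andP[bx xa];rewrite ler_expR -mulrA -mulrN ler_pM2l// expr2;nra.
have dF (x : R) : is_derive x (1 : R) (fun v=> (c * a)^-1 * expR (c * a * v)) (expR (c * a * x)).
 have h: is_derive x (1 : R) (fun v : R=> c * a * v) (c * a).
  by derive_eq;ring.
 by derive_eq;field;lra.
rewrite (sint_FTC ab' cl dF).
have h1:= expR_ge0 (c * a * - b).
have h2: expR (c * a * - a) <= 1 by rewrite expR_le1 mulrN oppr_le0 mulr_ge0 ?ltW.
have i0: 0 <= (c * a)^-1 by rewrite invr_ge0 ltW.
by nra.
Qed.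

(** At frequency 0 this is the mass of a normal density of variance 1/t, up to its normalising
    constant. *)
Lemma gfour_cvg0 : gfour n%:R 0 @[n --> \oo] --> sqrtr (2 * pi / t).
pose s:= sqrtr t^-1.
have s0: 0 < s by rewrite sqrtr_gt0 invr_gt0.
have s2: s^+2 = t^-1 by rewrite sqr_sqrtr ?invr_ge0 ?ltW.
pose K:= sqrtr (2 * pi/t).
have K0: 0 < K by rewrite sqrtr_gt0 divr_gt0// mulr_gt0 ?pi_gt0.
have pdfE v: normal_pdf 0 s v = K^-1 * gker v.
 rewrite normal_pdfE ?lt0r_neq0// /normal_peak /normal_fun s2 subr0;congr (_^-1 * expR _).
  by rewrite /K;congr sqrtr;ring.
 by field;exact: lt0r_neq0.
have int1:= @integral_normal_pdf R 0 s.
have c1: (\int[leb]_(x in `[(- (n%:R : R))%R, (n%:R : R)%R]) (normal_pdf 0 s x)%:E)%E @[n --> \oo] --> (1%:E : \bar R).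
 rewrite -int1.
 have <- : \bigcup_n (`[- (n%:R : R), n%:R]%classic : set R) = setT.
  apply/seteqP;split=> // x _;exists (truncn `|x|).+1=> //=.
  by rewrite in_itv/= -ler_norml ltW// truncnS_gt.
 apply: ge0_nondecreasing_set_cvg_integral.
 - move=> i j ij;apply/subsetPset;apply: subset_itv;rewrite bnd_simp ?lerN2 ler_nat//.
 - by [].
 - by move=> i;apply/measurable_EFinP;apply: measurable_funTS;exact: measurable_normal_pdf.
 - by move=> i x _;rewrite lee_fin normal_pdf_ge0.
have e n: (\int[leb]_(x in `[(- (n%:R : R))%R, (n%:R : R)%R]) (normal_pdf 0 s x)%:E)%E = (K^-1 * gfour n%:R 0)%:E.
 rewrite /gfour -sintZ;last exact: continuous_gker_cos.
 rewrite /sint /Rintegral fineK.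
  by apply: eq_integral=> x _;rewrite pdfE mulr0 cos0 mulr1.
 apply: integrable_fin_num=> //;apply: sintegrable=> x.
 by apply: cvgMr;exact: continuous_gker_cos.
move: c1;under eq_cvg do rewrite e;move=> c1.
move/fine_cvgP: c1=> [_ /= c1].
rewrite -/K -[K]mulr1.
have ->: (fun n=> gfour n%:R 0) = (fun n=> K*(K^-1 * gfour n%:R 0)).
 by apply/funext=> n;rewrite mulrA divff ?mul1r// lt0r_neq0.
by apply: cvgMr;exact: c1.
Qed.

Lemma gfour_tail (M M' z : R) : 0 < M -> M <= M' ->
  `|gfour M' z - gfour M z| <= 4 / (t * M).
move=> M0 MM';have cg:= @continuous_gker_cos z.
have h: `|gfour M' z-gfour M z| <=
  sint (- M') (- M) (fun v=> expR (- (t/2 * v^+2)))+sint M M' (fun v=> expR (- (t/2 * v^+2))).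
 have ->: gfour M' z-gfour M z = sint (- M') (- M) (fun v=> gker v * cos (v * z)) +
   sint M M' (fun v=> gker v * cos (v * z)).
  rewrite {1}/gfour (@sint_split _ (- M') M' (- M))//;try lra.
  by rewrite (@sint_split _ (- M) M' M)//;[rewrite /gfour;lra|lra..].
 apply: (le_trans (ler_normD _ _));apply: lerD;apply: (le_trans (norm_sint _ _ cg));
  (apply: le_sint;[exact: continuous_norm|exact: continuous_gauss|move=> x _]);
  rewrite normrM (ger0_norm (gker_ge0 _)) /gker [t * _/2]mulrAC ler_piMr ?expR_ge0 ?cos_max//.
have t2: 0 < t/2 by rewrite divr_gt0.
apply: (le_trans h);have h1:= sint_gauss_tail t2 M0 MM';have h2:= sint_gauss_tailN t2 M0 MM'.
have ->: 4/(t*M) = (t/2*M)^-1+(t/2*M)^-1 by field;lra.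
exact: lerD.
Qed.

(** Compare with a window [n] tending to infinity: [gfour_tail] pays for the change of window and
    [gfour_gauss] identifies the large one. The bound is uniform in [z], as the local limit theorem
    requires. *)
Lemma gfour_lim (M z : R) : 0 < M ->
  `|gfour M z - sqrtr (2 * pi / t) * expR (- (z ^+ 2 / (2 * t)))| <= 4 / (t * M).
move=> M0;set K:= sqrtr _;set ez:= expR _.
have tn0:= lt0r_neq0 t0.
have ez1: 0 <= ez <= 1 by rewrite expR_ge0 expR_le1 oppr_le0 divr_ge0 ?sqr_ge0 ?mulr_ge0 ?ltW.
apply/ler_addgt0Pr=> e e0.
have : \forall n \near \oo, `|gfour M z-K * ez| <= 4/(t*M)+e.
 have:= gfour_cvg0=> /cvgrPdist_le /(_ (e/2));rewrite divr_gt0// => /(_ isT) hK.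
 near=> n.
 have n1: (1 : R) <= n%:R by near_nat n.
 have nM: M <= n%:R by near_nat n.
 have nz: 8 * `|z| / (t*(t * e)) <= n%:R by near_nat n.
 have hKn: `|K-gfour n%:R 0| <= e/2 by near: n;exact: hK.
 have h1:= gfour_tail z M0 nM.
 have h2:= gfour_gauss z (le_trans ler01 n1).
 have g1: gker n%:R <= 2/(t * n%:R).
  have tn: 0 < t * n%:R by rewrite mulr_gt0//;lra.
  rewrite /gker expRN -[2/_]invrK invf_div lef_pV2 ?posrE ?expR_gt0 ?divr_gt0//.
  apply: le_trans (expR_ge1Dx _);apply: (le_via (t * n%:R^+2/2));last by lra.
  by rewrite ler_pM2r// ler_pM2l// expr2;nra.
 have h3: 2 * gker n%:R/t * `|z| <= e/2.
  apply: (le_via (2*(2/(t * n%:R))/t * `|z|)).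
   by rewrite ler_wpM2r// ler_pM2r ?invr_gt0// ler_pM2l.
  have n0: 0 < n%:R :> R by lra.
  have ->: 2*(2/(t * n%:R))/t * `|z| = 8 * `|z| / (t*(t * e))*(e/2)/n%:R.
   by field;lra.
  rewrite ler_pdivrMr// [leRHS]mulrC ler_wpM2r//;lra.
 have ->: gfour M z-K * ez = - (gfour n%:R z-gfour M z)
   + (gfour n%:R z-ez * gfour n%:R 0) + - (ez*(K-gfour n%:R 0)) by ring.
 apply: (le_trans (ler_normD _ _));have ->: 4/(t*M)+e = (4/(t*M)+e/2)+e/2 by field;lra.
 apply: lerD.
  by apply: (le_trans (ler_normD _ _));rewrite normrN;apply: lerD=> //;exact: le_trans h2 h3.
 by rewrite normrN normrM ger0_norm;[nra|case/andP: ez1].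
by case=> n _ /(_ n (leqnn n)).
Unshelve. all: end_near.
Qed.

End GaussFourier.

(** * Characteristic functions and the local limit theorem *)

Section TrigBounds.
Context {R : realType}.
Implicit Types x y c : R.

(** Integrating the sign of a derivative from 0 yields the Taylor inequalities below, one order at a
    time. *)
Lemma ge0_of_derive (f df : R -> R) : (forall x : R, is_derive x (1 : R) f (df x)) ->
  0 <= f 0 -> (forall x, 0 <= x -> 0 <= df x) -> forall x, 0 <= x -> 0 <= f x.
move=> dF f0 df0 x x0.
have cF: {within `[0, x], continuous f}.
 apply: continuous_subspaceT=> y;apply: differentiable_continuous.
 by apply/derivable1_diffP;have []:= dF y.
have [c /[!in_itv]/= /andP[c0 cx] e]:= MVT_segment x0 (fun y _=> dF y) cF.
have : 0 <= df c*(x-0) by rewrite mulr_ge0 ?subr_ge0 ?df0.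
by rewrite -e;lra.
Qed.

Lemma sin_lex x : 0 <= x -> sin x <= x.
move=> x0;rewrite -subr_ge0;move: x x0.
have d (x : R) : is_derive x (1 : R) (fun x=> x-sin x) ((fun x=> 1-cos x) x).
 by derive_eq;ring.
apply: (ge0_of_derive d)=> {d}.
- by rewrite sin0 subrr lexx.
- by move=> x _;rewrite subr_ge0 cos_le1.
Qed.

Lemma cos_ge x : 0 <= x -> 0 <= cos x - 1 + x ^+ 2 / 2.
move: x;have d (x : R) : is_derive x (1 : R) (fun x=> cos x-1+x^+2/2) ((fun x=> x-sin x) x).
 by derive_eq;field.
apply: (ge0_of_derive d)=> {d}.
- by rewrite cos0 expr0n/= mul0r;lra.
- by move=> x x0;rewrite subr_ge0 sin_lex.
Qed.

Lemma sin_ge x : 0 <= x -> 0 <= sin x - x + x ^+ 3 / 6.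
move: x;have d (x : R) : is_derive x (1 : R) (fun x=> sin x-x+x^+3/6) ((fun x=> cos x-1+x^+2/2) x).
 by derive_eq;field.
apply: (ge0_of_derive d)=> {d}.
- by rewrite sin0 expr0n/= mul0r;lra.
- by move=> x x0;rewrite cos_ge.
Qed.

Lemma cos_le x : 0 <= x -> 0 <= x ^+ 3 - (cos x - 1 + x ^+ 2 / 2).
move: x;have d (x : R) : is_derive x (1 : R) (fun x=> x^+3-(cos x-1+x^+2/2)) ((fun x=> 3 * x^+2-(x-sin x)) x).
 by derive_eq;field.
apply: (ge0_of_derive d)=> {d}.
- by rewrite cos0 !expr0n/= mul0r;lra.
have d (x : R) : is_derive x (1 : R) (fun x=> 3 * x^+2-(x-sin x)) ((fun x=> 6 * x-(1-cos x)) x).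
 by derive_eq;field.
apply: (ge0_of_derive d)=> {d}.
- by rewrite sin0 !expr0n/=;lra.
have d (x : R) : is_derive x (1 : R) (fun x=> 6 * x-(1-cos x)) ((fun x=> 6-sin x) x).
 by derive_eq;field.
apply: (ge0_of_derive d)=> {d}.
- by rewrite cos0;lra.
- by move=> x _;have:= sin_le1 x;lra.
Qed.

(** The factor [minr 1 |x|] stands in for a third power: only second moments are finite, and this
    form sums to the Lindeberg quantity [lind]. *)
Lemma cos_taylor x : `|cos x - 1 + x ^+ 2 / 2| <= x ^+ 2 * minr 1 `|x|.
wlog x0: x/0 <= x.
 by move=> W;case: (leP 0 x)=> [/W//|/ltW x0];have:= W (- x);rewrite cosN sqrrN normrN oppr_ge0;exact.
rewrite ger0_norm ?cos_ge// (ger0_norm x0).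
case: (leP 1 x)=> [x1|x1];have:= cos_le x0;have:= cos_le1 x;first by nra.
by rewrite exprSr;lra.
Qed.

Lemma sin_taylor x : `|sin x - x| <= 2 * (x ^+ 2 * minr 1 `|x|).
wlog x0: x/0 <= x.
 move=> W;case: (leP 0 x)=> [/W//|/ltW x0].
 by have:= W (- x);rewrite sinN sqrrN normrN oppr_ge0 -opprD normrN;exact.
rewrite ler0_norm ?subr_le0 ?sin_lex// (ger0_norm x0).
case: (leP 1 x)=> [x1|x1];have:= sin_ge x0;have:= sin_geN1 x;first by nra.
by rewrite exprSr;nra.
Qed.

Lemma cosD_taylor c x :
  `|cos (c + x) - (cos c - x * sin c - x ^+ 2 / 2 * cos c)| <= 3 * (x ^+ 2 * minr 1 `|x|).
rewrite cosD;have ->: cos c * cos x-sin c * sin x-(cos c-x * sin c-x^+2/2 * cos c) =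
 cos c*(cos x-1+x^+2/2)-sin c*(sin x-x) by ring.
apply: (le_trans (ler_normB _ _));rewrite !normrM.
have ->: 3*(x^+2 * minr 1 `|x|) = 1*(x^+2 * minr 1 `|x|)+1*(2*(x^+2 * minr 1 `|x|)) by ring.
by apply: lerD;apply: ler_pM=> //;rewrite ?cos_max ?sin_max ?cos_taylor ?sin_taylor.
Qed.

Lemma cosB1_le x : 1 - cos x <= x ^+ 2 / 2.
wlog x0: x/0 <= x.
 by move=> W;case: (leP 0 x)=> [/W//|/ltW x0];have:= W (- x);rewrite cosN sqrrN oppr_ge0;exact.
by have:= cos_ge x0;lra.
Qed.

Lemma cos_half x : 1 - cos x = 2 * sin (x / 2) ^+ 2.
Proof. by rewrite [in cos x](splitr x) cosD -!expr2 cos2sin2;ring. Qed.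

(** With y = x/2, which is at most pi/2 < 2, sin y >= y - y^3/6 >= y/3; squaring and doubling gives
    1/18. *)
Lemma cosB1_ge x : `|x| <= pi -> x ^+ 2 / 18 <= 1 - cos x.
wlog x0: x/0 <= x.
 by move=> W;case: (leP 0 x)=> [/W//|/ltW x0];have:= W (- x);rewrite cosN sqrrN normrN oppr_ge0;exact.
rewrite (ger0_norm x0) cos_half=> xpi.
have y0: 0 <= x/2 by rewrite divr_ge0.
have y2: x/2 <= 2 by have:= @pihalf_lt2 R;lra.
have s3: x/6 <= sin (x/2).
 have:= sin_ge y0;set y:= x/2 in y0 y2 *;have ->: x/6 = y/3 by rewrite /y;lra.
 by rewrite exprSr;nra.
by nra.
Qed.

(** Half angles satisfy sin^2(a - b) <= 2 (sin^2 a + sin^2 b). This separates the frequency of the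
    walk from the perturbation due to the additive functional. *)
Lemma cosD_lower x y : (1 - cos x) / 2 - (1 - cos y) <= 1 - cos (x + y).
rewrite !cos_half;have ->: x/2 = (x+y)/2-y/2 by ring.
rewrite sinB;set a:= (x+y)/2;set b:= y/2.
have ha:= cos2Dsin2 a;have hb:= cos2Dsin2 b.
have : (sin a * cos b-cos a * sin b)^+2 <= 2*(sin a^+2+sin b^+2);last by lra.
apply: (le_via (2*((sin a * cos b)^+2+(cos a * sin b)^+2))).
 by have:= sqr_ge0 (sin a * cos b+cos a * sin b);rewrite !expr2;lra.
rewrite ler_pM2l// !exprMn;apply: lerD.
 by rewrite ler_piMr ?sqr_ge0//;have:= sqr_ge0 (sin b);lra.
by rewrite ler_piMl ?sqr_ge0//;have:= sqr_ge0 (sin a);lra.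
Qed.

End TrigBounds.

(** * Truncated moments and the one-step expansion *)

Section Moments.
Context {R : realType}.
Variable (mu : nat -> R).
Hypothesis mu_ge0 : forall k, 0 <= mu k.

Definition msum (f : nat -> R) (N : nat) : R := \sum_(k < N) mu k * f k.

Variable V1 : R.
Hypothesis cvg1 : msum (fun=> 1) N @[N --> \oo] --> (1 : R).
Hypothesis cvg_sq : msum (fun k => k.+1%:R ^+ 2) N @[N --> \oo] --> V1.

Definition mtail N : R := V1 - msum (fun k => k.+1%:R ^+ 2) N.

Lemma msum_split f N N' : (N <= N')%N ->
  msum f N' - msum f N = \sum_(N <= k < N') mu k * f k.
move=> NN';rewrite /msum -!(big_mkord xpredT (fun k=> mu k * f k)).
by rewrite (@big_cat_nat _ _ _ N 0 N')//= [X in X-_]addrC addrK.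
Qed.

Lemma le_msum f g N : (forall k, f k <= g k) -> msum f N <= msum g N.
Proof. by move=> fg;apply: ler_sum=> k _;exact: ler_wpM2l. Qed.

Lemma msum_ge0 f N : (forall k, 0 <= f k) -> 0 <= msum f N.
Proof. by move=> f0;apply: sumr_ge0=> k _;rewrite mulr_ge0. Qed.

Lemma msum_norm f N : `|msum f N| <= msum (fun k => `|f k|) N.
by apply: (le_trans (ler_norm_sum _ _ _));apply: ler_sum=> k _;rewrite normrM ger0_norm.
Qed.

Lemma msum_lim_ge f L N : (forall k, 0 <= f k) -> msum f N @[N --> \oo] --> L -> msum f N <= L.
move=> f0 cf;apply: (ler_cvg_to (cvg_cst (msum f N)) cf).
near=> N';rewrite -subr_ge0 msum_split;last by near: N';exact: nbhs_infty_ge.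
by apply: sumr_ge0=> k _;rewrite mulr_ge0.
Unshelve. all: end_near. Qed.

Lemma msum1_le1 N : msum (fun=> 1) N <= 1.
Proof. exact: msum_lim_ge. Qed.

Lemma sum_mu_le1 N : \sum_(k < N) mu k <= 1.
Proof. by have:= msum1_le1 N;rewrite /msum;under eq_bigr do rewrite mulr1. Qed.

Lemma mtail_ge0 N : 0 <= mtail N.
Proof. by rewrite subr_ge0;apply: msum_lim_ge cvg_sq=> k;exact: sqr_ge0. Qed.

Lemma mtail_cvg : mtail N @[N --> \oo] --> (0 : R).
Proof. by rewrite -(subrr V1);apply: cvgB=> //;exact: cvg_cst. Qed.

(** A letter [k] beyond [N] satisfies N^j <= (k+1)^j, so the tail of a lower moment is controlled by
    that of the second one with a gain of N^j. The cases j = 2, 1, 0 serve for mass, mean and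
    variance. *)
Lemma tail_bound j f C L : (forall k, `|f k| * k.+1%:R ^+ j <= C * k.+1%:R ^+ 2) ->
  msum f N @[N --> \oo] --> L -> forall N, N%:R ^+ j * `|msum f N - L| <= C * mtail N.
move=> fC cf N.
have c1: N%:R^+j * `|msum f N-msum f N'| @[N' --> \oo] --> N%:R^+j * `|msum f N-L|.
 by apply: cvgMr;apply: cvg_norm;apply: cvgB=> //;exact: cvg_cst.
have c2: C*(msum (fun k=> k.+1%:R^+2) N'-msum (fun k=> k.+1%:R^+2) N) @[N' --> \oo]
  --> C * mtail N.
 by apply: cvgMr;apply: cvgB=> //;exact: cvg_cst.
apply: (ler_cvg_to c1 c2);near=> N'.
have NN': (N <= N')%N by near: N';exact: nbhs_infty_ge.
rewrite distrC !msum_split// !mulr_sumr.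
apply: (le_via (N%:R^+j * \sum_(N <= k < N') mu k * `|f k|)).
 apply: ler_wpM2l;first by rewrite exprn_ge0.
 by apply: (le_trans (ler_norm_sum _ _ _));apply: ler_sum=> k _;rewrite normrM ger0_norm.
rewrite mulr_sumr big_seq [leRHS]big_seq;apply: ler_sum=> k;rewrite mem_index_iota=> /andP[Nk _].
rewrite mulrCA [leRHS]mulrCA;apply: ler_wpM2l=> //;apply: le_trans (fC k).
rewrite mulrC;apply: ler_wpM2l=> //;rewrite lerXn2r ?nnegrE// ler_nat.
exact: leqW.
Unshelve. all: end_near. Qed.

Definition lind n : R := msum (fun k => k.+1%:R ^+ 2 * minr 1 (k.+1%:R / sqn n)) n.+1.

Lemma lind_ge0 n : 0 <= lind n.
by apply: msum_ge0=> k;rewrite mulr_ge0 ?sqr_ge0// le_min ler01 divr_ge0 ?sqrtr_ge0.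
Qed.

Lemma V1_ge0 : 0 <= V1.
by apply: le_trans (@msum_lim_ge _ _ 0%N _ cvg_sq);[rewrite /msum big_ord0|move=> k;exact: sqr_ge0].
Qed.

Lemma lind_le K n : (K <= n.+1)%N -> lind n <= K%:R / sqn n * V1 + mtail K.
move=> Kn;have e:= msum_split (fun k=> k.+1%:R^+2 * minr 1 (k.+1%:R/sqn n)) Kn.
rewrite /lind -[leLHS](subrK (msum (fun k=> k.+1%:R^+2 * minr 1 (k.+1%:R/sqn n)) K)) addrC.
apply: lerD.
 apply: (le_via (msum (fun k=> K%:R/sqn n * k.+1%:R^+2) K)).
  apply: ler_sum=> k _;apply: ler_wpM2l=> //;rewrite mulrC;apply: ler_wpM2r;rewrite ?sqr_ge0//.
  rewrite ge_min;apply/orP;right;apply: ler_wpM2r;first by rewrite invr_ge0 sqrtr_ge0.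
  by rewrite ler_nat.
 rewrite /msum;under eq_bigr do rewrite mulrCA;rewrite -mulr_sumr.
 apply: ler_wpM2l;first by rewrite divr_ge0 ?sqrtr_ge0.
 by apply: (msum_lim_ge _ _ cvg_sq)=> k;exact: sqr_ge0.
rewrite e;apply: (le_via (msum (fun k=> k.+1%:R^+2) n.+1-msum (fun k=> k.+1%:R^+2) K)).
 rewrite msum_split//;apply: ler_sum=> k _;apply: ler_wpM2l=> //.
 by apply: ler_piMr;rewrite ?sqr_ge0// ge_min lexx.
by apply: lerB=> //;apply: (msum_lim_ge _ _ cvg_sq)=> k;exact: sqr_ge0.
Qed.

Lemma lind_small (e : R) : 0 < e -> \forall n \near \oo, lind n <= e.
move=> e0;have e2: 0 < e/2 by rewrite divr_gt0.
have /cvgrPdist_le /(_ _ e2)[K _ hK]:= mtail_cvg.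
have hKK: mtail K <= e/2.
 by have:= hK K (leqnn K);rewrite sub0r normrN ger0_norm// mtail_ge0.
near=> n.
have Kn: (K <= n.+1)%N by apply: leqW;near: n;exact: nbhs_infty_ge.
have h: K%:R*V1/(e/2) <= sqn n by near_nat n.
have n1: 1 <= sqn n :> R by near_nat n.
have s0: 0 < sqn n :> R by rewrite (lt_le_trans _ n1).
apply: (le_trans (lind_le Kn));rewrite [leRHS]splitr;apply: lerD;last exact: hKK.
by rewrite mulrAC ler_pdivrMr// -ler_pdivrMl// mulrC.
Unshelve. all: end_near. Qed.

Lemma expR_taylor2 (x : R) : 0 <= x -> `|expR (- x) - (1 - x)| <= x ^+ 2.
move=> x0;have h:= expR_ge1Dx (- x);have h2:= expR_ge1Dx x.
rewrite ger0_norm;last by lra.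
have x1: 0 < 1+x by lra.
have : expR (- x) <= (1+x)^-1.
 by rewrite expRN lef_pV2 ?posrE ?expR_gt0.
have ->: (1+x)^-1 = 1-x+x^+2/(1+x) by field;lra.
have : x^+2/(1+x) <= x^+2.
 by rewrite ler_pdivrMr// ler_peMr ?sqr_ge0//;lra.
lra.
Qed.

(** The error is multiplied by [n] because up to [n] such steps follow one another. Truncating mass,
    mean and variance at [n.+1] costs multiples of [mtail], the Taylor remainder costs [lind], and
    replacing 1 - V/(2n) by an exponential costs O(1/n). *)
Lemma one_step (B V : R) (Y : nat -> R) n c : (0 < n)%N -> 0 <= B ->
  (forall k, `|Y k| <= B * k.+1%:R) ->
  msum Y N @[N --> \oo] --> (0 : R) -> msum (fun k => Y k ^+ 2) N @[N --> \oo] --> V ->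
  n%:R * `|msum (fun k => cos (c + Y k / sqn n)) n.+1 - expR (- (V / (2 * n%:R))) * cos c|
   <= (1 + B + B ^+ 2) * mtail n.+1 + 3 * B ^+ 2 * (1 + B) * lind n + (B ^+ 2 * V1) ^+ 2 / n%:R.
move=> n0 B0 YB cY cY2;set q:= sqn n.
have nn0: 0 < n%:R :> R by rewrite ltr0n.
have q0: 0 < q by rewrite sqrtr_gt0.
have qi0: 0 <= q^-1 by rewrite invr_ge0 ltW.
have qq: q^+2 = n%:R by rewrite sqr_sqrtr// ltW.
have n1: 1 <= n%:R :> R by rewrite ler1n.
have q1: 1 <= q by rewrite -sqrtr1 ler_sqrt// ltW.
have nS: (n%:R : R) <= n.+1%:R by rewrite ler_nat.
have t0:= mtail_ge0 n.+1.
have V0: 0 <= V.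
 by apply: (le_trans _ (@msum_lim_ge _ _ 0%N _ cY2));[rewrite /msum big_ord0|move=> k;exact: sqr_ge0].
have Y2B k: Y k^+2 <= B^+2 * k.+1%:R^+2.
 by rewrite -exprMn -(real_normK (num_real (Y k))) lerXn2r ?nnegrE// mulr_ge0.
have VB: V <= B^+2*V1.
 have cB: msum (fun k=> B^+2 * k.+1%:R^+2) N @[N --> \oo] --> B^+2*V1.
  have ->: msum (fun k=> B^+2 * k.+1%:R^+2) = (fun N=> B^+2 * msum (fun k=> k.+1%:R^+2) N).
   by apply/funext=> N;rewrite /msum mulr_sumr;apply: eq_bigr=> k _;rewrite mulrCA.
  exact: cvgMr.
 by apply: (ler_cvg_to cY2 cB);apply: nearW=> N;exact: le_msum.
pose rr k:= cos (c+Y k/q)-(cos c-Y k/q * sin c-(Y k/q)^+2/2 * cos c).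
have dec: msum (fun k=> cos (c+Y k/q)) n.+1 = cos c * msum (fun=> 1) n.+1-sin c/q * msum Y n.+1
  - cos c/(2 * n%:R) * msum (fun k=> Y k^+2) n.+1+msum rr n.+1.
 rewrite /msum !mulr_sumr -!sumrB -big_split/=;apply: eq_bigr=> k _.
 by rewrite /rr -qq;field;lra.
have b1: n%:R * `|msum (fun=> 1) n.+1-1| <= mtail n.+1.
 have:= @tail_bound 2 (fun=> 1) 1 1 _ cvg1 n.+1;rewrite mul1r=> h.
 apply: le_trans (h _);last by move=> k;rewrite normr1.
 by apply: ler_wpM2r=> //;rewrite expr2;nra.
have b2: n%:R * `|msum Y n.+1| <= B * mtail n.+1.
 have:= @tail_bound 1 Y B 0 _ cY n.+1;rewrite subr0 expr1=> h.
 apply: le_trans (h _);first by apply: ler_wpM2r.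
 by move=> k;rewrite expr1 expr2 mulrA ler_wpM2r.
have b3: `|msum (fun k=> Y k^+2) n.+1-V| <= B^+2 * mtail n.+1.
 have:= @tail_bound 0 (fun k=> Y k^+2) (B^+2) V _ cY2 n.+1;rewrite expr0 mul1r;apply.
 by move=> k;rewrite expr0 mulr1 ger0_norm ?sqr_ge0.
have b4: n%:R * `|msum rr n.+1| <= 3*B^+2*(1+B) * lind n.
 apply: (le_via (n%:R * msum (fun k=> `|rr k|) n.+1)).
  by apply: ler_wpM2l;[exact: ltW|exact: msum_norm].
 rewrite /lind /msum !mulr_sumr;apply: ler_sum=> k _.
 rewrite mulrCA [leRHS]mulrCA;apply: ler_wpM2l=> //.
 apply: (le_via (n%:R*(3*((Y k/q)^+2 * minr 1 `|Y k/q|)))).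
  by apply: ler_wpM2l;[exact: ltW|exact: cosD_taylor].
 have ->: n%:R*(3*((Y k/q)^+2 * minr 1 `|Y k/q|)) = 3*(Y k^+2 * minr 1 `|Y k/q|).
  by rewrite -qq;field;lra.
 have ->: 3*B^+2*(1+B)*(k.+1%:R^+2 * minr 1 (k.+1%:R/q)) =
   3*((B^+2 * k.+1%:R^+2)*((1+B) * minr 1 (k.+1%:R/q))) by ring.
 rewrite ler_pM2l//.
 apply: ler_pM;[exact: sqr_ge0|by rewrite le_min ler01 normr_ge0|exact: Y2B|].
 rewrite normrM (ger0_norm qi0).
 have hk: `|Y k| / q <= B*(k.+1%:R/q).
  by rewrite mulrA;apply: ler_wpM2r;[rewrite invr_ge0 ltW|exact: YB].
 have k0: 0 <= k.+1%:R/q by rewrite divr_ge0 ?ltW.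
 have a1: minr 1 (`|Y k| / q) <= 1 by rewrite ge_min lexx.
 have a2: minr 1 (`|Y k| / q) <= `|Y k| / q by rewrite ge_min lexx orbT.
 have ->: minr 1 (k.+1%:R/q) = if 1 <= k.+1%:R/q then 1 else k.+1%:R/q by case: leP.
 case: ifP=> _;first by rewrite mulr1;apply: (le_trans a1);lra.
 by apply: (le_trans a2);apply: (le_trans hk);apply: ler_wpM2r=> //;lra.
have b5: n%:R * `|expR (- (V/(2 * n%:R)))-(1-V/(2 * n%:R))| <= (B^+2*V1)^+2/n%:R.
 apply: (le_via (n%:R*(V/(2 * n%:R))^+2)).
  by apply: ler_wpM2l;[exact: ltW|apply: expR_taylor2;rewrite divr_ge0// mulr_ge0// ltW].
 have ->: n%:R*(V/(2 * n%:R))^+2 = V^+2/4/n%:R by field;lra.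
 apply: ler_wpM2r;first by rewrite invr_ge0 ltW.
 by rewrite !expr2;nra.
have ->: msum (fun k=> cos (c+Y k/q)) n.+1-expR (- (V/(2 * n%:R))) * cos c =
  cos c*(msum (fun=> 1) n.+1-1)-sin c/q * msum Y n.+1
  - cos c/(2 * n%:R)*(msum (fun k=> Y k^+2) n.+1-V)+msum rr n.+1
  - cos c*(expR (- (V/(2 * n%:R)))-(1-V/(2 * n%:R))).
 by rewrite dec;field;lra.
have cm: `|cos c| <= 1:= cos_max c;have sm: `|sin c| <= 1:= sin_max c.
set x1:= msum (fun=> 1) n.+1-1 in b1 *;set x2:= msum Y n.+1 in b2 *.
set x3:= msum _ n.+1-V in b3 *;set x4:= msum rr n.+1 in b4 *.
set x5:= expR _-_ in b5 *.
have m1: n%:R * `|cos c * x1| <= mtail n.+1.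
 by rewrite normrM;apply: le_trans b1;rewrite ler_pM2l// ler_piMl.
have m2: n%:R * `|sin c/q * x2| <= B * mtail n.+1.
 apply: le_trans b2;rewrite ler_pM2l// !normrM ler_piMl// mulr_ile1//.
 by rewrite (ger0_norm qi0) invf_le1.
have m3: n%:R * `|cos c/(2 * n%:R) * x3| <= B^+2 * mtail n.+1.
 apply: le_trans b3;rewrite !normrM (ger0_norm (_ : 0 <= (2 * n%:R)^-1));last by rewrite invr_ge0 mulr_ge0// ltW.
 have ->: n%:R*(`|cos c| / (2 * n%:R) * `|x3|) = (`|cos c| / 2) * `|x3| by field;lra.
 by rewrite ler_piMl//;lra.
have m5: n%:R * `|cos c * x5| <= (B^+2*V1)^+2/n%:R.
 by rewrite normrM;apply: le_trans b5;rewrite ler_pM2l// ler_piMl.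
apply: (le_via (n%:R*(`|cos c * x1| + `|sin c/q * x2| + `|cos c/(2 * n%:R) * x3| + `|x4| + `|cos c * x5|))).
 rewrite ler_pM2l//;apply: (le_trans (ler_normB _ _));apply: lerD=> //.
 apply: (le_trans (ler_normD _ _));apply: lerD=> //.
 apply: (le_trans (ler_normB _ _));apply: lerD=> //.
 exact: ler_normB.
move: `|cos c * x1| `|_ * x2| `|_ * x3| `|x4| `|cos c * x5| m1 m2 m3 b4 m5=> y1 y2 y3 y4 y5 m1 m2 m3 b4 m5.
move: (mtail n.+1) (lind n) m1 m2 m3 b4 m5=> T L m1 m2 m3 b4 m5.
have ->: n%:R*(y1+y2+y3+y4+y5) = n%:R * y1+n%:R * y2+n%:R * y3+n%:R * y4+n%:R * y5 by ring.
have ->: (1+B+B^+2)*T = T+B*T+B^+2*T by ring.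
by do 4 (apply: lerD=> //).
Qed.

End Moments.

Notation mlim mu f x := (msum mu f N @[N --> \oo] --> x) (only parsing).

Section CharFun.
Context {R : realType}.
Variable (mu : nat -> R).
Hypothesis mu_ge0 : forall k, 0 <= mu k.
Variable V1 : R.
Hypothesis cvg1 : mlim mu (fun=> 1) (1 : R).
Hypothesis cvg_sq : mlim mu (fun k => k.+1%:R ^+ 2) V1.

(** Conditioning on the first letter only changes the phase [c], so one-step errors d/n add up over
    at most [n] letters. The threshold on [n] depends on [Y] only through [B], whence uniformity in
    the frequencies. *)
Lemma char_approx (B d : R) : 0 <= B -> 0 < d -> \forall n \near \oo,
  forall (Y : nat -> R) (V : R), (forall k, `|Y k| <= B * k.+1%:R) ->
  mlim mu Y (0 : R) -> mlim mu (fun k => Y k ^+ 2) V ->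
  forall m c, (m <= n)%N ->
  `|psum mu n.+1 m (fun s => cos (c + (\sum_(k <- s) Y k) / sqn n)) -
     expR (- (V * m%:R / (2 * n%:R))) * cos c| <= d.
move=> B0 d0.
pose K1:= 1+B+B^+2;pose K2:= 3*B^+2*(1+B).
have K10: 0 < K1 by rewrite /K1;have:= sqr_ge0 B;lra.
have K20: 0 <= K2 by rewrite /K2 !mulr_ge0 ?sqr_ge0//;lra.
have d3: 0 < d/3 by rewrite divr_gt0.
have dK1: 0 < d/3/K1 by rewrite divr_gt0.
have dK2: 0 < d/3/(1+K2) by rewrite divr_gt0//;lra.
have /cvgrPdist_le /(_ _ dK1)[N1 _ hN1]:= mtail_cvg cvg_sq.
near=> n=> Y V YB cY cY2.
have n0: (0 < n)%N by near_nat n.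
have nn0: 0 < n%:R :> R by rewrite ltr0n.
have hl: lind mu n <= d/3/(1+K2) by near: n;exact: (lind_small mu_ge0 cvg_sq).
have hn: (B^+2*V1)^+2/(d/3) <= n%:R by near_nat n.
have ht: mtail mu V1 n.+1 <= d/3/K1.
 have:= hN1 n.+1;rewrite sub0r normrN ger0_norm ?mtail_ge0//;apply.
 by rewrite /= leqW//;near: n;exact: nbhs_infty_ge.
have step c: n%:R * `|msum mu (fun k=> cos (c+Y k/sqn n)) n.+1
   - expR (- (V/(2 * n%:R))) * cos c| <= d.
 apply: (le_trans (one_step mu_ge0 cvg1 cvg_sq c n0 B0 YB cY cY2));rewrite -/K1 -/K2.
 have ->: d = d/3+d/3+d/3 by field.
 apply: lerD;[apply: lerD|].
 - by rewrite mulrC -ler_pdivlMr.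
 - apply: (le_via ((1+K2) * lind mu n));first by rewrite ler_wpM2r ?lind_ge0//;lra.
  by rewrite mulrC -ler_pdivlMr//;lra.
 - by rewrite ler_pdivrMr// -ler_pdivrMl// mulrC.
set E:= expR (- (V/(2 * n%:R))) in step.
have V0: 0 <= V.
 by apply: (le_trans _ (@msum_lim_ge _ _ mu_ge0 _ _ 0%N _ cY2));[rewrite /msum big_ord0|move=> k;exact: sqr_ge0].
have E01: 0 <= E <= 1.
 by rewrite expR_ge0 expR_le1 oppr_le0 divr_ge0// mulr_ge0// ltW.
have rec m c: `|psum mu n.+1 m (fun s=> cos (c+(\sum_(k <- s) Y k)/sqn n)) -
   E^+m * cos c| <= m%:R*(d/n%:R).
 elim: m c=> [|m IH] c /=.
  by rewrite big_nil mul0r addr0 expr0 mul1r subrr normr0 mul0r.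
 pose P k:= psum mu n.+1 m (fun s=> cos ((c+Y k/sqn n)+(\sum_(k <- s) Y k)/sqn n)).
 have ->: \sum_(k < n.+1) mu k * psum mu n.+1 m (fun s=> cos (c+(\sum_(j <- nat_of_ord k :: s) Y j)/sqn n))
   = msum mu P n.+1.
  apply: eq_bigr=> k _;congr (_ * _);apply: eq_psum=> s _ _.
  by rewrite big_cons mulrDl addrA.
 pose Q:= msum mu (fun k=> cos (c+Y k/sqn n)) n.+1.
 have ->: msum mu P n.+1-E^+m.+1 * cos c = (msum mu P n.+1-E^+m*Q)+E^+m*(Q-E * cos c).
  by rewrite exprSr;ring.
 apply: (le_trans (ler_normD _ _));rewrite -natr1 mulrDl;apply: lerD.
  rewrite /Q /msum mulr_sumr -sumrB.
  apply: (le_trans (ler_norm_sum _ _ _)).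
  apply: (le_via (\sum_(k < n.+1) mu k*(m%:R*(d/n%:R)))).
   apply: ler_sum=> k _;rewrite mulrCA -mulrBr normrM ger0_norm// ler_wpM2l//.
   exact: IH.
  rewrite -mulr_suml;apply: ler_piMl;last exact: sum_mu_le1.
  by rewrite mulr_ge0// divr_ge0// ltW.
 rewrite normrM ger0_norm;last by rewrite exprn_ge0//;case/andP: E01.
 rewrite mul1r;apply: (le_via `|Q-E * cos c|).
  by rewrite ler_piMl//;apply: exprn_ile1;case/andP: E01.
 by rewrite ler_pdivlMr// mulrC;exact: step.
move=> m c mn;have ->: expR (- (V * m%:R/(2 * n%:R))) = E^+m.
 by rewrite /E -expRM_natl;congr expR;ring.
apply: (le_trans (rec m c));rewrite mulrC -mulrA;apply: ler_piMr;first exact: ltW.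
by rewrite mulrC ler_pdivrMr// mul1r ler_nat.
Unshelve. all: end_near. Qed.

(** For weights of total mass 1 this is 1 - |phi(u)|^2, with phi the characteristic function. *)
Definition qform N (u : R) : R := \sum_(i < N) \sum_(j < N) mu i * mu j * (1 - cos (u * (i%:R - j%:R))).

Lemma sqr_sinB_le (x y : R) : sin (x - y) ^+ 2 <= 2 * (sin x ^+ 2 + sin y ^+ 2).
rewrite sinB;have hx:= cos2Dsin2 x;have hy:= cos2Dsin2 y.
apply: (le_via (2*((sin x * cos y)^+2+(cos x * sin y)^+2))).
 by have:= sqr_ge0 (sin x * cos y+cos x * sin y);rewrite !expr2;lra.
rewrite ler_pM2l// !exprMn;apply: lerD.
 by rewrite ler_piMr ?sqr_ge0//;have:= sqr_ge0 (sin y);lra.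
by rewrite ler_piMl ?sqr_ge0//;have:= sqr_ge0 (sin x);lra.
Qed.

(** For such [d], |phi(u)| close to 1 forces u d to be close to a multiple of 2 pi, quantitatively;
    these integers form a subgroup. *)
Definition controlled (d : int) := exists (C : R) (N0 : nat), 0 <= C /\
  forall N, (N0 <= N)%N -> forall u, sin (u * d%:~R / 2) ^+ 2 <= C * qform N u.

Lemma controlledB a b : controlled a -> controlled b -> controlled (a - b).
move=> [C [N [C0 h]]] [C' [N' [C'0 h']]].
exists (2*(C+C')), (maxn N N');split;first by rewrite mulr_ge0// addr_ge0.
move=> N2;rewrite geq_max=> /andP[l l'] u.
rewrite rmorphB/= mulrBr mulrBl;apply: (le_trans (sqr_sinB_le _ _)).
by rewrite -[leRHS]mulrA ler_pM2l// mulrDl;apply: lerD;[exact: h|exact: h'].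
Qed.

Lemma qform_term N (u : R) i j : (i < N)%N -> (j < N)%N ->
  mu i * mu j * (1 - cos (u * (i%:R - j%:R))) <= qform N u.
move=> iN jN;rewrite /qform.
have h k l: 0 <= mu k * mu l*(1-cos (u*(k%:R-l%:R))).
 by rewrite !mulr_ge0// subr_ge0 cos_le1.
rewrite (bigD1 (Ordinal iN))//= (bigD1 (Ordinal jN))//= -addrA lerDl.
by apply: addr_ge0;[|apply: sumr_ge0=> k _];apply: sumr_ge0.
Qed.

Lemma controlled_support i j : 0 < mu i -> 0 < mu j -> controlled (i%:Z - j%:Z).
move=> i0 j0;exists (2*(mu i * mu j))^-1, (maxn i j).+1.
have ij0: 0 < 2*(mu i * mu j) by rewrite !mulr_gt0.
split;first by rewrite invr_ge0 ltW.
move=> N;rewrite gtn_max=> /andP[iN jN] u.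
rewrite ler_pdivlMl// rmorphB/=.
have h:= qform_term u iN jN;rewrite cos_half in h.
by apply: le_trans h;rewrite -!pmulrn le_eqVlt;apply/orP;left;apply/eqP;ring.
Qed.

(** Differences of support points are controlled, and by Euclidean division the least positive
    controlled integer divides them all; if it exceeded 1, the support would lie in a lattice. *)
Lemma controlled_unit : nonlattice [set i | 0 < mu i] -> controlled 1.
move=> nl.
have [i0 pi0] : exists i0, 0 < mu i0.
 apply: contrapT=> /forallNP h.
 have m0 k: mu k = 0 by apply/eqP;rewrite eq_le mu_ge0 andbT leNgt;apply/negP;exact: h.
 have e0: msum mu (fun=> 1) = fun=> 0.
  by apply/funext=> N;rewrite /msum big1// => k _;rewrite m0 mul0r.
 have:= cvg1;rewrite e0=> c1.
 have e10: (1 : R) = 0 by apply: cvg_unique c1 (cvg_cst (0 : R));exact: norm_hausdorff.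
 by move/eqP: e10;rewrite oner_eq0.
have c0: controlled 0 by rewrite -(subrr i0%:Z);exact: controlled_support.
have cN a: controlled a -> controlled (- a) by move=> ca;rewrite -sub0r;exact: controlledB.
have cD a b: controlled a -> controlled b -> controlled (a+b).
 by move=> ca cb;rewrite -[b]opprK;apply: controlledB=> //;exact: cN.
have cMn a (n : nat) : controlled a -> controlled (a *+ n).
 by move=> ca;elim: n=> [|n IH];rewrite ?mulr0n// mulrS;exact: cD.
have cM (a q : int) : controlled a -> controlled (q * a).
 move=> ca;case: q=> n;first by rewrite -[Posz n]natz mulr_natl;exact: cMn.
 by rewrite NegzE mulNr -[Posz n.+1]natz mulr_natl;apply: cN;exact: cMn.
(* Without a positive controlled integer the support is a single point, which is contained in a
   lattice of step 2. *)
have exd: exists d, `[< (0 < d)%N /\ controlled d%:Z >].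
 apply: contrapT=> /forallNP h;apply: (nl i0%:Z 2%N)=> // i pi.
 have [->|ne]:= eqVneq i i0;first by rewrite subrr dvdz0.
 exfalso;apply: (h `|(i%:Z-i0%:Z)%R|%N);apply/asboolP;split.
  by rewrite absz_gt0 subr_eq0;apply: contra ne=> /eqP[->].
 have ca:= controlled_support pi pi0;rewrite abszE;case: (ger0P (i%:Z-i0%:Z))=> _ //.
 exact: cN.
have [d /asboolP[d0 cd] dmin]:= ex_minnP exd.
have [d1|d1]:= leqP d 1;first by have ->: 1 = d%:Z by move: d0 d1;case: (d)=> [|[]].
exfalso;apply: (nl i0%:Z d d1)=> i pi.
have ca:= controlled_support pi pi0;set a:= i%:Z-i0%:Z in ca *.
have dz: d%:Z != 0 by rewrite eqz_nat -lt0n.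
have cr: controlled (a %% d)%Z.
 by rewrite /modz -mulNr;apply: cD=> //;exact: cM.
have r0:= modz_ge0 a dz;have rd:= ltz_mod a dz.
case er : (a %% d)%Z=> [r|r];last by rewrite er in r0.
rewrite er in cr rd.
have [r00|rp]:= posnP r;first by apply/dvdz_mod0P;rewrite -/a er r00.
have : (d <= r)%N by apply: dmin;apply/asboolP.
by rewrite leqNgt -ltz_nat;move: rd;rewrite /= => ->.
Qed.

Section Domination.
Variables (eta : nat -> R) (gam2 : R).
Hypothesis cvg_eta2 : mlim mu (fun k => eta k ^+ 2) gam2.
Hypothesis ctrl : controlled 1.

(** This is the squared modulus of a product of characteristic functions, written with real and
    imaginary parts. *)
Lemma psum_cossin (X : nat -> R) N m :
  psum mu N m (fun s => cos (\sum_(k <- s) X k)) ^+ 2 + psum mu N m (fun s => sin (\sum_(k <- s) X k)) ^+ 2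
  = (msum mu (fun k => cos (X k)) N ^+ 2 + msum mu (fun k => sin (X k)) N ^+ 2) ^+ m.
elim: m=> [|m IH] /=;first by rewrite big_nil cos0 sin0 expr0n/= expr1n addr0 expr0.
set A:= psum _ _ _ _ in IH;set B:= psum _ _ _ _ in IH.
have ->: \sum_(k < N) mu k * psum mu N m (fun s=> cos (\sum_(j <- nat_of_ord k :: s) X j)) =
  msum mu (fun k=> cos (X k)) N*A-msum mu (fun k=> sin (X k)) N*B.
 rewrite /msum !mulr_suml -sumrB;apply: eq_bigr=> k _.
 rewrite -!mulrA -mulrBr;congr (_ * _);rewrite -!psumZ -psumB;apply: eq_psum=> s _ _.
 by rewrite big_cons cosD.
have ->: \sum_(k < N) mu k * psum mu N m (fun s=> sin (\sum_(j <- nat_of_ord k :: s) X j)) =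
  msum mu (fun k=> sin (X k)) N*A+msum mu (fun k=> cos (X k)) N*B.
 rewrite /msum !mulr_suml -big_split/=;apply: eq_bigr=> k _.
 rewrite -!mulrA -mulrDr;congr (_ * _);rewrite -!psumZ -psumD;apply: eq_psum=> s _ _.
 by rewrite big_cons sinD.
by rewrite [in RHS]exprS -IH;ring.
Qed.

Lemma cossin_sq (X : nat -> R) N :
  msum mu (fun k => cos (X k)) N ^+ 2 + msum mu (fun k => sin (X k)) N ^+ 2 =
  \sum_(i < N) \sum_(j < N) mu i * mu j * cos (X i - X j).
rewrite !expr2 {1 3}/msum !mulr_suml -big_split/=;apply: eq_bigr=> i _.
rewrite /msum !mulr_sumr -big_split/=;apply: eq_bigr=> j _.
by rewrite cosB;ring.
Qed.

(** The squared modulus of the characteristic function is a double sum of cosines of differences.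
    [cosD_lower] isolates the frequency of the walk, for which [ctrl] provides a gain of order u^2
    on |u| <= pi; the other frequency costs gam2 th^2. A phase [c] rotates the pair of cosine and
    sine and leaves the modulus unchanged. *)
Lemma char_dom : exists (cK : R) (N0 : nat), 0 < cK /\ forall N, (N0 <= N)%N ->
  forall (u th : R) m c, `|u| <= pi ->
  `|psum mu N m (fun s => cos (c + \sum_(k <- s) (u * (k%:R - 1) + th * eta k)))| <=
   expR (m%:R * (gam2 * th ^+ 2 - cK * u ^+ 2)).
have [C [N0 [C0 hC]]]:= ctrl.
have C1: 0 < C+1 by lra.
(* [cosB1_ge] and [ctrl] give u^2 <= 36 C q, and a quarter of q is available for the exponent: hence
   144. The extra 1 keeps the constant meaningful when C = 0. *)
exists (144*(C+1))^-1, N0;split;first by rewrite invr_gt0 mulr_gt0.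
move=> N NN0 u th m c upi;set X:= fun k : nat=> u*(k%:R-1)+th * eta k.
set D:= gam2 * th^+2-_.
have key: msum mu (fun k=> cos (X k)) N^+2+msum mu (fun k=> sin (X k)) N^+2 <= expR (2*D).
 apply: le_trans (expR_ge1Dx _);rewrite cossin_sq.
 have s1: msum mu (fun=> 1) N <= 1:= msum1_le1 mu_ge0 cvg1 N.
 have s0: 0 <= msum mu (fun=> 1) N by exact: msum_ge0.
 have e2: msum mu (fun k=> eta k^+2) N <= gam2.
  by apply: (msum_lim_ge mu_ge0 _ _ cvg_eta2)=> k;exact: sqr_ge0.
 have e20: 0 <= msum mu (fun k=> eta k^+2) N by apply: msum_ge0=> // k;exact: sqr_ge0.
 have dbl (f g : nat -> R) : \sum_(i < N) \sum_(j < N) mu i * mu j*(f i * g j) = msum mu f N * msum mu g N.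
  rewrite /msum mulr_suml;apply: eq_bigr=> i _;rewrite mulr_sumr;apply: eq_bigr=> j _;ring.
 apply: (le_via (\sum_(i < N) \sum_(j < N) (mu i * mu j*(1*1)
   + - (2^-1)*(mu i * mu j*(1-cos (u*(i%:R-j%:R))))
   + th^+2*(mu i * mu j*(eta i^+2*1)+mu i * mu j*(1 * eta j^+2))))).
  apply: ler_sum=> i _;apply: ler_sum=> j _.
  have h:= cosD_lower (u*(i%:R-j%:R)) (th*(eta i-eta j)).
  have h2:= cosB1_le (th*(eta i-eta j)).
  have ->: X i-X j = u*(i%:R-j%:R)+th*(eta i-eta j) by rewrite /X;ring.
  have h3: (th*(eta i-eta j))^+2/2 <= th^+2*(eta i^+2+eta j^+2).
   have ->: th^+2*(eta i^+2+eta j^+2) = (th*(eta i-eta j))^+2/2+(th*(eta i+eta j))^+2/2 by field.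
   by rewrite lerDl divr_ge0// sqr_ge0.
  have ->: forall x y z a b : R, x * y*(1*1) + - 2^-1*(x * y * z)+th^+2*(x * y*(a*1)+x * y*(1 * b))
   = x * y*(1-z/2+th^+2*(a+b)) by move=> *;field.
  by apply: ler_wpM2l;[rewrite mulr_ge0|lra].
 have ->: \sum_(i < N) \sum_(j < N) (mu i * mu j*(1*1)
   + - (2^-1)*(mu i * mu j*(1-cos (u*(i%:R-j%:R))))
   + th^+2*(mu i * mu j*(eta i^+2*1)+mu i * mu j*(1 * eta j^+2))) =
   msum mu (fun=> 1) N * msum mu (fun=> 1) N + - 2^-1 * qform N u +
   th^+2*(msum mu (fun k=> eta k^+2) N * msum mu (fun=> 1) N +
         msum mu (fun=> 1) N * msum mu (fun k=> eta k^+2) N).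
  rewrite -(dbl (fun=> 1) (fun=> 1)) -(dbl (fun k=> eta k^+2) (fun=> 1)).
  rewrite -(dbl (fun=> 1) (fun k=> eta k^+2)) /qform -big_split/= !mulr_sumr -!big_split/=.
  by apply: eq_bigr=> i _;rewrite -big_split/= !mulr_sumr -!big_split/=.
 have hq:= hC N NN0 u;have h18:= cosB1_ge upi;rewrite cos_half in h18.
 rewrite mulr1 in hq.
 have q0: 0 <= qform N u.
  by apply: sumr_ge0=> i _;apply: sumr_ge0=> j _;rewrite !mulr_ge0// subr_ge0 cos_le1.
 have hq2: u^+2/(36*(C+1)) <= qform N u.
  by rewrite ler_pdivrMr ?mulr_gt0//;nra.
 have hq3: u^+2/(36*(C+1)) = 4*((144*(C+1))^-1 * u^+2) by field;lra.
 rewrite {}hq3 in hq2;move: (qform N u) (_ * u^+2) hq2 q0 @D=> Q W hq2 q0 D.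
 move: (msum mu (fun=> 1) N) (msum mu (fun k=> eta k^+2) N) s1 s0 e2 e20=> S E s1 s0 e2 e20.
 rewrite /D.
 have t2:= sqr_ge0 th;have SE: E*S <= gam2 by apply: le_trans e2;rewrite ler_piMr.
 have SS: S*S <= 1 by rewrite mulr_ile1.
 have : th^+2*(E*S+S*E) <= th^+2*(gam2+gam2).
  by apply: ler_wpM2l=> //;rewrite [S*E]mulrC lerD.
 by lra.
have e1: psum mu N m (fun s=> cos (c + \sum_(k <- s) X k)) =
 cos c * psum mu N m (fun s=> cos (\sum_(k <- s) X k))-sin c * psum mu N m (fun s=> sin (\sum_(k <- s) X k)).
 by rewrite -!psumZ -psumB;apply: eq_psum=> s _ _;rewrite cosD.
have:= psum_cossin X N m;rewrite {}e1.
set A:= psum _ _ _ _;set B:= psum _ _ _ _=> e.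
have hAB: A^+2+B^+2 <= expR (m%:R*D)^+2.
 rewrite e -expRM_natl mulrCA expRM_natl;apply: lerXn2r;rewrite ?nnegrE ?expR_ge0//.
 by apply: addr_ge0;exact: sqr_ge0.
rewrite -ler_sqr ?nnegrE ?expR_ge0// real_normK ?num_real//;apply: le_trans hAB.
have hc:= cos2Dsin2 c.
have ->: A^+2+B^+2 = (cos c*A-sin c*B)^+2+(sin c*A+cos c*B)^+2.
 transitivity ((A^+2+B^+2)*(cos c^+2+sin c^+2));first by rewrite hc mulr1.
 by ring.
by rewrite lerDl sqr_ge0.
Qed.

End Domination.

End CharFun.

(** Writing the second moment with [k.+1] lets it dominate 1, [k] and (k - 1)^2 at once, also at k =
    0; [law_ctrl] is the quantitative form of the non-lattice assumption. *)
Record critical_law {R : realType} (mu : nat -> R) (V1 sig2 : R) : Prop := CriticalLaw {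
  law_ge0 : forall k, 0 <= mu k;
  law_one : mlim mu (fun=> 1) (1 : R);
  law_sq : mlim mu (fun k => k.+1%:R ^+ 2) V1;
  law_zeta : mlim mu (fun k => k%:R - 1) (0 : R);
  law_zeta2 : mlim mu (fun k => (k%:R - 1) ^+ 2) sig2;
  law_ctrl : controlled mu 1 }.

#[global] Hint Extern 0 (is_true (0 <= _)) =>
  match goal with h : critical_law _ _ _ |- _ => apply: (law_ge0 h) end : core.

(** * Orthogonality of cosines on a scaled lattice *)

Section FourierInversion.
Context {R : realType}.

Lemma norm_pred_le (k : nat) : `|k%:R - 1| <= k.+1%:R :> R.
Proof. by rewrite ler_norml -natr1;have:= ler0n R k;lra. Qed.

(** The prefactor 2 pi of the inversion formula is at least 4, so it absorbs four errors of size
    [e]. *)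
Lemma llt_arith (e P y1 y2 y3 y4 y5 : R) : 4 <= P -> 0 < e ->
  y1 <= y5 -> y2 <= y5 -> y3 <= e -> y4 <= e -> y5 + y5 <= e -> y1 + y2 + y3 + y4 <= P * e.
Proof. by move=> P4 e0 h1 h2 h3 h4 h5;apply: (le_via (4 * e));[lra|rewrite ler_pM2r]. Qed.

Lemma two_pi_ge4 : 4 <= 2 * pi :> R.
Proof. by have ->: 4 = 2*2 :> R;[lra|rewrite ler_pM2l// pi_ge2]. Qed.

Lemma pi_ge1 : 1 <= pi :> R.
Proof. by apply: le_trans (pi_ge2 R);lra. Qed.

Lemma sin_natpi (n : nat) : sin (pi * n%:R) = 0 :> R.
elim: n=> [|n IH];first by rewrite mulr0 sin0.
by rewrite -natr1 mulrDr mulr1 sinDpi IH oppr0.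
Qed.

Lemma sin_intpi (k : int) : sin (pi * k%:~R) = 0 :> R.
case: k=> n;first by rewrite -pmulrn sin_natpi.
by rewrite NegzE rmorphN/= mulrN sinN -pmulrn sin_natpi oppr0.
Qed.

Lemma continuous_cosM (a : R) : continuous (fun v : R => cos (v * a)).
move=> v;apply: continuous_comp;last exact: continuous_cos.
by apply: continuousM;[exact: id|exact: cst_continuous].
Qed.

Lemma sint_cos_int (L : R) (k : int) : 0 < L ->
  sint (- (pi * L)) (pi * L) (fun v => cos (v * (k%:~R / L))) = (k == 0)%:R * (2 * pi * L).
move=> L0;have pL: 0 < pi*L by rewrite mulr_gt0// pi_gt0.
have [->|k0]:= eqVneq k 0.
 rewrite (@eq_sint _ _ _ _ (fun=> 1))=> [|v _];last by rewrite mul0r mulr0 cos0.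
 by rewrite sint_cst;[rewrite ?eqxx /=;ring|lra].
have a0: k%:~R/L != 0 :> R by rewrite mulf_neq0 ?invr_eq0 ?intr_eq0// gt_eqF.
set a:= k%:~R/L in a0 *.
have dF (v : R) : is_derive v (1 : R) (fun v=> a^-1 * sin (v * a)) (cos (v * a)).
 have h: is_derive v (1 : R) (fun v : R=> v * a) a.
  by derive_eq;ring.
 have hs: is_derive v (1 : R) (sin \o (fun v : R=> v * a)) (cos (v * a) * a).
  exact: (is_derive1_comp (is_derive_sin _) h).
 by apply: (is_derive_eq (is_deriveZ a^-1 hs));rewrite /GRing.scale/=;field.
have Laa: pi*L * a = pi * k%:~R by rewrite /a;field;lra.
rewrite (sint_FTC _ (@continuous_cosM a) dF);last by lra.
by rewrite mulNr sinN Laa sin_intpi oppr0 mulr0 subrr mul0r.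
Qed.

End FourierInversion.

(** * Local limit theorem with an additive functional *)

Section LLT.
Context {R : realType}.
Variables (mu : nat -> R) (V1 : R).
Variables (eta : nat -> R) (Ce gam2 sig2 : R).
Hypothesis crit : critical_law mu V1 sig2.
Hypothesis sig2_gt0 : 0 < sig2.
Hypothesis eta_le : forall k, `|eta k| <= Ce * k.+1%:R.
Hypothesis cvg_eta : mlim mu eta (0 : R).
Hypothesis cvg_eta2 : mlim mu (fun k => eta k ^+ 2) gam2.
Hypothesis cvg_zeta_eta : mlim mu (fun k => (k%:R - 1) * eta k) (0 : R).

Let Gs (s : seq nat) : R := \sum_(k <- s) eta k.
Let Zs (s : seq nat) : R := \sum_(k <- s) (k%:R - 1).

Definition lclt (t z : R) : R := expR (- (z ^+ 2 / (2 * t))) / sqrtr (2 * pi * t).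

(* Fourier inversion on the lattice, with the phase split into even parts so that only
   cosines occur. *)
Let ff (L th c y v : R) (s : seq nat) : R :=
  cos (c + th * Gs s / L) * cos (v * ((Zs s + y) / L)).

Lemma continuous_ff L th c y s : continuous (fun v => ff L th c y v s).
Proof. by move=> v;apply: cvgMr;exact: continuous_cosM. Qed.

Lemma Zs_cons k s : Zs (k :: s) = k%:R - 1 + Zs s. Proof. by rewrite /Zs big_cons. Qed.

Lemma Zs_sumn s : Zs s = (sumn s)%:R - (size s)%:R.
elim: s=> [|k s IH];first by rewrite /Zs big_nil subr0.
by rewrite Zs_cons IH /= natrD -natr1;ring.
Qed.

Lemma fourier_inv (L th c : R) N m (p : int) : 0 < L ->
  2 * pi * L * psum mu N m (fun s => ((sumn s)%:Z + p == m%:Z)%:R * cos (c + th * Gs s / L)) =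
  sint (- (pi * L)) (pi * L) (fun v => psum mu N m (ff L th c p%:~R v)).
move=> L0;rewrite sint_psum;last by move=> s;exact: continuous_ff.
rewrite -psumZ;apply: eq_psum=> s sm _.
rewrite /ff sintZ;last exact: continuous_cosM.
have ->: Zs s+p%:~R = ((sumn s)%:Z+p-m%:Z)%:~R.
 by rewrite Zs_sumn sm rmorphB/= rmorphD/= -!pmulrn;ring.
rewrite sint_cos_int// subr_eq0;by ring.
Qed.

(** Product to sum: the two cosines of the inversion formula become single cosines with frequencies
    [v] and [- v], to which the bounds on characteristic functions apply. *)
Lemma ff_split (L th c : R) N m y v :
  psum mu N m (ff L th c y v) =
   (psum mu N m (fun s => cos ((c + v * (y / L)) + (\sum_(k <- s) (v * (k%:R - 1) + th * eta k)) / L)) +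
    psum mu N m (fun s => cos ((c - v * (y / L)) + (\sum_(k <- s) (- v * (k%:R - 1) + th * eta k)) / L))) / 2.
rewrite -psumD -psumZr;apply: eq_psum=> s _ _;rewrite /ff !big_split/= -!mulr_sumr -/(Gs s) -/(Zs s).
have ->: c+v*(y/L)+(v*Zs s+th*Gs s)/L = (c+th*Gs s/L)+v*((Zs s+y)/L) by ring.
have ->: c-v*(y/L)+(- v*Zs s+th*Gs s)/L = (c+th*Gs s/L)-v*((Zs s+y)/L) by ring.
by move: (c+th*Gs s/L) (v*((Zs s+y)/L))=> a b;rewrite cosD cosB;field.
Qed.

(** The cross term vanishes because [eta] is orthogonal to the step k - 1. *)
Lemma cvg_lincomb (v th : R) :
  msum mu (fun k => v * (k%:R - 1) + th * eta k) N @[N --> \oo] --> (0 : R) /\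
  msum mu (fun k => (v * (k%:R - 1) + th * eta k) ^+ 2) N @[N --> \oo] --> v ^+ 2 * sig2 + th ^+ 2 * gam2.
split.
 have ->: msum mu (fun k=> v*(k%:R-1)+th * eta k) =
   (fun N=> v * msum mu (fun k=> k%:R-1) N+th * msum mu eta N).
  apply/funext=> N;rewrite /msum !mulr_sumr -big_split/=;apply: eq_bigr=> k _;ring.
 have ->: 0 = v*0+th*0 :> R by rewrite !mulr0 addr0.
 by apply: cvgD;apply: cvgMr=> //;exact: (law_zeta crit).
have ->: msum mu (fun k=> (v*(k%:R-1)+th * eta k)^+2) =
   (fun N=> v^+2 * msum mu (fun k=> (k%:R-1)^+2) N+th^+2 * msum mu (fun k=> eta k^+2) N
    + 2 * v * th * msum mu (fun k=> (k%:R-1) * eta k) N).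
 apply/funext=> N;rewrite /msum !mulr_sumr -!big_split/=;apply: eq_bigr=> k _;ring.
have ->: v^+2 * sig2+th^+2 * gam2 = v^+2 * sig2+th^+2 * gam2+2 * v * th*0 :> R by ring.
by apply: cvgD;[apply: cvgD|];apply: cvgMr=> //;exact: (law_zeta2 crit).
Qed.

Lemma gam2_ge0 : 0 <= gam2.
by apply: (le_trans _ (@msum_lim_ge _ _ (law_ge0 crit) _ _ 0%N _ cvg_eta2));[rewrite /msum big_ord0|move=> k;exact: sqr_ge0].
Qed.

Lemma Ce_ge0 : 0 <= Ce.
Proof. by have:= eta_le 0%N;rewrite mulr1;apply: le_trans. Qed.

Lemma ff_dom : exists (cK : R) (N0 : nat), 0 < cK /\ forall N, (N0 <= N)%N ->
  forall L th c y v m, 0 < L -> `|v| <= pi * L ->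
  `|psum mu N m (ff L th c y v)| <= expR (m%:R / L ^+ 2 * (gam2 * th ^+ 2 - cK * v ^+ 2)).
have [cK [N0 [cK0 h]]]:= char_dom (law_ge0 crit) (law_one crit) cvg_eta2 (law_ctrl crit).
exists cK, N0;split=> // N NN0 L th c y v m L0 vL.
have e w c': (w = v \/ w = - v) -> `|psum mu N m (fun s=> cos (c'+(\sum_(k <- s) (w*(k%:R-1)+th * eta k))/L))|
  <= expR (m%:R/L^+2*(gam2 * th^+2-cK * v^+2)).
 move=> wv;have ->: m%:R/L^+2*(gam2 * th^+2-cK * v^+2) = m%:R*(gam2*(th/L)^+2-cK*(w/L)^+2).
  have ->: v^+2 = w^+2 by case: wv=> ->;rewrite ?sqrrN.
  by field;lra.
 have ->: psum mu N m (fun s=> cos (c'+(\sum_(k <- s) (w*(k%:R-1)+th * eta k))/L)) =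
   psum mu N m (fun s=> cos (c' + \sum_(k <- s) (w/L*(k%:R-1)+th/L * eta k))).
  apply: eq_psum=> s _ _;rewrite mulr_suml;congr (cos (_+_));apply: eq_bigr=> k _;field;lra.
 apply: h=> //;have ->: `|w/L| = `|v| / L.
  by rewrite normrM normfV (gtr0_norm L0);case: wv=> ->;rewrite ?normrN.
 by rewrite ler_pdivrMr.
rewrite ff_split normrM normfV (ger0_norm (_ : 0 <= 2))// ler_pdivrMr//.
apply: (le_trans (ler_normD _ _));rewrite mulr_natr mulr2n.
by apply: lerD;apply: e;[left|right].
Qed.

(** After inversion, frequencies |v| <= M are treated by [char_approx], those up to pi sqrt n by
    [ff_dom], and the Gaussian integral over the window is completed by [gfour_lim]. Uniformity in
    [m], [p] and [c] matters: all three vary when a word is cut. *)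
Theorem local_clt (d0 th e : R) : 0 < d0 -> 0 < e -> \forall n \near \oo,
  forall m p c, (m <= n)%N -> d0 * n%:R <= m%:R ->
  `|sqn n * psum mu n.+1 m (fun s => (sumn s + p == m)%:R * cos (c + th * Gs s / sqn n))
    - cos c * expR (- (th ^+ 2 * gam2 * m%:R / (2 * n%:R))) * lclt (sig2 * (m%:R / n%:R)) (p%:R / sqn n)| <= e.
move=> d00 e0;have [cK [N0 [cK0 hdom]]]:= ff_dom.
have g0:= gam2_ge0;have C0:= Ce_ge0.
pose eg:= expR (gam2 * th^+2).
have eg0: 0 < eg:= expR_gt0 _.
(* The first summand makes the transform beyond the window at most [e], the second does the same for
   the Gaussian. *)
pose M:= 2 * eg/(cK * d0 * e)+4/(sig2 * d0 * e)+1.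
have q1: 0 < 2 * eg/(cK * d0 * e) by rewrite divr_gt0 ?mulr_gt0.
have q2: 0 < 4/(sig2 * d0 * e) by rewrite divr_gt0 ?mulr_gt0.
have M0: 0 < M by rewrite /M;lra.
have M1: 2 * eg/(cK * d0*M) <= e.
 have ->: 2 * eg/(cK * d0*M) = 2 * eg/(cK * d0 * e) * e/M by field;lra.
 by rewrite ler_pdivrMr// [leRHS]mulrC ler_pM2r// /M;lra.
have M2: 4/(sig2 * d0*M) <= e.
 have ->: 4/(sig2 * d0*M) = 4/(sig2 * d0 * e) * e/M by field;rewrite ?(lt0r_neq0 M0) ?(lt0r_neq0 sig2_gt0) ?(lt0r_neq0 d00) ?(lt0r_neq0 e0).
 by rewrite ler_pdivrMr// [leRHS]mulrC ler_pM2r// /M;lra.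
clearbody M;pose B:= M + `|th| * Ce.
have B0: 0 <= B by rewrite addr_ge0 ?mulr_ge0// ltW.
have dM: 0 < e/(2*M) by rewrite divr_gt0 ?mulr_gt0.
have happ:= char_approx (law_ge0 crit) (law_one crit) (law_sq crit) B0 dM.
near=> n=> m p c mn dm.
have n0: (0 < n)%N by near_nat n.
have nn0: 0 < n%:R :> R by rewrite ltr0n.
have nN0: (N0 <= n.+1)%N by apply: leqW;near: n;exact: nbhs_infty_ge.
have LM: M <= sqn n by near_nat n.
have hn: forall (Y : nat -> R) (V : R), (forall k, `|Y k| <= B * k.+1%:R) ->
 mlim mu Y (0 : R) -> mlim mu (fun k=> Y k^+2) V ->
 forall m c, (m <= n)%N ->
 `|psum mu n.+1 m (fun s=> cos (c+(\sum_(k <- s) Y k)/sqn n)) -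
   expR (- (V * m%:R/(2 * n%:R))) * cos c| <= e/(2*M) by near: n;exact: happ.
set L:= sqn n in LM hn *.
have L0: 0 < L by rewrite (lt_le_trans M0).
have LL: L^+2 = n%:R by rewrite sqr_sqrtr// ltW.
set Et:= expR (- (th^+2 * gam2 * m%:R/(2 * n%:R))).
set t:= sig2*(m%:R/n%:R);set z:= p%:R/L.
have mn01: d0 <= m%:R/n%:R by rewrite ler_pdivlMr.
have mn1: m%:R/n%:R <= 1 :> R by rewrite ler_pdivrMr// mul1r ler_nat.
have t0: 0 < t by rewrite mulr_gt0//;exact: lt_le_trans d00 mn01.
have td: sig2 * d0 <= t by rewrite ler_pM2l.
pose f v:= psum mu n.+1 m (ff L th c p%:R v).
have cf: continuous f by apply: continuous_psum=> s;exact: continuous_ff.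
have happ2 v: `|v| <= M -> `|f v-cos c*Et*(gker t v * cos (v * z))| <= e/(2*M).
 move=> vM.
 have Yb w: `|w| <= M -> forall k, `|w*(k%:R-1)+th * eta k| <= B * k.+1%:R.
  move=> wM k;apply: (le_trans (ler_normD _ _));rewrite /B mulrDl;apply: lerD.
   by rewrite normrM;apply: ler_pM=> //;exact: norm_pred_le.
  by rewrite normrM -mulrA ler_wpM2l.
 have main w c': `|w| <= M -> w^+2 = v^+2 ->
   `|psum mu n.+1 m (fun s=> cos (c'+(\sum_(k <- s) (w*(k%:R-1)+th * eta k))/L))-Et * gker t v * cos c'| <= e/(2*M).
  move=> wM wv;have [c1 c2]:= cvg_lincomb w th.
  have:= hn _ _ (Yb w wM) c1 c2 m c' mn.
  have -> // : expR (- ((w^+2 * sig2+th^+2 * gam2) * m%:R/(2 * n%:R))) = Et * gker t v.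
  by rewrite /Et /gker -expRD wv;congr expR;rewrite /t;field;lra.
 rewrite /f ff_split.
 set P1:= psum _ _ _ _;set P2:= psum _ _ _ _.
 have h1: `|P1-Et * gker t v * cos (c+v * z)| <= e/(2*M) by exact: main.
 have h2: `|P2-Et * gker t v * cos (c-v * z)| <= e/(2*M) by apply: main;rewrite ?normrN ?sqrrN.
 have ->: (P1+P2)/2-cos c*Et*(gker t v * cos (v * z)) =
   ((P1-Et * gker t v * cos (c+v * z))+(P2-Et * gker t v * cos (c-v * z)))/2.
  by move: (v * z)=> vz;rewrite cosD cosB;field.
 rewrite normrM normfV (ger0_norm (_ : 0 <= 2))// ler_pdivrMr//.
 by apply: (le_trans (ler_normD _ _));rewrite mulr_natr mulr2n;exact: lerD.
have Ec: `|cos c*Et| <= 1.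
 have X0: 0 <= th^+2 * gam2 * m%:R/(2 * n%:R).
  by apply: divr_ge0;[apply: mulr_ge0=> //;apply: mulr_ge0=> //;exact: sqr_ge0|apply: mulr_ge0].
 rewrite normrM;apply: mulr_ile1;rewrite ?normr_ge0 ?cos_max// ger0_norm;last exact: expR_ge0.
 by rewrite expR_le1 oppr_le0.
clearbody t z Et.
have hd v: `|v| <= pi*L -> `|f v| <= eg * expR (- (cK * d0 * v^+2)).
 move=> vL;apply: (le_trans (hdom _ nN0 L th c p%:R v m L0 vL)).
 rewrite LL -expRD ler_expR mulrBr;apply: lerB.
  by apply: ler_piMl=> //;rewrite mulr_ge0// sqr_ge0.
 have ->: m%:R/n%:R*(cK * v^+2) = cK*(m%:R/n%:R) * v^+2 by ring.
 by apply: ler_wpM2r;[exact: sqr_ge0|rewrite ler_pM2l].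
have piL: M <= pi*L.
 by apply: (le_trans LM);apply: ler_peMl;[exact: ltW|exact: pi_ge1].
have M0': - M <= 0 by rewrite oppr_le0 ltW.
have pL0: 0 <= pi*L:= le_trans (ltW M0) piL.
clearbody L eg.
have key:= fourier_inv th c n.+1 m p%:Z L0.
have eb: psum mu n.+1 m (fun s=> ((sumn s)%:Z+p%:Z == m%:Z)%:R * cos (c+th*Gs s/L)) =
  psum mu n.+1 m (fun s=> (sumn s+p == m)%:R * cos (c+th*Gs s/L)).
 by apply: eq_psum=> s _ _;rewrite -PoszD eqz_nat.
rewrite {}eb -pmulrn in key.
set P:= psum mu n.+1 m _ in key *.
have cg: continuous (fun v : R=> eg * expR (- (cK * d0 * v^+2))).
 by move=> v;apply: cvgMr;exact: continuous_gauss.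
have T1: `|sint (- (pi*L)) (- M) f| <= eg/(cK * d0*M).
 apply: (le_trans (norm_sint _ _ cf)).
 apply: (le_via (sint (- (pi*L)) (- M) (fun v : R=> eg * expR (- (cK * d0 * v^+2))))).
  apply: le_sint=> //;first exact: continuous_norm.
  by move=> v /andP[v1 v2];apply: hd;rewrite ler_norml v1/= (le_trans v2)// (le_trans M0').
 rewrite sintZ;last exact: continuous_gauss.
 by rewrite ler_pM2l//;apply: sint_gauss_tailN=> //;rewrite mulr_gt0.
have T2: `|sint M (pi*L) f| <= eg/(cK * d0*M).
 apply: (le_trans (norm_sint _ _ cf)).
 apply: (le_via (sint M (pi*L) (fun v : R=> eg * expR (- (cK * d0 * v^+2))))).
  apply: le_sint=> //;first exact: continuous_norm.
  by move=> v /andP[v1 v2];apply: hd;rewrite ler_norml v2 andbT (le_trans _ v1)// (le_trans _ (ltW M0))// oppr_le0.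
 rewrite sintZ;last exact: continuous_gauss.
 by rewrite ler_pM2l//;apply: sint_gauss_tail=> //;rewrite mulr_gt0.
have cgc:= @continuous_gker_cos R t z.
have T3: `|sint (- M) M f-cos c*Et * gfour t M z| <= e.
 rewrite /gfour -sintZ//.
 have cc: continuous (fun v=> cos c*Et*(gker t v * cos (v * z))).
  by move=> v;apply: cvgMr;exact: cgc.
 apply: (le_via (sint (- M) M (fun=> e/(2*M)))).
  apply: norm_sintB_le=> //;first by move=> v;exact: cst_continuous.
  by move=> v /andP[v1 v2];apply: happ2;rewrite ler_norml v1.
 have MM: - M <= M by apply: (le_trans M0');exact: ltW.
 rewrite sint_cst// opprK -mulr2n -[M *+ 2]mulr_natl divfK//.
 by rewrite mulf_neq0 ?lt0r_neq0.
have T4: `|gfour t M z-sqrtr (2 * pi/t) * expR (- (z^+2/(2 * t)))| <= e.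
 apply: (le_trans (gfour_lim t0 z M0));apply: le_trans M2.
 have a0: 0 < t*M by exact: mulr_gt0.
 have b0: 0 < sig2 * d0*M by rewrite !mulr_gt0.
 apply: ler_wpM2l=> //;rewrite lef_pV2 ?posrE//.
 by apply: ler_wpM2r=> //;exact: ltW.
have sp: sint (- (pi*L)) (pi*L) f = sint (- (pi*L)) (- M) f+(sint (- M) M f+sint M (pi*L) f).
 have MM: - M <= M by apply: (le_trans M0');exact: ltW.
 rewrite (@sint_split _ _ _ (- M)) ?lerN2 ?(le_trans M0')//.
 by rewrite (@sint_split _ (- M) _ M).
have p0:= @pi_ge2 R.
have pp: 0 < 2 * pi :> R by rewrite mulr_gt0// pi_gt0.
have ->: lclt t z = (2 * pi)^-1*(sqrtr (2 * pi/t) * expR (- (z^+2/(2 * t)))).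
 rewrite /lclt;set E:= expR _;have s0: 0 < sqrtr (2 * pi * t) by rewrite sqrtr_gt0 mulr_gt0.
 have ->: 2 * pi/t = (2 * pi)^+2*(2 * pi * t)^-1.
  by rewrite invfM mulrA expr2 mulfK// lt0r_neq0.
 have t1: 0 <= 2 * pi * t by rewrite ltW// mulr_gt0.
 rewrite (@sqrtrM _ ((2 * pi)^+2) ((2 * pi * t)^-1) (sqr_ge0 _)) sqrtr_sqr gtr0_norm// sqrtrV//.
 have alg (a S E0 : R) : a != 0 -> S != 0 -> E0/S = a^-1*(a*S^-1*E0).
  by move=> a0 S0;field;rewrite a0 S0.
 by apply: alg;exact: lt0r_neq0.
set G:= sqrtr _ * expR _ in T4 *.
have ->: L*P-cos c*Et*((2 * pi)^-1*G) = (2 * pi)^-1*(2 * pi*L*P-cos c*Et*G).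
 have alg (a x y : R) : a != 0 -> x-cos c*Et*(a^-1 * y) = a^-1*(a * x-cos c*Et * y).
  by move=> a0;field.
 by rewrite -[2 * pi*L*P]mulrA;apply: alg;exact: lt0r_neq0.
rewrite normrM (ger0_norm (_ : 0 <= (2 * pi)^-1));last by rewrite invr_ge0 ltW.
rewrite ler_pdivrMl// key sp.
set x1:= sint _ _ f in T1 *;set x3:= sint _ _ f in T3 *;set x2:= sint _ _ f in T2 *.
have ->: x1+(x3+x2)-cos c*Et*G = x1+x2+(x3-cos c*Et * gfour t M z)+cos c*Et*(gfour t M z-G) by ring.
have T5: `|cos c*Et*(gfour t M z-G)| <= e.
 by rewrite normrM;apply: le_trans T4;rewrite ler_piMl.
have M1': eg/(cK * d0*M)+eg/(cK * d0*M) <= e by have ->: eg/(cK * d0*M)+eg/(cK * d0*M) = 2 * eg/(cK * d0*M) by ring.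
apply: (le_via (`|x1| + `|x2| + `|x3-cos c*Et * gfour t M z| + `|cos c*Et*(gfour t M z-G)|)).
 apply: (le_trans (ler_normD _ _));apply: lerD=> //.
 apply: (le_trans (ler_normD _ _));apply: lerD=> //.
 exact: ler_normD.
exact: llt_arith two_pi_ge4 e0 T1 T2 T3 T5 M1'.
Unshelve. all: end_near. Qed.

(** Integrate the Gaussian domination with th = 0. The scale is sqrt m and not sqrt n, so every
    positive length [m] is covered. *)
Lemma local_ub : exists (C0 : R) (N0 : nat), 0 < C0 /\ forall N, (N0 <= N)%N ->
  forall m (p : int), (0 < m)%N -> psum mu N m (fun s => ((sumn s)%:Z + p == m%:Z)%:R) <= C0 / sqrtr m%:R.
have [cK [N0 [cK0 hdom]]]:= ff_dom.
have i0: 0 < cK^-1 by rewrite invr_gt0.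
exists (2+2 * cK^-1), N0;split;first by lra.
move=> N NN0 m p m0;set L:= sqrtr m%:R.
have L1: 1 <= L by rewrite -sqrtr1 ler_sqrt ?ler1n.
have L0: 0 < L by lra.
have LL: L^+2 = m%:R by rewrite sqr_sqrtr.
have key:= fourier_inv 0 0 N m p L0.
set P:= psum mu N m (fun s=> ((sumn s)%:Z+p == m%:Z)%:R).
have eP: psum mu N m (fun s=> ((sumn s)%:Z+p == m%:Z)%:R * cos (0+0*Gs s/L)) = P.
 by apply: eq_psum=> s _ _;rewrite !mul0r addr0 cos0 mulr1.
rewrite {}eP in key.
pose f v:= psum mu N m (ff L 0 0 p%:~R v).
have cf: continuous f by apply: continuous_psum=> s;exact: continuous_ff.
have hd v: `|v| <= pi*L -> `|f v| <= expR (- (cK * v^+2)).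
 move=> vL;apply: (le_trans (hdom _ NN0 L 0 0 p%:~R v m L0 vL)).
 by rewrite LL divff ?pnatr_eq0 -?lt0n// mul1r expr0n/= mulr0 sub0r.
have cg:= @continuous_gauss R cK.
have p0:= @pi_ge2 R.
have piL: 1 <= pi*L by rewrite mulr_ege1// pi_ge1.
have le1: `|sint (- (pi*L)) (pi*L) f| <= 2+2 * cK^-1.
 apply: (le_trans (norm_sint _ _ cf)).
 apply: (le_via (sint (- (pi*L)) (pi*L) (fun v : R=> expR (- (cK * v^+2))))).
  apply: le_sint=> //;first exact: continuous_norm.
  by move=> v v1;apply: hd;rewrite ler_norml.
 have p11: -1 <= 1 :> R by rewrite -subr_ge0 opprK addr_ge0.
 have p10: -1 <= pi*L by exact: le_trans piL.
 rewrite (@sint_split _ _ _ (- 1)) ?lerN2//.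
 rewrite (@sint_split _ (- 1) _ 1)//.
 have t1:= sint_gauss_tailN cK0 ltr01 piL;have t2:= sint_gauss_tail cK0 ltr01 piL.
 rewrite mulr1 in t1 t2.
 have t3: sint (- 1) 1 (fun v : R=> expR (- (cK * v^+2))) <= 2.
  apply: (le_via (sint (- 1) 1 (fun=> (1 : R)))).
   apply: le_sint=> //;first by move=> v;exact: cst_continuous.
   by move=> v _;rewrite expR_le1 oppr_le0 mulr_ge0 ?sqr_ge0// ltW.
  by rewrite sint_cst// mul1r opprK.
 have ->: 2+2 * cK^-1 = cK^-1+(2+cK^-1) by ring.
 by apply: lerD=> //;exact: lerD.
rewrite -key in le1;rewrite ler_pdivlMr//;apply: le_trans le1;apply: le_trans (ler_norm _).
have P0: 0 <= P by apply: psum_ge0.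
have ->: 2 * pi*L*P = (2 * pi)*(P*L) by ring.
apply: ler_peMl;first by rewrite mulr_ge0// ltW.
by apply: le_trans two_pi_ge4;rewrite ler1n.
Qed.

End LLT.

(** * Tightness of the conditioned excursion *)

Section Maximal.
Context {R : realType}.
Implicit Types (w f : nat -> R).

Fixpoint crosses f (lam x : R) (s : seq nat) : bool :=
  (lam <= x) || (if s is k :: s' then crosses f lam (x + f k) s' else false).

(* Exponential tilting: t -> exp (t (x - lam)) rho^m dominates the crossing probability,
   by induction on the first step. *)
Lemma crosses_le w f N m (t rho lam x : R) : (forall k, 0 <= w k) -> 0 <= t -> 1 <= rho ->
  \sum_(k < N) w k <= 1 -> \sum_(k < N) w k * expR (t * f k) <= rho ->
  psum w N m (fun s => (crosses f lam x s)%:R) <= expR (t * (x - lam)) * rho ^+ m.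
move=> w0 t0 r1 w1 wr;elim: m x=> [|m IH] x.
 rewrite expr0 mulr1 /= orbF;case: (boolP (lam <= x))=> lx;last exact: expR_ge0.
 by apply: le_trans (expR_ge1Dx _);rewrite lerDl mulr_ge0// subr_ge0.
have [lx|lx]:= leP lam x.
 apply: (le_via 1).
  by apply: psum_le1=> // s _ _;case: (crosses _ _ _ _).
 apply: mulr_ege1;last exact: exprn_ege1.
 by apply: le_trans (expR_ge1Dx _);rewrite lerDl mulr_ge0// subr_ge0.
rewrite [leLHS](_ : _ = \sum_(k < N) w k * psum w N m (fun s=> (crosses f lam (x+f k) s)%:R));last first.
 by apply: eq_bigr=> k _;congr (_ * _);apply: eq_psum=> s _ _ /=;rewrite leNgt lx.
apply: (le_via (\sum_(k < N) w k*(expR (t*(x+f k-lam)) * rho^+m))).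
 by apply: ler_sum=> k _;exact: ler_wpM2l.
have r0: 0 <= rho by exact: le_trans r1.
have ->: \sum_(k < N) w k*(expR (t*(x+f k-lam)) * rho^+m) =
  (\sum_(k < N) w k * expR (t * f k))*(expR (t*(x-lam)) * rho^+m).
 rewrite mulr_suml;apply: eq_bigr=> k _.
 have ->: t*(x+f k-lam) = t * f k+t*(x-lam) by ring.
 by rewrite expRD !mulrA.
have ->: expR (t*(x-lam)) * rho^+m.+1 = rho*(expR (t*(x-lam)) * rho^+m).
 by rewrite exprS mulrCA.
by apply: ler_wpM2r=> //;rewrite mulr_ge0 ?expR_ge0 ?exprn_ge0.
Qed.

(** Weights are changed one letter at a time; each change costs at most the removed mass [q] because
    [F] is at most 1. *)
Lemma psum_truncate w w' N m F (q : R) : (forall k, 0 <= w' k <= w k) -> \sum_(k < N) w k <= 1 ->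
  \sum_(k < N) (w k - w' k) <= q -> (forall s, 0 <= F s <= 1) ->
  psum w N m F <= psum w' N m F + m%:R * q.
move=> ww w1 hq;have w0 k: 0 <= w k by case/andP: (ww k)=> h1;exact: le_trans.
elim: m F=> [|m IH] F F01 /=;first by rewrite mul0r addr0.
have q0: 0 <= q by apply: le_trans hq;apply: sumr_ge0=> k _;rewrite subr_ge0;case/andP: (ww k).
apply: (le_via (\sum_(k < N) (w' k * psum w' N m (fun s=> F (nat_of_ord k :: s))+(w k-w' k)
  + w k*(m%:R * q)))).
 apply: ler_sum=> k _.
 apply: (le_via (w k * psum w' N m (fun s=> F (nat_of_ord k :: s))+w k*(m%:R * q))).
  by rewrite -mulrDr ler_wpM2l// IH.
 rewrite lerD2r -lerBlDl -mulrBl ler_piMr//;first by rewrite subr_ge0;case/andP: (ww k).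
 apply: psum_le1=> //;first by move=> j;case/andP: (ww j).
  by apply: le_trans w1;apply: ler_sum=> j _;case/andP: (ww j).
 by move=> s _ _;case/andP: (F01 (nat_of_ord k :: s)).
rewrite !big_split/= -mulr_suml -!addrA lerD2l -natr1 mulrDl mul1r addrA addrC;apply: lerD.
 by rewrite ler_piMl// mulr_ge0.
by move: hq;rewrite big_split.
Qed.

Lemma crossesE f lam x s : crosses f lam x s =
  has (fun l => lam <= x + \sum_(k <- take l s) f k) (iota 0 (size s).+1).
elim: s x=> [|k s IH] x;first by rewrite /= big_nil addr0.
have ->: iota 0 (size (k :: s)).+1 = 0%N :: map S (iota 0 (size s).+1).
 by rewrite -(iotaDl 1).
rewrite [LHS]/= IH [RHS]/= has_map big_nil addr0;congr (_ || _).
by apply: eq_has=> l;rewrite /= big_cons addrA.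
Qed.

Lemma expR_le_sq (x : R) : `|x| <= 2^-1 -> expR x <= 1 + x + 2 * x ^+ 2.
rewrite ler_norml=> /andP[x1 x2].
have h:= expR_ge1Dx (- x);have p0: 0 < 1-x by lra.
have : expR x <= (1-x)^-1.
 by rewrite -[x in expR x]opprK expRN lef_pV2 ?posrE ?expR_gt0.
move=> h2;apply: (le_trans h2);rewrite -[leLHS]mul1r ler_pdivrMr//.
have ->: (1+x+2 * x^+2)*(1-x) = 1+x^+2*(1-2 * x) by ring.
by rewrite lerDl mulr_ge0 ?sqr_ge0//;lra.
Qed.

End Maximal.

(** * Truncation and maximal inequalities for the free walk *)

Section Tightness.
Context {R : realType}.
Variable (mu : nat -> R).
Hypothesis mu_ge0 : forall k, 0 <= mu k.
Variable V1 : R.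
Hypothesis cvg1 : mlim mu (fun=> 1) (1 : R).
Hypothesis cvg_sq : mlim mu (fun k => k.+1%:R ^+ 2) V1.
Variables (f : nat -> R) (Cf v2 : R).
Hypothesis f_le : forall k, `|f k| <= Cf * k.+1%:R.
Hypothesis cvg_f : mlim mu f (0 : R).
Hypothesis cvg_f2 : mlim mu (fun k => f k ^+ 2) v2.

Let trunc_mu (b : R) k : R := if `|f k| <= b then mu k else 0.

Lemma Cf_ge0 : 0 <= Cf.
Proof. by have:= f_le 0%N;rewrite mulr1;apply: le_trans. Qed.

Lemma v2_ge0 : 0 <= v2.
by apply: (le_trans _ (@msum_lim_ge _ _ mu_ge0 _ _ 0%N _ cvg_f2));[rewrite /msum big_ord0|move=> k;exact: sqr_ge0].
Qed.

Definition bigjump (N : nat) (b : R) : R := \sum_(k < N) (mu k - trunc_mu b k).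

(** With t = 1/(2b) the exponent stays below 1/2 on truncated letters and a quadratic bound applies.
    The truncated step is no longer centred: its mean is bounded through the removed part, at most
    v2/b, and the letters beyond [n], at most Cf V1/b since b <= sqrt n. *)
Lemma trunc_exp (b : R) n : (0 < n)%N -> 0 < b -> b <= sqn n ->
  \sum_(k < n.+1) trunc_mu b k * expR ((2 * b)^-1 * f k) <=
  1 + (v2 + Cf * V1) / b ^+ 2.
move=> n0 b0 bn;set t:= (2 * b)^-1.
have t0: 0 < t by rewrite invr_gt0 mulr_gt0.
have tb: t * b = 2^-1 by rewrite /t invfM -mulrA mulVf ?mulr1 ?lt0r_neq0.
have C0:= Cf_ge0;have V10:= V1_ge0 mu_ge0 cvg_sq;have v20:= v2_ge0.
pose g k:= if `|f k| <= b then 0 else mu k * f k.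
have hg: \sum_(k < n.+1) trunc_mu b k * f k <= `|msum mu f n.+1| + v2/b.
 have ->: \sum_(k < n.+1) trunc_mu b k * f k = msum mu f n.+1 - \sum_(k < n.+1) g k.
  rewrite /msum -sumrB;apply: eq_bigr=> k _;rewrite /trunc_mu /g;case: ifP=> _.
   by rewrite subr0.
  by rewrite mul0r subrr.
 apply: lerD;first exact: ler_norm.
 rewrite -sumrN;apply: (le_via (msum mu (fun k=> f k^+2) n.+1/b)).
  rewrite /msum mulr_suml;apply: ler_sum=> k _;rewrite /g;case: ifPn=> [_|].
   by rewrite oppr0;apply: mulr_ge0;[rewrite mulr_ge0 ?sqr_ge0|rewrite invr_ge0 ltW].
  rewrite -ltNge=> bf;rewrite -mulrN -mulrA ler_wpM2l// ler_pdivlMr//.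
  rewrite -(real_normK (num_real (f k))) expr2.
  apply: (le_via (`|f k| * b));last by rewrite ler_wpM2l// ltW.
  by rewrite ler_wpM2r// ?(ltW b0)// -normrN ler_norm.
 by apply: ler_wpM2r;[rewrite invr_ge0 ltW|apply: (msum_lim_ge mu_ge0 _ _ cvg_f2)=> k;exact: sqr_ge0].
have hm: `|msum mu f n.+1| <= Cf*V1/b.
 have:= @tail_bound _ _ mu_ge0 _ cvg_sq 1 f Cf 0 _ cvg_f n.+1;rewrite subr0 expr1=> h.
 have {h} h : n.+1%:R * `|msum mu f n.+1| <= Cf * mtail mu V1 n.+1.
  by apply: h=> k;rewrite expr1 expr2 mulrA ler_wpM2r.
 have tV: mtail mu V1 n.+1 <= V1.
  by rewrite /mtail lerBlDr lerDl;apply: msum_ge0=> // k;exact: sqr_ge0.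
 rewrite ler_pdivlMr//.
 apply: (le_via (n.+1%:R * `|msum mu f n.+1|));last first.
  by apply: (le_trans h);exact: ler_wpM2l.
 rewrite mulrC ler_wpM2r//;apply: (le_trans bn).
 have n1: 1 <= n.+1%:R :> R by rewrite ler1n.
 apply: (le_via (sqrtr (n.+1%:R^+2)));last by rewrite sqrtr_sqr ger0_norm.
 by rewrite ler_sqrt ?sqr_ge0// -natrX ler_nat expnS expn1 (leq_trans (leqnSn n))// leq_pmulr.
apply: (le_via (\sum_(k < n.+1) (trunc_mu b k+t*(trunc_mu b k * f k)+2 * t^+2*(mu k * f k^+2)))).
 apply: ler_sum=> k _;rewrite /trunc_mu;case: ifP=> fb;last first.
  rewrite !mul0r mulr0 addr0 add0r;apply: mulr_ge0;first by rewrite mulr_ge0// sqr_ge0.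
  by rewrite mulr_ge0// sqr_ge0.
 have ->: mu k+t*(mu k * f k)+2 * t^+2*(mu k * f k^+2) = mu k*(1+t * f k+2*(t * f k)^+2) by ring.
 apply: ler_wpM2l=> //;apply: expR_le_sq;rewrite normrM (gtr0_norm t0) -tb.
 by rewrite ler_wpM2l// ltW.
rewrite !big_split/= -!mulr_sumr.
have h1: \sum_(i < n.+1) trunc_mu b i <= 1.
 apply: (le_trans _ (sum_mu_le1 mu_ge0 cvg1 n.+1));apply: ler_sum=> k _.
 by rewrite /trunc_mu;case: ifP.
have h2: \sum_(i < n.+1) mu i * f i^+2 <= v2.
 by apply: (msum_lim_ge mu_ge0 _ _ cvg_f2)=> k;exact: sqr_ge0.
rewrite -addrA;apply: lerD=> //.
apply: (le_via (t*(Cf*V1/b+v2/b)+2 * t^+2 * v2)).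
 apply: lerD;apply: ler_wpM2l=> //;first exact: ltW.
  by apply: (le_trans hg);exact: lerD.
 by rewrite mulr_ge0// sqr_ge0.
have ->: t*(Cf*V1/b+v2/b)+2 * t^+2 * v2 = (v2+2^-1*(Cf*V1))/b^+2.
 by rewrite /t;field;exact: lt0r_neq0.
apply: ler_wpM2r;first by rewrite invr_ge0 sqr_ge0.
rewrite lerD2l;apply: ler_piMl;first exact: mulr_ge0.
by rewrite invf_le1// ler1n.
Qed.

(** A jump above [b] needs a letter at least [K]. This produces a tail of the second moment, so that
    [n] times [bigjump] at level a sqrt n tends to 0. *)
Lemma bigjump_le (b : R) N : 0 < b -> forall K, (Cf * K%:R <= b) ->
  bigjump N b <= Cf ^+ 2 * mtail mu V1 K / b ^+ 2.
move=> b0 K Kb;have C0:= Cf_ge0.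
rewrite ler_pdivlMr ?exprn_gt0// /bigjump mulr_suml.
pose G k:= if (K <= k)%N then mu k * k.+1%:R^+2 else 0.
apply: (le_via (\sum_(k < N) Cf^+2*G k)).
 apply: ler_sum=> k _;rewrite /trunc_mu /G;case: ifPn=> [_|].
  by rewrite subrr mul0r mulr_ge0 ?sqr_ge0//;case: ifP=> // _;rewrite mulr_ge0 ?sqr_ge0.
 rewrite -ltNge subr0=> bf;case: leqP=> Kk.
  rewrite [leRHS]mulrCA;apply: ler_wpM2l=> //;rewrite -exprMn lerXn2r ?nnegrE ?mulr_ge0 ?(ltW b0)//.
  by apply: le_trans (f_le k);exact: ltW.
 exfalso;move: bf;rewrite ltNge=> /negP;apply;apply: le_trans Kb;apply: (le_trans (f_le k)).
 by rewrite ler_wpM2l// ler_nat.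
rewrite -mulr_sumr;apply: ler_wpM2l;first exact: sqr_ge0.
have [KN|NK]:= leqP K N;last first.
 rewrite big1 ?mtail_ge0// => k _;rewrite /G leqNgt (ltn_trans (ltn_ord k))//.
apply: (le_via (msum mu (fun k=> k.+1%:R^+2) N-msum mu (fun k=> k.+1%:R^+2) K)).
 rewrite msum_split// -(big_mkord xpredT G) (@big_cat_nat _ _ _ K)//=.
 rewrite big_nat_cond big1 ?add0r;last by move=> k /andP[/andP[_ kK] _];rewrite /G leqNgt kK.
 by apply: eq_le_val;apply: eq_big_nat=> k /andP[Kk _];rewrite /G Kk.
by rewrite lerD2r;apply: (msum_lim_ge mu_ge0 _ _ cvg_sq)=> k;exact: sqr_ge0.
Qed.

Lemma free_max_one (a x lam : R) n m : (0 < n)%N -> 0 < a <= 1 -> (forall k, `|f k| <= Cf * k.+1%:R) ->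
  psum mu n.+1 m (fun s => (crosses f lam 0 s)%:R) <=
  expR (- lam / (2 * a * sqn n)) * expR (m%:R * ((v2 + Cf * V1) / (a ^+ 2 * n%:R)))
   + m%:R * bigjump n.+1 (a * sqn n).
move=> n0 /andP[a0 a1] _;set q:= sqn n.
have q0: 0 < q by rewrite sqrtr_gt0 ltr0n.
have b0: 0 < a * q by rewrite mulr_gt0.
have C0:= Cf_ge0;have V10:= V1_ge0 mu_ge0 cvg_sq;have v20:= v2_ge0.
have tm k: 0 <= trunc_mu (a * q) k <= mu k by rewrite /trunc_mu;case: ifP;rewrite ?lexx ?mu_ge0.
apply: (le_via (psum (trunc_mu (a * q)) n.+1 m (fun s=> (crosses f lam 0 s)%:R)+m%:R * bigjump n.+1 (a * q))).
 apply: psum_truncate=> //;first exact: sum_mu_le1.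
 by move=> s;case: (crosses _ _ _ _);rewrite ?lexx ler01.
apply: lerD=> //.
apply: (le_via (expR ((2*(a * q))^-1*(0-lam))*(1+(v2+Cf*V1)/(a * q)^+2)^+m)).
 apply: crosses_le=> //.
 - by move=> k;case/andP: (tm k).
 - by rewrite invr_ge0 mulr_ge0// ltW.
 - by rewrite lerDl divr_ge0 ?sqr_ge0// addr_ge0// mulr_ge0.
 - by apply: (le_trans _ (sum_mu_le1 mu_ge0 cvg1 n.+1));apply: ler_sum=> k _;case/andP: (tm k).
 - by apply: trunc_exp=> //;rewrite ler_piMl// ltW.
apply: ler_pM;rewrite ?expR_ge0//.
- by rewrite exprn_ge0// addr_ge0// divr_ge0 ?sqr_ge0// addr_ge0// mulr_ge0.
- by rewrite sub0r [X in expR X <= _]mulrC mulrA.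
rewrite expRM_natl;apply: lerXn2r;rewrite ?nnegrE ?expR_ge0//.
 by rewrite addr_ge0// divr_ge0 ?sqr_ge0// addr_ge0// mulr_ge0.
have ->: a^+2 * n%:R = (a * q)^+2 by rewrite exprMn sqr_sqrtr.
exact: expR_ge1Dx.
Qed.

Definition hugeosc (L : nat) (lam : R) (s : seq nat) : bool :=
  has (fun l => lam < `|\sum_(k <- take l s) f k|) (iota 0 L.+1).

(** Closing the word into a circle makes the event invariant under rotation, as the cycle lemma
    demands; [osc] is the event wanted in the end. *)
Definition circosc (L : nat) (lam : R) (s : seq nat) : bool :=
  has (fun i => hugeosc L lam (rot i s)) (iota 0 (size s)).

Definition osc (L : nat) (lam : R) (s : seq nat) : bool :=
  has (fun i => hugeosc L lam (drop i s)) (iota 0 (size s)).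

Lemma osc_circosc L lam s : osc L lam s -> circosc L lam s.
case/hasP=> i;rewrite mem_iota=> /andP[_ /= il] /hasP[l];rewrite mem_iota=> /andP[_ lL] h.
apply/hasP;exists i;first by rewrite mem_iota.
apply/hasP;exists (minn l (size s-i)).
 by rewrite mem_iota /=;move: lL;rewrite !add0n !ltnS=> lL;rewrite geq_min lL.
move: h;rewrite /rot take_cat size_drop;case: ltnP=> hl.
 by have ->: minn l (size s-i) = l by lia.
have ->: minn l (size s-i) = (size s-i)%N by lia.
by rewrite subnn take0 cats0 take_oversize// size_drop;lia.
Qed.

Lemma circosc_rot L lam s j : circosc L lam (rot j s) = circosc L lam s.
have imp t i: (i <= size t)%N -> circosc L lam (rot i t) -> circosc L lam t.
 move=> it /hasP[k];rewrite mem_iota size_rot add0n=> /andP[_ kl] h.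
 move: h;rewrite rot_add_mod ?(ltnW kl)//;set m:= (if _ then _ else _)=> h.
 have ml: (m <= size t)%N by rewrite /m;case: ifP=> //;lia.
 apply/hasP;move: ml;rewrite leq_eqVlt=> /predU1P[em|ml].
  by exists 0%N;[rewrite mem_iota;lia|rewrite rot0;move: h;rewrite em rot_size].
 by exists m=> //;rewrite mem_iota.
have [js|js]:= leqP (size s) j;first by rewrite rot_oversize.
apply/idP/idP;first by apply: imp;exact: ltnW.
have e: rot (size s-j) (rot j s) = s by rewrite -rotD subnK ?rot_size// ltnW.
by move=> h;apply: (imp _ (size s-j)%N);rewrite ?size_rot ?leq_subr// e.
Qed.

Lemma hugeosc_crosses L lam s : (L <= size s)%N -> hugeosc L lam s ->
  crosses f lam 0 (take L s) || crosses (fun k => - f k) lam 0 (take L s).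
move=> Ls /hasP[l];rewrite mem_iota=> /andP[_ lL];rewrite add0n ltnS in lL.
have lt: take l s = take l (take L s) by rewrite take_takel.
have lm: l \in iota 0 (size (take L s)).+1.
 by rewrite mem_iota /= add0n ltnS size_takel.
rewrite lt ltr_normr=> /orP[] h;apply/orP;[left|right];rewrite crossesE;apply/hasP;exists l=> //.
 by rewrite add0r ltW.
by rewrite add0r sumrN ltW.
Qed.

(* A long excursion of the cyclic walk is seen from the nearest earlier multiple of L. *)
Lemma circosc_blocks L lam s : (0 < L)%N -> (L.*2 <= size s)%N -> circosc L lam s ->
  has (fun a => hugeosc L.*2 (lam / 2) (rot (a * L) s)) (iota 0 (size s %/ L).+1).
move=> L0 Ls /hasP[i];rewrite mem_iota add0n=> /andP[_ il] /hasP[l].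
rewrite mem_iota add0n=> /andP[_ lL] h;rewrite ltnS in lL;pose a:= (i %/ L)%N.
have ia: (a*L <= i)%N by rewrite /a leq_trunc_div.
have ia2: (i < a*L+L)%N by rewrite /a {1}(divn_eq i L) ltn_add2l ltn_pmod.
apply/hasP;exists a.
 by rewrite mem_iota /= add0n ltnS /a leq_div2r// ltnW.
set t:= rot (a*L) s;set c:= (i-a*L)%N.
have et: rot i s = rot c t.
 by rewrite /t -rotD ?subnK// ltnW.
have cl: (c+l <= size t)%N by rewrite size_rot /c;lia.
have e1: take l (rot c t) = drop c (take (c+l) t).
 have h1: take (c+l) t = take c t ++ take l (drop c t) by rewrite takeD.
 rewrite h1 drop_size_cat ?size_takel//;last by lia.
 by rewrite /rot takel_cat// size_drop;lia.
move: h;rewrite et e1=> h.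
have sp: \sum_(k <- take (c+l) t) f k = \sum_(k <- take c t) f k + \sum_(k <- drop c (take (c+l) t)) f k.
 by rewrite -[in LHS](cat_take_drop c (take (c+l) t)) big_cat/= take_takel// leq_addr.
have [h1|h1]:= ltP (lam/2) `|\sum_(k <- take c t) f k|.
 by apply/hasP;exists c=> //;rewrite mem_iota /= add0n ltnS /c;lia.
apply/hasP;exists (c+l)%N;first by rewrite mem_iota /= add0n ltnS /c;lia.
rewrite ltNge;apply/negP=> h2.
move: h;rewrite ltNge=> /negP;apply.
have ->: \sum_(k <- drop c (take (c+l) t)) f k = \sum_(k <- take (c+l) t) f k - \sum_(k <- take c t) f k.
 by rewrite sp addrC addKr.
by apply: (le_trans (ler_normB _ _));rewrite [lam]splitr;exact: lerD.
Qed.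

End Tightness.

(** * Oscillation of the conditioned walk *)

Notation excsum mu n s F := (psum mu n.+1 n (fun s => (hits 1 s)%:R * F)) (only parsing).

Section ExcursionTightness.
Context {R : realType}.
Variables (mu : nat -> R) (V1 : R).
Variable sig2 : R.
Hypothesis crit : critical_law mu V1 sig2.
Hypothesis sig2_gt0 : 0 < sig2.

Lemma msum0 g : (forall k, g k = 0) -> mlim mu g (0 : R).
move=> g0;have ->: msum mu g = fun=> 0 by apply/funext=> N;rewrite /msum big1// => k _;rewrite g0 mulr0.
exact: cvg_cst.
Qed.

Lemma bridge_lb : exists2 c : R, 0 < c & \forall n \near \oo,
  c <= sqn n * psum mu n.+1 n (fun s => (sumn s + 1 == n)%:R).
pose c:= expR (- (1/(2 * sig2)))/sqrtr (2 * pi * sig2).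
have s0: 0 < sqrtr (2 * pi * sig2) by rewrite sqrtr_gt0 !mulr_gt0// pi_gt0.
have c0: 0 < c by rewrite divr_gt0// expR_gt0.
exists (c/2);first by rewrite divr_gt0.
have c20: 0 < c/2 by rewrite divr_gt0.
have z (k : nat) : `|(fun=> 0 : R) k| <= 0 * k.+1%:R :> R by rewrite normr0 mul0r.
have e1:= msum0 (fun k : nat=> erefl (0 : R)).
have e2: mlim mu (fun k=> (fun=> 0 : R) k^+2) (0 : R) by apply: msum0=> k;rewrite expr0n.
have e3: mlim mu (fun k=> (k%:R-1)*(fun=> 0 : R) k) (0 : R) by apply: msum0=> k;rewrite mulr0.
have h:= local_clt crit sig2_gt0 z e1 e2 e3 0 ltr01 c20.
near=> n.
have n0: (0 < n)%N by near_nat n.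
have nn0: 0 < n%:R :> R by rewrite ltr0n.
have : forall m p (c0 : R), (m <= n)%N -> 1 * n%:R <= m%:R :> R ->
 `|sqn n * psum mu n.+1 m (fun s=> (sumn s+p == m)%:R * cos (c0+0*(\sum_(k <- s) 0)/sqn n))
  - cos c0 * expR (- (0^+2*0 * m%:R/(2 * n%:R))) * lclt (sig2*(m%:R/n%:R)) (p%:R/sqn n)| <= c/2.
 by near: n;exact: h.
move=> /(_ n 1%N 0 (leqnn n));rewrite mul1r=> /(_ (lexx _)).
have ->: psum mu n.+1 n (fun s=> (sumn s+1 == n)%:R * cos (0+0*(\sum_(k <- s) 0)/sqn n)) =
 psum mu n.+1 n (fun s=> (sumn s+1 == n)%:R).
 by apply: eq_psum=> s _ _;rewrite !mul0r addr0 cos0 mulr1.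
rewrite cos0 mulr0 !mul0r oppr0 expR0 !mul1r divff ?mulr1;last exact: lt0r_neq0.
rewrite ler_norml=> /andP[hl _].
have hc: c <= lclt sig2 (1/sqn n).
 rewrite /lclt /c ler_pM2r ?invr_gt0// ler_expR lerN2 ler_pM2r ?invr_gt0 ?mulr_gt0//.
 by rewrite div1r exprVn (sqr_sqrtr (ltW nn0)) invf_le1// ler1n.
rewrite [c]splitr in hc;move: hl hc;rewrite mul1r.
by move: (_ * psum _ _ _ _) (lclt _ _) (c/2)=> x y w;lra.
Unshelve. all: end_near. Qed.

Lemma kemperman1 N m p : m%:R * psum mu N m (fun s => (hits p s)%:R) =
  p%:R * psum mu N m (fun s => (sumn s + p == m)%:R).
have:= @kemperman R mu N m p (fun=> 1) (fun _ _ _=> erefl).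
have e (F : seq nat -> bool) : psum mu N m (fun s=> (F s)%:R*1) = psum mu N m (fun s=> (F s)%:R).
 by apply: eq_psum=> s _ _;rewrite mulr1.
by rewrite !e.
Qed.

(** Total weight of the trees with [n] vertices. It is at least of order n^(-3/2), which is the
    yardstick for all later error bounds. *)
Definition treeP (n : nat) : R := psum mu n.+1 n (fun s => (hits 1 s)%:R).

Lemma treeP_lb : exists2 c : R, 0 < c & \forall n \near \oo, c <= n%:R * sqn n * treeP n.
have [c c0 h]:= bridge_lb;exists c=> //;near=> n.
rewrite mulrAC kemperman1 mul1r mulrC;by near: n;exact: h.
Unshelve. all: end_near. Qed.

Variables (f : nat -> R) (Cf v2 : R).
Hypothesis f_le : forall k, `|f k| <= Cf * k.+1%:R.
Hypothesis cvg_f : mlim mu f (0 : R).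
Hypothesis cvg_f2 : mlim mu (fun k => f k ^+ 2) v2.

Lemma cvg_fN : mlim mu (fun k => - f k) (0 : R).
have ->: msum mu (fun k=> - f k) = fun N=> - msum mu f N.
 by apply/funext=> N;rewrite /msum -sumrN;apply: eq_bigr=> k _;rewrite mulrN.
by rewrite -oppr0;exact: cvgN.
Qed.

Lemma free_hugeosc (a : R) L n lam : (0 < n)%N -> 0 < a <= 1 ->
  psum mu n.+1 L (fun s => (hugeosc f L lam s)%:R) <=
  2 * (expR (- lam / (2 * a * sqn n)) * expR (L%:R * ((v2 + Cf * V1) / (a ^+ 2 * n%:R)))
   + L%:R * bigjump mu f n.+1 (a * sqn n)).
move=> n0 a01.
have f_leN k: `|- f k| <= Cf * k.+1%:R by rewrite normrN.
have cvg_f2N: mlim mu (fun k=> (- f k)^+2) v2.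
 by under eq_fun do under [X in msum _ X]eq_fun do rewrite sqrrN.
apply: (le_via (psum mu n.+1 L (fun s=> (crosses f lam 0 s)%:R+(crosses (fun k=> - f k) lam 0 s)%:R))).
 apply: psum_ler=> // s sL _;case: (boolP (hugeosc f L lam s))=> [h|_];last by rewrite addr_ge0.
 have:= hugeosc_crosses (eq_leq (esym sL)) h;rewrite take_oversize ?sL//.
 by case/orP=> ->;rewrite ?lerDl ?lerDr.
rewrite psumD mulr_natl mulr2n;apply: lerD.
 exact: (free_max_one (law_ge0 crit) (law_one crit) (law_sq crit) f_le cvg_f cvg_f2).
have ->: bigjump mu f n.+1 (a * sqn n) = bigjump mu (fun k=> - f k) n.+1 (a * sqn n).
 by apply: eq_bigr=> k _;rewrite normrN.
exact: (free_max_one (law_ge0 crit) (law_one crit) (law_sq crit) f_leN cvg_fN cvg_f2N).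
Qed.

Lemma local_ub0 : exists (C0 : R) (N0 : nat), 0 < C0 /\ forall N, (N0 <= N)%N ->
  forall m (p : int), (0 < m)%N -> psum mu N m (fun s => ((sumn s)%:Z + p == m%:Z)%:R) <= C0 / sqrtr m%:R.
have e2: mlim mu (fun k=> (fun=> 0 : R) k^+2) (0 : R) by apply: msum0=> k;rewrite expr0n.
exact: (local_ub crit e2).
Qed.

(** Given the first [m] letters, the remaining ones, at least n/2 in number, must have a prescribed
    sum, an event of weight O(1/sqrt n) uniformly. *)
Lemma bridge_density : exists2 C : R, 0 < C & \forall n \near \oo, forall (G : seq nat -> R) m,
  (forall s, 0 <= G s) -> (2 * m <= n)%N ->
  psum mu n.+1 n (fun s => (sumn s + 1 == n)%:R * G (take m s)) <= C / sqn n * psum mu n.+1 m G.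
have [C0 [N0 [C00 hub]]]:= local_ub0.
exists (2*C0);first by rewrite mulr_gt0.
near=> n=> G m G0 mn.
have n0: (0 < n)%N by near_nat n.
have nn0: 0 < n%:R :> R by rewrite ltr0n.
have nN: (N0 <= n.+1)%N by apply: leqW;near: n;exact: nbhs_infty_ge.
have mn': (m <= n)%N by lia.
rewrite -[X in psum _ _ X _](subnKC mn') psum_cat -psumZ;apply: psum_ler=> // s sm _.
rewrite (@eq_psum _ _ _ _ _ (fun u=> ((sumn u)%:Z+((sumn s)%:Z+1-m%:Z) == (n-m)%:Z)%:R*G s));last first.
 move=> u _ _;rewrite -sm take_size_cat// sumn_cat;congr ((nat_of_bool _)%:R * _).
 by apply/idP/idP=> /eqP h;apply/eqP;lia.
rewrite psumZr;apply: ler_wpM2r=> //.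
have nm0: (0 < n-m)%N by lia.
apply: (le_trans (hub _ nN (n-m)%N _ nm0)).
have q0: 0 < sqn n :> R by rewrite sqrtr_gt0.
have q1: 0 < sqrtr (n-m)%:R :> R by rewrite sqrtr_gt0 ltr0n.
rewrite ler_pdivrMr// mulrAC ler_pdivlMr// mulrC [2*C0]mulrC -mulrA.
rewrite [leLHS]mulrC ler_pM2l//.
have ->: 2 * sqrtr (n-m)%:R = sqrtr (4*(n-m)%:R) :> R.
 by rewrite sqrtrM// (_ : 4 = 2^+2) ?sqrtr_sqr ?ger0_norm// -natrX.
by rewrite ler_sqrt ?mulr_ge0// -natrM ler_nat;lia.
Unshelve. all: end_near. Qed.

(** About 1/a^2 blocks of length a^2 n will be summed; cubic decay leaves a total of order [a]. *)
Lemma exp_cube (y : R) : 0 < y -> expR (- y) <= 6 / y ^+ 3.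
move=> y0;have:= expR_ge1Dxn 2 (ltW y0);rewrite (_ : 3`! = 6%N)// => h.
rewrite expRN -[leRHS]invrK lef_pV2 ?posrE ?expR_gt0 ?invr_gt0 ?divr_gt0 ?exprn_gt0//.
by rewrite invf_div;apply: le_trans h;rewrite lerDr.
Qed.

Lemma hugeosc_take L lam s : (L <= size s)%N -> hugeosc f L lam (take L s) = hugeosc f L lam s.
move=> Ls;apply: eq_in_has=> l;rewrite mem_iota=> /andP[_ lL].
by rewrite take_takel// -ltnS.
Qed.

(* The oscillation of the walk under the law of the conditioned excursion: cyclic
   invariance reduces it to the bridge, whose first half has a bounded density with
   respect to the free walk. *)
Theorem excursion_circosc (e kap : R) : 0 < e -> 0 < kap -> exists2 d : R, 0 < d <= 1 &
  \forall n \near \oo, excsum mu n s (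
     (circosc f (truncn (d * n%:R)) (e * sqn n) s)%:R) <= kap * treeP n.
move=> e0 k0;have [c c0 hlb]:= bridge_lb;have [C C0 hden]:= bridge_density.
pose K:= v2+Cf*V1.
have K0: 0 <= K by rewrite addr_ge0 ?(v2_ge0 (law_ge0 crit) cvg_f2)// mulr_ge0 ?(Cf_ge0 f_le)// (V1_ge0 (law_ge0 crit) (law_sq crit)).
(* 384 is 6 times 4^3, from [exp_cube] at y = e/(4a). *)
have [w w0 ew] : exists2 w : R, 0 < w & w = 384 by exists 384;rewrite ?ltr0n.
pose D:= 8*C * expR (2*K)*(w/e^+3).
have D0: 0 < D.
 apply: mulr_gt0;last by apply: divr_gt0=> //;exact: exprn_gt0.
 by apply: mulr_gt0;[exact: mulr_gt0|exact: expR_gt0].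
(* [a] gives both the truncation level a sqrt n and the window a^2 n; a <= 1/3 makes two windows
   shorter than half the word. *)
pose a:= minr 3^-1 (kap * c/(2*D)).
have q0: 0 < kap * c/(2*D) by apply: divr_gt0;exact: mulr_gt0.
have a0: 0 < a by rewrite lt_min q0 invr_gt0 ltr0n.
have a3: a <= 3^-1 by rewrite ge_min lexx.
have aD: D * a <= kap * c/2.
 have h: a <= kap * c/(2*D) by rewrite ge_min lexx orbT.
 rewrite mulrC -ler_pdivlMr//;apply: (le_trans h).
 by rewrite invfM mulrA.
clearbody a.
have d9: a^+2 <= 9^-1 by rewrite (_ : 9^-1 = 3^-1^+2);[rewrite ler_sqr ?nnegrE ?invr_ge0// ltW|rewrite exprVn -natrX].
have d0: 0 < a^+2 by rewrite exprn_gt0.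
exists (a^+2).
 by rewrite d0;apply: (le_trans d9);rewrite invf_le1// ler1n.
pose D2:= 16*C*Cf^+2/a^+2.
have D20: 0 <= D2.
 by apply: divr_ge0;[apply: mulr_ge0;[apply: mulr_ge0=> //;exact: ltW|exact: sqr_ge0]|exact: sqr_ge0].
have dD2: 0 < kap * c/2/(D2+1).
 by apply: divr_gt0;[apply: divr_gt0=> //;exact: mulr_gt0|exact: ltr_wpDl].
have /cvgrPdist_le /(_ _ dD2)[K1 _ hK1]:= mtail_cvg (law_sq crit).
have tK1: mtail mu V1 K1 <= kap * c/2/(D2+1).
 by have:= hK1 K1 (leqnn K1);rewrite sub0r normrN ger0_norm// (mtail_ge0 (law_ge0 crit) (law_sq crit)).
near=> n.
have n0: (0 < n)%N by near_nat n.
have nn0: 0 < n%:R :> R by rewrite ltr0n.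
have q1: 0 < sqn n :> R by rewrite sqrtr_gt0.
have hdn: forall (G : seq nat -> R) m, (forall s, 0 <= G s) -> (2 * m <= n)%N ->
 psum mu n.+1 n (fun s=> (sumn s+1 == n)%:R*G (take m s)) <= C/sqn n * psum mu n.+1 m G.
 by near: n;exact: hden.
have hB: c <= sqn n * psum mu n.+1 n (fun s=> (sumn s+1 == n)%:R) by near: n;exact: hlb.
have hdn2: 2/a^+2 <= n%:R by near_nat n.
have hsq: Cf*K1%:R/a <= sqn n by near_nat n.
set L:= truncn (a^+2 * n%:R).
have dn2: 2 <= a^+2 * n%:R by rewrite mulrC -ler_pdivrMr.
have L1: L%:R <= a^+2 * n%:R by rewrite truncn_le// mulr_ge0// ltW.
have L2: a^+2 * n%:R < L%:R+1 by rewrite natr1 truncnS_gt.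
clearbody L.
have L0: (0 < L)%N.
 rewrite -(ltr0n R);apply: (@lt_le_trans _ _ 1)=> //;rewrite -(lerD2r 1);apply: (le_trans dn2).
 exact: ltW.
have L9: (4*L <= n)%N.
 rewrite -(ler_nat R) natrM;apply: (le_via (4*(9^-1 * n%:R))).
  by rewrite ler_pM2l//;apply: (le_trans L1);rewrite ler_pM2r.
 rewrite mulrA;apply: ler_piMl;first exact: ltW.
 by rewrite ler_pdivrMr ?ltr0n// mul1r ler_nat.
have L4n: (2*L.*2 <= n)%N by rewrite -mul2n mulnA.
have L2n: (L.*2 <= n)%N by apply: leq_trans L4n;rewrite leq_pmull.
have Lh: n%:R * a^+2 <= 2*L%:R.
 rewrite mulrC;have : (1 : R) <= L%:R by rewrite ler1n.
 by move=> h;apply: (le_trans (ltW L2));rewrite mulr_natl mulr2n lerD2l.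
have nL: (n %/ L).+1%:R*L%:R <= 2 * n%:R :> R.
 rewrite -!natrM ler_nat mulSn mul2n -addnn;apply: leq_add (leq_trunc_div n L).
 by apply: leq_trans L9;rewrite leq_pmull.
set lam:= e * sqn n.
set BB:= psum mu n.+1 n (fun s=> (sumn s+1 == n)%:R) in hB.
have kem: n%:R * treeP n = BB by rewrite kemperman1 mul1r.
have BB0: 0 <= BB by apply: psum_ge0.
rewrite -(ler_pM2l nn0) [leRHS]mulrCA kem.
apply: (le_trans (cycle_ineq (F:= fun s=> (circosc f L lam s)%:R) n.+1 n (law_ge0 crit) _ _))=> //.
 by move=> i s;rewrite circosc_rot.
pose H s : R:= (hugeosc f L.*2 (lam/2) s)%:R.
apply: (le_via (\sum_(b < (n %/ L).+1) psum mu n.+1 n (fun s=> (sumn s+1 == n)%:R*H (rot (b*L) s)))).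
 rewrite -psum_sum;apply: psum_ler=> // s sn _;rewrite -mulr_sumr;apply: ler_wpM2l=> //.
 case: (boolP (circosc f L lam s))=> [hc|_];last by apply: sumr_ge0=> b _;rewrite /H.
 have : has (fun b=> hugeosc f L.*2 (lam/2) (rot (b*L) s)) (iota 0 (size s %/ L).+1).
  by apply: circosc_blocks=> //;rewrite sn.
 case/hasP=> b;rewrite mem_iota add0n sn=> /andP[_ bn] hb.
 rewrite (bigD1 (Ordinal bn))//= /H hb lerDl;by apply: sumr_ge0.
(* The bridge is invariant under rotation, so every block may be moved to the front, where the
   density bound holds. *)
have hper (b : 'I_(n %/ L).+1) : psum mu n.+1 n (fun s=> (sumn s+1 == n)%:R*H (rot (b*L) s)) =
  psum mu n.+1 n (fun s=> (sumn s+1 == n)%:R*H (take L.*2 s)).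
 transitivity (psum mu n.+1 n (fun s=> (fun t=> (sumn t+1 == n)%:R*H t) (rot (b*L) s))).
  by apply: eq_psum=> s _ _;rewrite (perm_sumn (_ : perm_eq (rot (b*L) s) s)) ?perm_rot.
 have bL: (b*L <= n)%N by apply: leq_trans (leq_trunc_div n L);rewrite leq_mul2r -ltnS ltn_ord orbT.
 rewrite (@psum_rot _ mu n.+1 n (b*L) (fun t=> (sumn t+1 == n)%:R*H t) bL).
 by apply: eq_psum=> s sn _;rewrite /H hugeosc_take// sn.
rewrite (eq_bigr _ (fun b _=> hper b)) sumr_const card_ord -mulr_natl.
have H0 s: 0 <= H s by rewrite /H.
apply: (le_via ((n %/ L).+1%:R*(C/sqn n * psum mu n.+1 L.*2 H))).
 by apply: ler_wpM2l=> //;exact: hdn.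
have a1: 0 < a <= 1 by rewrite a0 (le_trans a3)// invf_le1// ler1n.
have hH:= free_hugeosc L.*2 (lam/2) n0 a1.
rewrite -/(psum mu n.+1 L.*2 H) -/K in hH.
have E1: expR (- (lam/2)/(2 * a * sqn n)) <= w/e^+3 * a^+3.
 have ->: - (lam/2)/(2 * a * sqn n) = - (e/(4 * a)).
  by rewrite /lam;field;rewrite !lt0r_neq0.
 have ea0: 0 < e/(4 * a) by rewrite divr_gt0// mulr_gt0.
 apply: (le_trans (exp_cube ea0));apply: eq_le_val.
 by rewrite ew;field;rewrite !lt0r_neq0.
have E2: expR (L.*2%:R*(K/(a^+2 * n%:R))) <= expR (2*K).
 rewrite ler_expR mulrA ler_pdivrMr ?mulr_gt0// -mul2n natrM.
 have ->: 2*K*(a^+2 * n%:R) = 2*(a^+2 * n%:R)*K by ring.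
 by apply: ler_wpM2r=> //;rewrite ler_pM2l.
have E3: n%:R * bigjump mu f n.+1 (a * sqn n) <= Cf^+2 * mtail mu V1 K1/a^+2.
 have aq: 0 < a * sqn n by rewrite mulr_gt0.
 have hK: Cf*K1%:R <= a * sqn n by rewrite [leRHS]mulrC -ler_pdivrMr.
 have:= @bigjump_le _ _ (law_ge0 crit) _ (law_sq crit) _ _ f_le _ n.+1 aq K1 hK.
 rewrite exprMn (sqr_sqrtr (ltW nn0))=> h.
 apply: (le_via (n%:R*(Cf^+2 * mtail mu V1 K1/(a^+2 * n%:R)))).
  by apply: ler_wpM2l=> //;exact: ltW.
 by apply: eq_le_val;field;rewrite !lt0r_neq0.
have X0: 0 <= bigjump mu f n.+1 (a * sqn n).
 by apply: sumr_ge0=> k _;rewrite subr_ge0;case: ifP.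
have M0:= mtail_ge0 (law_ge0 crit) (law_sq crit) K1.
have Lr0: 0 < L%:R :> R by rewrite ltr0n.
have na: (n %/ L).+1%:R * a^+2 <= 4 :> R.
 rewrite -(ler_pM2r Lr0) mulrAC;apply: (le_via (2 * n%:R * a^+2)).
  by apply: ler_wpM2r=> //;exact: ltW.
 have ->: 4*L%:R = 2*(2*L%:R) :> R by ring.
 by rewrite -mulrA ler_pM2l.
have G1: expR (- (lam/2)/(2 * a * sqn n)) * expR (L.*2%:R*(K/(a^+2 * n%:R))) <=
  w/e^+3 * a^+3 * expR (2*K) by apply: ler_pM;rewrite ?expR_ge0.
set P:= psum mu n.+1 L.*2 H in hH *.
have cBB: c/sqn n <= BB by rewrite ler_pdivrMr// mulrC.
apply: (le_via (kap*(c/sqn n)));last by rewrite ler_pM2l.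
set N':= (n %/ L).+1%:R in nL na *.
have ->: N' * (C/sqn n*P) = N' * C*P/sqn n by ring.
rewrite [leRHS]mulrA ler_pM2r ?invr_gt0//.
have N'0: 0 <= N' by rewrite ler0n.
apply: (le_via (N' * C*(2*(w/e^+3 * a^+3 * expR (2*K)+L.*2%:R * bigjump mu f n.+1 (a * sqn n))))).
 apply: ler_wpM2l;first by rewrite mulr_ge0// ltW.
 by apply: (le_trans hH);rewrite ler_pM2l// lerD2r.
set X:= bigjump _ _ _ _ in E3 X0 *.
have ->: N' * C*(2*(w/e^+3 * a^+3 * expR (2*K)+L.*2%:R*X)) =
 (N' * a^+2)*(2*C*(w/e^+3) * a * expR (2*K))+4*C*(N' * L%:R)*X.
 by rewrite -mul2n natrM;ring.
rewrite [kap * c]splitr;apply: lerD.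
 apply: (le_trans _ aD);rewrite (_ : D * a = 4*(2*C*(w/e^+3) * a * expR (2*K)));last by rewrite /D;ring.
 apply: ler_wpM2r=> //;apply: mulr_ge0;last exact: expR_ge0.
 by apply: mulr_ge0;[apply: mulr_ge0;[apply: mulr_ge0=> //;exact: ltW|exact: ltW (divr_gt0 w0 (exprn_gt0 _ e0))]|exact: ltW].
apply: (le_via (8*C*(n%:R*X))).
 have ->: 8*C*(n%:R*X) = 4*C*(2 * n%:R)*X by ring.
 by apply: ler_wpM2r=> //;apply: ler_wpM2l=> //;apply: mulr_ge0=> //;exact: ltW.
apply: (le_via ((D2+1) * mtail mu V1 K1));last by rewrite mulrC -ler_pdivlMr// ltr_wpDl.
apply: (le_via (8*C*(Cf^+2 * mtail mu V1 K1/a^+2))).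
 by apply: ler_wpM2l=> //;apply: mulr_ge0=> //;exact: ltW.
have ->: 8*C*(Cf^+2 * mtail mu V1 K1/a^+2) = D2/2 * mtail mu V1 K1 by rewrite /D2;field;rewrite lt0r_neq0.
apply: ler_wpM2r=> //;apply: (le_via D2);last by rewrite lerDl.
by apply: ler_piMr=> //;rewrite invf_le1// ler1n.
Unshelve. all: end_near. Qed.

Corollary excursion_osc (e kap : R) : 0 < e -> 0 < kap -> exists2 d : R, 0 < d <= 1 &
  \forall n \near \oo, excsum mu n s (
     (osc f (truncn (d * n%:R)) (e * sqn n) s)%:R) <= kap * treeP n.
move=> e0 k0;have [d d0 h]:= excursion_circosc e0 k0;exists d=> //.
near=> n;apply: (le_via (excsum mu n s (
   (circosc f (truncn (d * n%:R)) (e * sqn n) s)%:R)));last by near: n;exact: h.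
apply: psum_ler=> // s _ _;apply: ler_wpM2l=> //.
 case: (boolP (osc _ _ _ _))=> [/osc_circosc ->//|_];exact: ler0n.
Unshelve. all: end_near. Qed.

End ExcursionTightness.

(** * Finite-dimensional laws of the conditioned walk *)

Section ExcursionFdd.
Context {R : realType}.
Variables (mu : nat -> R) (V1 : R).
Variables (eta : nat -> R) (Ce gam2 sig2 : R).
Hypothesis crit : critical_law mu V1 sig2.
Hypothesis sig2_gt0 : 0 < sig2.
Hypothesis eta_le : forall k, `|eta k| <= Ce * k.+1%:R.
Hypothesis cvg_eta : mlim mu eta (0 : R).
Hypothesis cvg_eta2 : mlim mu (fun k => eta k ^+ 2) gam2.
Hypothesis cvg_zeta_eta : mlim mu (fun k => (k%:R - 1) * eta k) (0 : R).

Definition esum_ (s : seq nat) : R := \sum_(k <- s) eta k.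

Lemma mean_le1 N : \sum_(k < N) mu k * k%:R <= 1.
have h: mlim mu (fun k=> k%:R) (1 : R).
 have ->: msum mu (fun k=> k%:R) = (fun N=> msum mu (fun k=> k%:R-1) N+msum mu (fun=> 1) N).
  by apply/funext=> M;rewrite /msum -big_split/=;apply: eq_bigr=> k _;ring.
 by rewrite -[1 in X in _ --> X]add0r;exact: cvgD (law_zeta crit) (law_one crit).
exact: (msum_lim_ge (law_ge0 crit) N _ h).
Qed.

(** Truncation can only lower the mean offspring, so the killed walk is a supermartingale. Errors
    proportional to the height [p] therefore remain bounded when summed over the law of a prefix. *)
Lemma alive_supermartingale N m p :
  psum mu N m (fun s => (alive p s)%:R * (pend p s)%:R) <= p%:R.
elim: m p=> [|m IH] p /=.
 by rewrite /pend /= andbT;case: p=> [|p];rewrite ?mul0r ?mul1r.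
case: p=> [|p].
 rewrite big1 // => k _;rewrite (@eq_psum _ _ _ _ _ (fun=> 0)) ?psum0 ?mulr0// => s _ _.
 by rewrite mul0r.
apply: (le_via (\sum_(k < N) mu k*(p+k)%:R)).
 by apply: ler_sum=> k _;apply: ler_wpM2l=> //;exact: IH.
under eq_bigr do rewrite natrD mulrDr.
rewrite big_split/= -mulr_suml -natr1;apply: lerD;last exact: mean_le1.
by rewrite ler_piMl// (sum_mu_le1 (law_ge0 crit) (law_one crit)).
Qed.

(** Up to the factor [p], the limit of n^(3/2) times the probability that the walk from height [p],
    with p close to z sqrt n, dies after t n steps. *)
Definition kap0 (t z : R) : R := lclt (sig2 * t) z / t.

Lemma kap0E t z : 0 < t -> kap0 t z = kap0 t 0 * expR (- (z ^+ 2 / (2 * sig2 * t))).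
move=> t0;rewrite /kap0 /lclt expr0n/= mul0r oppr0 expR0 mulrA;ring.
Qed.

Lemma kap0_gt0 t : 0 < t -> 0 < kap0 t 0.
by move=> t0;rewrite /kap0 /lclt !divr_gt0 ?expR_gt0// sqrtr_gt0 !mulr_gt0// pi_gt0.
Qed.

(** The bound is uniform in [a] because y exp(-y) <= 1; it yields continuity of [kap0] in time,
    uniformly in the height. *)
Lemma expR_inv_cont (t x a : R) : 0 < t -> 0 < x -> 0 <= a ->
  `|expR (- (a / x)) - expR (- (a / t))| <= `|x - t| / minr x t.
move=> t0 x0 a0;wlog xt: x t t0 x0/x <= t.
 move=> W;case/orP: (le_total x t)=> h;first exact: (W x t t0 x0 h).
 by rewrite distrC (distrC x t) minC;exact: (W t x x0 t0 h).
have ->: minr x t = x by apply/min_idPl.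
have ax: a/t <= a/x by rewrite ler_wpM2l// lef_pV2.
rewrite distrC ger0_norm ?subr_ge0 ?ler_expR ?lerN2// distrC ger0_norm ?subr_ge0//.
have ->: expR (- (a/t))-expR (- (a/x)) = expR (- (a/t))*(1-expR (- (a/x-a/t))).
 by rewrite mulrBr mulr1 -expRD;congr (_-expR _);ring.
have h1: 1-expR (- (a/x-a/t)) <= a/x-a/t.
 by have:= expR_ge1Dx (- (a/x-a/t));lra.
have h2: expR (- (a/t))*(a/t) <= 1.
 have e:= expRxMexpNx_1 (a/t);have h:= expR_ge1Dx (a/t);have p:= expR_ge0 (- (a/t)).
 rewrite -e mulrC ler_wpM2r//;lra.
apply: (le_via (expR (- (a/t))*(a/x-a/t)));first by rewrite ler_wpM2l ?expR_ge0.
have ->: expR (- (a/t))*(a/x-a/t) = expR (- (a/t))*(a/t)*((t-x)/x) by field;rewrite !lt0r_neq0.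
by apply: ler_piMl=> //;rewrite divr_ge0 ?subr_ge0// ltW.
Qed.

Lemma kap0_cont (b t e : R) : 0 < t -> 0 < e -> exists2 d : R, 0 < d & forall x z, `|x - t| <= d ->
  `|expR (- (b * x)) * kap0 x z - expR (- (b * t)) * kap0 t z| <= e.
move=> t0 e0;pose A x:= expR (- (b * x)) * kap0 x 0.
have cA: {for t, continuous A}.
 apply: continuousM.
  apply: continuous_comp;last exact: continuous_expR.
  by apply: continuousN;apply: continuousM;[exact: cst_continuous|exact: id].
 have ->: kap0^~ 0 = (fun x=> (sqrtr (2 * pi*(sig2 * x)))^-1/x).
  by apply/funext=> x;rewrite /kap0 /lclt expr0n/= mul0r oppr0 expR0 mul1r.
 apply: continuousM;last by apply: continuousV;[exact: lt0r_neq0|exact: id].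
 apply: continuousV;first by rewrite lt0r_neq0// sqrtr_gt0 !mulr_gt0// pi_gt0.
 apply: continuous_comp;last exact: sqrt_continuous.
 apply: continuousM;first exact: cst_continuous.
 by apply: continuousM;[exact: cst_continuous|exact: id].
have A0 x: 0 < x -> 0 <= A x.
 by move=> x0;rewrite mulr_ge0 ?expR_ge0// ltW// kap0_gt0.
have e2: 0 < e/2 by rewrite divr_gt0.
have /cvgrPdist_lt /(_ _ e2) [d1 /= d10 h1]:= cA.
pose d2:= e * t/(4*(A t+1)).
have At1: 0 < A t+1 by rewrite ltr_wpDl// A0.
have d20: 0 < d2 by rewrite divr_gt0 ?mulr_gt0.
exists (minr (d1/2) (minr (t/2) d2));first by rewrite !lt_min d20 !divr_gt0.
move=> x z;rewrite !le_min=> /and3P[x1 x2 x3].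
have xt: t/2 <= x by move: x2;rewrite ler_norml=> /andP[h _];lra.
have x0: 0 < x by apply: lt_le_trans xt;rewrite divr_gt0.
rewrite (kap0E z x0) (kap0E z t0) [_*(kap0 x 0 * _)]mulrA [_*(kap0 t 0 * _)]mulrA -/(A x) -/(A t).
set a:= z^+2/(2 * sig2).
have ea y: 0 < y -> expR (- (z^+2/(2 * sig2 * y))) = expR (- (a/y)) by move=> y0;congr (expR (- _));rewrite /a;field;rewrite !lt0r_neq0.
rewrite !ea//;have a0: 0 <= a by rewrite divr_ge0 ?sqr_ge0// mulr_ge0// ltW.
have ->: A x * expR (- (a/x))-A t * expR (- (a/t)) =
 (A x-A t) * expR (- (a/x))+A t*(expR (- (a/x))-expR (- (a/t))) by ring.
apply: (le_trans (ler_normD _ _));rewrite [e]splitr;apply: lerD.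
 rewrite normrM (ger0_norm (expR_ge0 _)).
 apply: (le_via `|A x-A t|).
  by rewrite ler_piMr// expR_le1 oppr_le0 divr_ge0// ltW.
 rewrite distrC;apply: ltW;apply: h1;rewrite /ball_/= distrC;apply: le_lt_trans x1 _.
 by rewrite ltr_pdivrMr// ltr_pMr// ltr1n.
rewrite normrM (ger0_norm (A0 t t0));apply: (le_via (A t*(d2/(t/2)))).
 apply: ler_wpM2l;first exact: A0.
 apply: (le_trans (expR_inv_cont t0 x0 a0));apply: ler_pM=> //.
  by rewrite invr_ge0 le_min ltW// ltW.
 rewrite lef_pV2 ?posrE ?divr_gt0//;last by rewrite lt_min x0.
 by rewrite le_min xt/= ler_piMr ?(ltW t0)// invf_le1// ler1n.
have ->: A t*(d2/(t/2)) = (A t/(A t+1))*(e/2) by rewrite /d2;field;rewrite !lt0r_neq0.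
by apply: ler_piMl;[exact: ltW|rewrite ler_pdivrMr// mul1r lerDl].
Qed.

Definition suffixQ n r (beta c : R) p : R :=
  n%:R * sqn n * psum mu n.+1 r (fun u => (hits p u)%:R * cos (c + beta * esum_ u / sqn n)).

(** The error is measured relative to [p], so that [alive_supermartingale] can integrate it over the
    height reached at a cut. *)
Definition suffix_close n (tau beta e : R) : Prop := forall r p c, (r <= n)%N -> `|r%:R - tau * n%:R| <= 1 ->
  `|suffixQ n r beta c p - p%:R * (cos c * (expR (- (beta ^+ 2 * gam2 / 2 * tau)) * kap0 tau (p%:R / sqn n)))|
    <= e * p%:R.

(** The cosine of an additive functional is invariant under permutations, so Kemperman's formula
    reduces first passage to the free walk with a factor p/r, and the local limit theorem applies.
    The length [r] may differ from tau n by rounding. *)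
Lemma suffixQ_lim (tau beta e : R) : 0 < tau <= 1 -> 0 < e -> \forall n \near \oo, suffix_close n tau beta e.
move=> /andP[t0 t1] e0.
have e2: 0 < e/2 by rewrite divr_gt0.
have e3: 0 < e/2*(tau/2) by rewrite !mulr_gt0// invr_gt0.
have t2: 0 < tau/2 by rewrite divr_gt0.
have [d d0 hd]:= kap0_cont (beta^+2 * gam2/2) t0 e2.
have hl:= local_clt crit sig2_gt0 eta_le cvg_eta cvg_eta2 cvg_zeta_eta beta t2 e3.
near=> n=> r p c rn hr.
have n0: (0 < n)%N by near_nat n.
have nn0: 0 < n%:R :> R by rewrite ltr0n.
have n2: 2/tau <= n%:R by near_nat n.
have n3: d^-1 <= n%:R by near_nat n.
have hln: forall m p (c : R), (m <= n)%N -> tau/2 * n%:R <= m%:R ->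
 `|sqn n * psum mu n.+1 m (fun s=> (sumn s+p == m)%:R * cos (c+beta*(\sum_(k <- s) eta k)/sqn n))
  - cos c * expR (- (beta^+2 * gam2 * m%:R/(2 * n%:R))) * lclt (sig2*(m%:R/n%:R)) (p%:R/sqn n)| <= e/2*(tau/2).
 by near: n;exact: hl.
have tn2: 2 <= tau * n%:R by rewrite mulrC -ler_pdivrMr.
have rh: tau/2 * n%:R <= r%:R.
 by move: hr;rewrite ler_norml=> /andP[h _];rewrite mulrAC;lra.
have r0: 0 < r%:R :> R by apply: lt_le_trans rh;rewrite mulr_gt0.
have:= hln r p c rn rh.
set Q:= psum _ _ _ _;set z:= p%:R/_=> hQ.
have kem: suffixQ n r beta c p = p%:R*(n%:R/r%:R*(sqn n*Q)).
 have h:= @kemperman R mu n.+1 r p (fun s=> cos (c+beta*(\sum_(k <- s) eta k)/sqn n)).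
 have {h} h : r%:R * psum mu n.+1 r (fun s=> (hits p s)%:R * cos (c+beta*(\sum_(k <- s) eta k)/sqn n)) = p%:R*Q.
  by apply: h=> s t st;rewrite (perm_big _ st).
 rewrite /suffixQ /esum_;apply: (mulfI (lt0r_neq0 r0)).
 have ->: r%:R*(p%:R*(n%:R/r%:R*(sqn n*Q))) = n%:R * sqn n*(p%:R*Q).
  by field;rewrite lt0r_neq0.
 by rewrite -h;ring.
have hx: `|r%:R/n%:R-tau| <= d.
 have ->: r%:R/n%:R-tau = (r%:R-tau * n%:R)/n%:R by field;rewrite lt0r_neq0.
 rewrite normrM normfV (gtr0_norm nn0) ler_pdivrMr//;apply: (le_trans hr).
 by rewrite mulrC -ler_pdivrMr// mul1r.
have hk:= hd _ z hx.
set K:= expR _ * kap0 tau z in hk *.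
rewrite kem -mulrBr normrM ger0_norm// mulrC ler_wpM2r//.
have ->: n%:R/r%:R*(sqn n*Q)-cos c*K =
 n%:R/r%:R*(sqn n*Q-cos c * expR (- (beta^+2 * gam2 * r%:R/(2 * n%:R))) * lclt (sig2*(r%:R/n%:R)) z)
 + cos c*(expR (- (beta^+2 * gam2/2*(r%:R/n%:R))) * kap0 (r%:R/n%:R) z-K).
 have ->: expR (- (beta^+2 * gam2/2*(r%:R/n%:R))) = expR (- (beta^+2 * gam2 * r%:R/(2 * n%:R))).
  by congr expR;field;rewrite lt0r_neq0.
 by rewrite /kap0;field;rewrite !lt0r_neq0.
apply: (le_trans (ler_normD _ _));rewrite [e]splitr;apply: lerD;last first.
 by rewrite normrM;apply: le_trans hk;rewrite ler_piMl// cos_max.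
rewrite normrM ger0_norm;last by rewrite divr_ge0// ltW.
apply: (le_via (n%:R/r%:R*(e/2*(tau/2)))).
 by apply: ler_wpM2l=> //;rewrite divr_ge0// ltW.
have ->: n%:R/r%:R*(e/2*(tau/2)) = e/2*(tau/2 * n%:R/r%:R) by ring.
by rewrite ler_piMr ?(ltW e2)// ler_pdivrMr// mul1r.
Unshelve. all: end_near. Qed.

(* A test functional: times t (in increasing order towards the head of the list), Gaussian
   weights lam for the height, frequencies al for the additive functional. *)
Implicit Type D : seq (R * R * R).

Definition lamsum n D (s : seq nat) : R :=
  \sum_(d <- D) d.1.2 * (pend 1 (take (truncn (d.1.1 * n%:R)) s))%:R ^+ 2 / n%:R.
Definition phsum n D (s : seq nat) : R :=
  \sum_(d <- D) d.2 * esum_ (take (truncn (d.1.1 * n%:R)) s).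

(** The horizon [l] is free while [n] remains the scale: integrating out the latest time replaces
    [l] by a smaller horizon. *)
Definition Zfun n (l beta c : R) D : R := n%:R * sqn n *
  psum mu n.+1 (truncn (l * n%:R)) (fun s => (hits 1 s)%:R * (expR (- lamsum n D s) *
     cos (c + (beta * esum_ s + phsum n D s) / sqn n))).

Definition shorten (tau lam : R) : R := (tau^-1 + 2 * sig2 * lam)^-1.

(** The prefactor is what remains when the Gaussian weight is absorbed by the kernel of the last
    interval and the frequency passes from [beta] to [beta']; the division anticipates the factor
    that the shortened horizon brings back. *)
Fixpoint Zlim (l beta : R) D : R :=
  if D is (t, lam, al) :: D' then
    let tau := l - t in let tau' := shorten tau lam in let beta' := al + beta in
    kap0 tau 0 / kap0 tau' 0 * expR (- (beta ^+ 2 * gam2 / 2 * tau)) / expR (- (beta' ^+ 2 * gam2 / 2 * tau'))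
     * Zlim (t + tau') beta' D'
  else expR (- (beta ^+ 2 * gam2 / 2 * l)) * kap0 l 0.

Fixpoint admissible (l : R) D : Prop :=
  if D is (t, lam, al) :: D' then [/\ 0 < t < l, 0 <= lam & admissible t D'] else True.

Lemma admissible_le l l' D : l <= l' -> admissible l D -> admissible l' D.
Proof. by case: D=> [//|[[t lam] al] D] ll /= [/andP[t0 tl] h1 h2];split=> //;rewrite t0 (lt_le_trans tl). Qed.

Lemma admissible_times l D : admissible l D -> forall d, d \in D -> 0 < d.1.1 < l.
elim: D l=> [//|[[t lam] al] D IH] l /= [/andP[t0 tl] h1 h2] d;rewrite inE=> /orP[/eqP ->/=|dD];first by rewrite t0.
by have /andP[-> h]:= IH _ h2 _ dD;apply: lt_trans h tl.
Qed.

Lemma shorten_gt0 tau lam : 0 < tau -> 0 <= lam -> 0 < shorten tau lam.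
Proof. by move=> t0 l0;rewrite invr_gt0 ltr_pwDl ?invr_gt0// !mulr_ge0// ltW. Qed.

Lemma shorten_le tau lam : 0 < tau -> 0 <= lam -> shorten tau lam <= tau.
move=> t0 l0;rewrite -[leRHS]invrK lef_pV2 ?posrE ?invr_gt0// ?lerDl ?mulr_ge0// ?(ltW sig2_gt0)//.
by rewrite ltr_pwDl ?invr_gt0// !mulr_ge0// ltW.
Qed.

(** Two Gaussians in [z] are multiplied, so inverse times add up, which is how [shorten] is
    defined. *)
Lemma shorten_kap0 tau lam z : 0 < tau -> 0 <= lam ->
  expR (- (lam * z ^+ 2)) * kap0 tau z = kap0 tau 0 / kap0 (shorten tau lam) 0 * kap0 (shorten tau lam) z.
move=> t0 l0;have s0:= shorten_gt0 t0 l0;rewrite (kap0E z t0) (kap0E z s0).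
have ->: kap0 tau 0/kap0 (shorten tau lam) 0*(kap0 (shorten tau lam) 0 * expR (- (z^+2/(2 * sig2 * shorten tau lam)))) =
 kap0 tau 0 * expR (- (z^+2/(2 * sig2 * shorten tau lam))).
 by field;rewrite lt0r_neq0// kap0_gt0.
rewrite mulrCA -expRD;congr (_ * expR _).
rewrite /shorten;field;rewrite !lt0r_neq0//.
by rewrite ltr_pwDl// !mulr_ge0// ltW.
Qed.

Lemma phase_cat n D (s u : seq nat) :
  (forall d, d \in D -> truncn (d.1.1 * n%:R) <= size s)%N ->
  lamsum n D (s ++ u) = lamsum n D s /\ phsum n D (s ++ u) = phsum n D s.
move=> h;rewrite /lamsum /phsum;split;apply: eq_big_seq=> d /h;rewrite take_cat leq_eqVlt=> /orP[/eqP ->|->//];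
by rewrite ltnn subnn take0 cats0 take_size.
Qed.

(* [Zfun] cut at an intermediate time: the part after time t enters only through [suffixQ]. *)
Lemma Zfun_cut n (l t beta c : R) D : 0 < t < l -> (forall d, d \in D -> d.1.1 <= t) ->
  (truncn (t * n%:R) < truncn (l * n%:R))%N ->
  Zfun n l beta c D = psum mu n.+1 (truncn (t * n%:R)) (fun s => (alive 1 s)%:R * (expR (- lamsum n D s) *
     suffixQ n (truncn (l * n%:R) - truncn (t * n%:R)) beta
       (c + (beta * esum_ s + phsum n D s) / sqn n) (pend 1 s))).
move=> /andP[t0 tl] aD tl';rewrite /Zfun;set a:= truncn (t * _);set b:= truncn _.
have {1}-> : b = (a+(b-a))%N by rewrite subnKC// ltnW.
rewrite psum_cat -psumZ;apply: eq_psum=> s ss _;rewrite /suffixQ.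
rewrite !mulrA -!psumZ;apply: eq_psum=> u su _.
have u0: (0 < size u)%N by rewrite su subn_gt0.
have [-> ->] : lamsum n D (s ++ u) = lamsum n D s /\ phsum n D (s ++ u) = phsum n D s.
 by apply: phase_cat=> d /aD dt;rewrite ss;apply: le_truncn;rewrite ler_wpM2r.
have ->: esum_ (s ++ u) = esum_ s+esum_ u by rewrite /esum_ big_cat.
rewrite hits_cat// -mulnb natrM.
have ->: c+(beta*(esum_ s+esum_ u)+phsum n D s)/sqn n =
 c+(beta * esum_ s+phsum n D s)/sqn n+beta * esum_ u/sqn n by ring.
ring.
Qed.

Lemma lamsum_ge0 n l D s : admissible l D -> 0 <= lamsum n D s.
elim: D l=> [|[[t lam] al] D IH] l;rewrite /lamsum;first by rewrite big_nil.
move=> /= [_ l0 aD];rewrite big_cons addr_ge0 ?(IH t)//.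
by rewrite !mulr_ge0 ?invr_ge0// sqr_ge0.
Qed.

Lemma truncn_diff (l t : R) n : 0 < t < l ->
  `|(truncn (l * n%:R) - truncn (t * n%:R))%N%:R - (l - t) * n%:R| <= 1.
move=> /andP[t0 tl];have h: t * n%:R <= l * n%:R by rewrite ler_wpM2r// ltW.
have l0: 0 <= l * n%:R by rewrite mulr_ge0// ltW// (lt_trans t0).
have t00: 0 <= t * n%:R by rewrite mulr_ge0// ltW.
rewrite natrB ?le_truncn//.
have /andP[a1 a2]:= truncn_itv l0;have /andP[b1 b2]:= truncn_itv t00.
rewrite -natr1 in a2;rewrite -natr1 in b2;rewrite ler_norml;apply/andP;split;lra.
Qed.

(** Both terms have the same limit by [shorten_kap0]. Comparing two discrete quantities leaves a
    discrete one, so that after integration a [Zfun] with one time less appears. *)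
Lemma suffixQ_peel (l t lam al beta e : R) : 0 < t < l -> l <= 1 -> 0 <= lam -> 0 < e ->
  let tau := l - t in let tau' := shorten tau lam in let beta' := al + beta in
  let K := kap0 tau 0 / kap0 tau' 0 * expR (- (beta ^+ 2 * gam2 / 2 * tau)) / expR (- (beta' ^+ 2 * gam2 / 2 * tau')) in
  \forall n \near \oo, forall c p,
   `|expR (- (lam * p%:R ^+ 2 / n%:R)) * suffixQ n (truncn (l * n%:R) - truncn (t * n%:R)) beta c p
     - K * suffixQ n (truncn ((t + tau') * n%:R) - truncn (t * n%:R)) beta' c p| <= e * p%:R.
move=> /andP[t0 tl] l1 lam0 e0 tau tau' beta' K.
have tau0: 0 < tau by rewrite subr_gt0.
have tau'0: 0 < tau':= shorten_gt0 tau0 lam0.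
have tau't: tau' <= tau:= shorten_le tau0 lam0.
have tau1: tau <= 1 by rewrite lerBlDr (le_trans l1)// lerDl ltW.
have K0: 0 < K.
 rewrite /K;apply: divr_gt0;last exact: expR_gt0.
 by apply: mulr_gt0;[apply: divr_gt0;exact: kap0_gt0|exact: expR_gt0].
have e1: 0 < e/2/(1+K) by rewrite !divr_gt0// addr_gt0.
have h1: 0 < tau <= 1 by rewrite tau0.
have h2: 0 < tau' <= 1 by rewrite tau'0 (le_trans tau't).
have hA:= suffixQ_lim beta h1 e1;have hB:= suffixQ_lim beta' h2 e1.
near=> n=> c p.
have n0: (0 < n)%N by near_nat n.
have nn0: 0 < n%:R :> R by rewrite ltr0n.
have le_n (x : R) : x <= 1 -> (truncn (x * n%:R)-truncn (t * n%:R) <= n)%N.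
 move=> x1;apply: (leq_trans (leq_subr _ _));rewrite -[leqRHS](@natrK R);apply: le_truncn.
 by rewrite ler_piMl.
have t'l: t+tau' <= l by rewrite -lerBrDl.
have cA: suffix_close n tau beta (e/2/(1+K)) by near: n;exact: hA.
have cB: suffix_close n tau' beta' (e/2/(1+K)) by near: n;exact: hB.
have t'n: 0 < t < t+tau' by rewrite t0 ltrDl.
have tl': 0 < t < l by rewrite t0.
have:= cA _ p c (le_n _ l1) (truncn_diff n tl').
have:= truncn_diff n t'n;rewrite [t+tau'-t]addrC addKr=> tdiff.
have:= cB _ p c (le_n _ (le_trans t'l l1)) tdiff.
set QB:= suffixQ _ _ beta' _ _;set QA:= suffixQ _ _ beta _ _.
set z:= p%:R/_=> hQB hQA.
have ez: expR (- (lam * p%:R^+2/n%:R)) = expR (- (lam * z^+2)).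
 by rewrite -mulrA;congr (expR (- (lam * _)));rewrite /z expr_div_n sqr_sqrtr.
have hK: expR (- (lam * z^+2))*(p%:R*(cos c*(expR (- (beta^+2 * gam2/2 * tau)) * kap0 tau z))) =
  K*(p%:R*(cos c*(expR (- (beta'^+2 * gam2/2 * tau')) * kap0 tau' z))).
 have ->: expR (- (lam * z^+2))*(p%:R*(cos c*(expR (- (beta^+2 * gam2/2 * tau)) * kap0 tau z))) =
  p%:R*(cos c*(expR (- (beta^+2 * gam2/2 * tau))))*(expR (- (lam * z^+2)) * kap0 tau z) by ring.
 rewrite shorten_kap0// -/tau' /K;field;rewrite !lt0r_neq0 ?kap0_gt0 ?expR_gt0//.
rewrite ez;set E1:= expR (- (lam * z^+2)) in hK *.
have E1le: 0 <= E1 <= 1 by rewrite expR_ge0 expR_le1 oppr_le0 mulr_ge0// sqr_ge0.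
move: hQA hQB hK;set TA:= p%:R * _;set TB:= p%:R * _=> hQA hQB hK.
have ->: E1*QA-K*QB = E1*(QA-TA)-K*(QB-TB) by rewrite !mulrBr hK;ring.
have ->: e * p%:R = e/2/(1+K) * p%:R*(1+K)*2.
 by field;rewrite lt0r_neq0// addr_gt0.
apply: (le_trans (ler_normB _ _));rewrite (normrM E1) (normrM K) (gtr0_norm K0) (ger0_norm (andP E1le).1).
have B0: 0 <= e/2/(1+K) * p%:R by rewrite mulr_ge0// ltW.
set BB:= e/2/_ * _ in hQA hQB B0 *.
apply: (le_via (1*BB+K*BB)).
 by apply: lerD;apply: ler_pM=> //;[case/andP: E1le|case/andP: E1le|exact: ltW].
by rewrite -mulrDl mulrC ler_peMr ?ler1n// mulr_ge0// addr_ge0// ltW.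
Unshelve. all: end_near. Qed.

Lemma Zfun_peel (l t lam al beta c e : R) D : 0 < t < l -> l <= 1 -> 0 <= lam -> admissible t D -> 0 < e ->
  let tau := l - t in let tau' := shorten tau lam in let beta' := al + beta in
  let K := kap0 tau 0 / kap0 tau' 0 * expR (- (beta ^+ 2 * gam2 / 2 * tau)) / expR (- (beta' ^+ 2 * gam2 / 2 * tau')) in
  \forall n \near \oo, `|Zfun n l beta c ((t, lam, al) :: D) - K * Zfun n (t + tau') beta' c D| <= e.
move=> tl l1 lam0 aD e0 tau tau' beta' K;have /andP[t0 t_l]:= tl.
have tau0: 0 < tau by rewrite subr_gt0.
have tau'0: 0 < tau':= shorten_gt0 tau0 lam0.
have hP:= suffixQ_peel al beta tl l1 lam0 e0.
near=> n.
have n0: (0 < n)%N by near_nat n.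
have nn0: 0 < n%:R :> R by rewrite ltr0n.
have n1: 2/tau' <= n%:R by near_nat n.
have n2: 2/tau <= n%:R by near_nat n.
have lt_tr (x : R) : 0 < x -> 2/x <= n%:R -> (truncn (t * n%:R) < truncn ((t+x) * n%:R))%N.
 move=> x0 xn;have h: 2 <= x * n%:R by rewrite mulrC -ler_pdivrMr.
 have tn0: 0 <= t * n%:R by rewrite mulr_ge0// ltW.
 have /andP[a1 a2]:= truncn_itv tn0.
 rewrite truncn_ge_nat ?mulr_ge0 ?addr_ge0 ?ltW// -natr1 mulrDl;lra.
have hPn: forall c p, `|expR (- (lam * p%:R^+2/n%:R)) * suffixQ n (truncn (l * n%:R)-truncn (t * n%:R)) beta c p
   - K * suffixQ n (truncn ((t+tau') * n%:R)-truncn (t * n%:R)) beta' c p| <= e * p%:R.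
 by near: n;exact: hP.
have aD' d: d \in D -> d.1.1 <= t by move=> /(admissible_times aD)/andP[_ /ltW].
rewrite (@Zfun_cut n (t+tau') t beta' c D)//;[|by rewrite t0 ltrDl|exact: lt_tr].
have cut1: Zfun n l beta c ((t, lam, al) :: D) = psum mu n.+1 (truncn (t * n%:R)) (fun s=> (alive 1 s)%:R*(expR (- lamsum n ((t, lam, al) :: D) s) *
   suffixQ n (truncn (l * n%:R)-truncn (t * n%:R)) beta
    (c+(beta * esum_ s+phsum n ((t, lam, al) :: D) s)/sqn n) (pend 1 s))).
 apply: Zfun_cut=> //;first by move=> d;rewrite inE=> /orP[/eqP->//|/aD'].
 by have:= lt_tr _ tau0 n2;rewrite /tau [t+(l-t)]addrC subrK.
rewrite cut1 -psumZ -psumB;apply: (le_trans (psum_norm _ _ _ (law_ge0 crit))).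
apply: (le_via (e * psum mu n.+1 (truncn (t * n%:R)) (fun s=> (alive 1 s)%:R*(pend 1 s)%:R)));last first.
 by rewrite ler_piMr ?(ltW e0)//;apply: le_trans (alive_supermartingale _ _ _) _.
rewrite -psumZ;apply: psum_ler=> // s ss _.
have ->: lamsum n ((t, lam, al) :: D) s = lam*(pend 1 s)%:R^+2/n%:R+lamsum n D s.
 by rewrite /lamsum big_cons /= take_oversize// ss.
have ->: phsum n ((t, lam, al) :: D) s = al * esum_ s+phsum n D s.
 by rewrite /phsum big_cons /= take_oversize// ss.
have ->: beta * esum_ s+(al * esum_ s+phsum n D s) = beta' * esum_ s+phsum n D s by rewrite /beta';ring.
have:= hPn (c+(beta' * esum_ s+phsum n D s)/sqn n) (pend 1 s).
set QB:= suffixQ _ _ beta' _ _;set QA:= suffixQ _ _ beta _ _=> h.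
rewrite opprD expRD;set E1:= expR (- (lam * _/_)) in h *;set E2:= expR (- lamsum n D s).
have ->: (alive 1 s)%:R*(E1*E2*QA)-K*((alive 1 s)%:R*(E2*QB)) = (alive 1 s)%:R*(E2*(E1*QA-K*QB)) by ring.
rewrite normrM (ger0_norm (ler0n _ _)) [leRHS]mulrCA ler_wpM2l// normrM (ger0_norm (expR_ge0 _)) -[leRHS]mul1r.
by apply: ler_pM=> //;rewrite ?expR_ge0// expR_le1 oppr_le0 (lamsum_ge0 _ _ aD).
Unshelve. all: end_near. Qed.

Theorem Zfun_cvg (l beta c : R) D : 0 < l <= 1 -> admissible l D ->
  Zfun n l beta c D @[n --> \oo] --> cos c * Zlim l beta D.
elim: D l beta=> [|[[t lam] al] D IH] l beta /andP[l0 l1].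
 move=> _ /=;apply/cvgrPdist_le=> e e0.
 have e2: 0 < e/2 by rewrite divr_gt0.
 have h1: 0 < l <= 1 by rewrite l0.
 have h2: 0 < 1 :> R by [].
 have hA:= suffixQ_lim beta h1 e2.
 pose E1:= expR (- (beta^+2 * gam2/2 * l)) * kap0 l 0.
 have E10: 0 < E1 by rewrite mulr_gt0 ?expR_gt0 ?kap0_gt0.
 near=> n.
 have n0: (0 < n)%N by near_nat n.
 have nn0: 0 < n%:R :> R by rewrite ltr0n.
 have cA: suffix_close n l beta (e/2) by near: n;exact: hA.
 have n1: E1/(2 * sig2 * l)/(e/2) <= n%:R by near_nat n.
 have ln0: 0 <= l * n%:R by rewrite mulr_ge0// ltW.
 have rn: (truncn (l * n%:R) <= n)%N.
  by rewrite -[leqRHS](@natrK R);apply: le_truncn;rewrite ler_piMl.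
 have rl: `|(truncn (l * n%:R))%:R-l * n%:R| <= 1.
  have /andP[a1 a2]:= truncn_itv ln0;rewrite -natr1 in a2.
  by rewrite ler_norml;apply/andP;split;lra.
 have:= cA _ 1 c rn rl;rewrite !mul1r mulr1.
 have ->: Zfun n l beta c [::] = suffixQ n (truncn (l * n%:R)) beta c 1.
  rewrite /Zfun /suffixQ;congr (_ * _);apply: eq_psum=> s _ _.
  by rewrite /lamsum /phsum !big_nil oppr0 expR0 mul1r addr0.
 (* Starting from height 1 means 1/sqrt n on the limit scale; the exponential factor produced by
    [kap0E] tends to 1. *)
 rewrite kap0E//;set Q:= suffixQ _ _ _ _ _=> hQ;rewrite -/E1.
 rewrite distrC -(subrKA (cos c*(E1 * expR (- ((sqn n)^-1^+2/(2 * sig2 * l)))))).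
 apply: (le_trans (ler_normD _ _));rewrite [e]splitr;apply: lerD.
  by move: hQ;rewrite [expR _*(kap0 l 0 * _)]mulrA -/E1.
 rewrite -mulrBr -{2}[E1]mulr1 -mulrBr normrM -[leRHS]mul1r;apply: ler_pM=> //;first exact: cos_max.
 rewrite normrM (gtr0_norm E10) exprVn sqr_sqrtr// distrC ger0_norm ?subr_ge0;last first.
  by rewrite expR_le1 oppr_le0 divr_ge0 ?invr_ge0// !mulr_ge0// ltW.
 apply: (le_via (E1*(n%:R^-1/(2 * sig2 * l)))).
  apply: ler_wpM2l;first exact: ltW.
  by have:= expR_ge1Dx (- (n%:R^-1/(2 * sig2 * l)));set x:= _/_;move=> h;lra.
 have ->: E1*(n%:R^-1/(2 * sig2 * l)) = E1/(2 * sig2 * l)/n%:R by ring.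
 by rewrite ler_pdivrMr// [leRHS]mulrC -ler_pdivrMr//.
move=> /= [tl lam0 aD];have /andP[t0 t_l]:= tl.
set tau:= l-t;set tau':= shorten tau lam.
have tau0: 0 < tau by rewrite subr_gt0.
have tau'0: 0 < tau':= shorten_gt0 tau0 lam0.
have tau't: tau' <= tau:= shorten_le tau0 lam0.
set K:= kap0 tau 0/_ * _/_.
have t'l: t+tau' <= l by rewrite -lerBrDl.
have /IH -/(_ (al+beta)) hI : 0 < t+tau' <= 1 by rewrite addr_gt0// (le_trans t'l).
have tt': t <= t+tau' by rewrite lerDl ltW.
have {}hI:= hI (admissible_le tt' aD).
have ->: (fun n=> Zfun n l beta c ((t, lam, al) :: D)) = (fun n =>
  (Zfun n l beta c ((t, lam, al) :: D)-K*Zfun n (t+tau') (al+beta) c D)+K*Zfun n (t+tau') (al+beta) c D).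
 by apply/funext=> n;rewrite subrK.
rewrite mulrCA -[X in _ --> X]add0r;apply: cvgD;last by apply: cvgMr;exact: hI.
apply/cvgrPdist_le=> e e0;have:= Zfun_peel al beta c tl l1 lam0 aD e0.
by apply: filterS=> n;rewrite sub0r normrN.
Unshelve. all: end_near. Qed.
End ExcursionFdd.

(** * Laws of the excursion and of Brownian motion *)

Section ContinuousAlgebra.
Context {R : realType}.
Implicit Types f g : R -> R.

Lemma continuousR_mul f g : continuous f -> continuous g -> continuous (fun x => f x * g x).
Proof. by move=> cf cg x;apply: continuousM;[exact: cf|exact: cg]. Qed.

Lemma continuousR_sub f g : continuous f -> continuous g -> continuous (fun x => f x - g x).
Proof. by move=> cf cg x;apply: continuousB;[exact: cf|exact: cg]. Qed.

Lemma continuousR_add f g : continuous f -> continuous g -> continuous (fun x => f x + g x).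
Proof. by move=> cf cg x;apply: continuousD;[exact: cf|exact: cg]. Qed.

Lemma continuousR_id : continuous (fun x : R => x).
Proof. by move=> x;exact: cvg_id. Qed.
End ContinuousAlgebra.

Section GaussPair.
Context {R : realType}.
Notation leb := (@lebesgue_measure R).
Variables (m v : R).
Hypotheses (m0 : 0 <= m) (v0 : 0 < v).

Definition gbump (y : R) : R := expR (- ((y - m) ^+ 2 / (2 * v))).

Lemma is_derive_gbump (y : R) : is_derive y (1 : R) gbump (- ((y - m) / v) * gbump y).
have h: is_derive y 1 (fun y : R=> - ((y-m)^+2/(2 * v))) (- ((y-m)/v)).
 derive_eq;field;exact: lt0r_neq0.
by apply: is_derive_eq;rewrite /GRing.scale/= mulrC.
Qed.

Lemma is_derive_gbumpN (y : R) : is_derive y (1 : R) (fun y : R => gbump (- y)) (- ((y + m) / v) * gbump (- y)).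
have h1: is_derive (- y) 1 gbump (- ((- y-m)/v) * gbump (- y)) by exact: is_derive_gbump.
have h2: is_derive y 1 (fun y : R=> - y) (-1) by apply: is_derive_eq.
have:= @is_derive1_comp _ gbump (fun y : R=> - y) y _ _ h1 h2.
by congr is_derive;ring.
Qed.

Lemma continuous_gbump : continuous gbump.
Proof. by move=> y;apply: differentiable_continuous;apply/derivable1_diffP;have []:= is_derive_gbump y. Qed.

Lemma continuous_gbumpN : continuous (fun y => gbump (- y)).
Proof. by move=> y;apply: differentiable_continuous;apply/derivable1_diffP;have []:= is_derive_gbumpN y. Qed.

Lemma gbumpN_le y : 0 <= y -> gbump (- y) <= gbump y.
move=> y0;rewrite ler_expR lerN2 ler_pM2r ?invr_gt0 ?mulr_gt0//.
have ->: (- y-m)^+2 = (y-m)^+2+4*(y * m) by ring.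
by rewrite lerDl !mulr_ge0.
Qed.

Lemma normal_pdf_gbump : normal_pdf m (sqrtr v) = (fun y => (sqrtr (2 * pi * v))^-1 * gbump y).
rewrite normal_pdfE ?lt0r_neq0 ?sqrtr_gt0//;apply/funext=> y.
rewrite /normal_peak /normal_fun sqr_sqrtr ?ltW// /gbump;congr ((sqrtr _)^-1 * expR _);first by rewrite -mulr_natl;ring.
by rewrite -mulr_natl mulNr.
Qed.
End GaussPair.

(** * Chapman-Kolmogorov for the killed heat kernel *)

Section CK.
Context {R : realType}.
Notation leb := (@lebesgue_measure R).

Lemma integral_gbump (m v : R) : 0 < v ->
  (\int[leb]_y (gbump m v y)%:E = (sqrtr (2 * pi * v))%:E)%E.
move=> v0;have:= @integral_normal_pdf R m (sqrtr v).
have K0: 0 < sqrtr (2 * pi * v) by rewrite sqrtr_gt0 !mulr_gt0// pi_gt0.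
rewrite normal_pdf_gbump//;under eq_integral do rewrite EFinM.
have mg: mfunT (fun y=> (gbump m v y)%:E).
 by apply/measurable_EFinP;apply: continuous_measurable_fun;exact: continuous_gbump.
rewrite ge0_integralZl_EFin ?invr_ge0 ?(ltW K0)//;last by move=> y _;rewrite lee_fin expR_ge0.
move=> h;have:= congr1 (fun x=> (sqrtr (2 * pi * v))%:E * x)%E h.
by rewrite muleA -EFinM divff ?lt0r_neq0// mul1e mule1.
Qed.

Lemma gbump_opp (m v y : R) : gbump m v (- y) = gbump (- m) v y.
Proof. by rewrite /gbump;have ->: (- y-m)^+2 = (y - - m)^+2 by ring. Qed.

Lemma gbump_cvg0 (m v : R) : 0 < v -> gbump m v n%:R @[n --> \oo] --> (0 : R).
move=> v0;apply/cvgrPdist_le=> e e0;near=> n.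
have h1: m+1 <= n%:R by near_nat n.
have h2: m+2 * v/e <= n%:R by near_nat n.
rewrite sub0r normrN ger0_norm ?expR_ge0//.
have d1: 1 <= n%:R-m by lra.
set d:= n%:R-m in d1.
have d0: 0 < d by lra.
have de: 2 * v/e <= d by rewrite /d;lra.
apply: (le_via (2 * v/d)).
 rewrite /gbump -/d expRN -[leRHS]invrK lef_pV2 ?posrE ?expR_gt0 ?invr_gt0 ?divr_gt0 ?mulr_gt0//.
 rewrite invf_div;apply: (le_via (d^+2/(2 * v))).
  by rewrite ler_pM2r ?invr_gt0 ?mulr_gt0// expr2 ler_peMl// ltW.
 by have:= expR_ge1Dx (d^+2/(2 * v));apply: le_trans;rewrite lerDr.
rewrite ler_pdivrMr// -ler_pdivrMl// mulrC//.
Unshelve. all: end_near. Qed.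

(** With h the bump, y (h(y) - h(-y)) equals m (h(y) + h(-y)) plus the derivative of v h(-y) - v
    h(y), a function vanishing at 0 and at infinity; the first part integrates to [m] times the full
    Gaussian mass. *)
Lemma gauss_pair_moment (m v : R) : 0 <= m -> 0 < v ->
  (\int[leb]_(y in `[0%R, +oo[) (y * (gbump m v y - gbump m v (- y)))%:E = (m * sqrtr (2 * pi * v))%:E)%E.
move=> m0 v0;pose h:= gbump m v;pose k y:= h y+h (- y).
have ch: continuous h by exact: continuous_gbump.
have chN: continuous (fun y=> h (- y)) by exact: continuous_gbumpN.
have ck: continuous k by move=> y;apply: continuousD;[exact: ch|exact: chN].
have K0: 0 < sqrtr (2 * pi * v) by rewrite sqrtr_gt0 !mulr_gt0// pi_gt0.
have k0 y: 0 <= k y by rewrite addr_ge0// expR_ge0.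
have intk: (\int[leb]_(y in `[0%R, +oo[) (k y)%:E = (sqrtr (2 * pi * v))%:E)%E.
 have : (\int[leb]_y (k y)%:E = (2 * sqrtr (2 * pi * v))%:E)%E.
  under eq_integral do rewrite EFinD.
  rewrite ge0_integralD//=.
  - have ->: (\int[leb]_x (h (- x))%:E = \int[leb]_x (gbump (- m) v x)%:E)%E.
    by apply: eq_integral=> y _;rewrite /h gbump_opp.
   transitivity ((sqrtr (2 * pi * v))%:E+(sqrtr (2 * pi * v))%:E)%E.
    exact: (congr2 adde (integral_gbump m v0) (integral_gbump (- m) v0)).
   by have ->: 2 * sqrtr (2 * pi * v) = sqrtr (2 * pi * v)+sqrtr (2 * pi * v) by ring.
  - by move=> y _;rewrite lee_fin expR_ge0.
  - by apply/measurable_EFinP;apply: continuous_measurable_fun.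
  - by move=> y _;rewrite lee_fin expR_ge0.
  - by apply/measurable_EFinP;apply: continuous_measurable_fun.
 rewrite ge0_symfun_integralT//=;last by move=> y /=;rewrite /k opprK addrC.
 rewrite (_ : [set x | _] = `[0, +oo[%classic);last first.
  by apply/seteqP;split=> x/=;rewrite in_itv/= andbT.
 move=> e2;have:= congr1 (fun x=> (2^-1)%:E * x)%E e2.
 by rewrite muleA -!EFinM mulVf// mul1e mulrA mulVf// mul1r.
pose F y:= y*(h y-h (- y)).
have cF: continuous F.
 exact: continuousR_mul continuousR_id (continuousR_sub ch chN).
have F0 y: 0 <= F y.
 rewrite /F;have [y0|/ltW y0]:= leP 0 y;first by rewrite mulr_ge0// subr_ge0 gbumpN_le.
 by rewrite mulr_le0// subr_le0 -{1}[y]opprK gbumpN_le// oppr_ge0.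
have toE (f : R -> R) n : continuous f -> (\int[leb]_(x in `[0%R, n%:R]) (f x)%:E = (sint 0 n%:R f)%:E)%E.
 by move=> cf;rewrite /sint /Rintegral fineK//;apply: integrable_fin_num=> //;exact: sintegrable.
have mF: mfunT F by exact: continuous_measurable_fun.
have mk: mfunT k by exact: continuous_measurable_fun.
have cvF:= @ge0_cvgn_integral R leb F F0 mF.
have:= @ge0_cvgn_integral R leb k k0 mk;rewrite intk.
under [X in X @ _ --> _]eq_fun do rewrite toE//.
move=> /fine_cvgP[_] /= cvk.
have FE n: sint 0 n%:R F = m * sint 0 n%:R k+(v * h (- n%:R)-v * h n%:R).
 have dphi (y : R) : is_derive y 1 (fun y=> v * h (- y)-v * h y) ((y-m) * h y-(y+m) * h (- y)).
  have d1: is_derive y 1 h (- ((y-m)/v) * h y):= is_derive_gbump m v0 y.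
  have d2: is_derive y 1 (fun y=> h (- y)) (- ((y+m)/v) * h (- y)):= is_derive_gbumpN m v0 y.
  by derive_eq;field;exact: lt0r_neq0.
 have cphi: continuous (fun y=> (y-m) * h y-(y+m) * h (- y)).
  have cst (c : R) : continuous (fun _ : R=> c) by move=> ?;exact: cst_continuous.
  apply: continuousR_sub;apply: continuousR_mul=> //.
   exact: continuousR_sub continuousR_id (cst m).
  exact: continuousR_add continuousR_id (cst m).
 have ->: v * h (- n%:R)-v * h n%:R = sint 0 n%:R (fun y=> (y-m) * h y-(y+m) * h (- y)).
  by rewrite (sint_FTC _ cphi dphi)// oppr0 subrr subr0.
 rewrite -sintZ// -sintD//;first by apply: eq_sint=> y _;rewrite /F /k;ring.
 by move=> y;apply: continuousM;[exact: cst_continuous|exact: ck].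
have lim2: sint 0 n%:R F @[n --> \oo] --> m * sqrtr (2 * pi * v).
 have ->: (fun n=> sint 0 n%:R F) = (fun n=> m * sint 0 n%:R k+(v * gbump (- m) v n%:R-v * gbump m v n%:R)).
  by apply/funext=> n;rewrite FE /h gbump_opp.
 rewrite -[X in _ --> X]addr0 -[X in _+X](subrr (v*0));apply: cvgD;first exact: cvgMr.
 by apply: cvgB;apply: cvgMr;exact: gbump_cvg0.
have lim3: (sint 0 n%:R F)%:E @[n --> \oo] --> (m * sqrtr (2 * pi * v))%:E.
 by apply: cvg_EFin;[exact: nearW|exact: lim2].
have fE: (fun n=> \int[leb]_(x in `[0%R, n%:R]) (F x)%:E)%E = (fun n=> (sint 0 n%:R F)%:E).
 by apply/funext=> n;exact: toE.
rewrite fE in cvF;exact: (cvg_unique _ cvF lim3).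
Qed.

(** Both kernels vanish on the boundary of the half-line, so composing with [maxr x 0] extends them
    by zero and all integrals run over the whole line. *)
Definition qker (r x : R) : R := exc_q r (maxr x 0).
Definition pker (s x y : R) : R := exc_p s (maxr x 0) (maxr y 0).

Lemma measurable_qker r : mfunT (qker r).
have mm: mfunT (fun x : R=> maxr x 0) by apply: measurable_maxr.
apply: measurable_funM;first by apply: measurable_funM=> //.
apply: measurableT_comp=> //;apply: measurable_funM=> //.
by apply: measurableT_comp=> //;apply: measurable_funX.
Qed.

Lemma measurable_pker s : mfunT (fun z : R * R => pker s z.1 z.2).
have m1: mfunT (fun z : R*R=> maxr z.1 0) by apply: measurable_maxr=> //;exact: measurable_fst.
have m2: mfunT (fun z : R*R=> maxr z.2 0) by apply: measurable_maxr=> //;exact: measurable_snd.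
apply: measurable_funM=> //;apply: measurable_funB;
 (apply: measurableT_comp=> //;apply: measurable_funM=> //;
  apply: measurableT_comp=> //;apply: measurable_funX).
- exact: measurable_funB.
- exact: measurable_funD.
Qed.

Lemma qker_ge0 r x : 0 <= qker r x.
Proof. by rewrite /qker /exc_q mulr_ge0 ?expR_ge0// divr_ge0// le_max lexx orbT. Qed.

Lemma pker_ge0 s x y : 0 < s -> 0 <= pker s x y.
move=> s0;rewrite /pker /exc_p;set a:= maxr x 0;set b:= maxr y 0.
have a0: 0 <= a by rewrite le_max lexx orbT.
have b0: 0 <= b by rewrite le_max lexx orbT.
rewrite mulr_ge0 ?invr_ge0// subr_ge0 ler_expR ler_pM2r ?invr_gt0 ?mulr_gt0// lerN2.
have ->: (a+b)^+2 = (a-b)^+2+4*(a * b) by ring.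
by rewrite lerDl !mulr_ge0.
Qed.

Lemma qker0 r x : x <= 0 -> qker r x = 0.
Proof. by move=> x0;rewrite /qker (max_idPr x0) /exc_q !mul0r. Qed.

Lemma pker0 s x y : (x <= 0) || (y <= 0) -> pker s x y = 0.
case/orP=> h;rewrite /pker /exc_p (max_idPr h).
 by rewrite sub0r add0r sqrrN subrr mulr0.
by rewrite subr0 addr0 subrr mulr0.
Qed.

Definition qc (r : R) : R := (sqrtr (2 * pi * r ^+ 3))^-1.

Lemma qc_gt0 r : 0 < r -> 0 < qc r.
Proof. by move=> r0;rewrite invr_gt0 sqrtr_gt0 !mulr_gt0// ?pi_gt0// exprn_gt0. Qed.

Lemma qkerE r x : 0 <= x -> qker r x = x * qc r * expR (- (x ^+ 2 / (2 * r))).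
Proof. by move=> x0;rewrite /qker (max_idPl x0) /exc_q mulNr. Qed.

(** Completing the square turns the product into y times a difference of two Gaussians centred at
    [m] and [- m], the situation of [gauss_pair_moment]. Here [m] and [v] are the mean and variance
    at time [s] of a Brownian bridge from [x] to 0 of length s + r. *)
Lemma chapman_kolmogorov (s r x : R) : 0 < s -> 0 < r ->
  (\int[leb]_y (pker s x y * qker r y)%:E = (qker (s + r) x)%:E)%E.
move=> s0 r0;have [x0|x0]:= leP x 0.
 rewrite qker0//;under eq_integral do rewrite pker0 ?x0// mul0r.
 by rewrite integral0.
have sr0: 0 < s+r by rewrite addr_gt0.
pose m:= x * r/(s+r);pose v:= s * r/(s+r).
have m0: 0 < m by rewrite !(divr_gt0, mulr_gt0).
have v0: 0 < v by rewrite !(divr_gt0, mulr_gt0).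
pose C:= (sqrtr (2 * pi * s))^-1 * qc r * expR (- (x^+2/(2*(s+r)))).
have C0: 0 <= C by rewrite !mulr_ge0 ?expR_ge0 ?invr_ge0.
have mS: measurable_fun (`[0%R, +oo[ : set R) (fun y : R=> (y*(gbump m v y-gbump m v (- y)))%:E).
 have cS: continuous (fun y : R=> y*(gbump m v y-gbump m v (- y))).
  have ch: continuous (gbump m v) by exact: continuous_gbump.
  have chN: continuous (fun y=> gbump m v (- y)) by exact: continuous_gbumpN.
  exact: continuousR_mul continuousR_id (continuousR_sub ch chN).
 apply/measurable_EFinP;apply: measurable_funTS;exact: continuous_measurable_fun.
transitivity (\int[leb]_(y in `[0%R, +oo[) (C%:E*(y*(gbump m v y-gbump m v (- y)))%:E))%E.
 rewrite [RHS]integral_mkcond;apply: eq_integral=> y _;rewrite patchE.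
 case: ifPn=> [/set_mem|/negP yN];last first.
  have y0: y <= 0 by apply/ltW;rewrite ltNge;apply/negP=> y0;apply: yN;apply/mem_set;rewrite /= in_itv/= y0.
  by rewrite pker0 ?y0 ?orbT// mul0r.
 rewrite /= in_itv/= andbT=> y0;rewrite -EFinM;congr _%:E;rewrite qkerE// /pker (max_idPl (ltW x0)) (max_idPl y0) /exc_p.
 have cs (z : R) : expR (- (x-z)^+2/(2 * s)) * expR (- (z^+2/(2 * r))) =
   expR (- (x^+2/(2*(s+r)))) * gbump m v z.
  rewrite -!expRD;congr expR;rewrite /m /v;field.
  by rewrite !lt0r_neq0.
 have cp:= cs y;have:= cs (- y);rewrite opprK sqrrN=> cm.
 rewrite /C;transitivity ((sqrtr (2 * pi * s))^-1 * qc r * y *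
  (expR (- (x-y)^+2/(2 * s)) * expR (- (y^+2/(2 * r))) -
   expR (- (x+y)^+2/(2 * s)) * expR (- (y^+2/(2 * r)))));first by ring.
 by rewrite cp cm;ring.
rewrite ge0_integralZl_EFin//;last first.
 move=> y;rewrite /= in_itv/= andbT=> y0;rewrite lee_fin mulr_ge0// subr_ge0 gbumpN_le//;exact: ltW.
rewrite gauss_pair_moment//;last exact: ltW.
rewrite -EFinM qkerE ?ltW//;congr _%:E.
rewrite /C;set ex:= expR _.
have ->: x * qc (s+r) * ex = x * ex * qc (s+r) by ring.
have ->: (sqrtr (2 * pi * s))^-1 * qc r * ex*(m * sqrtr (2 * pi * v)) =
  x * ex*((sqrtr (2 * pi * s))^-1 * qc r*(r/(s+r)) * sqrtr (2 * pi * v)) by rewrite /m;ring.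
congr (_ * _);have p0:= @pi_gt0 R.
apply/eqP;rewrite -(@eqrXn2 _ 2)//;last 2 first.
- by rewrite !mulr_ge0 ?invr_ge0// ltW.
- by rewrite invr_ge0.
have q (z : R) : 0 < z -> 0 <= 2 * pi * z by move=> z0;rewrite !mulr_ge0// ltW.
apply/eqP;rewrite /qc !exprMn !exprVn !sqr_sqrtr ?q ?exprn_gt0//.
by rewrite /v;move: p0;move: (pi)=> p p0;field;rewrite !lt0r_neq0.
Qed.

Definition gweight (lam y : R) : R := expR (- (lam * y ^+ 2)).

(** Continuous counterpart of [shorten_kap0]: a Gaussian weight is absorbed by a shorter remaining
    time. *)
Lemma qker_gweight lam r y : 0 <= lam -> 0 < r ->
  gweight lam y * qker r y = qc r / qc (r^-1 + 2 * lam)^-1 * qker (r^-1 + 2 * lam)^-1 y.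
move=> l0 r0;have [y0|y0]:= leP y 0;first by rewrite !qker0// !mulr0.
have s0: 0 < r^-1+2 * lam by rewrite ltr_pwDl ?invr_gt0// mulr_ge0.
have q0: 0 < qc (r^-1+2 * lam)^-1 by rewrite qc_gt0// invr_gt0.
rewrite !qkerE ?(ltW y0)//;set r':= (_+_)^-1 in q0 *.
have ->: gweight lam y*(y * qc r * expR (- (y^+2/(2 * r)))) = qc r * y*(gweight lam y * expR (- (y^+2/(2 * r)))) by ring.
rewrite /gweight -expRD;have ->: - (lam * y^+2) + - (y^+2/(2 * r)) = - (y^+2/(2 * r')).
 by rewrite /r';field;rewrite !lt0r_neq0// ltr_pwDl// !mulr_ge0// ltW.
by field;rewrite lt0r_neq0.
Qed.
End CK.

(** * From indicators to bounded functions, one time at a time *)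

Section SlotFunctionals.
Context {R : realType}.
Implicit Types (f g : R -> R).

Definition slot f : Prop := mfunT f /\ forall x, 0 <= f x.

Lemma slot_indic (A : set R) : measurable A -> slot \1_A.
Proof. by move=> mA;split=> //;apply: measurable_indic. Qed.

Lemma slotD f g : slot f -> slot g -> slot (fun x => f x + g x).
Proof. by move=> [mf f0] [mg g0];split=> [|x];[exact: measurable_funD|rewrite addr_ge0]. Qed.

Lemma slotZ c f : 0 <= c -> slot f -> slot (fun x => c * f x).
Proof. by move=> c0 [mf f0];split=> [|x];[exact: measurable_funM|rewrite mulr_ge0]. Qed.

(** An integral seen as a functional of the function at one time, the others being frozen; it covers
    expectations and the iterated integrals of the excursion alike. *)
Definition positive_functional (J : (R -> R) -> \bar R) : Prop :=
  [/\ forall f, slot f -> (0 <= J f)%E,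
      forall f g, slot f -> slot g -> J (fun x => f x + g x) = (J f + J g)%E,
      forall c f, 0 <= c -> slot f -> J (fun x => c * f x) = (c%:E * J f)%E &
      forall f g, slot f -> slot g -> (forall x, f x <= g x) -> (J f <= J g)%E].

Definition level f (r : R) : set R := [set x | r <= f x].
Definition stair m f (x : R) : R := \sum_(j < m) m%:R^-1 * \1_(level f (j.+1%:R / m%:R)) x.

Lemma level_measurable f r : mfunT f -> measurable (level f r).
move=> mf;have ->: level f r = setT `&` f @^-1` `[r, +oo[.
 by rewrite setTI;apply/seteqP;split=> x;rewrite /= in_itv/= andbT.
exact: mf.
Qed.

Lemma slot_stair m f : slot f -> slot (stair m f).
move=> [mf f0];split=> [|x];last by rewrite sumr_ge0// => j _;rewrite mulr_ge0// invr_ge0.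
apply: measurable_sum=> j;apply: measurable_funM=> //;apply: measurable_indic;exact: level_measurable.
Qed.

Lemma stair_bounds m f x : (0 < m)%N -> 0 <= f x <= 1 -> stair m f x <= f x <= stair m f x + m%:R^-1.
move=> m0 /andP[f0 f1];have mm: 0 < m%:R :> R by rewrite ltr0n.
have y0: 0 <= m%:R * f x by rewrite mulr_ge0.
have ym: (truncn (m%:R * f x) <= m)%N.
 by rewrite -[leqRHS](@natrK R);apply: le_truncn;rewrite ler_piMr.
have ->: stair m f x = (truncn (m%:R * f x))%:R/m%:R.
 rewrite /stair -mulr_sumr mulrC;congr (_/_).
 rewrite (eq_bigr (fun j : 'I_m=> ((j < truncn (m%:R * f x))%N)%:R));last first.
  move=> j _;rewrite indicE;congr (nat_of_bool _)%:R.
  have ->: (j < truncn (m%:R * f x))%N = (j.+1%:R/m%:R <= f x) by rewrite truncn_ge_nat// ler_pdivrMr// mulrC.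
  by apply/idP/idP=> [/set_mem|h];[|apply/mem_set].
 rewrite -natr_sum;congr _%:R.
 rewrite -[RHS]card_ord -sum1_card.
 rewrite (big_ord_widen m (fun=> 1%N) ym) [RHS]big_mkcond/=.
 by apply: eq_bigr=> j _;case: ltnP.
have /andP[a1 a2]:= truncn_itv y0.
rewrite ler_pdivrMr// [f x * _]mulrC a1/= -[X in _+X]mul1r -mulrDl ler_pdivlMr// natr1 [f x * _]mulrC.
exact: ltW.
Qed.

Lemma positive_functional_stair J m f : positive_functional J -> slot f ->
  J (stair m f) = (\sum_(j < m) (m%:R^-1)%:E * J \1_(level f (j.+1%:R / m%:R)))%E.
move=> [J0 JD JZ _] [mf f0];rewrite /stair.
have sl (j : nat) : slot (fun x=> m%:R^-1 * \1_(level f (j.+1%:R/m%:R)) x).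
 by apply: slotZ;[rewrite invr_ge0|apply: slot_indic;exact: level_measurable].
have J00: J (fun=> 0) = 0%E.
 have:= JZ 0 (fun=> 0) (lexx 0) _;rewrite mul0e=> <-;last by split.
 by congr J;apply/funext=> x;rewrite mul0r.
have sls k: slot (fun x=> \sum_(j < k) m%:R^-1 * \1_(level f (j.+1%:R/m%:R)) x).
 split;first by apply: measurable_sum=> j;case: (sl j).
 by move=> x;apply: sumr_ge0=> j _;case: (sl j)=> _.
suff gen k: J (fun x=> \sum_(j < k) m%:R^-1 * \1_(level f (j.+1%:R/m%:R)) x) =
  (\sum_(j < k) (m%:R^-1)%:E*J \1_(level f (j.+1%:R/m%:R)))%E by exact: gen.
elim: k=> [|k IH].
 by rewrite big_ord0 -J00;congr J;apply/funext=> x;rewrite big_ord0.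
rewrite big_ord_recr/= -IH -JZ ?invr_ge0//;last by apply: slot_indic;exact: level_measurable.
rewrite -JD;[|exact: sls|exact: (sl k)].
by congr J;apply/funext=> x;rewrite big_ord_recr.
Qed.

(** A function with values in [0,1] is within 1/m of a staircase with [m] levels, a combination of
    indicators; the finite mass of the constant 1 makes the error vanish. *)
Lemma positive_functional_eq J J' f : positive_functional J -> positive_functional J' ->
  (forall A, measurable A -> J \1_A = J' \1_A) -> (J (fun=> 1%R) < +oo)%E ->
  slot f -> (forall x, f x <= 1) -> J f = J' f.
move=> PJ PJ' JJ J1 sf f1.
have one_indic: (fun=> 1 : R) = \1_(@setT R) by apply/funext=> x;rewrite indicE in_setT.
have s1: slot (fun=> 1) by rewrite one_indic;exact: slot_indic.
have le1 (H K : (R -> R) -> \bar R) : positive_functional H -> positive_functional K ->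
  (forall A, measurable A -> H \1_A = K \1_A) -> (H (fun=> 1%R) < +oo)%E -> (H f <= K f)%E.
 move=> PH PK HK H1;have [H0 HD HZ Hle]:= PH;have [K0 KD KZ Kle]:= PK.
 have h1: H (fun=> 1) \is a fin_num by rewrite ge0_fin_numE// H0.
 apply/lee_addgt0Pr=> e e0;set c:= fine (H (fun=> 1)).
 have c0: 0 <= c by rewrite fine_ge0// H0.
 pose m:= (truncn (c/e)).+1;have m0: 0 < m%:R :> R by rewrite ltr0n.
 have mi: 0 <= m%:R^-1 :> R by rewrite invr_ge0.
 have sst:= slot_stair m sf.
 have sc: slot (fun=> m%:R^-1*1) by exact: (slotZ mi s1).
 apply: (le_via (H (fun x=> stair m f x+m%:R^-1*1))).
  apply: Hle=> //;first exact: slotD.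
  move=> x;rewrite mulr1;have fx: 0 <= f x <= 1 by rewrite f1 (sf.2 x).
  by have /andP[]:= stair_bounds (ltn0Sn _ : (0 < m)%N) fx.
 rewrite HD// HZ//;apply: leeD.
  rewrite (_ : H (stair m f) = K (stair m f)).
   apply: Kle=> // x;have fx: 0 <= f x <= 1 by rewrite f1 (sf.2 x).
   by have /andP[]:= stair_bounds (ltn0Sn _ : (0 < m)%N) fx.
  rewrite !positive_functional_stair//;apply: eq_bigr=> j _;rewrite HK//.
  by apply: level_measurable;case: sf.
 rewrite -(fineK h1) -EFinM lee_fin -/c mulrC ler_pdivrMr// -ler_pdivrMl// mulrC.
 by apply: ltW;rewrite truncnS_gt.
have J1': (J' (fun=> 1%R) < +oo)%E by rewrite one_indic -JJ// -one_indic.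
by apply/eqP;rewrite eq_le !le1// => A mA;rewrite JJ.
Qed.

Lemma positive_functionalZ (J : (R -> R) -> \bar R) (k : R) : 0 <= k -> positive_functional J ->
  positive_functional (fun f => (k%:E * J f)%E).
move=> k0 [J0 JD JZ Jle];split.
- by move=> f sf;rewrite mule_ge0// J0.
- by move=> f g sf sg;rewrite JD// ge0_muleDr// J0.
- by move=> c f c0 sf;rewrite JZ// !muleA -!EFinM mulrC.
- by move=> f g sf sg fg;apply: lee_wpmul2l;rewrite ?lee_fin//;exact: Jle.
Qed.

(* expectation functionals: one slot varies, the others form the bounded weight Y *)
Lemma positive_functional_expect d (Omega : measurableType d) (P : probability Omega R)
    (X Y : Omega -> R) : mfunT X -> mfunT Y -> (forall w, 0 <= Y w) ->
  positive_functional (fun f => \int[P]_w (f (X w) * Y w)%:E)%E.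
move=> mX mY Y0.
have mm f: slot f -> mfunT (fun w=> (f (X w)*Y w)%:E).
 by move=> [mf _];apply/measurable_EFinP;apply: measurable_funM=> //;exact: measurableT_comp.
have ge f: slot f -> forall w, (0 <= (f (X w)*Y w)%:E)%E.
 by move=> [_ f0] w;rewrite lee_fin mulr_ge0.
split.
- by move=> f sf;apply: integral_ge0=> w _;exact: ge.
- move=> f g sf sg;under eq_integral do rewrite mulrDl EFinD.
 by rewrite ge0_integralD//;[move=> w _;exact: ge|exact: mm|move=> w _;exact: ge|exact: mm].
- move=> c f c0 sf;under eq_integral do rewrite -mulrA EFinM.
 by rewrite ge0_integralZl_EFin//;[move=> w _;exact: ge|exact: mm].
- move=> f g sf sg fg;apply: ge0_le_integral=> //=;[by move=> w _;exact: ge|exact: mm|exact: mm|].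
 by move=> w _;rewrite lee_fin ler_wpM2r.
Qed.
End SlotFunctionals.

(** * Iterated kernels of the excursion *)

Section ExcFunctions.
Context {R : realType}.
Notation leb := (@lebesgue_measure R).
Implicit Types (fs : seq (R * (R -> R))) (us : seq (R * set R)).

(** [exc_aux] with functions in place of sets and a free horizon [l], which Gaussian weights will
    shorten. *)
Fixpoint excA (l tp xp : R) fs : \bar R :=
  if fs is (t, f) :: fs' then
    (\int[leb]_x ((pker (t - tp) xp x * f x)%:E * excA l t x fs'))%E
  else (qker (l - tp) xp)%:E.

Definition excE (l : R) fs : \bar R :=
  if fs is (t, f) :: fs' then (\int[leb]_x ((qker t x * f x)%:E * excA l t x fs'))%E else 1%E.

Fixpoint timed (l tp : R) fs : Prop :=
  if fs is (t, f) :: fs' then [/\ tp < t, slot f & timed l t fs'] else tp < l.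

Lemma timed_lt l tp fs : timed l tp fs -> tp < l.
Proof. by elim: fs tp=> [//|[t f] fs IH] tp /= [h _ /IH];apply: lt_trans. Qed.

Lemma excA_slot l tp fs : timed l tp fs ->
  mfunT (excA l tp ^~ fs) /\ forall x, (0 <= excA l tp x fs)%E.
elim: fs tp=> [|[t f] fs IH] tp /=.
 by move=> _;split=> [|x];[apply/measurable_EFinP;exact: measurable_qker|rewrite lee_fin qker_ge0].
move=> [tt [mf f0] /IH[mA A0]].
have ge0 (x y : R) : (0 <= (pker (t-tp) x y * f y)%:E * excA l t y fs)%E.
 by rewrite mule_ge0// lee_fin mulr_ge0// pker_ge0 ?subr_gt0.
split=> [|x];last by apply: integral_ge0=> y _.
have mm: mfunT (fun z : R*R=> ((pker (t-tp) z.1 z.2 * f z.2)%:E * excA l t z.2 fs)%E).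
 have m2: mfunT (fun z : R*R=> excA l t z.2 fs):= measurableT_comp mA measurable_snd.
 apply: (emeasurable_funM _ m2).
 apply/measurable_EFinP;apply: measurable_funM;first exact: measurable_pker.
 by apply: measurableT_comp=> //;exact: measurable_snd.
exact: (@measurable_fun_fubini_tonelli_F _ _ _ _ _ leb _ mm (fun z=> ge0 z.1 z.2)).
Qed.

Lemma slot_mul_meas (g : R -> R) l t fs f : timed l t fs -> slot f -> mfunT g -> (forall x, 0 <= g x) ->
  mfunT (fun x => ((g x * f x)%:E * excA l t x fs)%E) /\
  (forall x, (0 <= (g x * f x)%:E * excA l t x fs)%E).
move=> /excA_slot[mA A0] [mf f0] mg g0;split=> [|x];last by rewrite mule_ge0// lee_fin mulr_ge0.
by apply: emeasurable_funM=> //;apply/measurable_EFinP;exact: measurable_funM.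
Qed.

Lemma measurable_pker1 (s x : R) : mfunT (pker s x).
Proof. exact: (measurableT_comp (measurable_pker s) (measurable_pair1 x)). Qed.

Lemma positive_functional_int (g : R -> R) (l t : R) fs : timed l t fs ->
  mfunT g -> (forall x, 0 <= g x) ->
  positive_functional (fun f => \int[leb]_x ((g x * f x)%:E * excA l t x fs))%E.
move=> tf mg g0;have ok f (sf : slot f):= slot_mul_meas tf sf mg g0.
split.
- by move=> f sf;apply: integral_ge0=> x _;have []:= ok f sf.
- move=> f h sf sh;have [m1 p1]:= ok f sf;have [m2 p2]:= ok h sh.
 rewrite -ge0_integralD//;apply: eq_integral=> x _.
 by rewrite mulrDr EFinD ge0_muleDl// lee_fin mulr_ge0//;[case: sf|case: sh].
- move=> c f c0 sf;have [m1 p1]:= ok f sf.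
 by rewrite -ge0_integralZl_EFin//;apply: eq_integral=> x _;rewrite mulrCA EFinM muleA.
- move=> f h sf sh fh;have [m1 p1]:= ok f sf;have [m2 p2]:= ok h sh.
 apply: ge0_le_integral=> //= x _;apply: lee_wpmul2r;first by have []:= excA_slot tf.
 by rewrite lee_fin ler_wpM2l.
Qed.

Lemma timed_slot l tp fs1 t f g fs2 : slot g -> timed l tp (fs1 ++ (t, f) :: fs2) -> timed l tp (fs1 ++ (t, g) :: fs2).
Proof. by move=> sg;elim: fs1 tp=> [|[t1 f1] fs1 IH] tp /= [h1 h2 h3];split=> //;exact: IH. Qed.

Lemma positive_functional_excA l tp xp fs1 t f0 fs2 : timed l tp (fs1 ++ (t, f0) :: fs2) ->
  positive_functional (fun f => excA l tp xp (fs1 ++ (t, f) :: fs2)).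
elim: fs1 tp xp=> [|[t1 f1] fs1 IH] tp xp /=.
 move=> [tt sf0 tf];apply: positive_functional_int=> //;first exact: measurable_pker1.
 by move=> x;rewrite pker_ge0 ?subr_gt0.
move=> [tt1 sf1 tf].
have p0 x: 0 <= pker (t1-tp) xp x by rewrite pker_ge0 ?subr_gt0.
have ok f (sf : slot f):= slot_mul_meas (timed_slot sf tf) sf1 (@measurable_pker1 (t1-tp) xp) p0.
split.
- by move=> f sf;apply: integral_ge0=> x _;have []:= ok f sf.
- move=> f h sf sh;have [m1 p1]:= ok f sf;have [m2 p2]:= ok h sh.
 rewrite -ge0_integralD//;apply: eq_integral=> x _.
 by have [J0 JD _ _]:= IH t1 x tf;rewrite JD// ge0_muleDr// J0.
- move=> c f c0 sf;have [m1 p1]:= ok f sf.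
 rewrite -ge0_integralZl_EFin//;apply: eq_integral=> x _.
 by have [J0 _ JZ _]:= IH t1 x tf;rewrite JZ// muleCA.
- move=> f h sf sh fh;have [m1 p1]:= ok f sf;have [m2 p2]:= ok h sh.
 apply: ge0_le_integral=> //= x _;apply: lee_wpmul2l.
  by rewrite lee_fin mulr_ge0//;case: sf1.
 by have [_ _ _ Jle]:= IH t1 x tf;exact: Jle.
Qed.

Lemma positive_functional_excE l fs1 t f0 fs2 : timed l 0 (fs1 ++ (t, f0) :: fs2) ->
  positive_functional (fun f => excE l (fs1 ++ (t, f) :: fs2)).
case: fs1=> [|[t1 f1] fs1] /=.
 move=> [tt sf0 tf];apply: positive_functional_int=> //;first exact: measurable_qker.
 exact: qker_ge0.
move=> [tt1 sf1 tf].
have ok f (sf : slot f):= slot_mul_meas (timed_slot sf tf) sf1 (@measurable_qker R t1) (qker_ge0 t1).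
have IH x:= positive_functional_excA x tf.
split.
- by move=> f sf;apply: integral_ge0=> x _;have []:= ok f sf.
- move=> f h sf sh;have [m1 p1]:= ok f sf;have [m2 p2]:= ok h sh.
 rewrite -ge0_integralD//;apply: eq_integral=> x _.
 by have [J0 JD _ _]:= IH x;rewrite JD// ge0_muleDr// J0.
- move=> c f c0 sf;have [m1 p1]:= ok f sf.
 rewrite -ge0_integralZl_EFin//;apply: eq_integral=> x _.
 by have [J0 _ JZ _]:= IH x;rewrite JZ// muleCA.
- move=> f h sf sh fh;have [m1 p1]:= ok f sf;have [m2 p2]:= ok h sh.
 apply: ge0_le_integral=> //= x _;apply: lee_wpmul2l.
  by rewrite lee_fin mulr_ge0 ?qker_ge0//;case: sf1.
 by have [_ _ _ Jle]:= IH x;exact: Jle.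
Qed.

Definition indics us : seq (R * (R -> R)) := [seq (p.1, \1_p.2 : R -> R) | p <- us].

Lemma exc_aux_indics us tp x : 0 < x -> exc_aux tp x us = excA 1 tp x (indics us).
elim: us tp x=> [|[t A] us IH] tp x x0 /=;first by rewrite /qker (max_idPl (ltW x0)).
rewrite integral_mkcond;apply: eq_integral=> y _;rewrite patchE /pker (max_idPl (ltW x0)).
case: ifPn=> [/set_mem[/= Ay y0]|/negP yN].
 by rewrite (max_idPl (ltW y0)) indicE mem_set// mulr1 IH.
have [y0|y0]:= leP y 0.
 by rewrite /exc_p subr0 addr0 subrr mulr0 mul0r mul0e.
rewrite indicE memNset ?mulr0 ?mul0e// => Ay;apply: yN;exact/mem_set.
Qed.

Lemma exc_fdd_indics us : us != [::] ->
  exc_fdd us = ((2 * sqrtr (2 * pi))%:E * excE 1 (indics us))%E.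
case: us=> [//|[t A] us] _ /=;congr (_ * _)%E.
rewrite integral_mkcond;apply: eq_integral=> y _;rewrite patchE.
case: ifPn=> [/set_mem[/= Ay y0]|/negP yN].
 by rewrite /qker (max_idPl (ltW y0)) indicE mem_set// mulr1 exc_aux_indics.
have [y0|y0]:= leP y 0;first by rewrite qker0// mul0r mul0e.
rewrite indicE memNset ?mulr0 ?mul0e// => Ay;apply: yN;exact/mem_set.
Qed.
End ExcFunctions.

Section ExcursionExpectation.
Context {R : realType} {d : measure_display} {Omega : measurableType d}.
Variables (P : probability Omega R) (e : Omega -> R -> R).
Hypothesis exc : is_norm_excursion P e.
Notation leb := (@lebesgue_measure R).
Implicit Types (fs : seq (R * (R -> R))) (us : seq (R * set R)).

Definition slotprod (X : Omega -> R -> R) fs (w : Omega) : R := \prod_(p <- fs) p.2 (X w p.1).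

Definition slots fs : Prop := forall p, p \in fs -> slot p.2.

Lemma slotprod_meas (X : Omega -> R -> R) fs : (forall t, mfunT (X ^~ t)) ->
  slots fs -> mfunT (slotprod X fs) /\ forall w, 0 <= slotprod X fs w.
move=> mX;elim: fs=> [|[t f] fs IH] sl;rewrite /slotprod.
 by split=> [|w];[under eq_fun do rewrite big_nil;exact: measurable_cst|rewrite big_nil].
have [|m1 p1]:= IH;first by move=> p pf;apply: sl;rewrite inE pf orbT.
have [mf f0] : slot f by apply: (sl (t, f));rewrite mem_head.
split=> [|w];last by rewrite big_cons mulr_ge0//;exact: p1.
under eq_fun do rewrite big_cons;apply: measurable_funM=> //=.
exact: (measurableT_comp mf (mX t)).
Qed.

Lemma slotprod_indics (X : Omega -> R -> R) us w : slotprod X (indics us) w = \1_(cyl X us) w.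
rewrite /slotprod /indics big_map;elim: us=> [|[t A] us IH].
 by rewrite big_nil indicE mem_set.
rewrite big_cons IH /= !indicE -natrM mulnb;congr (nat_of_bool _)%:R.
apply/andP/idP=> [[/set_mem h1 /set_mem h2]|/set_mem[h1 h2]];first exact/mem_set.
by split;exact/mem_set.
Qed.

Lemma slots_cat fs1 fs2 : slots (fs1 ++ fs2) <-> slots fs1 /\ slots fs2.
split=> [h|[h1 h2] p];last by rewrite mem_cat=> /orP[/h1|/h2].
by split=> p pf;apply: h;rewrite mem_cat pf ?orbT.
Qed.

Lemma cyl_measurable (X : Omega -> R -> R) us : (forall t, mfunT (X ^~ t)) ->
  borel_specs us -> measurable (cyl X us).
move=> mX;elim: us=> [|[t A] us IH] /=;first by move=> _;exact: measurableT.
move=> [mA mus];rewrite (_ : cyl _ _ = X ^~ t @^-1` A `&` cyl X us)//;apply: measurableI;last exact: IH.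
by rewrite -[X in measurable X]setTI;exact: mX.
Qed.

Definition le1_slots fs : Prop := forall p, p \in fs -> forall x, p.2 x <= 1.

Lemma slotprod_le1 (X : Omega -> R -> R) fs w : slots fs -> le1_slots fs -> 0 <= slotprod X fs w <= 1.
rewrite /slotprod;elim: fs=> [|p fs IH] s1 l1;first by rewrite big_nil ler01 lexx.
rewrite big_cons;have /andP[h1 h2] : 0 <= \prod_(p <- fs) p.2 (X w p.1) <= 1.
 by apply: IH=> q qf;[apply: s1|apply: l1];rewrite inE qf orbT.
have [_ p0]:= s1 p (mem_head _ _);rewrite mulr_ge0//= -[leRHS]mul1r;apply: ler_pM=> //.
by apply: l1;rewrite mem_head.
Qed.

(** The finite-dimensional laws are given on sets. Induction on the number of genuine functions:
    both sides are positive functionals of the last one, which may thus be replaced by an indicator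
    and moved to [us]. *)
Lemma excursion_expect fs us : timed 1 0 (fs ++ indics us) -> borel_specs us -> le1_slots fs ->
  fs ++ indics us != [::] ->
  (\int[P]_w (slotprod e (fs ++ indics us) w)%:E = (2 * sqrtr (2 * pi))%:E * excE 1 (fs ++ indics us))%E.
have [me _ _ fdd]:= exc.
elim/last_ind: fs us=> [|fs [t f] IH] us /=.
 move=> tus bus _ us0;rewrite -exc_fdd_indics;last by case: us us0 {tus bus}.
 under eq_integral do rewrite slotprod_indics.
 rewrite integral_indic//;last exact: cyl_measurable.
 rewrite setIT;apply: fdd=> //.
  suff gen tp: timed 1 tp (indics us) -> 0 <= tp -> times_in `]0, 1[ us by exact: (gen 0).
  elim: us tp {tus bus us0}=> [//|[t A] us IH] tp /= [tt _ h] t0;split.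
   by rewrite in_itv/= (le_lt_trans t0 tt) (timed_lt h).
  by apply: (IH t)=> //;exact: ltW (le_lt_trans t0 tt).
 case: us tus {bus us0}=> [//|[t A] us] /= [_ _];elim: us t A=> [//|[t' A'] us IH] t A /= [-> _ h] /=.
 exact: IH h.
rewrite cat_rcons=> tfs bus le1 _.
have sf: slot f.
 elim: {IH le1} fs 0 tfs=> [|[t1 f1] fs IH] tp /= [_ // _];exact: IH.
have st: timed 1 0 (fs ++ (t, f) :: indics us) -> slots (fs ++ (t, f) :: indics us).
 elim: (fs ++ _) 0=> [//|[t1 f1] fs1 IH1] tp /= [_ sf1 /IH1 h] p;rewrite inE=> /orP[/eqP->//|];exact: h.
have:= st tfs;rewrite -cat1s=> /slots_cat[s1 /slots_cat[_ s2]].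
have [m1 p1]:= slotprod_meas me s1;have [m2 p2]:= slotprod_meas me s2.
pose Y w:= slotprod e fs w * slotprod e (indics us) w.
have mY: mfunT Y by exact: measurable_funM.
have Y0 w: 0 <= Y w by rewrite mulr_ge0.
have prodE g w: slotprod e (fs ++ (t, g) :: indics us) w = g (e w t)*Y w.
 by rewrite /Y /slotprod big_cat big_cons /=;ring.
under eq_integral do rewrite prodE.
have c0: 0 <= 2 * sqrtr (2 * pi) :> R by rewrite mulr_ge0.
have Y1 w: Y w <= 1.
 rewrite /Y -[leRHS]mul1r;apply: ler_pM=> //.
  suff /andP[] : 0 <= slotprod e fs w <= 1 by [].
  by apply: slotprod_le1=> // p pf;apply: le1;rewrite mem_rcons inE pf orbT.
 by rewrite slotprod_indics indicE;case: (_ \in _).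
apply: (positive_functional_eq (positive_functional_expect P (me t) mY Y0)
  (positive_functionalZ c0 (positive_functional_excE tfs)))=> //.
- move=> A mA /=.
 have ->: fs ++ (t, \1_A) :: indics us = fs ++ indics ((t, A) :: us) by [].
 rewrite -IH//.
 + by apply: eq_integral=> w _;rewrite -prodE.
 + by apply: timed_slot tfs;exact: slot_indic.
 + by move=> p pf;apply: le1;rewrite mem_rcons inE pf orbT.
 + by case: (fs).
- apply: (@le_lt_trans _ _ (\int[P]_w 1)%E);last first.
  by rewrite integral_cst//= mul1e;apply: le_lt_trans (probability_le1 _ _) (ltry _).
 apply: ge0_le_integral=> //=;first by move=> w _;rewrite lee_fin mul1r.
  by apply/measurable_EFinP;exact: measurable_funM.
 by move=> w _;rewrite lee_fin mul1r.
- by move=> x;apply: (le1 (t, f));rewrite mem_rcons mem_head.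
Qed.

Lemma gweight_slot lam : 0 <= lam -> slot (gweight lam : R -> R) /\ forall x : R, gweight lam x <= 1.
move=> l0;split;last by move=> x;rewrite expR_le1 oppr_le0 mulr_ge0// sqr_ge0.
split=> [|x];last exact: expR_ge0.
by apply: measurableT_comp=> //;apply: measurableT_comp=> //;apply: measurable_funM=> //;apply: measurable_funX.
Qed.

(* The Gaussian weight at the last time is absorbed by shortening the time horizon. *)
Lemma excA_gweight_last l tp fs t lam x : timed l tp (rcons fs (t, gweight lam)) -> 0 <= lam ->
  let r := l - t in let r' := (r^-1 + 2 * lam)^-1 in
  excA l tp x (rcons fs (t, gweight lam)) = ((qc r / qc r')%:E * excA (t + r') tp x fs)%E.
move=> tm l0 r r';have r0: 0 < r.
 by rewrite subr_gt0;elim: fs tp tm=> [|[t1 f1] fs IH] tp /= [// _ _];exact: IH.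
have r'0: 0 < r' by rewrite invr_gt0 ltr_pwDl ?invr_gt0// mulr_ge0.
have q0: 0 <= qc r/qc r' by rewrite divr_ge0// ltW// qc_gt0.
elim: fs tp x tm=> [|[t1 f1] fs IH] tp x /=.
 move=> [tt sf _];under eq_integral do rewrite -EFinM -mulrA -/r qker_gweight// -/r' mulrCA EFinM.
 rewrite ge0_integralZl_EFin//;last 2 first.
 - by move=> y _;rewrite lee_fin mulr_ge0 ?qker_ge0// pker_ge0// subr_gt0.
 - by apply/measurable_EFinP;apply: measurable_funM;[exact: measurable_pker1|exact: measurable_qker].
 by rewrite chapman_kolmogorov ?subr_gt0// addrAC.
move=> [tt sf tm];under eq_integral do rewrite IH// muleCA.
have tm': timed (t+r') t1 fs.
 elim: {IH} fs t1 tm {tt}=> [|[t2 f2] fs IH] t1 /= [h1 h2 h3];first by rewrite (lt_trans h1)// ltrDl.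
 by split=> //;exact: IH.
have [m1 p1]:= slot_mul_meas tm' sf (@measurable_pker1 R (t1-tp) x) (fun y=> pker_ge0 x y (etrans (subr_gt0 _ _) tt)).
by rewrite ge0_integralZl_EFin.
Qed.

(* The integral of q_t q_r is only needed up to the total mass, which is known to be one. *)
Lemma excE_mass (t r : R) : 0 < t -> 0 < r -> t + r <= 1 ->
  ((2 * sqrtr (2 * pi))%:E * \int[leb]_x (qker t x * qker r x)%:E = (qc (t + r) / qc 1)%:E)%E.
move=> t0 r0 tr1;set c:= 2 * _.
have tr0: 0 < t+r by rewrite addr_gt0.
pose v:= t * r/(t+r);have v0: 0 < v by rewrite !(divr_gt0, mulr_gt0).
have v1: 4 * v <= 1.
 rewrite /v mulrA ler_pdivrMr// mul1r;apply: le_trans (_ : (t+r)^+2 <= _).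
  have ->: (t+r)^+2 = 4*(t * r)+(t-r)^+2 by ring.
  by rewrite lerDl sqr_ge0.
 by rewrite expr2 ler_piMr// ltW.
pose q:= sqrtr (1-4 * v);have q0: 0 <= q:= sqrtr_ge0 _.
have qq: q^+2 = 1-4 * v by rewrite sqr_sqrtr// subr_ge0.
have q1: q < 1.
 rewrite ltNge;apply/negP=> h;have h2: 1 <= q^+2 by rewrite exprn_ege1.
 by move: h2;rewrite qq lerBrDr gerDl leNgt mulr_gt0.
(* a + b = 1 and ab = v = tr/(t+r): then q_a q_b is proportional to q_t q_r, and its integral is
   known from the total mass of the law of the excursion at time [a]. The roots are real because v
   <= 1/4. *)
pose a:= (1-q)/2;pose b:= (1+q)/2.
have a0: 0 < a by rewrite divr_gt0// subr_gt0.
have b0: 0 < b by rewrite divr_gt0// ltr_pwDl.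
have ab1: b = 1-a by rewrite /a /b;field.
have ab: a * b = v.
 have ->: a * b = (1-q^+2)/4 by rewrite /a /b;field.
 by rewrite qq;field.
have a1: a < 1 by rewrite -subr_gt0 -ab1.
have mass: (c%:E * \int[leb]_x (qker a x * qker b x)%:E = 1)%E.
 have [_ _ _ /(_ [:: (a, setT)])]:= exc.
 rewrite exc_fdd_indics// => h.
 have : P (cyl e [:: (a, setT)]) = 1%E.
  by rewrite -(@probability_setT _ _ _ P);congr (P _);apply/seteqP;split.
 rewrite h//=;last by rewrite in_itv/= a0 a1.
 by move=> <-;congr (_ * _)%E;apply: eq_integral=> x _;rewrite indicE in_setT mulr1 ab1.
have qq0 (s u x : R) : 0 < s -> 0 < u -> qker s x * qker u x = qc s * qc u*(maxr x 0^+2 * expR (- (maxr x 0^+2/(2*(s * u/(s+u)))))).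
 move=> s0 u0;rewrite /qker;set y:= maxr x 0.
 have y0: 0 <= y by rewrite le_max lexx orbT.
 have:= qkerE s y0;have:= qkerE u y0;rewrite /qker (max_idPl y0)=> -> ->.
 have ->: y * qc s * expR (- (y^+2/(2 * s)))*(y * qc u * expR (- (y^+2/(2 * u)))) =
  qc s * qc u*(y^+2*(expR (- (y^+2/(2 * s))) * expR (- (y^+2/(2 * u))))) by ring.
 rewrite -expRD;congr (_*(_ * expR _));field;rewrite !lt0r_neq0// addr_gt0//.
have E x: qker t x * qker r x = qc t * qc r/(qc a * qc b)*(qker a x * qker b x).
 rewrite !qq0//;have ->: a * b/(a+b) = v.
  by rewrite ab;(have ->: a+b = 1 by rewrite ab1 addrC subrK);rewrite divr1.
 by rewrite -/v;field;rewrite !lt0r_neq0 ?qc_gt0.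
under eq_integral do rewrite E EFinM.
rewrite ge0_integralZl_EFin//;last 3 first.
- by move=> x _;rewrite lee_fin mulr_ge0 ?qker_ge0.
- by apply/measurable_EFinP;apply: measurable_funM;exact: measurable_qker.
- by rewrite divr_ge0 ?mulr_ge0// ltW// qc_gt0.
rewrite muleCA mass mule1;congr _%:E.
have Q (x : R) : 0 < x -> qc x^+2 = (2 * pi * x^+3)^-1.
 by move=> x0;rewrite /qc exprVn sqr_sqrtr// !mulr_ge0// ?exprn_ge0 ?ltW// pi_gt0.
have QE: qc t * qc r * qc 1 = qc (t+r)*(qc a * qc b).
 have Q0 (x : R) : 0 <= qc x by rewrite invr_ge0.
 apply/eqP;rewrite -(@eqrXn2 _ 2)//;[|by rewrite !mulr_ge0|by rewrite !mulr_ge0].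
 apply/eqP;rewrite !exprMn !Q//.
 have ->: (2 * pi * a^+3)^-1*(2 * pi * b^+3)^-1 = (2 * pi*(2 * pi)*(a * b)^+3)^-1 :> R.
  by rewrite -invfM;congr (_^-1);ring.
 rewrite ab /v expr1n;have:= @pi_gt0 R;move: (pi)=> p p0;field.
 by rewrite !lt0r_neq0.
have qa:= qc_gt0 a0;have qb:= qc_gt0 b0;have q1':= @qc_gt0 R 1 ltr01.
apply: (mulIf (lt0r_neq0 q1'));rewrite mulrAC QE;field.
by rewrite !lt0r_neq0.
Qed.
End ExcursionExpectation.

Section BoundedExpectation.
Context {R : realType} {d : measure_display} {Omega : measurableType d}.
Variable P : probability Omega R.
Implicit Types f g : Omega -> R.

Definition Ex f : R := \int[P]_w f w.
Definition bmfun f : Prop := mfunT f /\ exists K : R, forall w, `|f w| <= K.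

Lemma bmfun_cst c : bmfun (fun=> c).
Proof. by split;[exact: measurable_cst|exists `|c|]. Qed.

Lemma bmfunD f g : bmfun f -> bmfun g -> bmfun (fun w => f w + g w).
move=> [mf [K hK]] [mg [L hL]];split;first exact: measurable_funD.
by exists (K+L)=> w;apply: le_trans (ler_normD _ _) _;exact: lerD.
Qed.

Lemma bmfunM f g : bmfun f -> bmfun g -> bmfun (fun w => f w * g w).
move=> [mf [K hK]] [mg [L hL]];split;first exact: measurable_funM.
by exists (K*L)=> w;rewrite normrM ler_pM.
Qed.

Lemma bmfunZ c f : bmfun f -> bmfun (fun w => c * f w).
Proof. by move=> bf;apply: bmfunM=> //;exact: bmfun_cst. Qed.

Lemma bmfunB f g : bmfun f -> bmfun g -> bmfun (fun w => f w - g w).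
move=> bf bg;have:= bmfunD bf (bmfunZ (-1) bg).
by under eq_fun do rewrite mulN1r.
Qed.

Lemma bmfun_norm f : bmfun f -> bmfun (fun w => `|f w|).
move=> [mf [K hK]];split;first exact: measurableT_comp.
by exists K=> w;rewrite normr_id.
Qed.

Lemma bmfun01 f : mfunT f -> (forall w, 0 <= f w <= 1) -> bmfun f.
Proof. by move=> mf f01;split=> //;exists 1=> w;have /andP[h1 h2]:= f01 w;rewrite ger0_norm. Qed.

Lemma bmfun_indic (A : set Omega) : measurable A -> bmfun \1_A.
move=> mA;apply: bmfun01;first exact: measurable_indic.
by move=> w;rewrite indicE;case: (_ \in _);rewrite ?lexx ?ler01.
Qed.

Lemma bmfun_integrable f : bmfun f -> P.-integrable setT (EFin \o f).
move=> [mf [K hK]];apply: measurable_bounded_integrable=> //.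
 by apply: le_lt_trans (probability_le1 _ _) (ltry _).
exists K;split;first by rewrite num_real.
by move=> x Kx w _;exact: le_trans (hK w) (ltW Kx).
Qed.

Lemma ExE f : bmfun f -> (\int[P]_w (f w)%:E)%E = (Ex f)%:E.
Proof. by move=> bf;rewrite /Ex /Rintegral fineK//;apply: integrable_fin_num=> //;exact: bmfun_integrable. Qed.

Lemma ExD f g : bmfun f -> bmfun g -> Ex (fun w => f w + g w) = Ex f + Ex g.
Proof. by move=> bf bg;apply: RintegralD=> //;exact: bmfun_integrable. Qed.

Lemma ExB f g : bmfun f -> bmfun g -> Ex (fun w => f w - g w) = Ex f - Ex g.
Proof. by move=> bf bg;apply: RintegralB=> //;exact: bmfun_integrable. Qed.

Lemma ExZ c f : bmfun f -> Ex (fun w => c * f w) = c * Ex f.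
Proof. by move=> bf;apply: RintegralZl=> //;exact: bmfun_integrable. Qed.

Lemma Ex_cst c : Ex (fun=> c) = c.
Proof. by rewrite /Ex Rintegral_cst// [X in fine X](@probability_setT _ _ _ P) mulr1. Qed.

Lemma le_Ex f g : bmfun f -> bmfun g -> (forall w, f w <= g w) -> Ex f <= Ex g.
Proof. by move=> bf bg fg;apply: le_Rintegral=> //;exact: bmfun_integrable. Qed.

Lemma Ex_ge0 f : (forall w, 0 <= f w) -> 0 <= Ex f.
Proof. by move=> f0;apply: Rintegral_ge0. Qed.

Lemma Ex_sum (I : Type) (r : seq I) (F : I -> Omega -> R) : (forall i, bmfun (F i)) ->
  bmfun (fun w => \sum_(i <- r) F i w) /\ Ex (fun w => \sum_(i <- r) F i w) = \sum_(i <- r) Ex (F i).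
move=> bF;elim: r=> [|i r [IHb IH]].
 have ->: (fun w=> \sum_(i <- [::]) F i w) = (fun=> 0) by apply/funext=> w;rewrite big_nil.
 by rewrite big_nil Ex_cst;split=> //;exact: bmfun_cst.
rewrite big_cons -IH -ExD//;split;last by congr Ex;apply/funext=> w;rewrite big_cons.
by under eq_fun do rewrite big_cons;exact: bmfunD.
Qed.

Lemma norm_Ex f : bmfun f -> `|Ex f| <= Ex (fun w => `|f w|).
move=> bf;have bn:= bmfun_norm bf;rewrite ler_norml;apply/andP;split;last by apply: le_Ex=> // w;exact: ler_norm.
rewrite -mulN1r -ExZ//;apply: le_Ex=> //;first exact: bmfunZ.
by move=> w;rewrite mulN1r lerNl -normrN ler_norm.
Qed.
End BoundedExpectation.

Section SlotFactorisation.
Context {R : realType} {d : measure_display} {Omega : measurableType d}.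
Variables (P : probability Omega R) (X : Omega -> R -> R) (T : set R).
Hypothesis mX : forall t, mfunT (X ^~ t).
Implicit Types (fs : seq (R * (R -> R))) (us : seq (R * set R)).

Definition times fs : Prop := forall p, p \in fs -> T p.1.

Lemma slotprod_bm fs : slots fs -> le1_slots fs -> bmfun (slotprod X fs).
move=> s1 l1;apply: bmfun01;first by have []:= slotprod_meas mX s1.
by move=> w;exact: slotprod_le1.
Qed.

Lemma indics_slots us : borel_specs us -> slots (indics us) /\ le1_slots (indics us).
elim: us=> [|[t A] us IH] /=;first by split=> p.
move=> [mA /IH[h1 h2]];split=> p;rewrite inE=> /orP[/eqP->/=|];[exact: slot_indic|exact: h1| |exact: h2].
by move=> x;rewrite indicE;case: (_ \in _).
Qed.

(** The factorisation is assumed on cylinders; functions are introduced one time at a time, both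
    sides being positive functionals of the current slot. *)
Lemma expect_slots (Z : Omega -> R) (kappa : R) : bmfun Z -> (forall w, 0 <= Z w) -> 0 <= kappa ->
  (forall us, borel_specs us -> times_in T us -> Ex P (fun w => \1_(cyl X us) w * Z w) = kappa * Ex P \1_(cyl X us)) ->
  forall fs us, slots fs -> le1_slots fs -> times fs -> borel_specs us -> times_in T us ->
  Ex P (fun w => slotprod X (fs ++ indics us) w * Z w) = kappa * Ex P (slotprod X (fs ++ indics us)).
move=> bZ Z0 k0 H;elim=> [|[t f] fs IH] us /= sf lf tf bus tus.
 have ->: slotprod X (indics us) = \1_(cyl X us) by apply/funext=> w;exact: slotprod_indics.
 by rewrite -H//;congr Ex;apply/funext=> w;rewrite slotprod_indics.
have sf': slots fs by move=> p pf;apply: sf;rewrite inE pf orbT.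
have lf': le1_slots fs by move=> p pf;apply: lf;rewrite inE pf orbT.
have tf': times fs by move=> p pf;apply: tf;rewrite inE pf orbT.
have [su lu]:= indics_slots bus.
have sfu: slots (fs ++ indics us) by apply/slots_cat.
have lfu: le1_slots (fs ++ indics us) by move=> p;rewrite mem_cat=> /orP[/lf'|/lu].
pose Y:= slotprod X (fs ++ indics us).
have bY: bmfun Y by exact: slotprod_bm.
have Y0 w: 0 <= Y w by have /andP[]:= slotprod_le1 X w sfu lfu.
have sft: slot f by apply: (sf (t, f));rewrite mem_head.
have f1 x: f x <= 1 by apply: (lf (t, f));rewrite mem_head.
have bfX g: slot g -> (forall x, g x <= 1) -> bmfun (fun w=> g (X w t)).
 move=> [mg g0] g1;apply: bmfun01;first exact: (measurableT_comp mg (mX t)).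
 by move=> w;rewrite g0 g1.
have prodE g w: slotprod X ((t, g) :: fs ++ indics us) w = g (X w t)*Y w by rewrite /slotprod big_cons.
have bYZ:= bmfunM bY bZ.
have conv1 g: slot g -> (forall x, g x <= 1) -> (\int[P]_w (g (X w t)*(Y w*Z w))%:E)%E = (Ex P (fun w=> slotprod X ((t, g) :: fs ++ indics us) w*Z w))%:E.
 by move=> sg g1;rewrite ExE;[congr ((Ex P _)%:E);apply/funext=> w;rewrite prodE mulrA|exact: bmfunM (bfX g sg g1) bYZ].
have conv2 g: slot g -> (forall x, g x <= 1) -> (\int[P]_w (g (X w t)*Y w)%:E)%E = (Ex P (slotprod X ((t, g) :: fs ++ indics us)))%:E.
 by move=> sg g1;rewrite ExE;[congr ((Ex P _)%:E);apply/funext=> w;rewrite prodE|exact: bmfunM (bfX g sg g1) bY].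
apply: EFin_inj;rewrite EFinM -conv1// -conv2//.
have mY:= bY.1;have mYZ:= bYZ.1.
apply: (positive_functional_eq (positive_functional_expect P (mX t) mYZ _) (positive_functionalZ k0 (positive_functional_expect P (mX t) mY Y0)))=> //.
- by move=> w;rewrite mulr_ge0.
- move=> A mA /=;rewrite conv1 ?conv2//;try exact: slot_indic;try by move=> x;rewrite indicE;case: (_ \in _).
 rewrite -EFinM;congr _%:E.
 have permE w: slotprod X ((t, \1_A) :: fs ++ indics us) w = slotprod X (fs ++ indics ((t, A) :: us)) w.
  by rewrite /slotprod /= !big_cons !big_cat /= big_cons /=;ring.
 have:= IH ((t, A) :: us) sf' lf' tf';rewrite /= -(funext permE)=> <- //.
 + by split=> //;exact: (tf (t, f) (mem_head _ _)).
- rewrite (eq_integral (fun w=> (Y w*Z w)%:E));last by move=> w _;rewrite mul1r.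
 by rewrite ExE// ltry.
Qed.

Definition phase (as_ : seq (R * R)) (w : Omega) : R := \sum_(p <- as_) p.2 * X w p.1.

Lemma phase_meas as_ : mfunT (phase as_).
Proof. by apply: measurable_sum=> p;apply: measurable_funM=> //;exact: mX. Qed.

Lemma cos_bm (g : Omega -> R) : mfunT g -> bmfun (fun w => cos (g w)).
move=> mg;split;last by exists 1=> w;exact: cos_max.
exact: (measurableT_comp (continuous_measurable_fun (@continuous_cos R)) mg).
Qed.

(** A cosine moved into [0,1], so that it becomes a slot. *)
Definition halfcos (a c x : R) : R := (1 + cos (c + a * x)) / 2.

Lemma halfcos_slot a c : slot (halfcos a c) /\ forall x, halfcos a c x <= 1.
have h x: -1 <= cos (c+a * x) <= 1 by rewrite cos_geN1 cos_le1.
split;last by move=> x;rewrite /halfcos;have /andP[_ h2]:= h x;rewrite ler_pdivrMr//;lra.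
split=> [|x];last by rewrite /halfcos;have /andP[h1 _]:= h x;apply: divr_ge0=> //;lra.
apply: measurable_funM=> //;apply: measurable_funD=> //.
apply: (measurableT_comp (continuous_measurable_fun (@continuous_cos R))).
by apply: measurable_funD=> //;exact: measurable_funM.
Qed.

(** The shifts 0 and pi/2 provide the cosine and the sine of [a * x], so the angle addition formula
    is expressed with slots in [x]. *)
Lemma cos_split (a x u : R) :
  cos (a * x + u) = 2 * (halfcos a 0 x * cos u) - cos u + 2 * (halfcos a (pi / 2) x * cos (- (pi / 2) + u)) - cos (- (pi / 2) + u).
have e1: cos (pi/2+a * x) = - sin (a * x) by rewrite cosD cos_pihalf sin_pihalf mul0r mul1r sub0r.
have e2: cos (- (pi/2)+u) = sin u by rewrite cosD cosN sinN cos_pihalf sin_pihalf mul0r mulN1r opprK add0r.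
by rewrite /halfcos add0r e1 e2 cosD;field.
Qed.

Lemma expect_phase (Z : Omega -> R) (kappa : R) : bmfun Z ->
  (forall fs, slots fs -> le1_slots fs -> times fs ->
     Ex P (fun w => slotprod X fs w * Z w) = kappa * Ex P (slotprod X fs)) ->
  forall as_ c, (forall p, p \in as_ -> T p.1) ->
  Ex P (fun w => cos (c + phase as_ w) * Z w) = kappa * Ex P (fun w => cos (c + phase as_ w)).
move=> bZ H as_;suff gen fs c: slots fs -> le1_slots fs -> times fs -> (forall p, p \in as_ -> T p.1) ->
 Ex P (fun w=> slotprod X fs w * cos (c+phase as_ w)*Z w) = kappa*Ex P (fun w=> slotprod X fs w * cos (c+phase as_ w)).
 have e w: slotprod X [::] w = 1 by rewrite /slotprod big_nil.
 move=> c tas;transitivity (Ex P (fun w=> slotprod X [::] w * cos (c+phase as_ w)*Z w)).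
  by congr Ex;apply/funext=> w;rewrite e mul1r.
 rewrite gen//;congr (_*Ex P _);by apply/funext=> w;rewrite e mul1r.
elim: as_ fs c=> [|[t a] as_ IH] fs c sf lf tf tas.
 have bs:= slotprod_bm sf lf.
 rewrite /phase;under eq_fun do rewrite big_nil addr0 mulrAC mulrC.
 under [in RHS]eq_fun do rewrite big_nil addr0 mulrC.
 rewrite !ExZ//;last exact: bmfunM.
 by rewrite H// mulrCA.
have tT: T t by apply: (tas (t, a));rewrite mem_head.
have tas' p: p \in as_ -> T p.1 by move=> pa;apply: tas;rewrite inE pa orbT.
have ext c': [/\ slots ((t, halfcos a c') :: fs), le1_slots ((t, halfcos a c') :: fs) & times ((t, halfcos a c') :: fs)].
 have [sh lh]:= halfcos_slot a c'.
 by split=> p;rewrite inE=> /orP[/eqP->//|pf];[apply: sf|apply: lf|apply: tf].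
have [s1 l1 t1]:= ext 0;have [s2 l2 t2]:= ext (pi/2).
have b c' gs: slots gs -> le1_slots gs -> bmfun (fun w=> slotprod X gs w * cos (c'+phase as_ w)).
 by move=> sg lg;apply: bmfunM;[exact: slotprod_bm|apply: cos_bm;apply: measurable_funD=> //;exact: phase_meas].
have dec w: slotprod X fs w * cos (c+phase ((t, a) :: as_) w) =
 2*(slotprod X ((t, halfcos a 0) :: fs) w * cos (c+phase as_ w))-slotprod X fs w * cos (c+phase as_ w) +
 (2*(slotprod X ((t, halfcos a (pi/2)) :: fs) w * cos (c-pi/2+phase as_ w))-slotprod X fs w * cos (c-pi/2+phase as_ w)).
 rewrite /phase big_cons /= -/(phase as_ w) addrCA cos_split /slotprod !big_cons /=.
 have ->: - (pi/2)+(c+phase as_ w) = c-pi/2+phase as_ w by ring.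
 ring.
have dE (F G H' K : Omega -> R) : bmfun F -> bmfun G -> bmfun H' -> bmfun K ->
 Ex P (fun w=> 2*F w-G w+(2*H' w-K w)) = 2*Ex P F-Ex P G+(2*Ex P H'-Ex P K).
 move=> bF bG bH bK;rewrite ExD;[|exact: bmfunB (bmfunZ 2 bF) bG|exact: bmfunB (bmfunZ 2 bH) bK].
 by rewrite !ExB ?ExZ//;exact: bmfunZ.
under [in RHS]eq_fun do rewrite dec;rewrite dE;try exact: b.
under eq_fun do rewrite dec.
have ->: (fun w=> (2*(slotprod X ((t, halfcos a 0) :: fs) w * cos (c+phase as_ w))-slotprod X fs w * cos (c+phase as_ w) +
 (2*(slotprod X ((t, halfcos a (pi/2)) :: fs) w * cos (c-pi/2+phase as_ w))-slotprod X fs w * cos (c-pi/2+phase as_ w)))*Z w) =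
 (fun w=> (2*(slotprod X ((t, halfcos a 0) :: fs) w * cos (c+phase as_ w)*Z w)-slotprod X fs w * cos (c+phase as_ w)*Z w +
 (2*(slotprod X ((t, halfcos a (pi/2)) :: fs) w * cos (c-pi/2+phase as_ w)*Z w)-slotprod X fs w * cos (c-pi/2+phase as_ w)*Z w))).
 by apply/funext=> w;ring.
rewrite dE;try by apply: bmfunM=> //;exact: b.
by rewrite !IH//;ring.
Qed.
End SlotFactorisation.

Section GaussCos.
Context {R : realType}.
Notation leb := (@lebesgue_measure R).

Lemma sint_odd (n : nat) (f : R -> R) : continuous f -> (forall x, f (- x) = - f x) -> sint (- n%:R) n%:R f = 0.
move=> cf of_.
have h: sint (- n%:R) n%:R f = sint (- n%:R) n%:R (fun x=> -1 * f x).
 have nn: - n%:R <= n%:R :> R by rewrite lerNl (le_trans _ (ler0n _ _))// oppr_le0.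
 have:= @integration_by_substitution_oppr R f _ _ nn (continuous_subspaceT cf).
 rewrite opprK /sint /Rintegral=> ->;congr fine;apply: eq_integral=> x _.
 by rewrite /= of_ mulN1r.
by move: h;rewrite sintZ// mulN1r=> /eqP;rewrite -subr_eq0 opprK -mulr2n mulrn_eq0/= => /eqP.
Qed.

(** The odd part integrates to zero and the even part is [gfour] on a growing window. *)
Lemma normal_halfcos (a c v : R) : 0 < v ->
  (\int[leb]_x (halfcos a c x * normal_pdf 0 (sqrtr v) x)%:E = ((1 + cos c * expR (- (a ^+ 2 / 2 * v))) / 2)%:E)%E.
move=> v0;have t0: 0 < v^-1 by rewrite invr_gt0.
have K0: 0 < sqrtr (2 * pi * v) by rewrite sqrtr_gt0 !mulr_gt0// pi_gt0.
set K:= sqrtr _ in K0.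
have pdfE: normal_pdf 0 (sqrtr v) = (fun x=> K^-1 * gker v^-1 x).
 rewrite normal_pdf_gbump//;apply/funext=> x;congr (_ * expR (- _)).
 by rewrite subr0;field;exact: lt0r_neq0.
have cg: continuous (gker v^-1) by exact: continuous_gker.
have cc: continuous (fun x=> gker v^-1 x * cos (x * a)) by exact: continuous_gker_cos.
have csn: continuous (fun x=> gker v^-1 x * sin (a * x)).
 apply: (continuousR_mul cg)=> x;apply: continuous_comp;last exact: continuous_sin.
 by apply: continuousM;[exact: cst_continuous|exact: id].
pose G x:= halfcos a c x * normal_pdf 0 (sqrtr v) x.
have GE x: G x = K^-1/2*(gker v^-1 x+(cos c*(gker v^-1 x * cos (x * a))-sin c*(gker v^-1 x * sin (a * x)))).
 by rewrite /G pdfE /halfcos cosD [x * a]mulrC;field;exact: lt0r_neq0.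
have cst (r : R) (f : R -> R) : continuous f -> continuous (fun x=> r * f x).
 by move=> cf;apply: continuousR_mul=> // x;exact: cst_continuous.
have c1: continuous (fun x=> cos c*(gker v^-1 x * cos (x * a))-sin c*(gker v^-1 x * sin (a * x))).
 by apply: continuousR_sub;exact: cst.
have cG: continuous G by rewrite (funext GE);apply: cst;exact: continuousR_add.
have G0 x: 0 <= G x by rewrite mulr_ge0 ?normal_pdf_ge0//;have [[_ h] _]:= halfcos_slot a c;exact: h.
have sG n: sint (- n%:R) n%:R G = K^-1/2*(gfour v^-1 n%:R 0+cos c * gfour v^-1 n%:R a).
 rewrite (funext GE) sintZ;last exact: continuousR_add.
 rewrite sintD// sintB//;[|exact: cst|exact: cst].
 rewrite !sintZ// (sint_odd _ csn) ?mulr0 ?subr0;last first.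
  by move=> x;rewrite /gker sqrrN mulrN sinN mulrN.
 congr (_*(_+_));rewrite /gfour;apply: eq_sint=> x _.
 by rewrite mulr0 cos0 mulr1.
have gl z: gfour v^-1 n%:R z @[n --> \oo] --> K * expR (- (z^+2/2 * v)).
 apply/cvgrPdist_le=> e e0;near=> n.
 have n0: 0 < n%:R :> R by rewrite ltr0n;near: n;exact: nbhs_infty_gt.
 have n1: 4 * v/e <= n%:R by near_nat n.
 have:= gfour_lim t0 z n0;rewrite distrC.
 have ->: sqrtr (2 * pi/v^-1) * expR (- (z^+2/(2 * v^-1))) = K * expR (- (z^+2/2 * v)).
  by rewrite /K invrK;congr (_ * expR (- _));field;rewrite lt0r_neq0.
 move/le_trans;apply;rewrite invfM invrK mulrA ler_pdivrMr// -ler_pdivrMl//.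
 by rewrite mulrC.
have lim1: sint (- n%:R) n%:R G @[n --> \oo] --> (1+cos c * expR (- (a^+2/2 * v)))/2.
 have ->: (1+cos c * expR (- (a^+2/2 * v)))/2 = K^-1/2*(K * expR (- (0^+2/2 * v))+cos c*(K * expR (- (a^+2/2 * v)))).
  by rewrite expr0n/= !mul0r oppr0 expR0;field;exact: lt0r_neq0.
 under eq_fun do rewrite sG;apply: cvgMr;apply: cvgD;[exact: gl|apply: cvgMr;exact: gl].
have lim2: (sint (- n%:R) n%:R G)%:E @[n --> \oo] --> (((1+cos c * expR (- (a^+2/2 * v)))/2)%:E : \bar R).
 by apply: cvg_EFin;[exact: nearW|exact: lim1].
pose F (n : nat) : set R:= [set` `[- n%:R, n%:R]].
have UF: \bigcup_n F n = setT.
 apply/seteqP;split=> // x _;exists (truncn `|x|).+1=> //=.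
 by rewrite /F /= in_itv/= -ler_norml;apply/ltW;rewrite truncnS_gt.
have lim3: (\int[leb]_(x in F n) (G x)%:E @[n --> \oo] --> \int[leb]_(x in \bigcup_n F n) (G x)%:E)%E.
 apply: ge0_nondecreasing_set_cvg_integral.
 - move=> m n mn;apply/subsetPset=> x;rewrite /F /= !in_itv/= => /andP[h1 h2].
  have mn': m%:R <= n%:R :> R by rewrite ler_nat.
  by rewrite (le_trans _ h1) ?lerN2// (le_trans h2).
 - by move=> n;exact: measurable_itv.
 - move=> n;apply/measurable_EFinP;apply: measurable_funTS;exact: continuous_measurable_fun.
 - by move=> n x _;rewrite lee_fin.
have fE: (fun n=> \int[leb]_(x in F n) (G x)%:E)%E = (fun n=> (sint (- n%:R) n%:R G)%:E).
 by apply/funext=> n;rewrite /sint /Rintegral fineK//;apply: integrable_fin_num=> //;exact: sintegrable.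
rewrite UF fE in lim3;exact: (cvg_unique _ lim3 lim2).
Unshelve. all: end_near. Qed.
End GaussCos.

(** * Characteristic functions of Brownian motion *)

Section BrownianPhase.
Context {R : realType} {d : measure_display} {Omega : measurableType d}.
Variables (P : probability Omega R) (B : Omega -> R -> R).
Hypothesis bm : is_std_BM P B.
Notation leb := (@lebesgue_measure R).

Let mB : forall t, mfunT (B ^~ t). Proof. by case: bm. Qed.

Section Increment.
Variables s t : R.
Hypothesis st : 0 <= s < t.
Let incr w := B w t - B w s.
Let mi : mfunT incr. Proof. exact: measurable_funB. Qed.

Lemma increment_slot f : slot f -> (forall x, f x <= 1) -> bmfun (fun w => f (incr w)).
move=> [mf f0] f1;apply: bmfun01;first exact: (measurableT_comp mf mi).
by move=> w;rewrite f0 f1.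
Qed.

Lemma increment_law f : slot f -> (forall x, f x <= 1) ->
  (\int[leb]_x (f x * normal_pdf 0 (sqrtr (t - s)) x)%:E)%E = (Ex P (fun w => f (incr w)))%:E.
move=> sf f1;rewrite -ExE;last exact: increment_slot.
have PJ1: positive_functional (fun f=> \int[leb]_x (f x * normal_pdf 0 (sqrtr (t-s)) x)%:E)%E.
 have mm g: slot g -> mfunT (fun x=> (g x * normal_pdf 0 (sqrtr (t-s)) x)%:E).
  by move=> [mg _];apply/measurable_EFinP;apply: measurable_funM=> //;exact: measurable_normal_pdf.
 have ge g: slot g -> forall x, (0 <= (g x * normal_pdf 0 (sqrtr (t-s)) x)%:E)%E.
  by move=> [_ g0] x;rewrite lee_fin mulr_ge0// normal_pdf_ge0.
 split.
 - by move=> g sg;apply: integral_ge0=> w _;exact: ge.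
 - move=> g h sg sh;under eq_integral do rewrite mulrDl EFinD.
  by rewrite ge0_integralD//;[move=> w _;exact: ge|exact: mm|move=> w _;exact: ge|exact: mm].
 - move=> c g c0 sg;under eq_integral do rewrite -mulrA EFinM.
  by rewrite ge0_integralZl_EFin//;[move=> w _;exact: ge|exact: mm].
 - move=> g h sg sh gh;apply: ge0_le_integral=> //=;[by move=> w _;exact: ge|exact: mm|exact: mm|].
  by move=> w _;rewrite lee_fin ler_wpM2r// normal_pdf_ge0.
have PJ2: positive_functional (fun f=> \int[P]_w (f (incr w))%:E)%E.
 have:= positive_functional_expect P mi (measurable_cst (1 : R)) (fun=> ler01).
 by congr positive_functional;apply/funext=> g;apply: eq_integral=> w _;rewrite mulr1.
apply: (positive_functional_eq PJ1 PJ2)=> //.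
- move=> A mA;have [_ _ _ /(_ s t st A mA) law _]:= bm.
 rewrite (_ : (\int[P]_w _)%E = P [set w | A (incr w)]);last first.
  have mAi: measurable [set w | A (incr w)] by rewrite -[X in measurable X]setTI;exact: mi.
  by have:= @integral_indic _ _ _ P setT measurableT [set w | A (incr w)] mAi;rewrite setIT.
 rewrite law /normal_prob [RHS]integral_mkcond;apply: eq_integral=> x _.
 rewrite patchE indicE;case: (x \in A);by rewrite ?mul1r ?mul0r.
- by under eq_integral do rewrite mul1r;rewrite integral_normal_pdf ltry.
Qed.

Lemma increment_slots f fs : slot f -> (forall x, f x <= 1) ->
  slots fs -> le1_slots fs -> times `[0, s] fs ->
  Ex P (fun w => slotprod B fs w * f (incr w)) = Ex P (fun w => f (incr w)) * Ex P (slotprod B fs).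
move=> sf f1 sl l1 tf;have [_ _ _ _ ind]:= bm.
have bY: bmfun (slotprod B fs) by exact: slotprod_bm.
have Y0 w: 0 <= slotprod B fs w by have /andP[]:= slotprod_le1 B w sl l1.
have k0: 0 <= Ex P (slotprod B fs) by exact: Ex_ge0.
have conv1 g: slot g -> (forall x, g x <= 1) -> (\int[P]_w (g (incr w) * slotprod B fs w)%:E)%E = (Ex P (fun w=> slotprod B fs w * g (incr w)))%:E.
 move=> sg g1;rewrite ExE;last exact: bmfunM (increment_slot sg g1) bY.
 by congr ((Ex P _)%:E);apply/funext=> w;rewrite mulrC.
have conv2 g: slot g -> (forall x, g x <= 1) -> (\int[P]_w (g (incr w)*1)%:E)%E = (Ex P (fun w=> g (incr w)))%:E.
 move=> sg g1;rewrite -ExE;last exact: increment_slot.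
 by apply: eq_integral=> w _;rewrite mulr1.
apply: EFin_inj;rewrite EFinM -conv1// -conv2// muleC.
apply: (positive_functional_eq (positive_functional_expect P mi bY.1 Y0)
 (positive_functionalZ k0 (positive_functional_expect P mi (measurable_cst (1 : R)) (fun=> ler01))))=> //.
- move=> A mA /=;have sA:= slot_indic mA.
 have A1 (x : R) : \1_A x <= 1 :> R by rewrite indicE;case: (_ \in _).
 rewrite conv1// conv2// -EFinM mulrC;congr _%:E.
 have iE: (fun w=> \1_A (incr w)) = \1_[set w | A (incr w)] :> (Omega -> R).
  by apply/funext=> w;rewrite !indicE.
 have mAi: measurable [set w | A (incr w)] by rewrite -[X in measurable X]setTI;exact: mi.
 have ExI (C : set Omega) : measurable C -> Ex P \1_C = fine (P C).
  by move=> mC;rewrite /Ex /Rintegral integral_indic// setIT.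
 have:= @expect_slots R _ _ P B `[0, s] mB (fun w=> \1_A (incr w)) (Ex P (fun w=> \1_A (incr w))).
 have bA: bmfun (fun w=> \1_A (incr w) : R) by exact: increment_slot.
 have A0 w: 0 <= \1_A (incr w) :> R by rewrite indicE;case: (_ \in _).
 move=> /(_ bA A0 (Ex_ge0 _ A0));have mc us:= @cyl_measurable _ _ _ B us mB.
 move=> /(_ _ fs [::] sl l1 tf I I);rewrite cats0;apply.
 move=> us bus tus;rewrite iE !ExI//;[|exact: mc..].
 have ->: (fun w=> \1_(cyl B us) w * \1_[set w | A (incr w)] w) = \1_([set w | A (incr w)] `&` cyl B us) :> (Omega -> R).
  by apply/funext=> w;rewrite indicI /= mulrC.
 rewrite ExI;last by apply: measurableI=> //;exact: mc.
 rewrite ind// fineM//;apply: fin_num_measure=> //;exact: mc.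
- under eq_integral do rewrite mul1r;by rewrite ExE// ltry.
Qed.
End Increment.

(** The last increment is independent of the past, and the averages of its cosine and sine are
    exp(-a^2 (t-s)/2) and 0. *)
Lemma increment_cos s t a c (as_ : seq (R * R)) : 0 <= s < t -> (forall p, p \in as_ -> 0 <= p.1 <= s) ->
  Ex P (fun w => cos (c + (a * (B w t - B w s) + phase B as_ w))) =
  expR (- (a ^+ 2 / 2 * (t - s))) * Ex P (fun w => cos (c + phase B as_ w)).
move=> st tas;have ts: 0 < t-s by rewrite subr_gt0;case/andP: st.
have mphase:= phase_meas mB as_.
have mi: mfunT (fun w=> B w t-B w s) by exact: measurable_funB.
have law c': Ex P (fun w=> halfcos a c' (B w t-B w s)) = (1+cos c' * expR (- (a^+2/2*(t-s))))/2.
 by have [sh lh]:= halfcos_slot a c';apply: EFin_inj;rewrite -(increment_law st sh lh) normal_halfcos.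
have fac c' u: Ex P (fun w=> cos (u+phase B as_ w) * halfcos a c' (B w t-B w s)) =
  (1+cos c' * expR (- (a^+2/2*(t-s))))/2*Ex P (fun w=> cos (u+phase B as_ w)).
 rewrite -law;have [sh lh]:= halfcos_slot a c'.
 apply: (expect_phase mB (T:= `[0, s]));first exact: increment_slot.
  by move=> fs sl l1 tf;exact: increment_slots.
 by move=> p /tas;rewrite /= in_itv.
have bc u: bmfun (fun w=> cos (u+phase B as_ w)) by apply: cos_bm;exact: measurable_funD.
have bh c': bmfun (fun w=> halfcos a c' (B w t-B w s)) by have [sh lh]:= halfcos_slot a c';exact: increment_slot.
have ->: (fun w=> cos (c+(a*(B w t-B w s)+phase B as_ w))) = (fun w =>
  2*(cos (c+phase B as_ w) * halfcos a 0 (B w t-B w s))-cos (c+phase B as_ w) +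
  (2*(cos (c-pi/2+phase B as_ w) * halfcos a (pi/2) (B w t-B w s))-cos (c-pi/2+phase B as_ w))).
 apply/funext=> w;rewrite addrCA cos_split.
 have ->: - (pi/2)+(c+phase B as_ w) = c-pi/2+phase B as_ w by ring.
 ring.
have b2 u c':= bmfunM (bc u) (bh c').
rewrite ExD;[|exact: bmfunB (bmfunZ 2 (b2 _ _)) (bc _)|exact: bmfunB (bmfunZ 2 (b2 _ _)) (bc _)].
rewrite !ExB ?ExZ//;try exact: bmfunZ;try exact: b2;try exact: bc.
by rewrite !fac cos0 cos_pihalf;field.
Qed.
End BrownianPhase.

(** * Identification of the limit functional *)

Section LimitFunctional.
Context {R : realType} {d : measure_display} {Omega : measurableType d}.
Variables (P : probability Omega R) (e B : Omega -> R -> R).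
Hypothesis exc : is_norm_excursion P e.
Hypothesis bm : is_std_BM P B.
Hypothesis ind : indep_processes P e B.
Variables (sig2 gam gam2 : R).
Hypothesis sig2_gt0 : 0 < sig2.
Hypothesis gamE : gam ^+ 2 = gam2.
Implicit Types D : seq (R * R * R).

Let mB : forall t, mfunT (B ^~ t). Proof. by case: bm. Qed.
Let me : forall t, mfunT (e ^~ t). Proof. by case: exc. Qed.

Fixpoint Blim (l beta : R) D : R :=
  if D is (t, lam, al) :: D' then expR (- (beta ^+ 2 * gam2 / 2 * (l - t))) * Blim t (al + beta) D'
  else expR (- (beta ^+ 2 * gam2 / 2 * l)).

Fixpoint Elim (l : R) D : R :=
  if D is (t, lam, al) :: D' then
    let tau := l - t in let tau' := shorten sig2 tau lam in
    qc tau / qc tau' * Elim (t + tau') D'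
  else qc l / qc 1.

Lemma Blim_shift l l' beta D : Blim l' beta D = expR (- (beta ^+ 2 * gam2 / 2 * (l' - l))) * Blim l beta D.
case: D=> [|[[t lam] al] D] /=;first by rewrite -expRD;congr expR;ring.
by rewrite mulrA -expRD;congr (expR _ * _);ring.
Qed.

Lemma kap0_qc (r : R) : 0 < r -> kap0 sig2 r 0 = qc r / sqrtr sig2.
move=> r0;have p0:= @pi_gt0 R.
have s0: 0 < sqrtr sig2 by rewrite sqrtr_gt0.
rewrite /kap0 /lclt expr0n/= mul0r oppr0 expR0 mul1r.
apply/eqP;rewrite -(@eqrXn2 _ 2)//;last 2 first.
- by rewrite divr_ge0 ?invr_ge0// ltW.
- by rewrite divr_ge0 ?invr_ge0// ltW.
apply/eqP;rewrite !expr_div_n /qc !exprVn !sqr_sqrtr ?(ltW sig2_gt0)//;last 2 first.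
- by rewrite !mulr_ge0 ?exprn_ge0// ltW.
- by rewrite !mulr_ge0// ltW.
by move: p0;move: (pi)=> p p0;field;rewrite !lt0r_neq0.
Qed.

(** At z = 0 the kernel [kap0] is [qc] up to a constant, so its ratios are those of the excursion;
    the exponentials telescope into the Brownian factor by [Blim_shift]. *)
Lemma Zlim_factor l beta D : 0 < l -> admissible l D ->
  Zlim gam2 sig2 l beta D = kap0 sig2 1 0 * (Elim l D * Blim l beta D).
elim: D l beta=> [|[[t lam] al] D IH] l beta l0 /=.
 move=> _;rewrite !kap0_qc//;have q1: 0 < qc (1 : R) by rewrite qc_gt0.
 by field;rewrite !lt0r_neq0// sqrtr_gt0.
move=> [/andP[t0 tl] lam0 aD];have tau0: 0 < l-t by rewrite subr_gt0.
have tau'0:= shorten_gt0 sig2_gt0 tau0 lam0;set tau':= shorten _ _ _ in tau'0 *.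
rewrite IH ?addr_gt0//;last by apply: admissible_le aD;rewrite lerDl ltW.
rewrite (Blim_shift t (t+tau')) [t+tau'-t]addrAC subrr add0r !kap0_qc//.
have q1:= qc_gt0 tau0;have q2:= qc_gt0 tau'0;have s0: 0 < sqrtr sig2 by rewrite sqrtr_gt0.
set E1:= expR _;set E2:= expR (- (_ * tau')).
have E20: 0 < E2 by exact: expR_gt0.
by field;rewrite !lt0r_neq0// qc_gt0.
Qed.

(** [D] lists the latest time first, hence [rev]; the weight is multiplied by [sig2] because the
    height of the walk is sigma times the excursion. *)
Definition eslots D : seq (R * (R -> R)) := rev [seq (p.1.1, gweight (sig2 * p.1.2)) | p <- D].
Definition bphase l beta D : seq (R * R) := (l, beta) :: [seq (p.1.1, p.2) | p <- D].

Lemma rcons_timed (l tp t : R) fs f : slot f -> tp < t < l -> timed t tp fs -> timed l tp (rcons fs (t, f)).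
move=> sf;elim: fs tp=> [|[t1 f1] fs IH] tp /andP[h1 h2] /=;first by split.
move=> [h3 s1 tm];split=> //;apply: IH=> //;by rewrite (timed_lt tm) h2.
Qed.

Lemma eslots_timed l D : 0 < l -> admissible l D -> timed l 0 (eslots D).
elim: D l=> [|[[t lam] al] D IH] l l0 //= [/andP[t0 tl] lam0 aD].
rewrite /eslots /= rev_cons;apply: rcons_timed;[|by rewrite t0|exact: IH].
by have []:= @gweight_slot R (sig2 * lam) (mulr_ge0 (ltW sig2_gt0) lam0).
Qed.

Lemma eslots_ok l D : admissible l D -> slots (eslots D) /\ le1_slots (eslots D).
elim: D l=> [|[[t lam] al] D IH] l;first by split=> p.
move=> /= [_ lam0 aD];have [h1 h2]:= IH _ aD.
have [g1 g2]:= @gweight_slot R (sig2 * lam) (mulr_ge0 (ltW sig2_gt0) lam0).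
by rewrite /eslots /= rev_cons;split=> p;rewrite mem_rcons inE=> /orP[/eqP->//|];[exact: h1|exact: h2].
Qed.

(** Each step absorbs the last weight by [excA_gweight_last]; a single remaining time is settled by
    [excE_mass]. *)
Lemma excE_Elim l D : 0 < l <= 1 -> admissible l D -> D != [::] ->
  ((2 * sqrtr (2 * pi))%:E * excE l (eslots D) = (Elim l D)%:E)%E.
elim: D l=> [//|[[t lam] al] D IH] l /andP[l0 l1] /= aD _;have [/andP[t0 tl] lam0 aD']:= aD.
have tau0: 0 < l-t by rewrite subr_gt0.
have tau'0:= shorten_gt0 sig2_gt0 tau0 lam0;have tau't:= shorten_le sig2_gt0 tau0 lam0.
have c0: 0 <= 2 * sqrtr (2 * pi) :> R by rewrite mulr_ge0.
have sl0: 0 <= sig2 * lam by rewrite mulr_ge0// ltW.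
have shE: ((l-t)^-1+2*(sig2 * lam))^-1 = shorten sig2 (l-t) lam by rewrite /shorten mulrA.
set tau':= shorten _ _ _ in tau'0 tau't shE *.
have tt': t+tau' <= 1 by apply: le_trans l1;rewrite -lerBrDl.
have K0: 0 <= qc (l-t)/qc tau' by rewrite divr_ge0// ltW// qc_gt0.
have tm: timed l 0 (rcons (eslots D) (t, gweight (sig2 * lam))).
 by have:= eslots_timed l0 (D:= (t, lam, al) :: D) aD;rewrite /eslots /= rev_cons.
rewrite /eslots /= rev_cons -/(eslots D).
case: (eqVneq D [::]) IH=> [-> _|D0 /(_ (t+tau')) IH].
 transitivity ((2 * sqrtr (2 * pi))%:E * \int[@lebesgue_measure R]_x ((qc (l-t)/qc tau')%:E*(qker t x * qker tau' x)%:E))%E.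
  congr (_ * _)%E;apply: eq_integral=> x _.
  by rewrite -!EFinM -mulrA qker_gweight// shE mulrCA.
 rewrite ge0_integralZl_EFin//;last 2 first.
 - by move=> x _;rewrite lee_fin mulr_ge0 ?qker_ge0.
 - by apply/measurable_EFinP;apply: measurable_funM;exact: measurable_qker.
 by rewrite muleCA (excE_mass exc)// EFinM.
have t01: 0 < t+tau' <= 1 by rewrite addr_gt0.
have aDt: admissible (t+tau') D by apply: admissible_le aD';rewrite lerDl ltW.
have {}IH:= IH t01 aDt isT.
rewrite [RHS]EFinM -IH [RHS]muleCA;congr (_ * _)%E.
case ED : (eslots D) tm=> [|[t1 f1] fs] /=.
 by move: D0;rewrite -size_eq0 -(size_map (fun p : R*R*R=> (p.1.1, gweight (sig2 * p.1.2)))) -size_rev -/(eslots D) ED.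
move=> [t10 sf1 tm];under eq_integral do rewrite excA_gweight_last// shE muleCA.
have tm': timed (t+tau') t1 fs.
 move: tm;clear ED t10;elim: fs t1=> [|[t2 f2] fs IHf] t1 /= [h1 h2 h3];first by rewrite (lt_trans h1)// ltrDl.
 by split=> //;exact: IHf.
have [m1 p1]:= slot_mul_meas tm' sf1 (@measurable_qker R t1) (qker_ge0 t1).
by rewrite ge0_integralZl_EFin.
Qed.

Lemma expect_excursion l D : l = 1 -> admissible l D -> Ex P (slotprod e (eslots D)) = Elim l D.
move=> -> aD;have [s1 l1]:= eslots_ok aD.
case: (eqVneq D [::])=> [->|D0].
 have ->: slotprod e (eslots [::]) = (fun=> 1) by apply/funext=> w;rewrite /slotprod big_nil.
 by rewrite Ex_cst /= divff// lt0r_neq0// qc_gt0.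
have es0: eslots D != [::] by rewrite -size_eq0 size_rev size_map size_eq0.
have h01: 0 < (1 : R) <= 1 by rewrite ltr01 lexx.
have:= @excursion_expect R d Omega P e exc (eslots D) [::];rewrite !cats0=> /(_ (eslots_timed ltr01 aD) I l1 es0).
by rewrite excE_Elim// ExE;[move=> [->]|exact: slotprod_bm].
Qed.

(** Independence is given on cylinders, so [expect_slots] is applied twice: to the excursion with a
    Brownian cylinder fixed, then to the Brownian slots. *)
Lemma indep_slotprod fs gs : slots fs -> le1_slots fs -> slots gs -> le1_slots gs ->
  Ex P (fun w => slotprod B gs w * slotprod e fs w) = Ex P (slotprod e fs) * Ex P (slotprod B gs).
move=> sf lf sg lg;have tT (hs : seq (R*(R -> R))) : times setT hs by [].
have tTu us: times_in (setT : set R) us by elim: us=> //= p us IH;split.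
have mc (X : Omega -> R -> R) us : (forall t, mfunT (X ^~ t)) -> borel_specs us -> measurable (cyl X us).
 by move=> mX;exact: cyl_measurable.
have ExI (C : set Omega) : measurable C -> Ex P \1_C = fine (P C).
 by move=> mC;rewrite /Ex /Rintegral integral_indic// setIT.
have i0 (C : set Omega) w : 0 <= \1_C w :> R by rewrite indicE;case: (_ \in _).
have ecyl vs: borel_specs vs ->
  Ex P (fun w=> slotprod e fs w * \1_(cyl B vs) w) = Ex P \1_(cyl B vs)*Ex P (slotprod e fs).
 move=> bvs;have:= @expect_slots R _ _ P e setT me \1_(cyl B vs) (Ex P \1_(cyl B vs)).
 move=> /(_ (bmfun_indic (mc _ _ mB bvs)) (i0 _) (Ex_ge0 _ (i0 _))).
 move=> /(_ _ fs [::] sf lf (tT _) I I);rewrite cats0;apply.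
 move=> us bus _;rewrite !ExI;[|exact: mc..].
 have ->: (fun w=> \1_(cyl e us) w * \1_(cyl B vs) w) = \1_(cyl e us `&` cyl B vs) :> (Omega -> R).
  by apply/funext=> w;rewrite indicI.
 rewrite ExI;last by apply: measurableI;exact: mc.
 rewrite ind// fineM;[by rewrite mulrC|by apply: fin_num_measure;exact: mc..].
have s0 w: 0 <= slotprod e fs w by have /andP[]:= slotprod_le1 e w sf lf.
have:= @expect_slots R _ _ P B setT mB (slotprod e fs) (Ex P (slotprod e fs)).
move=> /(_ (slotprod_bm me sf lf) s0 (Ex_ge0 _ s0)).
move=> /(_ _ gs [::] sg lg (tT _) I I);rewrite cats0;apply.
move=> us bus _;rewrite mulrC -ecyl//;congr Ex;apply/funext=> w;rewrite mulrC//.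
Qed.

Lemma expect_bphase l beta c D : 0 < l -> admissible l D ->
  Ex P (fun w => cos (c + gam * phase B (bphase l beta D) w)) = cos c * Blim l beta D.
have [_ B0 _ _ _]:= bm.
elim: D l beta=> [|[[t lam] al] D IH] l beta l0 aD /=.
 have h:= @increment_cos R _ _ P B bm 0 l (gam * beta) c [::].
 rewrite (_ : (fun w=> _) = (fun w=> cos (c+(gam * beta*(B w l-B w 0)+phase B [::] w))));last first.
  by apply/funext=> w;rewrite /phase /bphase big_cons !big_nil B0 subr0 !addr0 mulrA.
 rewrite h ?lexx//;rewrite (_ : (fun w=> _) = (fun=> cos c));last first.
  by apply/funext=> w;rewrite /phase big_nil addr0.
 by rewrite Ex_cst mulrC subr0 exprMn gamE;congr (_ * expR _);ring.
move: aD=> /= [/andP[t0 tl] lam0 aD].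
have h:= @increment_cos R _ _ P B bm t l (gam * beta) c [seq (p.1, gam * p.2) | p <- bphase t (al+beta) D].
have phE as_ w: phase B [seq (p.1, gam * p.2) | p <- as_] w = gam * phase B as_ w.
 by rewrite /phase big_map mulr_sumr;apply: eq_bigr=> p _;rewrite /= mulrA.
rewrite (_ : (fun w=> _) = (fun w=> cos (c+(gam * beta*(B w l-B w t)+phase B [seq (p.1, gam * p.2) | p <- bphase t (al+beta) D] w))));last first.
 by apply/funext=> w;rewrite phE /phase /bphase !big_cons /=;congr cos;ring.
rewrite h;last 2 first.
- by rewrite (ltW t0).
- move=> p /mapP[q qb ->] /=;move: qb;rewrite inE=> /orP[/eqP->/=|/mapP[r rD ->]/=];first by rewrite ltW//= lexx.
 by have /andP[/ltW -> /ltW]:= admissible_times aD rD.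
under [X in _*Ex P X]eq_fun do rewrite phE.
rewrite IH// mulrCA;congr (_*(expR (- _) * _));rewrite exprMn gamE;ring.
Qed.

Theorem limit_functional beta c D : admissible 1 D ->
  Ex P (fun w => slotprod e (eslots D) w * cos (c + gam * phase B (bphase 1 beta D) w)) =
  cos c * (Elim 1 D * Blim 1 beta D).
move=> aD;have [s1 l1]:= eslots_ok aD.
have phE as_ w: phase B [seq (p.1, gam * p.2) | p <- as_] w = gam * phase B as_ w.
 by rewrite /phase big_map mulr_sumr;apply: eq_bigr=> p _;rewrite /= mulrA.
have h:= @expect_phase R _ _ P B setT mB (slotprod e (eslots D)) (Ex P (slotprod e (eslots D))) (slotprod_bm me s1 l1).
have {}h:= h (fun gs sg lg _=> indep_slotprod s1 l1 sg lg) [seq (p.1, gam * p.2) | p <- bphase 1 beta D] c (fun _ _=> I).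
rewrite (_ : (fun w=> _) = (fun w=> cos (c+phase B [seq (p.1, gam * p.2) | p <- bphase 1 beta D] w) * slotprod e (eslots D) w));last first.
 by apply/funext=> w;rewrite phE mulrC.
rewrite h;under [X in _*Ex P X]eq_fun do rewrite phE.
by rewrite (expect_excursion erefl)// expect_bphase// mulrCA.
Qed.
End LimitFunctional.

(** * Moments, inf-convolutions and weak convergence *)

Section BernoulliSums.
Context {R : realType}.

(** Bernoulli weights: the [psum] of a function of [sumn s] under them is a Bernstein polynomial in
    [u]. *)
Definition bw (u : R) (k : nat) : R := if k == 0%N then 1 - u else u.

Lemma bw_ge0 u k : 0 <= u <= 1 -> 0 <= bw u k.
Proof. by move=> /andP[u0 u1];rewrite /bw;case: ifP=> // _;rewrite subr_ge0. Qed.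

Lemma psum_bwS u m F :
  psum (bw u) 2 m.+1 F = (1 - u) * psum (bw u) 2 m (fun s => F (0%N :: s)) + u * psum (bw u) 2 m (fun s => F (1%N :: s)).
Proof. by rewrite /= !big_ord_recl big_ord0 addr0. Qed.

Lemma psum_bw1 u m c : psum (bw u) 2 m (fun=> c) = c.
Proof. by elim: m=> [//|m IH];rewrite psum_bwS !IH;ring. Qed.

Lemma psum_bw_mean u m : psum (bw u) 2 m (fun s => (sumn s)%:R - m%:R * u) = 0.
elim: m=> [|m IH];first by rewrite /= mul0r subr0.
rewrite psum_bwS.
rewrite (@eq_psum _ _ _ _ _ (fun s=> ((sumn s)%:R-m%:R * u) + - u));last by move=> s _ _ /=;rewrite -natr1;ring.
rewrite [X in _+_*X](@eq_psum _ _ _ _ _ (fun s=> ((sumn s)%:R-m%:R * u)+(1-u)));last by move=> s _ _ /=;rewrite natrD -natr1;ring.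
by rewrite !(psumD _ _ _ (fun s : seq nat=> (sumn s)%:R-m%:R * u)) IH !psum_bw1;ring.
Qed.

Lemma psum_bw_var u m : psum (bw u) 2 m (fun s => ((sumn s)%:R - m%:R * u) ^+ 2) = m%:R * (u * (1 - u)).
elim: m=> [|m IH];first by rewrite /= !mul0r subr0 expr0n.
rewrite psum_bwS.
rewrite (@eq_psum _ _ _ _ _ (fun s=> ((sumn s)%:R-m%:R * u)^+2+(- 2 * u*((sumn s)%:R-m%:R * u)+u^+2)));last first.
 by move=> s _ _ /=;rewrite -natr1;ring.
rewrite [X in _+_*X](@eq_psum _ _ _ _ _ (fun s=> ((sumn s)%:R-m%:R * u)^+2+(2*(1-u)*((sumn s)%:R-m%:R * u)+(1-u)^+2)));last first.
 by move=> s _ _ /=;rewrite natrD -natr1;ring.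
by rewrite !psumD !psumZ !psum_bw_mean IH !psum_bw1 -natr1;ring.
Qed.

(* Chebyshev for the law of large numbers behind Bernstein polynomials *)
Lemma bernstein_approx (f : R -> R) (y u delta M rho : R) m : (0 < m)%N -> 0 <= u <= 1 -> 0 < delta ->
  0 <= rho -> 0 <= M ->
  (forall r, `|u - r| <= delta -> `|y - f r| <= rho) -> (forall r, `|y - f r| <= M) ->
  `|y - psum (bw u) 2 m (fun s => f ((sumn s)%:R / m%:R))| <= rho + M / (m%:R * delta ^+ 2).
move=> m0 u01 d0 r0 M0 h1 h2;have mm: 0 < m%:R :> R by rewrite ltr0n.
rewrite -{1}(psum_bw1 u m y) -psumB;apply: (le_trans (psum_norm _ _ _ (fun k=> bw_ge0 k u01))).
have d2: 0 < (m%:R * delta)^+2 by rewrite exprn_gt0// mulr_gt0.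
apply: (le_via (psum (bw u) 2 m (fun s=> rho+M/(m%:R * delta)^+2*((sumn s)%:R-m%:R * u)^+2))).
 apply: psum_ler=> [k|s _ _];first exact: bw_ge0.
 have h3: 0 <= M/(m%:R * delta)^+2 by rewrite divr_ge0// ltW.
 have [h|h]:= leP `|u-(sumn s)%:R/m%:R| delta.
  by apply: (le_trans (h1 _ h));rewrite lerDl mulr_ge0// sqr_ge0.
 apply: (le_trans (h2 _));rewrite -[leLHS]add0r;apply: lerD=> //.
 rewrite mulrAC ler_pdivlMr// ler_wpM2l//.
 have ->: (sumn s)%:R-m%:R * u = m%:R*((sumn s)%:R/m%:R-u) by field;rewrite lt0r_neq0.
 rewrite !exprMn ler_wpM2l ?exprn_ge0// -[leRHS]real_normK ?num_real// distrC.
 by rewrite lerXn2r ?nnegrE ?(ltW d0)// ltW.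
rewrite psumD psumZ psum_bw1 psum_bw_var lerD2l.
have ->: M/(m%:R * delta)^+2*(m%:R*(u*(1-u))) = M/(m%:R * delta^+2)*(u*(1-u)).
 by field;rewrite !lt0r_neq0.
have /andP[u0 u1]:= u01.
apply: ler_piMr;first by rewrite divr_ge0// mulr_ge0// ?exprn_ge0// ltW.
by rewrite -[leRHS]mulr1;apply: ler_pM=> //;lra.
Qed.
End BernoulliSums.

(** * Polynomial approximation in bounded charts *)

Section Moments.
Context {R : realType}.
Implicit Types (Phi Psi : (nat -> R) -> R) (x y : nat -> R).

(** The case r = 0 says that [Phi] depends on the first [K] coordinates only. *)
Definition lipK (K : nat) (L : R) Phi : Prop :=
  forall x y r, (forall i, (i < K)%N -> `|x i - y i| <= r) -> 0 <= r -> `|Phi x - Phi y| <= L * r.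

Definition upd x i v : nat -> R := fun j => if j == i then v else x j.

Lemma lipK_upd K L Phi v : lipK K.+1 L Phi -> lipK K L (fun x => Phi (upd x K v)).
move=> h x y r xy r0;apply: h=> // i iK;rewrite /upd;case: eqP=> [_|/eqP iK'];first by rewrite subrr normr0.
by apply: xy;rewrite ltn_neqAle iK' -ltnS.
Qed.

Variables (u : nat -> R -> R) (W : nat -> set R).
Hypothesis u01 : forall i (x : R), 0 <= u i x <= 1.
Hypothesis inj : forall i (e : R), 0 < e -> exists2 d : R, 0 < d &
  forall x y : R, W i x -> W i y -> `|u i x - u i y| <= d -> `|x - y| <= e.

Inductive mspan (K : nat) : ((nat -> R) -> R) -> Prop :=
| mspan_mon (js : seq nat) : all (fun j => j < K)%N js -> mspan K (fun x => \prod_(j <- js) u j (x j))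
| mspan_add Phi Psi : mspan K Phi -> mspan K Psi -> mspan K (fun x => Phi x + Psi x)
| mspan_scale c Phi : mspan K Phi -> mspan K (fun x => c * Phi x).

Lemma mspan_mul K i Phi : (i < K)%N -> mspan K Phi -> mspan K (fun x => u i (x i) * Phi x).
move=> iK;elim=> [js hjs|Phi1 Phi2 _ h1 _ h2|c Phi1 _ h1].
- have ->: (fun x=> u i (x i) * \prod_(j <- js) u j (x j)) = (fun x=> \prod_(j <- i :: js) u j (x j)).
  by apply/funext=> x;rewrite big_cons.
 by apply: mspan_mon;rewrite /= iK.
- have ->: (fun x=> u i (x i)*(Phi1 x+Phi2 x)) = (fun x=> u i (x i)*Phi1 x+u i (x i)*Phi2 x).
  by apply/funext=> x;rewrite mulrDr.
 exact: mspan_add.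
- have ->: (fun x=> u i (x i)*(c*Phi1 x)) = (fun x=> c*(u i (x i)*Phi1 x)).
  by apply/funext=> x;rewrite mulrCA.
 exact: mspan_scale.
Qed.

Lemma mspan_le K K' Phi : (K <= K')%N -> mspan K Phi -> mspan K' Phi.
move=> KK;elim=> [js hjs|Phi1 Phi2 _ h1 _ h2|c Phi1 _ h1].
- by apply: mspan_mon;apply: sub_all hjs=> j jK;exact: leq_trans jK KK.
- exact: mspan_add.
- exact: mspan_scale.
Qed.

Lemma mspan_psum K i m (F : seq nat -> (nat -> R) -> R) : (i < K)%N -> (forall s, mspan K (F s)) ->
  mspan K (fun x => psum (bw (u i (x i))) 2 m (fun s => F s x)).
move=> iK;elim: m F=> [|m IH] F hF;first exact: (hF [::]).
have ->: (fun x=> psum (bw (u i (x i))) 2 m.+1 (fun s=> F s x)) =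
 (fun x=> (psum (bw (u i (x i))) 2 m (fun s=> F (0%N :: s) x) +
  (-1)*(u i (x i) * psum (bw (u i (x i))) 2 m (fun s=> F (0%N :: s) x))) +
  u i (x i) * psum (bw (u i (x i))) 2 m (fun s=> F (1%N :: s) x)).
 by apply/funext=> x;rewrite psum_bwS;ring.
apply: mspan_add;[apply: mspan_add;[|apply: mspan_scale;apply: mspan_mul=> //]|apply: mspan_mul=> //];
 apply: IH=> s;exact: hF.
Qed.

(** The last coordinate enters through a Bernstein polynomial in its chart, whose coefficients
    depend on the other coordinates and are approximated by induction. Charts are invertible with
    uniform modulus only on the sets [W i]; elsewhere the trivial bound 2M is paid. *)
Lemma mspan_approx (M rho : R) K L Phi : 0 <= M -> 0 < rho -> 0 <= L -> lipK K L Phi -> (forall x, `|Phi x| <= M) ->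
  exists2 Psi, mspan K Psi &
  forall x, `|Phi x - Psi x| <= \sum_(i < K) (rho + 2 * M * \1_(~` W i) (x i)).
move=> M0 r0 L0;elim: K Phi=> [|K IH] Phi lip bd.
 exists (fun x=> Phi (fun=> 0) * \prod_(j <- [::]) u j (x j)).
  by apply: mspan_scale;exact: mspan_mon.
 move=> x;rewrite big_ord0 big_nil mulr1;have:= lip x (fun=> 0) 0;rewrite mulr0;exact.
have e0: 0 < rho/(2*(L+1)) by rewrite divr_gt0// mulr_gt0// ltr_wpDl.
have [d d0 hd]:= inj K e0;set e:= rho/_ in e0 hd.
have d20: 0 < d/2 by rewrite divr_gt0.
pose m:= (truncn (2*(2*M)/(rho*(d/2)^+2))).+1.
have mP: 2*M/(m%:R*(d/2)^+2) <= rho/2.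
 have q0: 0 < (d/2)^+2 by rewrite exprn_gt0.
 have : 2*(2*M)/(rho*(d/2)^+2) <= m%:R by rewrite ltW// truncnS_gt.
 rewrite ler_pdivrMr ?mulr_gt0// => h;rewrite ler_pdivrMr ?mulr_gt0 ?ltr0n//.
 have ->: rho/2*(m%:R*(d/2)^+2) = m%:R*(rho*(d/2)^+2)/2 by ring.
 by rewrite ler_pdivlMr// mulrC.
have mgt0: (0 < m)%N by [].
clearbody m.
(* An approximate inverse of the chart. The default 0 is harmless: [vP] is invoked only when a point
   of [W K] with a close chart value exists. *)
pose v r:= xget 0 [set y | W K y /\ `|u K y-r| <= d/2].
have vP (r y : R) : W K y -> `|u K y-r| <= d/2 -> `|y-v r| <= e.
 move=> Wy hy;have [] : W K (v r) /\ `|u K (v r)-r| <= d/2.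
  by rewrite /v;case: xgetP=> [z _ //|/(_ y)];case.
 move=> Wv hv;apply: hd=> //;rewrite -(subrKA r) [d]splitr;apply: le_trans (ler_normD _ _) _.
 by apply: lerD=> //;rewrite distrC.
have IHs (s : seq nat) : exists Psi, mspan K Psi /\
  forall x, `|Phi (upd x K (v ((sumn s)%:R/m%:R)))-Psi x| <= \sum_(i < K) (rho+2*M * \1_(~` W i) (x i)).
 by have [Psi h1 h2]:= IH _ (lipK_upd (v ((sumn s)%:R/m%:R)) lip) (fun x=> bd _);exists Psi.
have [PP hPP]:= choice IHs.
exists (fun x=> psum (bw (u K (x K))) 2 m (fun s=> PP s x)).
 by apply: mspan_psum=> // s;apply: mspan_le (leqnSn K) _;have []:= hPP s.
move=> x;rewrite big_ord_recr /= addrC.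
rewrite -(subrKA (psum (bw (u K (x K))) 2 m (fun s=> Phi (upd x K (v ((sumn s)%:R/m%:R)))))).
apply: (le_trans (ler_normD _ _));apply: lerD;last first.
 rewrite -psumB;apply: (le_trans (psum_norm _ _ _ (fun k=> bw_ge0 k (u01 K (x K))))).
 rewrite -[leRHS](psum_bw1 (u K (x K)) m);apply: psum_ler=> [k|s _ _];first exact: bw_ge0.
 by have []:= hPP s.
have bd2 y: `|Phi x-Phi y| <= 2*M.
 by apply: (le_trans (ler_normB _ _));rewrite mulr_natl mulr2n;exact: lerD.
rewrite indicE;case: (boolP (x K \in _))=> xW /=;last first.
 rewrite mulr0 addr0;have WK: W K (x K).
  by apply: contrapT=> nW;move/negP: xW;apply;exact/mem_set.
 apply: (le_via (rho/2+2*M/(m%:R*(d/2)^+2)));last by rewrite [leRHS]splitr lerD2l.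
 apply: (@bernstein_approx _ (fun r=> Phi (upd x K (v r))))=> //.
 - by rewrite divr_ge0// ltW.
 - by rewrite mulr_ge0.
 - move=> r hr;apply: (le_via (L * e));last first.
   rewrite /e;have ->: L*(rho/(2*(L+1))) = (L/(L+1))*(rho/2).
    by field;rewrite lt0r_neq0// ltr_wpDl.
   apply: ler_piMl;first by rewrite divr_ge0// ltW.
   by rewrite ler_pdivrMr ?mul1r ?ltr_wpDl// lerDl.
  apply: lip;last exact: ltW.
  move=> i iK;rewrite /upd;case: eqP=> [->|_];first exact: vP.
  by rewrite subrr normr0 ltW.
rewrite mulr1;apply: (le_via (2*M));last by rewrite lerDr ltW.
rewrite -{1}(psum_bw1 (u K (x K)) m (Phi x)) -psumB;apply: (le_trans (psum_norm _ _ _ (fun k=> bw_ge0 k (u01 K (x K))))).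
rewrite -[leRHS](psum_bw1 (u K (x K)) m);apply: psum_ler=> [k|s _ _];first exact: bw_ge0.
exact: bd2.
Qed.
End Moments.

Section LipMeasurable.
Context {R : realType} {d : measure_display} {Omega : measurableType d}.
Variable X : Omega -> nat -> R.
Hypothesis mX : forall i, mfunT (X ^~ i).

(** A Lipschitz function is the limit of functions that are constant in the last coordinate on the
    cells of a grid of mesh 1/(m+1) over [-(m+1), m+1); these are measurable by induction. *)
Lemma lipK_measurable K L (Phi : (nat -> R) -> R) : 0 <= L -> lipK K L Phi -> mfunT (fun w => Phi (X w)).
move=> L0;elim: K Phi=> [|K IH] Phi lip.
 have ->: (fun w=> Phi (X w)) = (fun=> Phi (fun=> 0)).
  apply/funext=> w;apply/eqP;rewrite -subr_eq0 -normr_le0.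
  by have:= lip (X w) (fun=> 0) 0;rewrite mulr0;exact.
 exact: measurable_cst.
pose node (m l : nat) : R:= l%:R/m%:R-m%:R.
pose cell (m l : nat) : set R:= [set` `[node m l, node m l.+1[].
pose Psi (m : nat) w : R:= \sum_(l < 2 * m.+1 * m.+1) \1_(cell m.+1 l) (X w K)*Phi (upd (X w) K (node m.+1 l)).
have mPsi m: mfunT (Psi m).
 apply: measurable_sum=> l;apply: measurable_funM;last exact: IH _ (lipK_upd _ lip).
 by apply: (measurableT_comp (measurable_indic (measurable_itv _)) (mX K)).
apply: (measurable_fun_cvg mPsi)=> w _;apply/cvgrPdist_le=> e e0;near=> m.
set M : R:= m.+1%:R;have M0: 0 < M by rewrite ltr0n.
have mX1: `|X w K| < M.
 have : `|X w K| <= m%:R by near: m;exact: nbhs_infty_ger.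
 by move/le_lt_trans;apply;rewrite ltr_nat.
have mL: L/e <= M.
 have : L/e <= m%:R by near: m;exact: nbhs_infty_ger.
 by move/le_trans;apply;rewrite ler_nat.
have /andP[xM1 xM2] : - M < X w K < M by rewrite -ltr_norml.
have y0: 0 <= (X w K+M)*M by rewrite mulr_ge0 ?(ltW M0)//;lra.
pose l0:= truncn ((X w K+M)*M).
have /andP[l1 l2]:= truncn_itv y0;rewrite -/l0 in l1 l2.
have l0m: (l0 < 2 * m.+1 * m.+1)%N.
 rewrite -(ltr_nat R) !natrM -/M;apply: le_lt_trans l1 _.
 by rewrite ltr_pM2r//;lra.
have cellE (l : nat) : \1_(cell m.+1 l) (X w K) = (l == l0)%:R :> R.
 rewrite indicE;congr (nat_of_bool _)%:R;apply/idP/eqP=> [/set_mem|->].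
  rewrite /cell /= in_itv/= /node -/M=> /andP[a1 a2].
  have h1: (l < l0.+1)%N.
   by rewrite -(ltr_nat R);apply: le_lt_trans l2;rewrite -ler_pdivrMr// -lerBlDr.
  have h2: (l0 < l.+1)%N.
   by rewrite -(ltr_nat R);apply: le_lt_trans l1 _;rewrite -ltr_pdivlMr// -ltrBrDr.
  by apply/eqP;rewrite eqn_leq -ltnS h1 -ltnS h2.
 apply/mem_set;rewrite /cell /= in_itv/= /node -/M.
 by rewrite lerBlDr ler_pdivrMr// l1/= ltrBrDr ltr_pdivlMr.
have ->: Psi m w = Phi (upd (X w) K (node m.+1 l0)).
 rewrite /Psi (bigD1 (Ordinal l0m))//= cellE eqxx mul1r big1 ?addr0// => l ll.
 by rewrite cellE;case: eqP=> [h|_];[case/eqP: ll;exact: val_inj|rewrite mul0r].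
apply: (le_via (L*M^-1));last by rewrite ler_pdivrMr// mulrC -ler_pdivrMr.
apply: lip;last by rewrite invr_ge0 ltW.
move=> i _;rewrite /upd;case: eqP=> [->|_];last by rewrite subrr normr0 invr_ge0 ltW.
have Mn:= lt0r_neq0 M0.
rewrite /node -/M;have ->: X w K-(l0%:R/M-M) = ((X w K+M)*M-l0%:R)/M by field.
rewrite ger0_norm;last by rewrite divr_ge0 ?(ltW M0)// subr_ge0.
by rewrite ler_pdivrMr// mulVf// lerBlDr [1+_]addrC natr1 ltW.
Unshelve. all: end_near. Qed.
End LipMeasurable.

Section MethodOfMoments.
Context {R : realType} {d : measure_display} {Omega : measurableType d}.
Variables (P : probability Omega R) (X : Omega -> nat -> R).
Hypothesis mX : forall i, mfunT (X ^~ i).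
Variables (S : Type) (Y : nat -> S -> nat -> R) (E : nat -> (S -> R) -> R).

(** An abstract expectation. For trees it is available once [treeP] is positive, hence for large [n]
    only. *)
Definition average (E : (S -> R) -> R) : Prop :=
  [/\ forall f g, E (fun s => f s + g s) = E f + E g,
      forall c f, E (fun s => c * f s) = c * E f,
      forall f g, (forall s, f s <= g s) -> E f <= E g &
      E (fun=> 1) = 1].

Lemma average_norm F f g h : average F -> (forall s, `|f s - g s| <= h s) -> `|F f - F g| <= F h.
move=> [FD FZ Fle _] fg;have FN f': F (fun s=> - f' s) = - F f'.
 by rewrite -mulN1r -FZ;congr F;apply/funext=> s;rewrite mulN1r.
have h1 s: f s-g s <= h s /\ - (f s-g s) <= h s by have:= fg s;rewrite ler_norml=> /andP[];split=> //;lra.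
rewrite -FN -FD ler_norml;apply/andP;split;last by apply: Fle=> s;have []:= h1 s.
by rewrite lerNl -FN;apply: Fle=> s;have []:= h1 s.
Qed.

Lemma average_cst F c : average F -> F (fun=> c) = c.
Proof. by move=> [_ FZ _ F1];rewrite -[RHS]mulr1 -F1 -FZ;congr F;apply/funext=> s;rewrite mulr1. Qed.

Lemma average_sum F (I : Type) (r : seq I) (f : I -> S -> R) : average F ->
  F (fun s => \sum_(i <- r) f i s) = \sum_(i <- r) F (f i).
move=> aF;have [FD _ _ _]:= aF;elim: r=> [|i r IH].
 by rewrite big_nil -[RHS](average_cst 0 aF);congr F;apply/funext=> s;rewrite big_nil.
by rewrite big_cons -IH -FD;congr F;apply/funext=> s;rewrite big_cons.
Qed.

Hypothesis avgE : \forall n \near \oo, average (E n).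

(** Convergence of moments of charts passes to their span, hence by [mspan_approx] to Lipschitz
    functions. Charts and sets may depend on the error [e], because tails need only be small for
    that error. *)
Theorem moments_cvg K L M (Phi : (nat -> R) -> R) : 0 <= L -> 0 <= M -> lipK K L Phi -> (forall x, `|Phi x| <= M) ->
  (forall e : R, 0 < e -> exists (u : nat -> R -> R) (W : nat -> set R),
     [/\ forall i x, 0 <= u i x <= 1, forall i, mfunT (u i) /\ measurable (W i),
         forall i (e' : R), 0 < e' -> exists2 d : R, 0 < d &
           forall x y : R, W i x -> W i y -> `|u i x - u i y| <= d -> `|x - y| <= e',
         forall js, all (fun j => j < K)%N js ->
           E n (fun s => \prod_(j <- js) u j (Y n s j)) @[n --> \oo] --> Ex P (fun w => \prod_(j <- js) u j (X w j)) &
         forall i, (i < K)%N -> (\forall n \near \oo, E n (fun s => \1_(~` W i) (Y n s i)) <= e) /\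
            Ex P (fun w => \1_(~` W i) (X w i)) <= e]) ->
  E n (fun s => Phi (Y n s)) @[n --> \oo] --> Ex P (fun w => Phi (X w)).
move=> L0 M0 lip bd H;apply/cvgrPdist_le=> e e0.
have K1: 0 < K.+1%:R :> R by rewrite ltr0n.
pose rho:= e/(8*K.+1%:R);have rho0: 0 < rho by rewrite divr_gt0// mulr_gt0.
pose ep:= e/(16*K.+1%:R*(M+1));have ep0: 0 < ep by rewrite divr_gt0// !mulr_gt0// ltr_wpDl.
have [u [W [u01 mu_ inj mom tails]]]:= H ep ep0.
have [Psi sPsi hPsi]:= mspan_approx u01 inj M0 rho0 L0 lip bd.
have bP: bmfun (fun w=> Phi (X w)) by split;[exact: lipK_measurable lip|exists M].
have mu_X i: bmfun (fun w=> u i (X w i)).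
 by apply: bmfun01=> [|w];[exact: (measurableT_comp (mu_ i).1 (mX i))|exact: u01].
have [bPsi cPsi] : bmfun (fun w=> Psi (X w)) /\ E n (fun s=> Psi (Y n s)) @[n --> \oo] --> Ex P (fun w=> Psi (X w)).
 elim: sPsi {hPsi}=> [js jK|Phi1 Phi2 _ [b1 c1] _ [b2 c2]|c Phi1 _ [b1 c1]].
 - split;last exact: mom.
  elim: js {jK}=> [|j js IH];first by under eq_fun do rewrite big_nil;exact: bmfun_cst.
  by under eq_fun do rewrite big_cons;exact: bmfunM.
 - split;first exact: bmfunD.
  rewrite ExD//;apply: cvg_trans (cvgD c1 c2);apply: near_eq_cvg.
  by move: avgE;apply: filterS=> n [ED _ _ _];exact: (esym (ED _ _)).
 - split;first exact: bmfunZ.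
  have h: c*E n (fun s=> Phi1 (Y n s)) @[n --> \oo] --> c*Ex P (fun w=> Phi1 (X w)) by apply: cvgMr.
  rewrite ExZ//;apply: cvg_trans h;apply: near_eq_cvg.
  by move: avgE;apply: filterS=> n [_ EZ _ _];exact: (esym (EZ _ _)).
have bI i: bmfun (fun w=> \1_(~` W i) (X w i) : R).
 apply: bmfun01=> [|w];last by rewrite indicE;case: (_ \in _);rewrite ?lexx ?ler01.
 exact: (measurableT_comp (measurable_indic (measurableC (mu_ i).2)) (mX i)).
have bT i: bmfun (fun w=> rho+2*M * \1_(~` W i) (X w i)).
 by apply: bmfunD;[exact: bmfun_cst|exact: bmfunZ].
have tot: \sum_(i < K) (rho+2*M * ep) <= e/4.
 rewrite sumr_const card_ord -[_ *+ K]mulr_natl.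
 apply: (le_via (K%:R*(e/(4*K.+1%:R)))).
  rewrite ler_wpM2l// /rho /ep.
  have ->: 2*M*(e/(16*K.+1%:R*(M+1))) = M/(M+1)*(e/(8*K.+1%:R)).
   by field;rewrite !lt0r_neq0// ltr_wpDl.
  have ->: e/(4*K.+1%:R) = e/(8*K.+1%:R)+e/(8*K.+1%:R) by field;rewrite lt0r_neq0.
  by rewrite lerD2l ler_piMl ?(ltW rho0)// ler_pdivrMr ?ltr_wpDl// mul1r lerDl.
 have ->: K%:R*(e/(4*K.+1%:R)) = K%:R/K.+1%:R*(e/4) by field;rewrite lt0r_neq0.
 by rewrite ler_piMl ?divr_ge0 ?(ltW e0)// ler_pdivrMr// mul1r ler_nat.
have hX: `|Ex P (fun w=> Phi (X w))-Ex P (fun w=> Psi (X w))| <= e/4.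
 rewrite -ExB//;apply: le_trans (norm_Ex P (bmfunB bP bPsi)) _.
 have [bs es]:= Ex_sum P (index_enum 'I_K) (fun i : 'I_K=> bT i).
 apply: (le_via (Ex P (fun w=> \sum_(i < K) (rho+2*M * \1_(~` W i) (X w i))))).
  by apply: le_Ex=> //;apply: bmfun_norm;exact: bmfunB.
 rewrite es;apply: le_trans tot;apply: ler_sum=> i _.
 rewrite ExD//;[|exact: bmfun_cst|exact: bmfunZ].
 rewrite Ex_cst ExZ// lerD2l ler_wpM2l ?mulr_ge0//;exact: (tails i (ltn_ord i)).2.
have e4: 0 < e/4 by rewrite divr_gt0.
have tl: \forall n \near \oo, forall i : 'I_K, E n (fun s=> \1_(~` W i) (Y n s i)) <= ep.
 by apply: filter_forall=> i;exact: (tails i (ltn_ord i)).1.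
have /cvgrPdist_le /(_ _ e4) cP:= cPsi.
near=> n.
have an: average (E n) by near: n;exact: avgE.
have [ED EZ Ele E1]:= an.
have hE: `|E n (fun s=> Phi (Y n s))-E n (fun s=> Psi (Y n s))| <= e/4.
 apply: le_trans (average_norm an (fun s=> hPsi (Y n s))) _.
 rewrite average_sum//;apply: le_trans tot;apply: ler_sum=> i _.
 rewrite ED EZ average_cst// lerD2l ler_wpM2l ?mulr_ge0//.
 by move: i;near: n;exact: tl.
have hP: `|Ex P (fun w=> Psi (X w))-E n (fun s=> Psi (Y n s))| <= e/4 by near: n;exact: cP.
move: hX hP hE;rewrite !ler_norml=> /andP[x1 x2] /andP[x3 x4] /andP[x5 x6].
by apply/andP;split;lra.
Unshelve. all: end_near. Qed.
End MethodOfMoments.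

Section UniformContinuity.
Context {R : realType}.

Lemma segment_unif (f : R -> R) : {within `[0, 1], continuous f} ->
  forall e : R, 0 < e -> exists2 d : R, 0 < d & forall x y, 0 <= x <= 1 -> 0 <= y <= 1 -> `|x - y| <= d -> `|f x - f y| <= e.
move=> cf e e0;have K: compact (`[0 : R, 1] : set R) by exact: segment_compact.
move/compact_near_coveringP : K.
pose Q (d x' : R):= forall y, 0 <= x' <= 1 -> 0 <= y <= 1 -> `|x'-y| <= d -> `|f x'-f y| <= e.
move=> /(_ _ (0 : R)^'+ Q _).
have e2: 0 < e/2 by rewrite divr_gt0.
case=> [x x01|r /= r0 hr].
 have x01': 0 <= x <= 1 by move: x01;rewrite /= in_itv.
 have /cvgrPdist_lt /(_ _ e2) [r /= r0 hr]:= (subspace_continuousP _ f).1 cf x x01.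
 have r2: 0 < r/2 by rewrite divr_gt0.
 have hr' y: 0 <= y <= 1 -> `|x-y| < r -> `|f x-f y| < e/2.
  by move=> y01 xy;apply: (hr y)=> //=;rewrite in_itv.
 near=> x' i=> y x'01 y01 hxy.
 have h1: `|x-x'| < r/2 by near: x';exact: (nbhsx_ballx x _ r2).
 have h2: i < r/2 by near: i;exact: (nbhs_right_lt r2).
 have h3: `|x-x'| < r by apply: lt_trans h1 _;rewrite ltr_pdivrMr// ltr_pMr// ltr1n.
 have h4: `|x-y| < r.
  rewrite -(subrKA x') [r]splitr;apply: le_lt_trans (ler_normD _ _) _.
  by apply: ltr_leD=> //;apply: ltW;exact: le_lt_trans hxy h2.
 rewrite -(subrKA (f x)) [e]splitr;apply: le_trans (ler_normD _ _) _;apply: lerD.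
  by rewrite distrC ltW// hr'.
 by rewrite ltW// hr'.
exists (r/2);first by rewrite divr_gt0.
move=> x y x01 y01 xy.
have b1: ball_ [eta normr] 0 r (r/2).
 by rewrite /ball_/= sub0r normrN gtr0_norm ?divr_gt0// ltr_pdivrMr// ltr_pMr// ltr1n.
have b2: 0 < r/2 by rewrite divr_gt0.
have b3: `[0 : R, 1]%classic x by rewrite /= in_itv.
exact: (hr _ b1 b2 x b3 y x01 y01 xy).
Unshelve. all: end_near. Qed.
End UniformContinuity.

Section DominatedExpectation.
Context {R : realType} {d : measure_display} {Omega : measurableType d}.
Variable P : probability Omega R.

Lemma Ex_dominated (f_ : nat -> Omega -> R) (f : Omega -> R) (C : R) :
  (forall n, mfunT (f_ n)) -> (forall n w, `|f_ n w| <= C) ->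
  (forall w, f_ n w @[n --> \oo] --> f w) ->
  bmfun f /\ Ex P (f_ n) @[n --> \oo] --> Ex P f.
move=> mf_ bf_ cf.
have mf: mfunT f by apply: (measurable_fun_cvg mf_)=> w _;exact: cf.
have bf w: `|f w| <= C.
 have h: `|f_ n w| @[n --> \oo] --> `|f w| by apply: cvg_norm;exact: cf.
 rewrite -(cvg_lim _ h)//;apply: limr_le;first by apply/cvg_ex;exists `|f w|.
 by near=> n;exact: bf_.
have bmf: bmfun f by split=> //;exists C.
have bmf_ n: bmfun (f_ n) by split=> //;exists C.
split=> //;have [|||||_ _]:= @dominated_convergence _ _ _ P setT measurableT (fun n w=> (f_ n w)%:E) (fun w=> (f w)%:E) (fun=> C%:E).
- by move=> n;exact/measurable_EFinP.
- exact/measurable_EFinP.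
- by apply: aeW=> w _;apply: cvg_EFin;[exact: nearW|exact: cf].
- exact: (bmfun_integrable P (bmfun_cst C)).
- by apply: aeW=> w n _ /=;rewrite lee_fin.
have ->: (fun n=> \int[P]_w (f_ n w)%:E)%E = (fun n=> (Ex P (f_ n))%:E) by apply/funext=> n;rewrite ExE.
by rewrite ExE// => /fine_cvgP[_].
Unshelve. all: end_near. Qed.
End DominatedExpectation.

(** * Lipschitz minorants of functionals of paths *)

Section InfConvolution.
Context {R : realType}.
Implicit Types (x y : R -> R * R) (F : (R -> R * R) -> (R -> R * R) -> R).

Definition supclose (r : R) x y : Prop := forall t, 0 <= t <= 1 -> dist2 (x t) (y t) <= r.

Lemma dist2_triangle (p q s : R * R) : dist2 p s <= dist2 p q + dist2 q s.
rewrite /dist2 ge_max;apply/andP;split.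
 by rewrite -(subrKA q.1) (le_trans (ler_normD _ _))// lerD// le_max lexx.
by rewrite -(subrKA q.2) (le_trans (ler_normD _ _))// lerD// le_max lexx orbT.
Qed.

Lemma dist2C (p q : R * R) : dist2 p q = dist2 q p.
Proof. by rewrite /dist2 (distrC p.1) (distrC p.2). Qed.

Lemma dist2xx (p : R * R) : dist2 p p = 0.
Proof. by rewrite /dist2 !subrr normr0 maxxx. Qed.

(** Closeness is imposed only for rho < 1: the choice rho = 1 is then always available and the set
    is nonempty for arbitrary functions, cadlag or not. *)
Definition infset F (L : R) x1 x2 : set R := [set r | exists y1 y2 rho,
  [/\ cadlag y1, cadlag y2, 0 <= rho, rho < 1 -> supclose rho x1 y1 /\ supclose rho x2 y2 & r = F y1 y2 + L * rho]].

Definition infconv F L x1 x2 : R := inf (infset F L x1 x2).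

Variables (F : (R -> R * R) -> (R -> R * R) -> R) (M : R).
Hypothesis bdF : forall x1 x2, cadlag x1 -> cadlag x2 -> `|F x1 x2| <= M.
Variable L : R.
Hypothesis L0 : 0 <= L.

Lemma cadlag_cst (p : R * R) : cadlag (fun=> p).
Proof. by split=> t _;[exact: cvg_cst|exists p;exact: cvg_cst]. Qed.

Lemma infset_lb x1 x2 : lbound (infset F L x1 x2) (- M).
move=> r [y1 [y2 [rho [c1 c2 r0 _ ->]]]].
have:= bdF c1 c2;rewrite ler_norml=> /andP[h _].
by rewrite -[- M]addr0 lerD// mulr_ge0.
Qed.

Lemma infset_has_lb x1 x2 : has_lbound (infset F L x1 x2).
Proof. by exists (- M);exact: infset_lb. Qed.

Lemma infset_mem0 x1 x2 : infset F L x1 x2 (F (fun=> (0, 0)) (fun=> (0, 0)) + L * 1).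
Proof. by exists (fun=> (0, 0)), (fun=> (0, 0)), 1;split=> //;[exact: cadlag_cst|exact: cadlag_cst|rewrite ltxx]. Qed.

Lemma infconv_bound x1 x2 : `|infconv F L x1 x2| <= M + L.
have M0: 0 <= M by apply: le_trans (bdF (cadlag_cst (0, 0)) (cadlag_cst (0, 0))).
rewrite ler_norml;apply/andP;split.
 apply: lb_le_inf;first by exists (F (fun=> (0, 0)) (fun=> (0, 0))+L*1);exact: infset_mem0.
 by move=> r /infset_lb;apply: le_trans;rewrite lerN2 lerDl.
apply: le_trans (ge_inf (infset_has_lb _ _) (infset_mem0 _ _)) _.
rewrite mulr1 lerD2r;have:= bdF (cadlag_cst (0, 0)) (cadlag_cst (0, 0)).
by rewrite ler_norml=> /andP[].
Qed.

Lemma infconv_le x1 x2 : cadlag x1 -> cadlag x2 -> - M <= infconv F L x1 x2 <= F x1 x2.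
move=> c1 c2;apply/andP;split.
 apply: lb_le_inf;last exact: infset_lb.
 by exists (F (fun=> (0, 0)) (fun=> (0, 0))+L*1);exact: infset_mem0.
apply: (ge_inf (infset_has_lb _ _));exists x1, x2, 0;split=> //;last by rewrite mulr0 addr0.
by move=> _;split=> t _;rewrite dist2xx.
Qed.

Lemma infconv_lip1 x1 x2 y1 y2 r : 0 <= r -> supclose r x1 y1 -> supclose r x2 y2 ->
  infconv F L x1 x2 <= infconv F L y1 y2 + L * r.
move=> r0 c1 c2;rewrite -lerBlDr;apply: lb_le_inf.
 by exists (F (fun=> (0, 0)) (fun=> (0, 0))+L*1);exact: infset_mem0.
move=> _ [z1 [z2 [rho [d1 d2 rho0 h ->]]]];rewrite lerBlDr.
have ->: F z1 z2+L * rho+L * r = F z1 z2+L*(rho+r) by ring.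
apply: (ge_inf (infset_has_lb _ _));exists z1, z2, (rho+r);split=> //;first exact: addr_ge0.
move=> rr;have [|h1 h2]:= h;first by apply: le_lt_trans rr;rewrite lerDl.
by split=> t t01;rewrite addrC;apply: le_trans (dist2_triangle _ _ _) _;apply: lerD;[exact: c1|exact: h1|exact: c2|exact: h2].
Qed.

Lemma infconv_lip x1 x2 y1 y2 r : 0 <= r -> supclose r x1 y1 -> supclose r x2 y2 ->
  `|infconv F L x1 x2 - infconv F L y1 y2| <= L * r.
move=> r0 c1 c2;have h1:= infconv_lip1 r0 c1 c2.
have sC x y: supclose r x y -> supclose r y x by move=> h t t01;rewrite dist2C;exact: h.
have h2:= infconv_lip1 r0 (sC _ _ c1) (sC _ _ c2).
by rewrite ler_norml;apply/andP;split;lra.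
Qed.
End InfConvolution.

Section InfConvolutionLimit.
Context {R : realType}.
Variables (F : (R -> R * R) -> (R -> R * R) -> R) (M : R).
Hypothesis bdF : forall x1 x2, cadlag x1 -> cadlag x2 -> `|F x1 x2| <= M.
Hypothesis cF : bdd_cont_DD F.

Lemma j1_close_sup (r dl : R) (x y : R -> R * R) : 0 < dl -> supclose r x y -> r < dl -> j1_close dl x y.
move=> d0 xy rd;exists id;split=> //;first by apply: continuous_subspaceT=> t;exact: cvg_id.
by move=> t t01;rewrite subrr normr0;split=> //;apply: le_lt_trans rd;exact: xy.
Qed.

(** For large [m] a competitor must be close to the given paths, since otherwise its penalty exceeds
    2M; sup-closeness implies J1-closeness, where [F] is continuous. *)
Lemma infconv_cvg x1 x2 : cadlag x1 -> cadlag x2 -> infconv F m%:R x1 x2 @[m --> \oo] --> F x1 x2.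
move=> c1 c2;apply/cvgrPdist_le=> e e0;have [_ /(_ x1 x2 c1 c2 e e0) [dl d0 hd]]:= cF.
pose d1:= Num.min dl 1;have d10: 0 < d1 by rewrite lt_min d0 ltr01.
near=> m;have m0: 0 <= m%:R :> R by [].
have mM: 2*M/d1 <= m%:R by near: m;exact: nbhs_infty_ger.
have /andP[_ h1]:= infconv_le bdF m0 c1 c2;rewrite ger0_norm ?subr_ge0// lerBlDr -lerBlDl.
apply: lb_le_inf;first by exists (F (fun=> (0, 0)) (fun=> (0, 0))+m%:R*1);exact: infset_mem0.
move=> _ [y1 [y2 [rho [k1 k2 rho0 h ->]]]];have [rd|rd]:= ltP rho d1.
 have [|s1 s2]:= h;first by apply: lt_le_trans rd _;rewrite ge_min lexx orbT.
 have rdl: rho < dl by apply: lt_le_trans rd _;rewrite ge_min lexx.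
 have:= hd _ _ k1 k2 (j1_close_sup d0 s1 rdl) (j1_close_sup d0 s2 rdl).
 have : 0 <= m%:R * rho by rewrite mulr_ge0.
 by rewrite ltr_norml=> ? /andP[_];lra.
have:= bdF c1 c2;have:= bdF k1 k2;rewrite !ler_norml=> /andP[a1 _] /andP[_ a2].
have : 2*M <= m%:R * rho.
 by move: mM;rewrite ler_pdivrMr// => /le_trans;apply;rewrite ler_wpM2l.
by lra.
Unshelve. all: end_near. Qed.
End InfConvolutionLimit.

(** * Paths rebuilt from finitely many samples *)

Section StepPaths.
Context {R : realType}.
Variables (a b c : R).

(** Both limits are linear images of one pair (w, g); the rescaled processes are compared with the
    same images of step functions. *)
Definition path1 (w g : R -> R) (t : R) : R * R := (w t, a * w t + g t).
Definition path2 (w g : R -> R) (t : R) : R * R := (b * w t, c * w t + g t).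

(* coordinates 2j and 2j+1 sample w and g at time j/k; the heights vanish at times 0 and 1 *)
Definition sample (k : nat) (w g : R -> R) (i : nat) : R :=
  let j := i./2 in
  if odd i then (if j == 0%N then 0 else g (j%:R / k%:R))
  else if (j == 0%N) || (j == k) then 0 else w (j%:R / k%:R).

Definition stepw (k : nat) (v : nat -> R) (t : R) : R := v (truncn (k%:R * t)).*2.
Definition stepg (k : nat) (v : nat -> R) (t : R) : R := v (truncn (k%:R * t)).*2.+1.

Definition lipc : R := 1 + `|a| + `|b| + `|c|.

Lemma lipc_ge1 : 1 <= lipc.
Proof. by rewrite /lipc -!addrA lerDl !addr_ge0. Qed.

Lemma path_close (w g w' g' : R -> R) r : 0 <= r ->
  (forall t, 0 <= t <= 1 -> `|w t - w' t| <= r /\ `|g t - g' t| <= r) ->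
  supclose (lipc * r) (path1 w g) (path1 w' g') /\ supclose (lipc * r) (path2 w g) (path2 w' g').
move=> r0 h;have gen (u t : R) : 0 <= t <= 1 -> `|u| <= lipc-1 -> `|u * w t+g t-(u * w' t+g' t)| <= lipc * r.
 move=> t01 hu;have [h1 h2]:= h t t01.
 have ->: u * w t+g t-(u * w' t+g' t) = u*(w t-w' t)+(g t-g' t) by ring.
 apply: (le_trans (ler_normD _ _));rewrite normrM.
 have ->: lipc * r = (lipc-1) * r+r by ring.
 by apply: lerD=> //;exact: ler_pM.
have na: `|a| <= lipc-1 by rewrite /lipc;have:= normr_ge0 b;have:= normr_ge0 c;lra.
have nb: `|b| <= lipc by rewrite /lipc;have:= normr_ge0 a;have:= normr_ge0 c;lra.
have nc: `|c| <= lipc-1 by rewrite /lipc;have:= normr_ge0 b;have:= normr_ge0 a;lra.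
split=> t t01;rewrite /dist2 ge_max gen// andbT /=;have [h1 _]:= h t t01.
 by apply: (le_trans h1);rewrite ler_peMl// lipc_ge1.
by rewrite -mulrBr normrM ler_pM.
Qed.

Lemma stepidx (k : nat) (t : R) : 0 <= t <= 1 -> (truncn (k%:R * t) <= k)%N.
move=> /andP[t0 t1];rewrite -[leqRHS](@natrK R);apply: le_truncn.
by rewrite ler_piMr.
Qed.

Lemma infconv_step_lip F M L (k : nat) : 0 <= L ->
  (forall x1 x2, cadlag x1 -> cadlag x2 -> `|F x1 x2| <= M) ->
  lipK (k.+1).*2 (L * lipc) (fun v => infconv F L (path1 (stepw k v) (stepg k v)) (path2 (stepw k v) (stepg k v))).
move=> L0 bd v v' r h r0.
have hc t: 0 <= t <= 1 -> `|stepw k v t-stepw k v' t| <= r /\ `|stepg k v t-stepg k v' t| <= r.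
 move=> /stepidx t01;split;apply: h;first by rewrite ltn_double ltnS t01.
 by rewrite doubleS ltnS ltnS leq_double (t01 k).
have [h1 h2]:= path_close r0 hc;rewrite -mulrA.
apply: (infconv_lip bd L0)=> //;rewrite mulr_ge0// (le_trans ler01)//;exact: lipc_ge1.
Qed.

Lemma sample_close (k : nat) (w g : R -> R) (e : R) : (0 < k)%N ->
  w 0 = 0 -> w 1 = 0 -> g 0 = 0 ->
  (forall s t, 0 <= s <= 1 -> 0 <= t <= 1 -> `|s - t| <= k%:R^-1 -> `|w s - w t| <= e /\ `|g s - g t| <= e) ->
  forall t, 0 <= t <= 1 -> `|w t - stepw k (sample k w g) t| <= e /\ `|g t - stepg k (sample k w g) t| <= e.
move=> k0 w0 w1 g0 h t t01;have kk: 0 < k%:R :> R by rewrite ltr0n.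
have /andP[t0 t1]:= t01.
set j:= truncn (k%:R * t);have jk: (j <= k)%N by exact: stepidx.
have kt0: 0 <= k%:R * t by rewrite mulr_ge0.
have /andP[j1 j2]:= truncn_itv kt0;rewrite -/j in j1 j2.
have s01: 0 <= (j%:R/k%:R : R) <= 1 by rewrite divr_ge0//= ler_pdivrMr// mul1r ler_nat.
have ts: `|t-j%:R/k%:R| <= k%:R^-1.
 have ->: t-j%:R/k%:R = (k%:R * t-j%:R)/k%:R by field;rewrite lt0r_neq0.
 rewrite ger0_norm ?divr_ge0 ?subr_ge0// ler_pdivrMr// mulVf ?lt0r_neq0//.
 by rewrite lerBlDl natr1 ltW.
have [hw hg]:= h t _ t01 s01 ts.
rewrite /stepw /stepg /sample -/j /= odd_double /= uphalf_double doubleK;split.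
 case: ifPn=> [/orP[/eqP j0|/eqP jk']|_] //;first by move: hw;rewrite j0 mul0r w0.
 by move: hw;rewrite jk' divff ?lt0r_neq0// w1.
by case: eqP=> [j0|_] //;move: hg;rewrite j0 mul0r g0.
Qed.
End StepPaths.

Section Cadlag.
Context {R : realType}.
Implicit Types f g : R -> R.

Definition cadlag1 f : Prop :=
  (forall t : R, 0 <= t < 1 -> f s @[s --> t^'+] --> f t) /\
  (forall t : R, 0 < t <= 1 -> exists l : R, f s @[s --> t^'-] --> l).

Lemma cadlag_pair f g : cadlag1 f -> cadlag1 g -> cadlag (fun t => (f t, g t)).
move=> [f1 f2] [g1 g2];split=> t ht;first exact: (cvg_pair (f1 t ht) (g1 t ht)).
have [l hl]:= f2 t ht;have [m hm]:= g2 t ht.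
by exists (l, m);exact: (cvg_pair hl hm).
Qed.

Lemma cadlag1D f g : cadlag1 f -> cadlag1 g -> cadlag1 (fun t => f t + g t).
move=> [f1 f2] [g1 g2];split=> t ht;first by apply: cvgD;[exact: f1|exact: g1].
have [l hl]:= f2 t ht;have [m hm]:= g2 t ht.
by exists (l+m);exact: cvgD.
Qed.

Lemma cadlag1Z c f : cadlag1 f -> cadlag1 (fun t => c * f t).
move=> [f1 f2];split=> t ht;first by apply: cvgMr;exact: f1.
by have [l hl]:= f2 t ht;exists (c * l);exact: cvgMr.
Qed.

Lemma continuous_cadlag1 f : {within `[0, 1], continuous f} -> cadlag1 f.
move/(continuous_within_itvP _ (@ltr01 R))=> [fi f0 f1];split=> t /andP[t0 t1].
 move: t0;rewrite le_eqVlt=> /predU1P[<-//|t0].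
 by apply: cvg_at_right_filter;apply: fi;rewrite in_itv/= t0.
exists (f t);move: t1;rewrite le_eqVlt=> /predU1P[->//|t1].
by apply: cvg_at_left_filter;apply: fi;rewrite in_itv/= t0.
Qed.

Lemma cadlag_path1 a (w g : R -> R) : cadlag1 w -> cadlag1 g -> cadlag (path1 a w g).
Proof. by move=> cw cg;apply: cadlag_pair=> //;apply: cadlag1D=> //;exact: cadlag1Z. Qed.

Lemma cadlag_path2 b c (w g : R -> R) : cadlag1 w -> cadlag1 g -> cadlag (path2 b c w g).
Proof. by move=> cw cg;apply: cadlag_pair;[exact: cadlag1Z|apply: cadlag1D=> //;exact: cadlag1Z]. Qed.
End Cadlag.

(** * Weak convergence from samples and step approximation *)

Section Portmanteau.
Context {R : realType} {d : measure_display} {Omega : measurableType d}.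
Variables (P : probability Omega R) (w g : Omega -> R -> R) (a b c : R).
Hypotheses (mw : forall t, mfunT (w ^~ t)) (mg : forall t, mfunT (g ^~ t)).
Hypotheses (cw : forall o, {within `[0, 1], continuous (w o)}) (cg : forall o, {within `[0, 1], continuous (g o)}).
Hypotheses (w0 : forall o, w o 0 = 0) (w1 : forall o, w o 1 = 0) (g0 : forall o, g o 0 = 0).
Variables (S : Type) (E : nat -> (S -> R) -> R) (X1 X2 : nat -> S -> R -> R * R) (V : nat -> nat -> S -> nat -> R).
Hypothesis avgE : \forall n \near \oo, average (E n).
Hypothesis cadX : forall n s, cadlag (X1 n s) /\ cadlag (X2 n s).

Definition stepclose (k n : nat) (e : R) (s : S) : Prop :=
  supclose e (X1 n s) (path1 a (stepw k (V k n s)) (stepg k (V k n s))) /\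
  supclose e (X2 n s) (path2 b c (stepw k (V k n s)) (stepg k (V k n s))).

Hypothesis close : forall e : R, 0 < e -> exists k0, forall k, (k0 <= k)%N ->
  \forall n \near \oo, E n (fun s => \1_(~` [set s | stepclose k n e s]) s) <= e.
Hypothesis fdd : forall k L M Phi, (0 < k)%N -> 0 <= L -> 0 <= M -> lipK (k.+1).*2 L Phi -> (forall x, `|Phi x| <= M) ->
  E n (fun s => Phi (V k n s)) @[n --> \oo] --> Ex P (fun o => Phi (sample k (w o) (g o))).

Let Y1 o := path1 a (w o) (g o).
Let Y2 o := path2 b c (w o) (g o).
Let cY1 o : cadlag (Y1 o). Proof. by apply: cadlag_path1;exact: continuous_cadlag1. Qed.
Let cY2 o : cadlag (Y2 o). Proof. by apply: cadlag_path2;exact: continuous_cadlag1. Qed.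

Section Functional.
Variables (F : (R -> R * R) -> (R -> R * R) -> R) (M : R).
Hypothesis bdF : forall x1 x2, cadlag x1 -> cadlag x2 -> `|F x1 x2| <= M.
Hypothesis cF : bdd_cont_DD F.

Let M0 : 0 <= M. Proof. by apply: le_trans (bdF (cadlag_cst (0, 0)) (cadlag_cst (0, 0))). Qed.

Definition stepF (L : R) (k : nat) (v : nat -> R) : R :=
  infconv F L (path1 a (stepw k v) (stepg k v)) (path2 b c (stepw k v) (stepg k v)).

Lemma sample_meas k i : mfunT (fun o => sample k (w o) (g o) i).
Proof. rewrite /sample;case: (odd i)=> /=.
 by case: (i./2 == 0%N);[exact: measurable_cst|exact: mg].
by case: ((i./2 == 0%N) || (i./2 == k));[exact: measurable_cst|exact: mw]. Qed.

Lemma stepF_cvg L o : 0 <= L -> stepF L k (sample k (w o) (g o)) @[k --> \oo] --> infconv F L (Y1 o) (Y2 o).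
move=> L0;apply/cvgrPdist_le=> e e0.
pose r:= e/((L+1) * lipc a b c).
have lc: 0 < lipc a b c by apply: lt_le_trans (lipc_ge1 _ _ _).
have r0: 0 < r by rewrite divr_gt0// mulr_gt0// ltr_wpDl.
have [d1 d10 h1]:= segment_unif (@cw o) (e:= r) r0;have [d2 d20 h2]:= segment_unif (@cg o) (e:= r) r0.
near=> k.
have k0: (0 < k)%N by near: k;exact: nbhs_infty_gt.
have kk: 0 < k%:R :> R by rewrite ltr0n.
have k1: d1^-1 <= k%:R by near: k;exact: nbhs_infty_ger.
have k2: d2^-1 <= k%:R by near: k;exact: nbhs_infty_ger.
have i1: k%:R^-1 <= d1 by rewrite -[leRHS]invrK lef_pV2 ?posrE ?invr_gt0.
have i2: k%:R^-1 <= d2 by rewrite -[leRHS]invrK lef_pV2 ?posrE ?invr_gt0.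
have hc:= sample_close k0 (w0 o) (w1 o) (g0 o) (fun s t s01 t01 st=> conj (h1 s t s01 t01 (le_trans st i1)) (h2 s t s01 t01 (le_trans st i2))).
have [s1 s2]:= path_close a b c (ltW r0) hc.
have lr: 0 <= lipc a b c * r by rewrite mulr_ge0// ltW.
apply: (le_trans (infconv_lip bdF L0 lr s1 s2)).
have ->: L*(lipc a b c * r) = L/(L+1) * e by rewrite /r;field;rewrite !lt0r_neq0// ltr_wpDl.
by rewrite ler_piMl ?(ltW e0)// ler_pdivrMr ?mul1r ?ltr_wpDl// lerDl.
Unshelve. all: end_near. Qed.

Lemma stepF_limit L : 0 <= L -> bmfun (fun o => infconv F L (Y1 o) (Y2 o)) /\
  Ex P (fun o => stepF L k (sample k (w o) (g o))) @[k --> \oo] --> Ex P (fun o => infconv F L (Y1 o) (Y2 o)).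
move=> L0;apply: (Ex_dominated P (C:= M+L)).
- move=> k;have lip:= infconv_step_lip a b c (k:= k) L0 bdF.
 apply: (lipK_measurable (sample_meas k) _ lip).
 by rewrite mulr_ge0// (le_trans ler01)// lipc_ge1.
- by move=> k o;exact: infconv_bound.
- by move=> o;exact: stepF_cvg.
Qed.

(** Measurability of [F] along the limit paths has to be produced: it is a pointwise limit of
    inf-convolutions, themselves limits of Lipschitz functions of finitely many samples. Bounded
    convergence gives the expectations as well. *)
Lemma infconv_limit : bmfun (fun o => F (Y1 o) (Y2 o)) /\
  Ex P (fun o => infconv F m%:R (Y1 o) (Y2 o)) @[m --> \oo] --> Ex P (fun o => F (Y1 o) (Y2 o)).
apply: (Ex_dominated P (C:= M)).
- by move=> m;have [[]]:= stepF_limit (ler0n R m).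
- move=> m o;have /andP[h1 h2]:= infconv_le bdF (ler0n R m) (cY1 o) (cY2 o).
 rewrite ler_norml h1/=;apply: (le_trans h2);have:= bdF (cY1 o) (cY2 o).
 by rewrite ler_norml=> /andP[].
- by move=> o;exact: (infconv_cvg bdF cF (cY1 o) (cY2 o)).
Qed.

(** [F] dominates its inf-convolution, which is Lipschitz for the sup distance and hence close to
    [stepF] unless the step approximation fails; in that case the bound M + L is paid twice. Applied
    to - F, the lemma also gives the upper bound. *)
Lemma portmanteau_lower (e : R) : 0 < e -> \forall n \near \oo,
  Ex P (fun o => F (Y1 o) (Y2 o)) - e <= E n (fun s => F (X1 n s) (X2 n s)).
move=> e0;have e4: 0 < e/4 by rewrite divr_gt0.
have [_ /cvgrPdist_le /(_ _ e4) [m0 _ /(_ m0 (leqnn _)) hm]]:= infconv_limit.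
set L : R:= m0%:R in hm;have L0: 0 <= L by [].
have [_ /cvgrPdist_le /(_ _ e4) [k1 _ hk1]]:= stepF_limit L0.
(* [q] bounds both the distance and the probability of failure; the denominator gathers the costs L
   and 2(M+L) of the two. *)
pose q:= e/4/(L+2*(M+L)+1).
have q10: 0 < L+2*(M+L)+1 by rewrite ltr_wpDl// addr_ge0// mulr_ge0// addr_ge0.
have q0: 0 < q by rewrite divr_gt0.
have [k0 hk0]:= close q0.
pose k:= maxn 1 (maxn k0 k1).
have k_gt0: (0 < k)%N by rewrite leq_max.
have /hk0 hc : (k0 <= k)%N by rewrite !leq_max leqnn orbT.
have /hk1 h2 : (k1 <= k)%N by rewrite !leq_max leqnn !orbT.
have lip:= infconv_step_lip a b c (k:= k) L0 bdF.
have LL: 0 <= L * lipc a b c by rewrite mulr_ge0// (le_trans ler01)// lipc_ge1.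
have ML: 0 <= M+L by rewrite addr_ge0.
have:= fdd k_gt0 LL ML lip (fun v=> infconv_bound bdF L0 _ _).
move=> /cvgrPdist_le /(_ _ e4) hf.
near=> n.
have an: average (E n) by near: n;exact: avgE.
have [ED EZ Ele E1]:= an.
have h3: `|Ex P (fun o=> stepF L k (sample k (w o) (g o)))-E n (fun s=> stepF L k (V k n s))| <= e/4.
 by near: n;exact: hf.
have h4: E n (fun s=> \1_(~` [set s | stepclose k n q s]) s) <= q by near: n;exact: hc.
have h5: E n (fun s=> stepF L k (V k n s))-e/4 <= E n (fun s=> F (X1 n s) (X2 n s)).
 pose bad s : R:= \1_(~` [set s | stepclose k n q s]) s.
 have : E n (fun s=> stepF L k (V k n s)+(- (L * q)+(- (2*(M+L))) * bad s)) <= E n (fun s=> F (X1 n s) (X2 n s)).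
  apply: Ele=> s;have [c1 c2]:= cadX n s.
  have /andP[_ hF]:= infconv_le bdF L0 c1 c2;apply: le_trans hF.
  rewrite /bad indicE;case: (boolP (s \in _))=> hs /=.
   have:= infconv_bound bdF L0 (X1 n s) (X2 n s).
   have:= infconv_bound bdF L0 (path1 a (stepw k (V k n s)) (stepg k (V k n s))) (path2 b c (stepw k (V k n s)) (stepg k (V k n s))).
   rewrite -/(stepF L k (V k n s)) !ler_norml=> /andP[_ u1] /andP[u2 _].
   have Lq: 0 <= L * q by rewrite mulr_ge0// ltW.
   by rewrite mulr1;lra.
  have [s1 s2] : stepclose k n q s.
   by apply: contrapT=> hn;move/negP: hs;apply;exact/mem_set.
  have:= infconv_lip bdF L0 (ltW q0) s1 s2;rewrite -/(stepF L k (V k n s)) ler_norml=> /andP[u1 _].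
  by rewrite mulr0 addr0;lra.
 rewrite ED ED EZ average_cst//;apply: le_trans;rewrite lerD2l.
 have : L * q+2*(M+L)*E n bad <= e/4;last by lra.
 apply: (le_via (L * q+2*(M+L) * q)).
  by rewrite lerD2l ler_wpM2l// mulr_ge0.
 have ->: L * q+2*(M+L) * q = (L+2*(M+L))/(L+2*(M+L)+1)*(e/4).
  by rewrite /q;field;rewrite lt0r_neq0.
 by rewrite ler_piMl ?(ltW e4)// ler_pdivrMr// mul1r lerDl.
have {}hm : `|Ex P (fun o=> F (Y1 o) (Y2 o))-Ex P (fun o=> infconv F L (Y1 o) (Y2 o))| <= e/4 by exact: hm.
have {}h2 : `|Ex P (fun o=> infconv F L (Y1 o) (Y2 o))-Ex P (fun o=> stepF L k (sample k (w o) (g o)))| <= e/4 by exact: h2.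
move: hm h2 h3 h5;rewrite !ler_norml=> /andP[_ y1] /andP[_ y2] /andP[_ y3] y4.
by lra.
Unshelve. all: end_near. Qed.
End Functional.

Theorem portmanteau F : bdd_cont_DD F -> bmfun (fun o => F (Y1 o) (Y2 o)) /\
  E n (fun s => F (X1 n s) (X2 n s)) @[n --> \oo] --> Ex P (fun o => F (Y1 o) (Y2 o)).
move=> cF;have [[M bdF] ctF]:= cF;have [bF _]:= infconv_limit bdF cF;split=> //.
pose F' x1 x2:= - F x1 x2.
have bdF' x1 x2: cadlag x1 -> cadlag x2 -> `|F' x1 x2| <= M by move=> c1 c2;rewrite normrN;exact: bdF.
have cF': bdd_cont_DD F'.
 split;first by exists M.
 move=> x1 x2 c1 c2 e e0;have [dl d0 h]:= ctF _ _ c1 c2 e e0;exists dl=> // y1 y2 k1 k2 j1 j2.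
 by rewrite /F' -opprD normrN;exact: h.
apply/cvgrPdist_le=> e e0.
have l1:= portmanteau_lower bdF cF e0;have l2:= portmanteau_lower bdF' cF' e0.
near=> n.
have an: average (E n) by near: n;exact: avgE.
have [ED EZ Ele E1]:= an.
have h1: Ex P (fun o=> F (Y1 o) (Y2 o))-e <= E n (fun s=> F (X1 n s) (X2 n s)) by near: n;exact: l1.
have h2: Ex P (fun o=> F' (Y1 o) (Y2 o))-e <= E n (fun s=> F' (X1 n s) (X2 n s)) by near: n;exact: l2.
have e1: Ex P (fun o=> F' (Y1 o) (Y2 o)) = - Ex P (fun o=> F (Y1 o) (Y2 o)).
 by rewrite -mulN1r -ExZ//;congr Ex;apply/funext=> o;rewrite mulN1r.
have e2: E n (fun s=> F' (X1 n s) (X2 n s)) = - E n (fun s=> F (X1 n s) (X2 n s)).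
 by rewrite -mulN1r -EZ;congr (E n);apply/funext=> s;rewrite mulN1r.
rewrite e1 e2 in h2;rewrite ler_norml;apply/andP;split;lra.
Unshelve. all: end_near. Qed.
End Portmanteau.

(** * The spine of a vertex *)

Section Stack.

(* The stack lists, from the current vertex up to the root, the numbers of unvisited
   right siblings: its size is the depth and its sum the value of the Lukasiewicz path. *)
Fixpoint dec (st : seq nat) : option (seq nat) :=
  if st is r :: st' then (if r is r'.+1 then Some (r' :: st') else dec st') else None.

Definition push (st : seq nat) (d : nat) : option (seq nat) :=
  if d is d'.+1 then Some (d' :: st) else dec st.

Fixpoint run (o : option (seq nat)) (s : seq nat) : option (seq nat) :=
  if s is d :: s' then run (obind (push^~ d) o) s' else o.

Lemma run_None s : run None s = None.
Proof. by elim: s. Qed.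

Lemma dec_sumn st : dec st = if (0 < sumn st)%N then dec st else None.
Proof. by elim: st=> [//|[|r] st IH]. Qed.

Lemma dec_pred st st' : dec st = Some st' -> (sumn st = (sumn st').+1)%N.
Proof. by elim: st=> [//|[|r] st IH] /=;[rewrite add0n|move=> [<-] /=;rewrite addSn]. Qed.

Lemma dec_some st : (0 < sumn st)%N -> exists st', dec st = Some st'.
Proof. by elim: st=> [//|[|r] st IH] /= h;[exact: IH|exists (r :: st)]. Qed.

Lemma run_alive st s : run (Some st) s = None <-> ~~ alive (sumn st).+1 s.
elim: s st=> [|d s IH] st //=.
case: d=> [|d] /=;last by rewrite IH /= addnS addnC.
rewrite addn0;have [s0|s0]:= posnP (sumn st).
 by rewrite dec_sumn s0 ltnn run_None;split=> // _;case: (s).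
have [st' h]:= dec_some s0;rewrite h IH;have:= dec_pred h=> ->;by [].
Qed.

Lemma run_pend st s st' : run (Some st) s = Some st' -> pend (sumn st).+1 s = (sumn st').+1.
elim: s st=> [|d s IH] st /=;first by move=> [->].
case: d=> [|d] /=;last by move=> /IH;rewrite /pend /= addnS addnC.
case h : (dec st)=> [st1|];last by rewrite run_None.
by move=> /IH;rewrite /pend /= addn0 (dec_pred h).
Qed.

Lemma run_cat o s t : run o (s ++ t) = run (run o s) t.
Proof. by elim: s o=> [//|d s IH] o /=;rewrite IH. Qed.

(** The [j] top entries of [st] contain all those missing from [st']. At some intermediate step [i]
    the walk has dropped by at least their sum, so with small oscillations little can have left the
    stack. *)
Lemma run_pop st u st' : run (Some st) u = Some st' -> exists (j i : nat) (sti : seq nat),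
  [/\ (j <= size st)%N, (size st <= size st' + j)%N, (i <= size u)%N,
      run (Some st) (take i u) = Some sti & (sumn (take j st) + sumn sti <= sumn st)%N].
elim: u st=> [|d u IH] st /=.
 by move=> [<-];exists 0%N, 0%N, st;rewrite take0 /=;split=> //;lia.
case: d=> [|d] /=;last first.
 move=> h;have [j [i [sti [j1 j2 i1 r1 s1]]]]:= IH _ h.
 case: j j1 j2 s1=> [|j] /= j1 j2 s1.
  by exists 0%N, 0%N, st;rewrite !take0 /=;split=> //;lia.
 by exists j, i.+1, sti;split=> //=;lia.
case E1 : (dec st)=> [st1|];last by rewrite run_None.
move=> h;have [j [i [sti [j1 j2 i1 r1 s1]]]]:= IH _ h.
have dj: exists a : nat, [/\ (a <= size st)%N, (size st1+a = size st)%N, sumn (take a st) = 0%N &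
  forall j', (j' < size st1)%N -> sumn (take (a+j'.+1) st) = (sumn (take j'.+1 st1)).+1].
 elim: (st) E1=> [//|[|r] st0 IH0] /=.
  by move=> /IH0[a [a1 a2 a3 a4]];exists a.+1;split=> //=;lia.
 by move=> [<-];exists 0%N;split=> //=;lia.
have [a [a1 a2 a3 a4]]:= dj;have es:= dec_pred E1.
case: j j1 j2 s1=> [|j] j1 j2 s1.
 by exists a, 0%N, st;rewrite a3;split=> //;lia.
by exists (a+j.+1)%N, i.+1, sti;rewrite a4//;split=> //=;rewrite ?E1//;lia.
Qed.
End Stack.

(** * Green function of the stack process *)

Section Green.
Context {R : realType}.
Variable (mu : nat -> R).
Hypothesis mu_ge0 : forall k, 0 <= mu k.
Implicit Types Psi : seq nat -> R.

(** The law of the number of right siblings along the spine: size-biased offspring with a uniform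
    rank. Without the cutoff [N], a critical law gives total mass 1 and mean sigma^2/2. *)
Definition mubar (N r : nat) : R := \sum_(i < N | (r < i)%N) mu i.

Lemma mubar_ge0 N r : 0 <= mubar N r.
Proof. by apply: sumr_ge0. Qed.

Lemma mubar_sum N (f : nat -> R) : \sum_(r < N) mubar N r * f r = \sum_(i < N) mu i * \sum_(r < i) f r.
rewrite /mubar;under eq_bigr do rewrite big_mkcond mulr_suml.
rewrite exchange_big;apply: eq_bigr=> i _;rewrite mulr_sumr (big_ord_widen N (fun r=> mu i * f r) (ltnW (ltn_ord i))).
by rewrite [RHS]big_mkcond;apply: eq_bigr=> r _;case: ifP;rewrite ?mul0r.
Qed.

Fixpoint visits N K (Psi : seq nat -> R) (o : option (seq nat)) : R :=
  if o is Some st then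
    if K is K'.+1 then Psi st + \sum_(d < N) mu d * visits N K' Psi (push st d) else 0
  else 0.

Lemma visits_psum N K Psi o : \sum_(k < K) psum mu N k (fun s => oapp Psi 0 (run o s)) = visits N K Psi o.
elim: K o=> [|K IH] o;first by rewrite big_ord0;case: o.
rewrite big_ord_recl /=;case: o=> [st|] /=;last first.
 rewrite add0r big1// => k _;rewrite big1// => d _.
 by rewrite (@eq_psum _ _ _ _ _ (fun=> 0)) ?psum0 ?mulr0// => s _ _;rewrite run_None.
congr (_+_);rewrite exchange_big;apply: eq_bigr=> d _ /=.
by rewrite -IH mulr_sumr.
Qed.

(* Pushing the entry r uses a degree greater than r, and the r.+1-th child subtree starts
   again from an empty stack on top of r :: st. *)
Definition greenB N K Psi (st : seq nat) : R := \sum_(h < K) psum (mubar N) N h (fun t => Psi (t ++ st)).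

Fixpoint rests N K Psi (st : seq nat) : R :=
  if st is r :: st' then \sum_(r' < r) greenB N K Psi (nat_of_ord r' :: st') + rests N K Psi st' else 0.

Lemma greenB_ge0 N K Psi st : (forall t, 0 <= Psi t) -> 0 <= greenB N K Psi st.
Proof. by move=> P0;apply: sumr_ge0=> h _;apply: psum_ge0=> // r;exact: mubar_ge0. Qed.

Lemma greenB_mono N K Psi st : (forall t, 0 <= Psi t) -> greenB N K Psi st <= greenB N K.+1 Psi st.
move=> P0;rewrite /greenB big_ord_recr /= lerDl;apply: psum_ge0=> // r;exact: mubar_ge0.
Qed.

Lemma rests_mono N K Psi st : (forall t, 0 <= Psi t) -> rests N K Psi st <= rests N K.+1 Psi st.
move=> P0;elim: st=> [//|r st IH] /=;apply: lerD=> //;apply: ler_sum=> r' _;exact: greenB_mono.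
Qed.

Lemma rests_ge0 N K Psi st : (forall t, 0 <= Psi t) -> 0 <= rests N K Psi st.
move=> P0;elim: st=> [//|r st IH] /=;apply: addr_ge0=> //;apply: sumr_ge0=> r' _;exact: greenB_ge0.
Qed.

Lemma greenB_rec N K Psi st :
  Psi st + \sum_(r < N) mubar N r * greenB N K Psi (nat_of_ord r :: st) = greenB N K.+1 Psi st.
rewrite /greenB big_ord_recl;congr (_+_).
under eq_bigr do rewrite mulr_sumr;rewrite exchange_big;apply: eq_bigr=> h _.
rewrite lift0 psum_rcons psum_sum;apply: eq_bigr=> r _;rewrite -psumZ.
by apply: eq_psum=> t _ _;rewrite cat_rcons.
Qed.

(** [rests] accounts for the subtrees still to be explored, one for each unvisited sibling in the
    stack. A degree [d] opens [d] subtrees, and averaging over [d] produces [mubar]. *)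
Lemma visits_le N K Psi st : (forall t, 0 <= Psi t) -> \sum_(k < N) mu k <= 1 ->
  visits N K Psi (Some st) <= greenB N K Psi st + rests N K Psi st.
move=> P0 m1;elim: K st=> [|K IH] st /=.
 by rewrite addr_ge0 ?greenB_ge0 ?rests_ge0.
rewrite -greenB_rec -addrA lerD2l.
have ext d: visits N K Psi (push st d) <= \sum_(r < d) greenB N K Psi (nat_of_ord r :: st)+rests N K Psi st.
 case: d=> [|d] /=;last first.
  by apply: (le_trans (IH _));rewrite /= big_ord_recr /=;rewrite addrA [X in X+_ <= _]addrC.
 rewrite big_ord0 add0r;elim: (st)=> [|[|r] st' IHs] /=;first by case: (K).
  by rewrite big_ord0 add0r.
 by apply: (le_trans (IH _));rewrite /= big_ord_recr /= addrA [X in X+_ <= _]addrC.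
apply: (le_via (\sum_(d < N) mu d*(\sum_(r < d) greenB N K Psi (nat_of_ord r :: st)+rests N K Psi st))).
 by apply: ler_sum=> d _;exact: ler_wpM2l.
under eq_bigr do rewrite mulrDr;rewrite big_split /= -mulr_suml.
rewrite -(mubar_sum N (fun r=> greenB N K Psi (r :: st))) lerD2l.
apply: le_trans (rests_mono N K st P0);rewrite ler_piMl// rests_ge0//.
Qed.

(** A many-to-one bound: summed over time, the random stack is replaced by words of independent
    [mubar] entries, so estimates on the spine reduce to sums of independent variables. *)
Theorem green_bound N K Psi : (forall t, 0 <= Psi t) -> \sum_(k < N) mu k <= 1 ->
  \sum_(k < K) psum mu N k (fun s => oapp Psi 0 (run (Some [::]) s)) <=
  \sum_(h < K) psum (mubar N) N h Psi.
move=> P0 m1;rewrite visits_psum;apply: (le_trans (visits_le K [::] P0 m1)).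
rewrite /= addr0;apply: ler_sum=> h _;apply: psum_ler=> [r|t _ _];first exact: mubar_ge0.
by rewrite cats0.
Qed.
End Green.

(** * Deviations for the entries of the spine *)

Section SpineLaw.
Context {R : realType}.
Variables (mu : nat -> R) (V1 : R).
Variables (sig2 : R).
Hypothesis crit : critical_law mu V1 sig2.
Hypothesis sig2_gt0 : 0 < sig2.

Notation half := (sig2 / 2).

Lemma mubar_le1 N : \sum_(r < N) mubar mu N r <= 1.
have:= mubar_sum mu N (fun=> 1);under eq_bigr do rewrite mulr1;move=> ->.
apply: le_trans (mean_le1 crit N);apply: ler_sum=> i _.
by rewrite sumr_const card_ord.
Qed.

Lemma sum_ord_id (i : nat) : \sum_(r < i) (r%:R : R) = i%:R * (i%:R - 1) / 2.
elim: i=> [|i IH];first by rewrite big_ord0 !mul0r.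
by rewrite big_ord_recr /= IH -natr1;field.
Qed.

Lemma cvg_binom : mlim mu (fun i => \sum_(r < i) (r%:R : R)) half.
have ->: msum mu (fun i=> \sum_(r < i) (r%:R : R)) =
  (fun N=> (msum mu (fun k=> (k%:R-1)^+2) N+msum mu (fun k=> k%:R-1) N)*2^-1).
 apply/funext=> N;rewrite /msum -big_split /= mulr_suml;apply: eq_bigr=> i _.
 by rewrite sum_ord_id;field.
by apply: cvgMl;rewrite -[X in _ --> X]addr0;exact: cvgD (law_zeta2 crit) (law_zeta crit).
Qed.

Lemma mubar_mean_le N : \sum_(r < N) mubar mu N r * r%:R <= half.
rewrite (mubar_sum mu N (fun r=> r%:R));apply: (msum_lim_ge (law_ge0 crit) N _ cvg_binom).
by move=> i;apply: sumr_ge0.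
Qed.

Lemma mubar_trunc e : 0 < e -> exists L : nat, (0 < L)%N /\ forall N, (L <= N)%N ->
  half - e <= \sum_(r < N) mubar mu N r * (minn r L)%:R.
move=> e0;have /cvgrPdist_le /(_ _ e0) [L0 _ h]:= cvg_binom.
exists L0.+1;split=> // N LN;have:= h L0.+1 (leqnSn _);rewrite ler_norml=> /andP[_ h1].
rewrite (mubar_sum mu N (fun r=> (minn r L0.+1)%:R));apply: (le_via (msum mu (fun i=> \sum_(r < i) (r%:R : R)) L0.+1));first lra.
rewrite /msum (big_ord_widen N (fun i=> mu i * \sum_(r < i) (r%:R : R)) LN) big_mkcond /=.
apply: ler_sum=> i _;case: ifP=> iL;last by rewrite mulr_ge0// sumr_ge0.
apply: ler_wpM2l=> //;apply: ler_sum=> r _;rewrite ler_nat.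
by have /minn_idPl -> : (r <= L0.+1)%N by apply: ltnW;exact: ltn_trans (ltn_ord r) iL.
Qed.

Lemma expR_quad (y : R) : y <= 2^-1 -> expR y <= 1 + y + 2 * y ^+ 2.
move=> y2;have y1: 0 < 1-y by lra.
have h:= expR_ge1Dx (- y);have p:= expR_gt0 (- y).
have ->: expR y = (expR (- y))^-1 by rewrite expRN invrK.
apply: (le_via (1-y)^-1);first by rewrite lef_pV2.
rewrite -[leRHS]mulr1 -[X in _*X](divff (lt0r_neq0 y1)) mulrA ler_pdivlMr// mulVf ?lt0r_neq0//.
have ->: (1+y+2 * y^+2)*(1-y) = 1+y^+2*(1-2 * y) by ring.
by rewrite lerDl mulr_ge0 ?sqr_ge0//;lra.
Qed.

Lemma natr_sumn (s : seq nat) : (sumn s)%:R = \sum_(r <- s) r%:R :> R.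
Proof. by rewrite sumnE natr_sum. Qed.

Definition low (e : R) (j : nat) (t : seq nat) : bool := (sumn t)%:R <= (half - e) * j%:R.

(** Entries are nonnegative and may be truncated at [L], so lower deviations are exponentially small
    even with a single moment; [th] is chosen so that the quadratic term costs half of the gain. *)
Lemma mubar_lower e : 0 < e -> exists (c : R) (N0 : nat), 0 < c /\ forall N j, (N0 <= N)%N ->
  psum (mubar mu N) N j (fun t => (low e j t)%:R) <= expR (- (c * j%:R)).
move=> e0;have e2: 0 < e/2 by rewrite divr_gt0.
have [L [L0 hL]]:= mubar_trunc e2;have LL: 0 < L%:R :> R by rewrite ltr0n.
pose th:= e/(8*L%:R^+2);have th0: 0 < th by rewrite divr_gt0// mulr_gt0// exprn_gt0.
exists (th * e/4), L;split=> [|N j LN];first by rewrite divr_gt0// mulr_gt0.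
have step: \sum_(r < N) mubar mu N r * expR (th*(half-e-r%:R)) <= expR (- (th * e/4)).
 have b r: expR (- (th * r%:R)) <= 1+2 * th^+2*L%:R^+2-th*(minn r L)%:R.
  apply: (le_via (expR (- (th*(minn r L)%:R)))).
   by rewrite ler_expR lerN2 ler_pM2l// ler_nat geq_minl.
  apply: (le_trans (expR_quad _)).
   by apply: (le_via 0);rewrite ?invr_ge0// oppr_le0 mulr_ge0// ltW.
  have q: (th*(minn r L)%:R)^+2 <= th^+2*L%:R^+2.
   by rewrite exprMn ler_wpM2l ?sqr_ge0// lerXn2r ?nnegrE// ler_nat geq_minr.
  rewrite sqrrN;have ->: 2 * th^+2*L%:R^+2 = 2*(th^+2*L%:R^+2) by ring.
  by move: q;set x:= th * _;move: (_^+2 * _) (x^+2)=> A B q;lra.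
 apply: (le_via (expR (th*(half-e)) * \sum_(r < N) mubar mu N r*(1+2 * th^+2*L%:R^+2-th*(minn r L)%:R))).
  rewrite mulr_sumr;apply: ler_sum=> r _.
  rewrite mulrBr expRD [leRHS]mulrCA ler_wpM2l ?mubar_ge0// ler_wpM2l ?expR_ge0//.
 have : \sum_(r < N) mubar mu N r*(1+2 * th^+2*L%:R^+2-th*(minn r L)%:R) <= 1+2 * th^+2*L%:R^+2-th*(half-e/2).
  rewrite (eq_bigr (fun r : 'I_N=> mubar mu N r*(1+2 * th^+2*L%:R^+2)-th*(mubar mu N r*(minn r L)%:R)));last by move=> r _;ring.
  rewrite sumrB -mulr_suml -mulr_sumr.
  apply: lerB;last by rewrite ler_pM2l//;exact: hL.
  apply: ler_piMl;last exact: mubar_le1.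
  by apply: addr_ge0=> //;apply: mulr_ge0;[apply: mulr_ge0=> //;exact: sqr_ge0|exact: sqr_ge0].
 move=> h;apply: (le_via (expR (th*(half-e)) * expR (2 * th^+2*L%:R^+2-th*(half-e/2)))).
  rewrite ler_wpM2l ?expR_ge0//;apply: (le_trans h).
  by have:= expR_ge1Dx (2 * th^+2*L%:R^+2-th*(half-e/2));lra.
 rewrite -expRD ler_expR.
 have ->: th*(half-e)+(2 * th^+2*L%:R^+2-th*(half-e/2)) = - (th * e/2)+2 * th*(th*L%:R^+2) by field.
 have ->: th*L%:R^+2 = e/8 by rewrite /th;field;rewrite lt0r_neq0.
 have ->: 2 * th*(e/8) = th * e/4 by field.
 by lra.
apply: (le_via (psum (mubar mu N) N j (fun t=> \prod_(r <- t) expR (th*(half-e-r%:R))))).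
 apply: psum_ler=> [r|t st _];first exact: mubar_ge0.
 have ->: \prod_(r <- t) expR (th*(half-e-r%:R)) = expR (th*((half-e) * j%:R-(sumn t)%:R)).
  rewrite -st natr_sumn;elim: t {st}=> [|r t IH];first by rewrite !big_nil mulr0 subr0 mulr0 expR0.
  by rewrite !big_cons IH -expRD;congr expR;rewrite /= -natr1;ring.
 case: (boolP (low e j t))=> h;last exact: expR_ge0.
 by apply: le_trans (expR_ge1Dx _);rewrite lerDl mulr_ge0 ?(ltW th0)// subr_ge0.
rewrite psum_prod;apply: (le_via (expR (- (th * e/4))^+j)).
 by rewrite lerXn2r ?nnegrE ?expR_ge0// sumr_ge0// => r _;rewrite mulr_ge0 ?mubar_ge0 ?expR_ge0.
by rewrite -expRM_natr mulNr.
Qed.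

(** All top segments of length at least [J] are watched, not only the whole stack, because it is a
    top segment that may be popped later. *)
Definition thin (e : R) (J : nat) (st : seq nat) : bool :=
  has (fun j => (J <= j)%N && low e j (take j st)) (iota 0 (size st).+1).

Lemma mubar_thin e : 0 < e -> exists (c : R) (N0 : nat), 0 < c /\ forall N h J, (N0 <= N)%N ->
  psum (mubar mu N) N h (fun t => (thin e J t)%:R) <= h.+1%:R * expR (- (c * J%:R)).
move=> e0;have [c [N0 [c0 hc]]]:= mubar_lower e0;exists c, N0;split=> // N h J NN.
apply: (le_via (psum (mubar mu N) N h (fun t=> \sum_(j < h.+1) ((J <= j)%N && low e j (take j t))%:R))).
 apply: psum_ler=> [r|t st _];first exact: mubar_ge0.
 rewrite /thin st;case: hasP=> [[j]|_];last by apply: sumr_ge0.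
 rewrite mem_iota /= add0n=> jh hj;rewrite (bigD1 (Ordinal jh)) //= hj lerDl.
 by apply: sumr_ge0.
rewrite psum_sum;apply: (le_via (\sum_(j < h.+1) expR (- (c*J%:R))));last first.
 by rewrite sumr_const card_ord mulr_natl.
apply: ler_sum=> j _;case: (leqP J j)=> Jj /=;last by rewrite psum0 expR_ge0.
have jh: (j <= h)%N by rewrite -ltnS.
case: j Jj jh=> j jlt /= Jj jh;rewrite -(subnKC jh).
apply: le_trans (_ : psum (mubar mu N) N j (fun t=> (low e j t)%:R) <= _).
 apply: (psum_take j (h-j) (F:= fun t=> (low e j t)%:R))=> //.
 - by move=> r;exact: mubar_ge0.
 - exact: mubar_le1.
apply: (le_trans (hc _ _ NN));by rewrite ler_expR lerN2 ler_pM2l// ler_nat.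
Qed.

Lemma psum_sum_le (w : nat -> R) N h (g : nat -> R) : (forall k, 0 <= w k) -> \sum_(k < N) w k <= 1 -> (forall k, 0 <= g k) ->
  psum w N h (fun t => \sum_(r <- t) g r) <= h%:R * \sum_(k < N) w k * g k.
move=> w0 w1 g0;elim: h=> [|h IH];first by rewrite /= big_nil mul0r.
have G0: 0 <= \sum_(k < N) w k * g k by apply: sumr_ge0=> k _;rewrite mulr_ge0.
rewrite /= (eq_bigr (fun k : 'I_N=> w k * g k*(\sum_(i < N) w i)^+h+w k * psum w N h (fun t=> \sum_(r <- t) g r)));last first.
 move=> k _;rewrite (@eq_psum _ _ _ _ _ (fun t=> g k + \sum_(r <- t) g r));last by move=> t _ _;rewrite big_cons.
 by rewrite psumD psum_cst;ring.
rewrite big_split /= -!mulr_suml -natr1 mulrDl mul1r addrC;apply: lerD.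
 apply: le_trans IH;rewrite ler_piMl//;apply: psum_ge0=> // t _ _;exact: sumr_ge0.
by rewrite ler_piMr// exprn_ile1// sumr_ge0.
Qed.

Lemma expR_inv_le (x : R) : 0 < x -> expR (- x) <= x^-1.
move=> x0;rewrite expRN lef_pV2 ?posrE ?expR_gt0//.
by have:= expR_ge1Dx x;lra.
Qed.

Definition fat (n : nat) (e : R) (t : seq nat) : bool :=
  half * (size t)%:R + e * sqn n < (sumn t)%:R.

(** With a single moment, upper deviations are not exponentially small; they are only o(sqrt n) in
    mean. The factor [(sumn t)%:R + 1] is the height from which the walk still has to die. *)
Lemma mubar_upper (e C kap : R) : 0 < e -> 0 < C -> 0 < kap -> \forall n \near \oo, forall h, h%:R <= C * sqn n ->
  psum (mubar mu n.+1) n.+1 h (fun t => ((sumn t)%:R + 1) * (fat n e t)%:R) <= kap * sqn n.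
move=> e0 C0 kap0;have half0: 0 < half by rewrite divr_gt0.
pose K1:= (half*C+e/2+1)*(2/e)+1.
have q0: 0 < half*C+e/2+1 by rewrite !addr_gt0 ?mulr_gt0 ?divr_gt0.
have K10: 0 < K1 by rewrite addr_gt0// mulr_gt0// divr_gt0.
pose e1:= kap/(2*K1*C);have e10: 0 < e1 by rewrite divr_gt0// !mulr_gt0.
have [L [L0 hL]]:= mubar_trunc e10;have LL: 0 < L%:R :> R by rewrite ltr0n.
pose B:= L%:R+half;have B0: 0 < B by rewrite addr_gt0.
pose th:= Num.min (e/(8*B^+2*C)) (2*B)^-1/(1+half).
have h10: 0 < 1+half by rewrite addr_gt0.
have mn0: 0 < Num.min (e/(8*B^+2*C)) (2*B)^-1.
 by rewrite lt_min invr_gt0 divr_gt0 ?mulr_gt0 ?exprn_gt0.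
have th0: 0 < th by rewrite divr_gt0.
have thle: th <= Num.min (e/(8*B^+2*C)) (2*B)^-1.
 by rewrite /th ler_pdivrMr// ler_peMr ?(ltW mn0)// lerDl ltW.
have th1: th*(8*B^+2*C) <= e.
 by rewrite -ler_pdivlMr ?mulr_gt0 ?exprn_gt0//;apply: (le_trans thle);rewrite ge_min lexx.
have th2: th*B <= 2^-1.
 rewrite -ler_pdivlMr//;apply: (le_trans thle);rewrite ge_min;apply/orP;right.
 by rewrite invfM.
have B1: 1 <= B by rewrite /B;have L1: 1 <= L%:R :> R by [rewrite ler1n];lra.
have th3: th * half <= 1.
 by apply: le_trans (_ : th*B <= _);[rewrite ler_pM2l// /B lerDr ltW|lra].
clear thle;clearbody th.
near=> n=> h hC.
have n0: (0 < n)%N by near_nat n.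
have sn1: 1 <= sqn n :> R by rewrite -[leLHS]sqrtr1 ler_wsqrtr// ler1n.
have sn0: 0 < sqn n :> R by lra.
have Ln: (L <= n.+1)%N by apply: leq_trans (leqnSn _);near: n;exact: nbhs_infty_ge.
have snK: 8*(C*L%:R+1)/(th * e * kap) <= sqn n.
 by near: n;apply: sqrt_nat_unbounded.
set sn:= sqn n in hC sn1 sn0 snK *.
pose w:= mubar mu n.+1;have w0 r: 0 <= w r by exact: mubar_ge0.
have w1: \sum_(r < n.+1) w r <= 1 by exact: mubar_le1.
pose ST (t : seq nat) : R:= \sum_(r <- t) (minn r L)%:R.
pose D (t : seq nat) : R:= \sum_(r <- t) (r%:R-(minn r L)%:R).
have D0 t: 0 <= D t by apply: sumr_ge0=> r _;rewrite subr_ge0 ler_nat geq_minl.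
(* Either the truncated sum is already too large, which an exponential bound makes rare, or the
   excess [D t] beyond the truncation is at least e sqrt n / 2 and then dominates the whole sum up
   to the factor [K1]. *)
have big t: size t = h -> ((sumn t)%:R+1)*(fat n e t)%:R <= K1*D t+(h%:R*L%:R+1)*(half * h%:R+e * sn/2 <= ST t)%R%:R.
 move=> st;have S_split: (sumn t)%:R = ST t+D t by rewrite natr_sumn -big_split /=;apply: eq_bigr=> r _;rewrite addrC subrK.
 have STle: ST t <= h%:R*L%:R.
  rewrite -st /ST;elim: (t)=> [|r t' IH];first by rewrite big_nil mul0r.
  by rewrite big_cons /= -natr1 mulrDl mul1r addrC lerD// ler_nat geq_minr.
 have hL0: 0 <= h%:R*L%:R+1 :> R by rewrite addr_ge0// mulr_ge0.
 have KD: D t <= K1*D t by rewrite ler_peMl// /K1 lerDr mulr_ge0// ?ltW// divr_gt0.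
 rewrite /fat st -/sn;case: (ltP (half * h%:R+e * sn) _)=> hS;last first.
  rewrite mulr0;apply: addr_ge0;first by rewrite mulr_ge0// ltW.
  by rewrite mulr_ge0.
 rewrite mulr1 S_split;case: (leP (half * h%:R+e * sn/2) (ST t))=> hT.
  by rewrite mulr1;lra.
 rewrite mulr0 addr0;have Dbig: e * sn/2 <= D t by rewrite S_split in hS;lra.
 have hh: half * h%:R <= half*C * sn by rewrite -(mulrA half) ler_pM2l.
 have : (half*C+e/2+1) * sn <= (half*C+e/2+1)*(2/e)*D t.
  have sE: sn = 2/e*(e * sn/2) by field;rewrite lt0r_neq0.
  by rewrite -[leRHS]mulrA ler_pM2l// {1}sE ler_pM2l// divr_gt0.
 by rewrite /K1 mulrDl mul1r;move: hT Dbig hh sn1;clear;move=> *;lra.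
apply: (le_via (psum w n.+1 h (fun t=> K1*D t+(h%:R*L%:R+1)*(half * h%:R+e * sn/2 <= ST t)%R%:R))).
 by apply: psum_ler=> // t st _;exact: big.
rewrite psumD !psumZ.
have ->: kap * sn = kap * sn/2+kap * sn/2 by field.
apply: lerD.
 apply: (le_via (K1*(h%:R * e1))).
  rewrite ler_pM2l//;apply: le_trans (psum_sum_le h w0 w1 _) _.
   by move=> r;rewrite subr_ge0 ler_nat geq_minl.
  rewrite ler_wpM2l//;under eq_bigr do rewrite mulrBr;rewrite sumrB.
  by have:= hL _ Ln;have:= mubar_mean_le n.+1;rewrite -/w;lra.
 apply: (le_via (K1*(C * sn * e1)));first by rewrite ler_pM2l// ler_pM2r.
 by rewrite /e1 le_eqVlt;apply/orP;left;apply/eqP;field;rewrite !lt0r_neq0.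
have step: \sum_(r < n.+1) w r * expR (th*((minn r L)%:R-half)) <= expR (2 * th^+2*B^+2).
 apply: (le_via (\sum_(r < n.+1) w r*(1+2 * th^+2*B^+2+th*((minn r L)%:R-half)))).
  apply: ler_sum=> r _;apply: ler_wpM2l=> //.
  have mL: (minn r L)%:R <= L%:R :> R by rewrite ler_nat geq_minr.
  have m0: 0 <= (minn r L)%:R :> R by [].
  apply: (le_trans (expR_quad _)).
   apply: le_trans th2;rewrite ler_pM2l// /B;lra.
  have q: ((minn r L)%:R-half)^+2 <= B^+2.
   by rewrite -subr_ge0 subr_sqr mulr_ge0// /B;lra.
  have q2: th^+2*((minn r L)%:R-half)^+2 <= th^+2*B^+2 by rewrite ler_wpM2l// sqr_ge0.
  rewrite exprMn (_ : 2 * th^+2*B^+2 = 2*(th^+2*B^+2));last by ring.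
  move: q2;set X:= th^+2 * _;set Y:= th^+2*B^+2;set Z:= th * _.
  by clearbody X Y Z;move=> q2;lra.
 have S1: \sum_(r < n.+1) w r*(minn r L)%:R <= half.
  by apply: le_trans (mubar_mean_le n.+1);apply: ler_sum=> r _;rewrite ler_wpM2l// ler_nat geq_minl.
 apply: (le_via (1+2 * th^+2*B^+2));last exact: expR_ge1Dx.
 rewrite (eq_bigr (fun r : 'I_n.+1=> w r*(1+2 * th^+2*B^+2)+(th*(w r*(minn r L)%:R)-w r*(th * half))));last by move=> r _;ring.
 rewrite big_split sumrB /= -!mulr_suml -mulr_sumr.
 set Q:= \sum_(r < n.+1) w r in w1 *.
 have Q0: 0 <= Q by apply: sumr_ge0.
 have a1: Q*(1+2 * th^+2*B^+2) <= Q+2 * th^+2*B^+2.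
  rewrite mulrDr mulr1 lerD2l;apply: ler_piMl=> //.
  by apply: mulr_ge0;[apply: mulr_ge0=> //;exact: sqr_ge0|exact: sqr_ge0].
 have a2: th*(\sum_(r < n.+1) w r*(minn r L)%:R) <= th * half by rewrite ler_pM2l.
 have a3: (1-Q)*(th * half) <= (1-Q)*1 by rewrite ler_wpM2l// subr_ge0.
 move: a1 a2 a3;rewrite mulr1 [(1-Q) * _]mulrBl mul1r.
 set X1:= Q * _;set X2:= th * _;set X3:= Q*(th * half);set X4:= th * half;set X5:= 2 * _ * _.
 clearbody X1 X2 X3 X4 X5;lra.
have tail: psum w n.+1 h (fun t=> (half * h%:R+e * sn/2 <= ST t)%R%:R) <= 4/(th * e * sn).
 apply: (le_via (expR (- (th * e * sn/4))));last first.
  apply: (le_trans (expR_inv_le _));first by rewrite divr_gt0// !mulr_gt0.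
  by rewrite invf_div.
 apply: (le_via (expR (- (th * e * sn/2)) * psum w n.+1 h (fun t=> \prod_(r <- t) expR (th*((minn r L)%:R-half))))).
  rewrite -psumZ;apply: psum_ler=> // t st _.
  have ->: \prod_(r <- t) expR (th*((minn r L)%:R-half)) = expR (th*(ST t-half * h%:R)).
   rewrite -st /ST;elim: (t)=> [|r t' IH];first by rewrite !big_nil mulr0 subr0 mulr0 expR0.
   by rewrite !big_cons IH -expRD;congr expR;rewrite /= -natr1;ring.
  rewrite -expRD;case: (boolP (_ <= ST t)%R)=> hS;last exact: expR_ge0.
  apply: le_trans (expR_ge1Dx _);rewrite lerDl.
  have ->: - (th * e * sn/2)+th*(ST t-half * h%:R) = th*(ST t-(half * h%:R+e * sn/2)) by field.
  by rewrite mulr_ge0 ?(ltW th0)// subr_ge0.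
 rewrite psum_prod;apply: (le_via (expR (- (th * e * sn/2)) * expR (2 * th^+2*B^+2)^+h)).
  rewrite ler_wpM2l ?expR_ge0// lerXn2r ?nnegrE ?expR_ge0//.
  by apply: sumr_ge0=> r _;rewrite mulr_ge0 ?expR_ge0.
 rewrite -expRM_natr -expRD ler_expR.
 have ->: 2 * th^+2*B^+2 * h%:R = th*(th*(8*B^+2)) * h%:R/4 by field.
 have h1: th*(th*(8*B^+2)) * h%:R <= th*(th*(8*B^+2))*(C * sn).
  by rewrite ler_wpM2l// !mulr_ge0 ?sqr_ge0// ltW.
 have h2: th*(th*(8*B^+2))*(C * sn) <= th * e * sn.
  have ->: th*(th*(8*B^+2))*(C * sn) = th*(th*(8*B^+2*C)) * sn by ring.
  by rewrite ler_pM2r// ler_pM2l.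
 lra.
apply: (le_via ((C*L%:R+1) * sn*(4/(th * e * sn)))).
 apply: ler_pM=> //;first by apply: psum_ge0.
 rewrite mulrDl mul1r;apply: lerD=> //.
 by rewrite mulrAC ler_wpM2r.
have ->: (C*L%:R+1) * sn*(4/(th * e * sn)) = 8*(C*L%:R+1)/(th * e * kap)*(kap/2).
 by field;rewrite !lt0r_neq0.
have ->: kap * sn/2 = sn*(kap/2) by ring.
by rewrite ler_pM2r// divr_gt0.
Unshelve. all: end_near. Qed.
End SpineLaw.

(** * Height and walk under the conditioned law *)

Section ExcursionStack.
Context {R : realType}.

Lemma mul_sqrt_mul (a b : R) : 0 <= a -> a * sqrtr a * (b * sqrtr b) = a * b * sqrtr (a * b).
Proof. by move=> a0;rewrite sqrtrM//;ring. Qed.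

Lemma or4_le (b b1 b2 b3 b4 : bool) : (b -> [|| b1, b2, b3 | b4]) ->
  b%:R <= b1%:R + (b2%:R + (b3%:R + b4%:R)) :> R.
rewrite -!natrD ler_nat;case: b=> //= /(_ isT).
by case: b1;case: b2;case: b3;case: b4.
Qed.

Lemma slope_upper (h e1 s W C q : R) : 0 < h -> 0 < e1 -> e1 <= h / 2 -> 0 <= W -> W <= C * q ->
  s * (h - e1) <= W -> s - W / h <= e1 * (2 * C / h ^+ 2) * q.
move=> h0 e10 e1h W0 WC hs;have hh0: 0 < h-e1 by lra.
have h1: s <= W/(h-e1) by rewrite ler_pdivlMr.
have h2: W/(h-e1)-W/h = W*(e1/(h*(h-e1))).
 by field;rewrite !lt0r_neq0.
have h3: e1/(h*(h-e1)) <= e1*(2/h^+2).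
 rewrite ler_pM2l// -[leLHS]mul1r ler_pdivrMr ?mulr_gt0//.
 have ->: 2/h^+2*(h*(h-e1)) = 2*(h-e1)/h by field;rewrite lt0r_neq0.
 by rewrite ler_pdivlMr//;lra.
have h4: W*(e1/(h*(h-e1))) <= C * q*(e1*(2/h^+2)).
 by apply: ler_pM=> //;apply: divr_ge0;apply: ltW=> //;exact: mulr_gt0.
have h5: C * q*(e1*(2/h^+2)) = e1*(2*C/h^+2) * q by ring.
lra.
Qed.

Definition stk (s : seq nat) (k : nat) : option (seq nat) := run (Some [::]) (take k s).
Definition zeta (k : nat) : R := k%:R - 1.

Lemma hits_alive s k : hits 1 s -> (k < size s)%N -> alive 1 (take k s).
move=> hs ks;move: hs;rewrite -{1}(cat_take_drop k s) hits_cat ?size_drop ?subn_gt0//.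
by case/andP.
Qed.

Lemma hits_stk s k : hits 1 s -> (k < size s)%N -> exists2 st, stk s k = Some st &
  (sumn st)%:R = \sum_(x <- take k s) zeta x.
move=> hs ks;have al:= hits_alive hs ks;rewrite /stk.
case E : (run _ _)=> [st|];last by move/run_alive: E;rewrite al.
exists st=> //;have:= run_pend E;rewrite /= => pe;have:= pend_alive al;rewrite pe.
have ->: \sum_(x <- take k s) zeta x = (sumn (take k s))%:R-(size (take k s))%:R :> R.
 elim: (take k s)=> [|x u IH];first by rewrite big_nil subr0.
 by rewrite big_cons IH /zeta /= natrD -natr1;ring.
move=> h;have {}h : (sumn st+size (take k s) = sumn (take k s))%N by move: h;lia.
by rewrite -h natrD addrK.
Qed.

Lemma take_window (s : seq nat) k l : take (k + l) s = take k s ++ take l (drop k s).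
Proof. by rewrite takeD. Qed.

Lemma osc_window (f : nat -> R) L lam s k l : ~~ osc f L lam s -> (k < size s)%N -> (l <= L)%N ->
  `|\sum_(x <- take (k + l) s) f x - \sum_(x <- take k s) f x| <= lam.
move=> /hasPn h ks lL;rewrite take_window big_cat /= addrC addrK.
have /h/hasPn : k \in iota 0 (size s) by rewrite mem_iota.
move=> /(_ l);rewrite mem_iota /= add0n ltnS lL=> /(_ isT).
by rewrite -leNgt.
Qed.

Lemma osc_bound (f : nat -> R) L lam s k : ~~ osc f L lam s -> (0 < L)%N -> 0 <= lam -> (k < size s)%N ->
  `|\sum_(x <- take k s) f x| <= ((k %/ L)%:R + 1) * lam.
move=> h L0 l0;elim/ltn_ind: k=> k IH ks.
have [kL|Lk]:= ltnP k L.
 rewrite divn_small// add0r mul1r.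
 by have:= osc_window (k:= 0) (l:= k) h (leq_ltn_trans (leq0n k) ks) (ltnW kL);rewrite add0n take0 big_nil subr0.
have kk: (k-L < k)%N by lia.
have kLs: (k-L < size s)%N by lia.
have:= IH _ kk kLs;have:= osc_window (k:= k-L) (l:= L) h kLs (leqnn L).
have ->: (k-L+L = k)%N by lia.
have ->: (k %/ L = ((k-L) %/ L).+1)%N by rewrite -{1}(subnK Lk) divnDr// divnn L0 addn1.
rewrite -natr1;set a:= \sum_(x <- take k s) _;set b:= \sum_(x <- take (k-L) s) _=> h1 h2.
rewrite -[a](subrK b);apply: le_trans (ler_normD _ _) _.
rewrite mulrDl mul1r mulrDl mul1r in h2 *;lra.
Qed.

Lemma osc_walk_le (f : nat -> R) (dl : R) n s : 0 < dl -> 1 <= dl * n%:R -> size s = n ->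
  ~~ osc f (truncn (dl * n%:R)) (sqn n) s ->
  forall j, (j < n)%N -> `|\sum_(x <- take j s) f x| <= (2 / dl + 1) * sqn n.
move=> dl0 dn ss ho j jn;have q0:= sqrtr_ge0 (n%:R : R).
have L0: (0 < truncn (dl * n%:R))%N by rewrite truncn_gt0.
have n0': 0 < n%:R :> R by rewrite ltr0n (leq_ltn_trans _ jn).
apply: (le_trans (osc_bound ho L0 q0 _));first by rewrite ss.
rewrite ler_wpM2r// lerD2r ler_pdivlMr// -(ler_pM2r n0') -mulrA.
have /andP[h1 h2]:= truncn_itv (le_trans ler01 dn).
move: (truncn _) h1 h2 L0=> L h1 h2 L0.
have LL: dl * n%:R <= 2*L%:R.
 apply: (le_trans (ltW h2));rewrite -natr1 mulr2n mulrDl mul1r lerD2l.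
 by rewrite -[1]/(1%:R) ler_nat.
apply: (le_via ((j %/ L)%:R*(2*L%:R)));first by rewrite ler_wpM2l.
rewrite mulrCA ler_pM2l// -natrM ler_nat;apply: leq_trans (leq_divM _ _) _;exact: ltnW.
Qed.

Variable sig2 : R.
Hypothesis sig2_gt0 : 0 < sig2.
Notation half := (sig2 / 2).

Definition isthin (e : R) (J : nat) (o : option (seq nat)) : bool := oapp (thin sig2 e J) false o.
Definition isfat (n : nat) (e C : R) (o : option (seq nat)) : bool :=
  oapp (fun st => ((size st)%:R <= C * sqn n) && fat sig2 n e st) false o.

Definition dev (e : R) (n : nat) (o : option (seq nat)) : bool :=
  oapp (fun st => e * sqn n < `|(size st)%:R - (sumn st)%:R / half|) false o.

(** Absence of thin stacks bounds the height from above at every time. For the lower bound, fewer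
    than [M] times are fat, so one of the [L] times up to [k] is not; there the height is nearly the
    walk divided by sigma^2/2 or more, and [run_pop] with small oscillations shows that few levels
    are lost up to time [k]. Near both ends of the word the walk itself is small. *)
Lemma height_close (e e1 C' : R) (n L K J M : nat) s : hits 1 s -> size s = n -> (0 < n)%N ->
  0 < e1 -> e1 <= 1 -> e1 <= half / 2 -> 0 < C' -> (1 <= e1 * sqn n)%R ->
  e1 * (4 / half + 1 + 2 * C' / half ^+ 2) <= e ->
  J = truncn (e1 * sqn n) -> (0 < L)%N -> (n - K <= L)%N -> (M <= L)%N ->
  (forall k, (k < n)%N -> `|\sum_(x <- take k s) zeta x| <= C' * sqn n) ->
  (forall k, (k < n)%N -> ~~ isthin e1 J (stk s k)) ->
  ~~ osc zeta L (e1 * sqn n) s ->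
  (\sum_(k < K) isfat n e1 (1 + 2 * C' / half)%R (stk s k) < M)%N ->
  forall k, (k < n)%N -> ~~ dev e n (stk s k).
move=> hs sn n0 e10 e11 e1h C'0 e1sn e1e JE L0 nKL ML Wmax nthin nosc nfat k kn.
have half0: 0 < half by rewrite divr_gt0.
set q:= sqn n in e1sn JE Wmax nosc *.
have q0: 0 < q by rewrite sqrtr_gt0 ltr0n.
have eq0: 0 < e1 * q by rewrite mulr_gt0.
have Jle: J%:R <= e1 * q by rewrite JE;have /andP[]:= truncn_itv (ltW eq0).
have top j i st: (i < n)%N -> stk s i = Some st -> (j <= size st)%N -> (J <= j)%N -> (half-e1) * j%:R < (sumn (take j st))%:R.
 move=> iN Ei js Jj;have:= nthin _ iN;rewrite Ei /isthin /= => /hasPn /(_ j).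
 by rewrite mem_iota /= add0n ltnS js Jj /= /low -ltNge=> /(_ isT).
have hhalf: half/2 <= half-e1 by lra.
have upper i st: (i < n)%N -> stk s i = Some st -> (size st)%:R <= e1 * q \/ (size st)%:R*(half-e1) <= (sumn st)%:R.
 move=> iN Ei;have [Jh|Jh]:= leqP J (size st).
  by right;have:= top _ _ _ iN Ei (leqnn _) Jh;rewrite take_size mulrC=> /ltW.
 by left;apply: le_trans Jle;rewrite ler_nat ltnW.
have upper2 i st: (i < n)%N -> stk s i = Some st -> (size st)%:R-(sumn st)%:R/half <= e1 * q+e1*(2*C'/half^+2) * q.
 move=> iN Ei;have [st' Est Wst]:= hits_stk hs (eq_ind_r (fun m=> (i < m)%N) iN sn).
 have ? : st' = st by rewrite Ei in Est;case: Est.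
 subst st';have:= Wmax _ iN;rewrite -Wst ger0_norm// => WC.
 case: (upper _ _ iN Ei)=> h.
  have c0: 0 <= e1*(2*C'/half^+2) * q.
   by rewrite mulr_ge0// ?(ltW q0)// mulr_ge0// ?(ltW e10)// divr_ge0 ?sqr_ge0// mulr_ge0// (ltW C'0).
  have W0: 0 <= (sumn st)%:R/half by rewrite divr_ge0// (ltW half0).
  lra.
 apply: (le_trans (slope_upper half0 e10 e1h _ WC h))=> //.
 by rewrite lerDr ltW.
have upperC i st: (i < n)%N -> stk s i = Some st -> (size st)%:R <= (1+2*C'/half) * q.
 move=> iN Ei;have [st' Est Wst]:= hits_stk hs (eq_ind_r (fun m=> (i < m)%N) iN sn).
 have ? : st' = st by rewrite Ei in Est;case: Est.
 subst st';have:= Wmax _ iN;rewrite -Wst ger0_norm// => WC.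
 case: (upper _ _ iN Ei)=> h.
  apply: (le_trans h);rewrite ler_pM2r//.
  have : 0 <= 2*C'/half by rewrite divr_ge0 ?mulr_ge0// ltW.
  lra.
 have h1: (size st)%:R*(half/2) <= C' * q.
  by apply: le_trans WC;apply: le_trans h;rewrite ler_wpM2l.
 have h2: (size st)%:R <= 2*C'/half * q.
  have ->: 2*C'/half * q = C' * q/(half/2) by field;rewrite !lt0r_neq0.
  by rewrite ler_pdivlMr// divr_gt0.
 by apply: (le_trans h2);rewrite ler_pM2r// lerDr.
have [st Ek Wk]:= hits_stk hs (eq_ind_r (fun m=> (k < m)%N) kn sn).
have final: - (e * q) <= (size st)%:R-(sumn st)%:R/half <= e * q -> ~~ dev e n (stk s k).
 by move=> h;rewrite Ek /dev /= -leNgt ler_norml.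
apply: final;apply/andP;split;last first.
 apply: le_trans (upper2 _ _ kn Ek) _.
 have ->: e1 * q+e1*(2*C'/half^+2) * q = e1*(1+2*C'/half^+2) * q by ring.
 rewrite ler_pM2r//;apply: le_trans e1e;rewrite ler_pM2l// lerD2r.
 by rewrite lerDr divr_ge0// ltW.
have e1e': e1*(4/half+1) * q <= e * q.
 rewrite ler_pM2r//;apply: le_trans e1e;rewrite ler_pM2l// lerDl.
 by rewrite divr_ge0 ?sqr_ge0// mulr_ge0// ltW.
suff lowb: (sumn st)%:R/half <= (size st)%:R+e1*(4/half+1) * q by lra.
have smallW: (sumn st)%:R <= e1 * q -> (sumn st)%:R/half <= (size st)%:R+e1*(4/half+1) * q.
 move=> h;apply: (le_via (e1 * q/half));first by rewrite ler_pM2r// invr_gt0.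
 have ->: e1*(4/half+1) * q = e1 * q/half+(3*(e1 * q/half)+e1 * q) by ring.
 have : 0 <= e1 * q/half by rewrite divr_ge0// ltW.
 have : 0 <= (size st)%:R :> R by [].
 lra.
have ks: (k < size s)%N by rewrite sn.
have [kL|Lk]:= leqP k L.
 apply: smallW;rewrite Wk.
 have:= osc_window (k:= 0) (l:= k) nosc (leq_ltn_trans (leq0n k) ks) kL.
 by rewrite add0n take0 big_nil subr0=> /(le_trans (ler_norm _)).
have [Kk|kK]:= leqP K k.
 apply: smallW;rewrite Wk.
 have nkL: (n-k <= L)%N by apply: leq_trans nKL;rewrite leq_sub2l.
 have:= osc_window (k:= k) (l:= n-k) nosc ks nkL.
 have ->: (k+(n-k) = n)%N by rewrite subnKC// ltnW.
 have ->: \sum_(x <- take n s) zeta x = -1 :> R.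
  rewrite take_oversize ?sn//;have:= hits_sum hs;rewrite sn=> h.
  have ->: \sum_(x <- s) zeta x = (sumn s)%:R-(size s)%:R :> R.
   elim: (s)=> [|x u IH];first by rewrite big_nil subr0.
   by rewrite big_cons IH /zeta /= natrD -natr1;ring.
  by rewrite sn -h natrD;ring.
 by rewrite ler_norml=> /andP[h _];lra.
have [i [ik1 ik2 ngood]] : exists i, [/\ (k-L < i)%N, (i <= k)%N & ~~ isfat n e1 (1+2*C'/half) (stk s i)].
 apply: contrapT=> hn;move: nfat;apply/negP;rewrite -leqNgt;apply: (leq_trans ML).
 have allfat i: (k-L < i)%N -> (i <= k)%N -> isfat n e1 (1+2*C'/half) (stk s i).
  by move=> h1 h2;apply: contrapT=> /negP h3;apply: hn;exists i.
 rewrite -(big_mkord predT (fun i=> nat_of_bool (isfat n e1 (1+2*C'/half) (stk s i)))).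
 have k1: ((k-L).+1 <= k.+1)%N by rewrite ltnS leq_subr.
 rewrite (@big_cat_nat _ _ _ (k-L).+1) //=;last exact: (leq_trans k1).
 rewrite (@big_cat_nat _ _ _ k.+1 (k-L).+1 K) //= addnA (addnC (bigop.body _ _ _)) -addnA.
 rewrite (@eq_big_nat _ _ _ (k-L).+1 k.+1 _ (fun=> 1%N)).
  apply: leq_trans (leq_addr _ _);rewrite sum_nat_const_nat muln1 subSS subKn//;exact: ltnW.
 by move=> i /andP[h1 h2];rewrite allfat.
have iN: (i < n)%N by apply: leq_ltn_trans ik2 kn.
have is_: (i < size s)%N by rewrite sn.
have [sti Ei Wi]:= hits_stk hs is_.
have szi:= upperC _ _ iN Ei.
have fati: (sumn sti)%:R <= half*(size sti)%:R+e1 * q.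
 by move: ngood;rewrite Ei /isfat /= szi /= /fat -leNgt.
have rk: run (Some sti) (take (k-i) (drop i s)) = Some st.
 by rewrite -Ek -Ei /stk -run_cat -take_window subnKC.
have [j [i' [st2 [j1 j2 i1 r1 s1]]]]:= run_pop rk.
have i'k: (i' <= k-i)%N by apply: (leq_trans i1);rewrite size_take;case: ltnP=> //;lia.
have i'E: stk s (i+i') = Some st2.
 by rewrite /stk take_window run_cat -/(stk s i) Ei;move: r1;rewrite take_takel.
have ii'N: (i+i' < size s)%N by rewrite sn;apply: leq_ltn_trans kn;rewrite -(subnKC ik2) leq_add2l.
have [st2' E2 W2]:= hits_stk hs ii'N.
have ? : st2' = st2 by rewrite i'E in E2;case: E2.
subst st2'.
have w1: (k-i <= L)%N -> _:= fun h=> osc_window (k:= i) (l:= i') nosc is_ (leq_trans i'k h).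
have w2:= osc_window (k:= i) (l:= k-i) nosc is_.
have kiL: (k-i <= L)%N by rewrite leq_subLR addnC -leq_subLR ltnW.
move: (w1 kiL) (w2 kiL);rewrite -W2 -Wi subnKC// -Wk=> {}w1 {}w2.
have s1': (sumn (take j sti))%:R+(sumn st2)%:R <= (sumn sti)%:R :> R by rewrite -natrD ler_nat.
have j2': (size sti)%:R <= (size st)%:R+j%:R :> R by rewrite -natrD ler_nat.
have tj: (sumn (take j sti))%:R <= e1 * q by move: w1;rewrite ler_norml=> /andP[h _];lra.
(* A popped segment of length at least [J] has a sum of the order of its length, and this sum is
   bounded by the oscillation; a shorter segment has length below [J], itself at most e1 sqrt n. *)
have jb: j%:R <= e1 * q/half*2+e1 * q.
 have z0: 0 <= e1 * q/half by rewrite divr_ge0// ltW.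
 have [Jj|jJ]:= leqP J j;last first.
  have : j%:R <= J%:R :> R by rewrite ler_nat ltnW.
  lra.
 have h1:= top _ _ _ iN Ei j1 Jj.
 have h2: half/2 * j%:R <= e1 * q.
  by apply: le_trans tj;apply: le_trans (ltW h1);rewrite ler_wpM2r.
 have ->: e1 * q/half*2 = e1 * q/(half/2) by field;rewrite !lt0r_neq0.
 apply: (le_via (e1 * q/(half/2)));last by rewrite lerDl ltW.
 by rewrite ler_pdivlMr ?divr_gt0// mulrC.
have Wb: (sumn st)%:R <= half*((size st)%:R+j%:R)+2*(e1 * q).
 move: w2;rewrite ler_norml=> /andP[_ h].
 have : half*(size sti)%:R <= half*((size st)%:R+j%:R) by rewrite ler_pM2l.
 lra.
have : (sumn st)%:R/half <= (size st)%:R+j%:R+2*(e1 * q/half).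
 rewrite ler_pdivrMr//;apply: (le_trans Wb);apply: eq_le_val.
 by field;rewrite !lt0r_neq0.
have ->: e1*(4/half+1) * q = 4*(e1 * q/half)+e1 * q by ring.
lra.
Qed.

Definition dev_ev (e : R) (n : nat) (s : seq nat) : bool := has (fun k => dev e n (stk s k)) (iota 0 n).
Definition thin_ev (e : R) (J n : nat) (s : seq nat) : bool := has (fun k => isthin e J (stk s k)) (iota 0 n).
Definition fat_ev (n : nat) (e C : R) (L : nat) (s : seq nat) : bool :=
  (L <= \sum_(k < n - L) isfat n e C (stk s k))%N.

Variables (mu : nat -> R) (V1 : R).
Hypothesis crit : critical_law mu V1 sig2.

Lemma psum_prefix (F : seq nat -> R) n k : (k <= n)%N -> (forall s, 0 <= F s) ->
  psum mu n.+1 n (fun s => F (take k s)) <= psum mu n.+1 k F.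
move=> kn F0;rewrite -{2}(subnKC kn).
exact: (@psum_take R mu n.+1 k (n-k)%N F (law_ge0 crit) (sum_mu_le1 (law_ge0 crit) (law_one crit) n.+1) F0).
Qed.

(** In powers of sqrt n, summing the Green function loses 4 and conditioning loses 3; the exponent 8
    exceeds their sum. *)
Lemma expR_pow8 (y : R) : 0 < y -> expR (- y) <= (8 / y) ^+ 8.
move=> y0;have h: expR (- y) = expR (- (y/8))^+8.
 by rewrite -expRM_natl;congr expR;field.
rewrite h lerXn2r ?nnegrE ?expR_ge0 ?divr_ge0 ?(ltW y0)//.
by have:= expR_inv_le (divr_gt0 y0 (ltr0Sn R 7));rewrite invf_div.
Qed.

Lemma thin_event (e kap : R) : 0 < e -> 0 < kap -> \forall n \near \oo,
  excsum mu n s ((thin_ev e (truncn (e * sqn n)) n s)%:R) <= kap * treeP mu n.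
move=> e0 kap0.
have [c [N0 [c0 hthin]]]:= mubar_thin crit e0.
have [b b0 hb]:= treeP_lb crit sig2_gt0.
pose D:= expR c*(8/(c * e))^+8.
have D0: 0 < D by rewrite mulr_gt0 ?expR_gt0// exprn_gt0// divr_gt0// mulr_gt0.
near=> n.
have n0: (0 < n)%N by near_nat n.
have q0: 0 < sqn n :> R by rewrite sqrtr_gt0 ltr0n.
set J:= truncn _.
have NN: (N0 <= n.+1)%N by apply: leqW;near: n;exact: nbhs_infty_ge.
have s1: excsum mu n s ((thin_ev e J n s)%:R) <= n%:R^+2 * expR (- (c*J%:R)).
 apply: (le_via (psum mu n.+1 n (fun s=> \sum_(k < n) oapp (fun st=> (thin sig2 e J st)%:R) 0 (run (Some [::]) (take k s))))).
  apply: psum_ler=> // s ss _;apply: (le_via (thin_ev e J n s)%:R).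
   by rewrite ler_piMl// lern1 leq_b1.
  have pos k: 0 <= oapp (fun st=> (thin sig2 e J st)%:R) 0 (run (Some [::]) (take k s)) :> R by case: run.
  rewrite /thin_ev;case: hasP=> [[k]|_];last by apply: sumr_ge0=> k _;exact: pos.
  rewrite mem_iota /= add0n=> kn;rewrite /isthin /stk=> hk.
  rewrite (bigD1 (Ordinal kn)) //=;move: hk;case: run=> //= st ->.
  by rewrite lerDl;apply: sumr_ge0=> i _;exact: pos.
 rewrite psum_sum.
 apply: (le_via (\sum_(k < n) psum mu n.+1 k (fun s=> oapp (fun st=> (thin sig2 e J st)%:R) 0 (run (Some [::]) s)))).
  apply: ler_sum=> k _;apply: (@psum_prefix (fun s=> oapp _ 0 (run (Some [::]) s)));first exact: ltnW.
  by move=> s;case: run.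
 apply: le_trans (green_bound (law_ge0 crit) _ _ _) _=> //;first by apply: (sum_mu_le1 (law_ge0 crit) (law_one crit)).
 apply: (le_via (\sum_(h < n) n%:R * expR (- (c*J%:R)))).
  apply: ler_sum=> h _;apply: (le_trans (hthin n.+1 h J NN)).
  by rewrite ler_wpM2r ?expR_ge0// ler_nat.
 by rewrite sumr_const card_ord -[leLHS]mulr_natl mulrA -expr2.
apply: (le_trans s1).
have J1: e * sqn n-1 <= J%:R.
 have /andP[_]:= truncn_itv (ltW (mulr_gt0 e0 q0));rewrite -/J -natr1;lra.
have s2: expR (- (c*J%:R)) <= D/sqn n^+8.
 apply: (le_via (expR (c-c * e * sqn n))).
  rewrite ler_expR;have:= ler_wpM2l (ltW c0) J1;lra.
 rewrite expRD /D -[leRHS]mulrA ler_pM2l ?expR_gt0//;apply: (le_trans (expR_pow8 _)).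
  by rewrite !mulr_gt0.
 rewrite -exprVn -exprMn;have -> // : 8/(c * e * sqn n) = 8/(c * e)/sqn n.
 by field;rewrite !lt0r_neq0.
have tp: b <= n%:R * sqn n * treeP mu n by near: n.
have nq: n%:R = sqn n^+2 :> R by rewrite sqr_sqrtr.
have large: D/(b * kap) <= sqn n by near_nat n.
move: (sqn n) q0 s2 tp nq large=> q q0 s2 tp nq large.
rewrite ler_pdivrMr ?mulr_gt0// in large.
have tpb: b/q^+3 <= treeP mu n.
 by rewrite ler_pdivrMr ?exprn_gt0// exprS -nq mulrC [q * _]mulrC.
apply: (le_via (kap*(b/q^+3)));last by rewrite ler_pM2l.
apply: (le_via (n%:R^+2*(D/q^+8)));first by rewrite ler_wpM2l ?sqr_ge0.
rewrite nq;have ->: (q^+2)^+2*(D/q^+8) = D/q/q^+3 by field;rewrite lt0r_neq0.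
rewrite mulrA ler_pM2r ?invr_gt0 ?exprn_gt0// ler_pdivrMr//.
by rewrite [kap * b]mulrC [leRHS]mulrC.
Unshelve. all: end_near. Qed.

Lemma hits_le_density : exists (C0 : R) (N0 : nat), 0 < C0 /\ forall N, (N0 <= N)%N -> forall m p, (0 < m)%N ->
  psum mu N m (fun s => (hits p s)%:R) <= p%:R * (C0 / (m%:R * sqrtr m%:R)).
have [C0 [N0 [C00 h]]]:= local_ub0 crit;exists C0, N0;split=> // N NN m p m0.
have m0': 0 < m%:R :> R by rewrite ltr0n.
rewrite -(ler_pM2l m0') kemperman1.
have ->: m%:R*(p%:R*(C0/(m%:R * sqrtr m%:R))) = p%:R*(C0/sqrtr m%:R).
 by field;rewrite !lt0r_neq0// sqrtr_gt0.
rewrite ler_wpM2l//;apply: le_trans (h N NN m p m0);apply: eq_le_val.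
by apply: eq_psum=> s _ _;rewrite -PoszD eqz_nat.
Qed.

(** Markov property at time [k]: the rest of the word must die from height [sumn st + 1], and the
    hypothesis on [q] is linear in that height. *)
Lemma hits_after N n k (Psi : seq nat -> R) (q : R) : (k < n)%N -> (forall t, 0 <= Psi t) ->
  (forall p, psum mu N (n - k)%N (fun s => (hits p s)%:R) <= p%:R * q) ->
  psum mu N n (fun s => (hits 1 s)%:R * oapp Psi 0 (stk s k)) <=
  q * psum mu N k (fun s => oapp (fun st => ((sumn st)%:R + 1) * Psi st) 0 (run (Some [::]) s)).
move=> kn P0 hq;rewrite -{1}(subnKC (ltnW kn)) psum_cat -psumZ;apply: psum_ler=> // s ss _.
rewrite (@eq_psum _ _ _ _ _ (fun t=> (alive 1 s)%:R * oapp Psi 0 (run (Some [::]) s)*(hits (pend 1 s) t)%:R));last first.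
 move=> t st _;rewrite hits_cat ?st ?subn_gt0// /stk take_cat -ss ltnn subnn take0 cats0.
 by case: alive=> /=;rewrite ?mul0r// mul1r mulrC.
rewrite psumZ;case E : (run _ _)=> [st|] /=;last by rewrite mulr0 mul0r mulr0.
have:= run_pend E;rewrite /= => ->;case al : alive;last first.
 by rewrite !mul0r;have []:= run_alive [::] s;rewrite /= al E=> _ /(_ isT).
rewrite mul1r mulrC;apply: le_trans (ler_wpM2r (P0 _) (hq _)) _.
by rewrite -natr1 le_eqVlt;apply/orP;left;apply/eqP;ring.
Qed.

(** Markov's inequality for the number of fat times before n - L. At least [L] letters then remain,
    so dying costs O(n^(-3/2)) times the height; by the Green function and [mubar_upper], each of
    the O(sqrt n) stack sizes contributes a small multiple of sqrt n. *)
Lemma fat_event (e C d kap : R) : 0 < e -> 0 < C -> 0 < d <= 1 -> 0 < kap -> \forall n \near \oo,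
  excsum mu n s ((fat_ev n e C (truncn (d * n%:R)) s)%:R) <= kap * treeP mu n.
move=> e0 C1 /andP[d0 d1] kap0.
have [b b0 hb]:= treeP_lb crit sig2_gt0.
have [C0 [N0 [C00 hdens]]]:= hits_le_density.
pose d':= d/2;have d'0: 0 < d' by rewrite divr_gt0.
pose D:= C0/(d' * sqrtr d')*(C+1)/d'.
have D0: 0 < D.
 apply: divr_gt0=> //;apply: mulr_gt0;last exact: addr_gt0.
 by apply: divr_gt0=> //;apply: mulr_gt0=> //;rewrite sqrtr_gt0.
have ka0: 0 < kap * b/D by apply: divr_gt0=> //;exact: mulr_gt0.
have hup:= mubar_upper crit sig2_gt0 e0 C1 ka0.
near=> n.
have n0: (0 < n)%N by near_nat n.
have n0': 0 < n%:R :> R by rewrite ltr0n.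
have q0: 0 < sqn n :> R by rewrite sqrtr_gt0.
have q1: 1 <= sqn n :> R by near_nat n.
have NN: (N0 <= n.+1)%N by apply: leqW;near: n;exact: nbhs_infty_ge.
set L:= truncn _.
have Ld: d' * n%:R <= L%:R.
 have /andP[_]:= truncn_itv (ltW (mulr_gt0 d0 n0'));rewrite -/L -natr1.
 have : 1 <= d' * n%:R by rewrite mulrC -ler_pdivrMr// mul1r;near: n;exact: nbhs_infty_ger.
 have ->: d * n%:R = d' * n%:R+d' * n%:R by rewrite /d';field.
 by move=> h1 h2;lra.
have L0: 0 < L%:R :> R by apply: lt_le_trans Ld;rewrite mulr_gt0.
have Ln: (L <= n)%N.
 rewrite -(ler_nat R);have /andP[+ _]:= truncn_itv (ltW (mulr_gt0 d0 n0')).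
 by rewrite -/L=> /le_trans;apply;rewrite ler_piMl.
pose Psi (st : seq nat) : R:= (((size st)%:R <= C * sqn n) && fat sig2 n e st)%:R.
have P0 st: 0 <= Psi st by rewrite ler0n.
have PE o: (isfat n e C o)%:R = oapp Psi 0 o by case: o.
pose q:= C0/(d' * sqrtr d')/(n%:R * sqn n).
have q0': 0 <= q by apply: ltW;rewrite !divr_gt0 ?mulr_gt0 ?sqrtr_gt0.
have s1: L%:R * excsum mu n s ((fat_ev n e C L s)%:R) <=
  \sum_(k < n-L) excsum mu n s (oapp Psi 0 (stk s k)).
 rewrite -psumZ -psum_sum;apply: psum_ler=> // s _ _.
 rewrite -mulr_sumr mulrCA ler_wpM2l//.
 under eq_bigr do rewrite -PE.
 rewrite -natr_sum -natrM ler_nat /fat_ev;case: (leqP L)=> h /=;last by rewrite muln0.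
 by rewrite muln1.
have s2: \sum_(k < n-L) excsum mu n s (oapp Psi 0 (stk s k)) <=
  q * \sum_(k < n) psum mu n.+1 k (fun s=> oapp (fun st=> ((sumn st)%:R+1)*Psi st) 0 (run (Some [::]) s)).
 have F0 k: 0 <= psum mu n.+1 k (fun s=> oapp (fun st=> ((sumn st)%:R+1)*Psi st) 0 (run (Some [::]) s)).
  by apply: psum_ge0=> // s;case: run=> //= st;rewrite mulr_ge0// addr_ge0.
 apply: (le_via (q * \sum_(k < n-L) psum mu n.+1 k (fun s=> oapp (fun st=> ((sumn st)%:R+1)*Psi st) 0 (run (Some [::]) s)))).
  rewrite mulr_sumr;apply: ler_sum=> k _;have kL:= ltn_ord k.
  have kn: (k < n)%N by apply: leq_trans kL (leq_subr _ _).
  apply: hits_after=> // p;apply: (le_trans (hdens _ NN _ _ _));first by rewrite subn_gt0.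
  rewrite ler_wpM2l// /q -mulrA ler_pM2l// -invfM lef_pV2 ?posrE ?mulr_gt0 ?sqrtr_gt0 ?ltr0n ?subn_gt0//.
  have h: d' * n%:R <= (n-k)%:R.
   by apply: (le_trans Ld);rewrite ler_nat leq_subRL ?(ltnW kn)// addnC -leq_subRL// ltnW.
  have ->: d' * sqrtr d' * (n%:R * sqn n) = d' * n%:R * sqrtr (d' * n%:R).
   exact: mul_sqrt_mul (ltW d'0).
  by apply: ler_pM;rewrite ?sqrtr_ge0// ?ler_sqrt// ?ltr0n ?subn_gt0// mulr_ge0// ltW.
 rewrite ler_wpM2l// -!(big_mkord predT (fun k=> psum mu n.+1 k _)).
 by rewrite [leRHS](big_cat_nat (leq0n _) (leq_subr L n)) /= lerDl sumr_ge0.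
have s3: \sum_(k < n) psum mu n.+1 k (fun s=> oapp (fun st=> ((sumn st)%:R+1)*Psi st) 0 (run (Some [::]) s)) <=
  (C+1) * sqn n*(kap * b/D * sqn n).
 apply: (le_trans (@green_bound R mu (law_ge0 crit) n.+1 n (fun st=> ((sumn st)%:R+1)*Psi st) _ _)).
 - by move=> t;rewrite mulr_ge0// addr_ge0.
 - exact: (sum_mu_le1 (law_ge0 crit) (law_one crit)).
 set T:= truncn (C * sqn n).
 have hT h: (h <= T)%N = (h%:R <= C * sqn n).
  by rewrite truncn_ge_nat// mulr_ge0// ltW.
 have hh: forall h, h%:R <= C * sqn n -> psum (mubar mu n.+1) n.+1 h (fun t=> ((sumn t)%:R+1)*(fat sig2 n e t)%:R) <= kap * b/D * sqn n by near: n.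
 apply: (le_via (\sum_(h < n) if (h <= T)%N then kap * b/D * sqn n else 0)).
  apply: ler_sum=> h _;rewrite (@eq_psum _ _ _ _ _ (fun t=> (h <= T)%N%:R*(((sumn t)%:R+1)*(fat sig2 n e t)%:R))).
   rewrite psumZ;case: ifP=> hTh;last by rewrite mul0r.
   by rewrite mul1r;apply: hh;rewrite -hT.
  by move=> t st _;rewrite /Psi st -hT;case: (h <= T)%N;rewrite /= ?mul1r ?mul0r ?mulr0.
 set c:= kap * b/D * _;have c0: 0 <= c by apply: mulr_ge0;exact: ltW.
 apply: (le_via (T.+1%:R * c));last first.
  rewrite ler_wpM2r// -natr1 mulrDl mul1r;apply: lerD=> //.
  by have /andP[]:= truncn_itv (ltW (mulr_gt0 C1 q0)).
 clearbody c;have [nT|Tn]:= leqP n T.+1.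
  apply: (le_via (\sum_(h < n) c));first by apply: ler_sum=> h _;case: ifP.
  by rewrite sumr_const card_ord -[leLHS]mulr_natl ler_wpM2r// ler_nat.
 rewrite -big_mkcond /= (eq_bigl (fun h : 'I_n=> h < T.+1)%N)//.
 by rewrite -(big_ord_widen n (fun=> c) (ltnW Tn)) sumr_const card_ord -[leLHS]mulr_natl.
have tp: b <= n%:R * sqn n * treeP mu n by near: n.
have tpb: b/(n%:R * sqn n) <= treeP mu n by rewrite ler_pdivrMr ?mulr_gt0// mulrC.
rewrite -(ler_pM2l L0);apply: (le_trans s1);apply: (le_trans s2).
apply: (le_trans (ler_wpM2l q0' s3)).
apply: (le_via (d' * n%:R*(kap*(b/(n%:R * sqn n)))));last first.
 apply: ler_pM=> //;[by rewrite mulr_ge0// ltW| |by rewrite ler_pM2l].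
 by apply: mulr_ge0;[exact: ltW|apply: divr_ge0;[exact: ltW|rewrite mulr_ge0// ltW]].
have nq: n%:R = sqn n^+2 :> R by rewrite sqr_sqrtr.
rewrite /q /D le_eqVlt;apply/orP;left;apply/eqP;rewrite nq [sqrtr (_^+2)]sqrtr_sqr ger0_norm//.
have sd: 0 < sqrtr d' by rewrite sqrtr_gt0.
by field;rewrite !lt0r_neq0// ?addr_gt0.
Unshelve. all: end_near. Qed.

Theorem height_walk (e kap : R) : 0 < e -> 0 < kap -> \forall n \near \oo,
  excsum mu n s ((dev_ev e n s)%:R) <= kap * treeP mu n.
move=> e0 kap0;have half0: 0 < half by rewrite divr_gt0.
have k4: 0 < kap/4 by rewrite divr_gt0.
have zle k: `|zeta k| <= 1 * k.+1%:R.
 rewrite mul1r /zeta ler_norml -natr1;have : 0 <= k%:R :> R by []. lra.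
have [d1 /andP[d10 d11] ho1]:= excursion_osc crit sig2_gt0 zle (law_zeta crit) (law_zeta2 crit) ltr01 k4.
pose C':= 2/d1+1;have C'0: 0 < C' by rewrite addr_gt0// divr_gt0.
pose A:= 4/half+1+2*C'/half^+2.
have A0: 0 < A by rewrite !addr_gt0// !divr_gt0 ?mulr_gt0 ?exprn_gt0.
pose e1:= Num.min (Num.min 1 (half/2)) (e/A).
have e10: 0 < e1 by rewrite !lt_min ltr01 !divr_gt0.
have e11: e1 <= 1 by rewrite !ge_min lexx.
have e1h: e1 <= half/2 by rewrite !ge_min lexx orbT.
have e1A: e1*A <= e by rewrite -ler_pdivlMr// !ge_min lexx orbT.
clearbody e1.
have [d /andP[d0 dle1] ho2]:= excursion_osc crit sig2_gt0 zle (law_zeta crit) (law_zeta2 crit) e10 k4.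
have CC0: 0 < 1+2*C'/half by rewrite addr_gt0// divr_gt0// mulr_gt0.
have dd: 0 < d <= 1 by rewrite d0.
have hf:= fat_event e10 CC0 dd k4.
have ht:= thin_event e10 k4.
near=> n.
have n0: (0 < n)%N by near_nat n.
have n0': 0 < n%:R :> R by rewrite ltr0n.
have q0: 0 < sqn n :> R by rewrite sqrtr_gt0.
have b1: excsum mu n s ((osc zeta (truncn (d1 * n%:R)) (1 * sqn n) s)%:R) <= kap/4 * treeP mu n by near: n.
have b2: excsum mu n s ((osc zeta (truncn (d * n%:R)) (e1 * sqn n) s)%:R) <= kap/4 * treeP mu n by near: n.
have b3: excsum mu n s ((thin_ev e1 (truncn (e1 * sqn n)) n s)%:R) <= kap/4 * treeP mu n by near: n.
have b4: excsum mu n s ((fat_ev n e1 (1+2*C'/half) (truncn (d * n%:R)) s)%:R) <= kap/4 * treeP mu n by near: n.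
have big1: 1 <= e1 * sqn n by rewrite -ler_pdivrMl// mulr1;near: n;exact: sqrt_nat_unbounded.
have L0: (0 < truncn (d * n%:R))%N.
 by rewrite truncn_gt0 -ler_pdivrMl// mulr1;near: n;exact: nbhs_infty_ger.
have nd1: 1 <= d1 * n%:R by rewrite -ler_pdivrMl// mulr1;near: n;exact: nbhs_infty_ger.
have L10: (0 < truncn (d1 * n%:R))%N by rewrite truncn_gt0.
apply: (le_via (psum mu n.+1 n (fun s=> (hits 1 s)%:R*(osc zeta (truncn (d1 * n%:R)) (1 * sqn n) s)%:R +
 ((hits 1 s)%:R*(osc zeta (truncn (d * n%:R)) (e1 * sqn n) s)%:R+((hits 1 s)%:R*(thin_ev e1 (truncn (e1 * sqn n)) n s)%:R +
 (hits 1 s)%:R*(fat_ev n e1 (1+2*C'/half) (truncn (d * n%:R)) s)%:R)))));last first.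
 rewrite !psumD;have ->: kap * treeP mu n = kap/4 * treeP mu n+(kap/4 * treeP mu n+(kap/4 * treeP mu n+kap/4 * treeP mu n)) by field.
 by apply: lerD=> //;apply: lerD=> //;apply: lerD.
apply: psum_ler=> // s ss _;rewrite -!mulrDr;case hs: (hits 1 s);last by rewrite !mul0r.
rewrite !mul1r;apply: or4_le;apply: contraLR;rewrite !negb_or=> /and4P[E1 E2 E3 E4].
apply/hasPn=> k;rewrite mem_iota /= add0n=> kn.
apply: (@height_close e e1 C' n (truncn (d * n%:R)) (n-truncn (d * n%:R)) _ (truncn (d * n%:R)) s hs ss n0 e10 e11 e1h C'0 big1 e1A erefl L0)=> //.
- by rewrite leq_subLR addnC -maxnE leq_maxr.
- by move=> i iN;exact: (osc_walk_le d10 nd1 ss E1).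
- by move=> i iN;move/hasPn: E3;apply;rewrite mem_iota.
- by rewrite ltnNge.
Unshelve. all: end_near. Qed.
End ExcursionStack.

(** * Plane trees and their degree sequences *)

Section PlaneTrees.
Close Scope ring_scope.
Close Scope classical_set_scope.

(* First-child/next-sibling coding of a plane forest: FNode c r is a tree whose root
   carries the forest c, followed by the forest r. *)
Inductive forest : Type := FNil | FNode of forest & forest.

Fixpoint width (f : forest) : nat := if f is FNode _ r then (width r).+1 else 0.
Fixpoint fsize (f : forest) : nat := if f is FNode c r then (fsize c + fsize r).+1 else 0.

(** [i] is the rank of the leftmost root, so that later siblings carry the following ranks. *)
Fixpoint fwords (i : nat) (f : forest) : seq word :=
  if f is FNode c r then [:: i] :: map (cons i) (fwords 1 c) ++ fwords i.+1 r else [::].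

Fixpoint degrees (f : forest) : seq nat :=
  if f is FNode c r then width c :: degrees c ++ degrees r else [::].

(** The entry [[::]] is the return of the contour to the common parent of the forest once a tree has
    been explored. *)
Fixpoint ftrace (i : nat) (f : forest) : seq word :=
  if f is FNode c r then [:: i] :: map (cons i) (ftrace 1 c) ++ [::] :: ftrace i.+1 r else [::].

Definition tree_words (c : forest) : seq word := [::] :: fwords 1 c.
Definition tree_degrees (c : forest) : seq nat := width c :: degrees c.

Lemma size_fwords i f : size (fwords i f) = fsize f.
Proof. by elim: f i=> //= c IHc r IHr i;rewrite size_cat size_map IHc IHr. Qed.

Lemma size_degrees f : size (degrees f) = fsize f.
Proof. by elim: f=> //= c IHc r IHr;rewrite size_cat IHc IHr. Qed.

Lemma size_ftrace i f : size (ftrace i f) = (fsize f).*2.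
by elim: f i=> //= c IHc r IHr i;rewrite size_cat size_map /= IHc IHr doubleS doubleD addnS.
Qed.

Lemma fwords_head i f w : w \in fwords i f -> exists j v, [/\ w = j :: v & i <= j]%N.
elim: f i w=> //= c _ r IH i w;rewrite inE mem_cat=> /orP[/eqP->|/orP[/mapP[v _ ->]|/IH[j [v [-> ij]]]]].
- by exists i, [::].
- by exists i, v.
- by exists j, v;split=> //;exact: ltnW.
Qed.

Lemma fwords_uniq i f : uniq (fwords i f).
elim: f i=> //= c IHc r IHr i;rewrite mem_cat cat_uniq IHr andbT map_inj_uniq ?IHc=> [|u v []//].
rewrite negb_or andTb -!andbA;apply/and3P;split.
- by apply/mapP=> -[v /fwords_head[j [u [-> _]]]].
- by apply/negP=> /fwords_head[j [v [[<- _]]]];rewrite ltnn.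
- by apply/hasPn=> w /fwords_head[j [v [-> ij]]];apply/mapP=> -[u _ [ji _]];rewrite ji ltnn in ij.
Qed.

Lemma tree_words_uniq c : uniq (tree_words c).
Proof. by rewrite /= fwords_uniq andbT;apply/negP=> /fwords_head[j [u [? _]]]. Qed.

Lemma lexle_trans : transitive lexle.
elim=> [|b v IH] [|a u] [|c w] //= /orP[ab|/andP[/eqP-> uv]] /orP[bc|/andP[/eqP<- vw]].
- by rewrite (ltn_trans ab bc).
- by rewrite ab.
- by rewrite bc.
- by rewrite eqxx (IH u) ?orbT.
Qed.

Lemma lexle_total : total lexle.
Proof. by elim=> [|a u IH] [|b v] //=;case: ltngtP=> //= _;exact: IH. Qed.

Lemma lexle_anti : antisymmetric lexle.
Proof. by elim=> [|a u IH] [|b v] //=;case: ltngtP=> //= -> /IH ->. Qed.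

Lemma fwords_sorted i f : sorted lexle (fwords i f).
elim: f i=> //= c IHc r IHr i;rewrite path_sortedE;last exact: lexle_trans.
apply/andP;split.
 rewrite all_cat;apply/andP;split;apply/allP=> w.
  by case/mapP=> v _ ->;rewrite /= eqxx orbT.
 by case/fwords_head=> j [v [-> ij]];rewrite /= ij.
rewrite sorted_pairwise;last exact: lexle_trans.
rewrite pairwise_cat -!sorted_pairwise;try exact: lexle_trans.
rewrite IHr andbT;apply/andP;split.
 apply/allrelP=> _ w /mapP[u _ ->] /fwords_head[j [v [-> ij]]].
 by rewrite /= ij.
rewrite sorted_map;apply: sub_sorted (IHc 1%N)=> u v /= ->.
by rewrite eqxx orbT.
Qed.

Lemma perm_forest (T : {fset word}) c : T =i tree_words c -> perm_eq (enum_fset T) (tree_words c).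
Proof. by move=> h;apply: uniq_perm;[exact: fset_uniq|exact: tree_words_uniq|exact: h]. Qed.

Lemma lex_vertices_forest (T : {fset word}) c : T =i tree_words c -> lex_vertices T = tree_words c.
move=> h;have pe:= perm_forest h.
apply: (sorted_eq lexle_trans lexle_anti).
- exact: (sort_sorted lexle_total).
- by rewrite /= path_sortedE ?fwords_sorted ?andbT;[exact/allP|exact: lexle_trans].
- by rewrite /lex_vertices perm_sort.
Qed.

Definition child_of (u v : word) : bool := (size v == (size u).+1) && (take (size u) v == u).

Lemma child_of_cons i u j v : child_of (i :: u) (j :: v) = (i == j) && child_of u v.
Proof. by rewrite /child_of /= eqSS eqseq_cons andbCA eq_sym. Qed.

Lemma width_count i f : count (child_of [::]) (fwords i f) = width f.
elim: f i=> //= c _ r IH i;rewrite count_cat IH -[RHS]add1n;congr (_+_)%N.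
rewrite -[RHS]add0n;congr (_+_)%N;rewrite count_map;apply/eqP;rewrite -leqn0 leqNgt -has_count.
by apply/hasPn=> w /fwords_head[j [v [-> _]]].
Qed.

Lemma count_head_lt i j u f : (j < i)%N -> count (child_of (j :: u)) (fwords i f) = 0%N.
move=> ji;apply/eqP;rewrite -leqn0 leqNgt -has_count;apply/hasPn=> w /fwords_head[k [v [-> ik]]].
by rewrite child_of_cons;case: eqP=> // e;move: ik;rewrite -e leqNgt ji.
Qed.

Lemma count_map_cons i u (L : seq word) : count (child_of (i :: u)) (map (cons i) L) = count (child_of u) L.
Proof. by rewrite count_map;apply: eq_count=> v /=;rewrite child_of_cons eqxx. Qed.

Lemma count_sub i c r v : count (child_of (i :: v)) (fwords i (FNode c r)) = count (child_of v) (fwords 1 c).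
Proof. by rewrite /= add0n count_cat count_map_cons count_head_lt// addn0. Qed.

Lemma count_rest i c r w : w \in fwords i.+1 r ->
  count (child_of w) (fwords i (FNode c r)) = count (child_of w) (fwords i.+1 r).
case/fwords_head=> j [v [-> ij]].
rewrite /= add0n count_cat count_map.
rewrite (@eq_count _ _ pred0) ?count_pred0// => x /=.
by rewrite child_of_cons (gtn_eqF ij).
Qed.

Lemma degrees_count i f : map (fun u => count (child_of u) (fwords i f)) (fwords i f) = degrees f.
elim: f i=> // c IHc r IHr i;rewrite [fwords i _ in X in map _ X]/= [degrees _]/= map_cons count_sub width_count.
congr cons;rewrite map_cat -map_comp -(IHc 1%N) -(IHr i.+1);congr (_ ++ _);apply/eq_in_map=> u uf.
 exact: count_sub.
exact: count_rest.
Qed.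

Lemma count_outdeg (T : {fset word}) c u : T =i tree_words c -> outdeg T u = count (child_of u) (tree_words c).
move=> h;by have /permP:= perm_forest h;apply.
Qed.

Lemma outdeg_forest (T : {fset word}) c : T =i tree_words c -> map (outdeg T) (tree_words c) = tree_degrees c.
move=> h;rewrite /tree_words /tree_degrees [LHS]/= !(count_outdeg _ h) -(width_count 1 c) -(degrees_count 1 c).
congr cons;apply/eq_in_map=> u /fwords_head[j [v [-> _]]].
by rewrite (count_outdeg _ h).
Qed.

Lemma nvert_forest (T : {fset word}) c : T =i tree_words c -> nvert T = (fsize c).+1.
move=> h;rewrite /nvert -(size_fwords 1 c) -[RHS]/(size (tree_words c));exact/perm_size/perm_forest.
Qed.

Lemma vtx_forest (T : {fset word}) c k : T =i tree_words c -> vtx T k = nth [::] (tree_words c) k.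
Proof. by move=> h;rewrite /vtx (lex_vertices_forest h). Qed.

Lemma outdeg_vtx (T : {fset word}) c k : T =i tree_words c -> (k <= fsize c)%N ->
  outdeg T (vtx T k) = nth 0%N (tree_degrees c) k.
move=> h kc;rewrite (vtx_forest _ h) -(outdeg_forest h) (nth_map [::])//.
by rewrite /= size_fwords ltnS.
Qed.

Lemma degrees_inj f g t t' : degrees f ++ t = degrees g ++ t' -> width f = width g -> f = g /\ t = t'.
elim: f g t t' => [|c IHc r IHr] [|c' r'] //= t t' [wc];rewrite -!catA=> h [wr].
have [-> {}h]:= IHc _ _ _ h wc.
by have [-> ->]:= IHr _ _ _ h wr.
Qed.

Lemma hits_degrees f p t : hits (width f + p) (degrees f ++ t) = hits p t.
elim: f p t=> [|c IHc r IHr] p t;first by [].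
by rewrite -[RHS]IHr -[RHS]IHc /= -catA;congr hits;lia.
Qed.

Lemma split_forest d p f : width f = (d + p)%N -> exists c r, [/\ width c = d, width r = p & degrees f = degrees c ++ degrees r].
elim: d f=> [|d IH] f;first by exists FNil, f.
case: f=> [//|c r] /= [/IH[c' [r' [w1 w2 h]]]].
by exists (FNode c c'), r';rewrite /= w1 w2 h catA.
Qed.

(** The rest of the word codes a forest by induction; the first letter [d] takes its first [d] trees
    as children. *)
Lemma hits_forest p s : hits p s -> exists2 f, width f = p & degrees f = s.
elim: s p=> [|d s IH] p /=;first by move/eqP=> ->;exists FNil.
case/andP=> p0 /IH[f];rewrite addnC=> /split_forest[c [r [w1 w2 e]]] fs.
by exists (FNode c r);rewrite /= ?w1 ?w2 ?prednK// -fs e.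
Qed.

(** Exploring the whole forest uses up the top entry, and the next move goes to the next unvisited
    sibling of an ancestor. *)
Lemma run_forest c r st t : run (Some (width r :: st)) (degrees (FNode c r) ++ t) = run (dec st) t.
have gen f: forall st t, match f with FNil=> True | FNode c r =>
 run (Some (width r :: st)) (degrees (FNode c r) ++ t) = run (dec st) t end.
 elim: f=> //= {}c IHc {}r IHr {}st {}t;rewrite -catA.
 have rest: run (dec (width r :: st)) (degrees r ++ t) = run (dec st) t.
  by case: (r) IHr=> //= c2 r2 IHr;rewrite -[RHS](IHr st t).
 by case: c IHc=> [//|c1 r1] IHc /=;rewrite -[RHS]rest -(IHc (width r :: st)) /=.
exact: (gen (FNode c r)).
Qed.

Lemma run_depth c r st i k : (k < fsize (FNode c r))%N -> exists2 st',
  run (Some (width r :: st)) (take k (degrees (FNode c r))) = Some st' &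
  size st' = (size st + size (nth [::] (fwords i (FNode c r)) k))%N.
have gen f: forall st i k, (k < fsize f)%N -> match f with FNil=> True | FNode c r=> exists2 st',
 run (Some (width r :: st)) (take k (degrees (FNode c r))) = Some st' &
 size st' = (size st+size (nth [::] (fwords i (FNode c r)) k))%N end.
 elim: f=> // {}c IHc {}r IHr {}st {}i [|{}k] kf.
  by rewrite /=;exists (width r :: st);rewrite //= addn1.
 rewrite /= take_cat nth_cat size_map size_fwords size_degrees.
 have [kc|ck]:= ltnP k (fsize c).
  rewrite (nth_map [::]) ?size_fwords//.
  case: c IHc kf kc=> // c1 r1 IHc kf kc;have [st' e1 e2]:= IHc (width r :: st) 1%N k kc.
  by exists st';[exact: e1|rewrite e2 /= addSnnS].
 have kr: (k-fsize c < fsize r)%N by rewrite ltn_subLR.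
 have e0: run (push (width r :: st) (width c)) (degrees c ++ take (k-fsize c) (degrees r)) = run (dec (width r :: st)) (take (k-fsize c) (degrees r)).
  by case: (c)=> // c1 r1;exact: (run_forest c1 r1 (width r :: st)).
 rewrite e0;case: r IHr kf kr {e0}=> // c2 r2 IHr kf kr.
 by have [st' e1 e2]:= IHr st i.+1 _ kr;exists st'.
by move=> kf;exact: (gen (FNode c r)).
Qed.

Lemma stk_forest c k : (k <= fsize c)%N -> exists2 st, stk (tree_degrees c) k = Some st &
  size st = size (nth [::] (tree_words c) k).
case: k=> [|k] kc;first by exists [::].
case: c kc=> // c r kc;rewrite /stk /=.
by have [st' e1 e2]:= run_depth [::] 1 kc;exists st'.
Qed.

(** Induction on a height bound codes the subtree of each child; an inner induction, from the last
    child to the first, assembles them into a list of siblings. *)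
Lemma forest_of_pred h (p : word -> bool) : p [::] -> (forall u v, p (u ++ v) -> p u) ->
  (forall u, p u -> exists k, forall i, p (rcons u i) <-> (1 <= i <= k)%N) ->
  (forall u, p u -> (size u <= h)%N) -> exists c, forall w, p w = (w \in tree_words c).
elim: h p=> [|h IH] p p0 pre kids bound.
 by exists FNil=> w;rewrite inE;apply/idP/eqP=> [/bound|->//];case: w.
have [k hk]:= kids _ p0.
have kid i: p [:: i] <-> (1 <= i <= k)%N:= hk i.
have sub i: (1 <= i <= k)%N -> exists c, forall w, p (i :: w) = (w \in tree_words c).
 move=> ik;apply: IH=> [|u v|u pu|u /bound//].
 - exact/kid.
 - by rewrite -cat_cons=> /pre.
 - by have [k' hk']:= kids _ pu;exists k' => j;rewrite -hk'.
suff gen m: forall i, (1 <= i)%N -> (i+m = k.+1)%N -> exists f, forall w,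
  (w \in fwords i f) = p w && (if w is j :: _ then i <= j else false)%N.
 have [f hf]:= gen k 1%N isT (add1n k).
 exists f=> w;rewrite inE hf;case: w=> [|j v];first by rewrite p0.
 rewrite orFb;case pj : (p _)=> //=;symmetry.
 by have /kid/andP[]:= pre [:: j] v pj.
elim: m=> [|m IHm] i i1 im.
 exists FNil=> w;rewrite in_nil;case: w=> [|j v];rewrite ?andbF//.
 apply/esym/negP=> /andP[pj ij];have /kid/andP[_ jk]:= pre [:: j] v pj.
 by move: ij;rewrite leqNgt -[i]addn0 im ltnS jk.
have [f hf]:= IHm i.+1 (leqW i1) (etrans (addSnnS _ _) im).
have ik: (1 <= i <= k)%N by lia.
have [c hc]:= sub _ ik.
exists (FNode c f)=> -[|j v];rewrite /= inE mem_cat hf.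
 by rewrite andbF;apply/negP=> /= /orP[/mapP[]|].
have ->: ((j :: v) \in map (cons i) (fwords 1 c)) = (j == i) && (v \in fwords 1 c).
 by apply/mapP/andP=> [[u uc [-> ->]]|[/eqP-> vc]];[rewrite eqxx|exists v].
rewrite eqseq_cons;case: (ltngtP i j)=> ij /=;rewrite ?andbF ?andbT// -ij.
by rewrite hc inE orbF.
Qed.

Lemma plane_tree_forest (T : {fset word}) : is_plane_tree T -> exists c, T =i tree_words c.
move=> [T0 [Tpos [Tpre Tkid]]].
have [||u uT|c hc]:= @forest_of_pred (\max_(u <- enum_fset T) size u) (fun w=> w \in T) T0.
- by move=> u v /(Tpre _ (size u));rewrite take_size_cat.
- by move=> u /Tkid[k hk];exists k.
- by rewrite (big_rem u) //= leq_maxl.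
- by exists c.
Qed.

Definition forest_tree (c : forest) : {fset word} := seq_fset tt (tree_words c).

Lemma forest_treeE c : forest_tree c =i tree_words c.
Proof. by move=> w;rewrite seq_fsetE. Qed.

Lemma mem_fwords i c r j v : (j :: v \in fwords i (FNode c r)) =
  ((j == i) && (v \in tree_words c)) || (j :: v \in fwords i.+1 r).
rewrite /= inE mem_cat eqseq_cons inE orbA;congr orb.
have ->: ((j :: v) \in map (cons i) (fwords 1 c)) = (j == i) && (v \in fwords 1 c).
 by apply/mapP/andP=> [[u uc [-> ->]]|[/eqP-> vc]];[rewrite eqxx|exists v].
by rewrite andb_orr.
Qed.

Lemma fwords_nil i f : [::] \in fwords i f = false.
Proof. by apply/negP=> /fwords_head[j [u []]]. Qed.

Lemma fwords_pos i f w : (0 < i)%N -> w \in fwords i f -> all (fun j => 0 < j)%N w.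
elim: f i w=> // c IHc r IHr i [|j v] i0 //;rewrite mem_fwords inE=> /orP[/andP[/eqP-> /orP[/eqP->|vc]]|].
- by rewrite /= i0.
- by rewrite /= i0 (IHc 1%N).
- exact: IHr.
Qed.

Lemma fwords_take i f w k : w \in fwords i f -> take k w \in [::] :: fwords i f.
elim: f i w k=> // c IHc r IHr i [|j v] [|k] //;rewrite mem_fwords [take _ _]/= => h;rewrite inE mem_fwords.
case/orP: h=> [/andP[-> h]|h].
 rewrite [in X in _ || X](_ : (take k v \in tree_words c) = true) ?orbT//.
 by move: h;rewrite inE=> /orP[/eqP->|];[rewrite inE|exact: IHc].
by have:= IHr i.+1 _ k.+1 h;rewrite inE /= => ->;rewrite orbT.
Qed.

Lemma fwords_roots i f j : ([:: j] \in fwords i f) = (i <= j < i + width f)%N.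
elim: f i=> [|c _ r IH] i;first by rewrite in_nil addn0;case: leqP.
by rewrite mem_fwords inE eqxx andbT IH /= addSnnS;case: ltngtP;rewrite ?orbF ?andbF//= => <-;rewrite addnS ltnS leq_addr.
Qed.

Lemma fwords_kids i f u : u \in fwords i f -> exists k, forall j, (rcons u j \in fwords i f) <-> (1 <= j <= k)%N.
elim: f i u=> // c IHc r IHr i [|l v];first by rewrite fwords_nil.
rewrite mem_fwords=> /orP[/andP[/eqP-> vc]|h];last first.
 have [k hk]:= IHr _ _ h;exists k=> j;rewrite -hk rcons_cons mem_fwords.
 have [m [w [[<- _] im]]]:= fwords_head h.
 by rewrite (gtn_eqF im).
have aux j: (rcons (i :: v) j \in fwords i (FNode c r)) = (rcons v j \in fwords 1 c).
 rewrite rcons_cons mem_fwords eqxx inE.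
 have ->: (rcons v j == [::]) = false by case: (v).
 have ->: (i :: rcons v j \in fwords i.+1 r) = false.
  by apply/negP=> /fwords_head[m [w [[<- _]]]];rewrite ltnn.
 by rewrite orbF.
move: vc;rewrite inE=> /orP[/eqP v0|vc].
 by exists (width c)=> j;rewrite aux v0 fwords_roots add1n ltnS.
by have [k hk]:= IHc _ _ vc;exists k=> j;rewrite aux.
Qed.

Lemma forest_tree_plane c : is_plane_tree (forest_tree c).
split;first by rewrite forest_treeE inE.
split=> [u|];first by rewrite forest_treeE inE=> /orP[/eqP->//|];exact: fwords_pos.
split=> [u k|u].
 by rewrite !forest_treeE [in X in X -> _]inE=> /orP[/eqP->|];[rewrite inE|exact: fwords_take].
rewrite forest_treeE inE=> /orP[/eqP->|uc].
 by exists (width c)=> j;rewrite forest_treeE inE /= fwords_roots add1n ltnS.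
have [k hk]:= fwords_kids uc;exists k=> j;rewrite forest_treeE inE -hk.
by case: (u).
Qed.

Arguments contour_step : simpl never.

Fixpoint walk (T : {fset word}) k x : seq word :=
  if k is k'.+1 then (contour_step T x).1 :: walk T k' (contour_step T x) else [::].

Lemma walk_add T a b x : walk T (a + b) x = walk T a x ++ walk T b (iter a (contour_step T) x).
Proof. by elim: a x=> //= a IH x;rewrite IH -iterSr. Qed.

Lemma walk_nth T k m x : (m <= k)%N -> (iter m (contour_step T) x).1 = nth [::] (x.1 :: walk T k x) m.
elim: k m x=> [|k IH] [|m] x // mk.
by rewrite iterSr IH//;case: (m) mk.
Qed.

Fixpoint grafted (T : {fset word}) (u : word) (i : nat) (f : forest) : Prop :=
  if f is FNode c r then
    [/\ outdeg T (rcons u i) = width c, grafted T (rcons u i) 1 c & grafted T u i.+1 r]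
  else True.

Lemma walk_grafted T u i f : outdeg T u = (i + width f)%N -> grafted T u i.+1 f ->
  walk T (fsize f).*2 (u, i) = map (cat u) (ftrace i.+1 f) /\
  iter (fsize f).*2 (contour_step T) (u, i) = (u, i + width f)%N.
elim: f u i=> [|c IHc r IHr] u i ou;first by rewrite addn0.
move=> [oi gc gr].
have [wc ic]:= IHc _ 0%N oi gc.
have [wr ir]:= IHr u i.+1 (etrans ou (addnS _ _)) gr.
have e1: contour_step T (u, i) = (rcons u i.+1, 0)%N.
 by rewrite /contour_step ou addnS ltnS leq_addr.
have e2: contour_step T (rcons u i.+1, width c) = (u, i.+1).
 by rewrite /contour_step oi ltnn size_rcons /= -cats1 take_size_cat// cats1 last_rcons.
have ->: (fsize (FNode c r)).*2 = ((fsize c).*2+(fsize r).*2.+1).+1.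
 by rewrite /= doubleS doubleD addnS.
split.
 rewrite [LHS]/= e1 walk_add wc ic add0n [walk T _.+1 _]/= e2 wr /= map_cat -map_comp /= cats0 cats1;congr (_ :: (_ ++ _)).
 by apply/eq_map=> w /=;rewrite cat_rcons.
by rewrite iterSr e1 addnC iterD ic add0n iterSr e2 ir addSnnS.
Qed.

Lemma grafted_count T u i f : (forall w, w \in fwords i f -> outdeg T (u ++ w) = count (child_of w) (fwords i f)) ->
  grafted T u i f.
elim: f u i=> // c IHc r IHr u i hu /=;split.
- by rewrite -cats1 hu ?inE ?eqxx// count_sub width_count.
- apply: IHc=> w wc;rewrite cat_rcons hu ?count_sub//.
 by rewrite mem_fwords eqxx inE wc orbT.
- apply: IHr=> w wr;rewrite hu ?count_rest//.
 by rewrite /= inE mem_cat wr !orbT.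
Qed.

Lemma forest_grafted T c : T =i tree_words c -> grafted T [::] 1 c.
move=> h;apply: grafted_count=> w wc;rewrite (count_outdeg _ h) /=.
by case: w wc=> [|? ?];rewrite ?fwords_nil.
Qed.

Lemma contour_vtx_forest T c m : T =i tree_words c -> (m <= (fsize c).*2)%N ->
  contour_vtx T m = nth [::] ([::] :: ftrace 1 c) m.
move=> h mc;have oc: outdeg T [::] = width c by rewrite (count_outdeg _ h) /= width_count.
have [w _]:= walk_grafted (i:= 0) oc (forest_grafted h).
by rewrite /contour_vtx (walk_nth _ _ mc) w (map_id _ : map (cat [::]) _ = _).
Qed.

Lemma ftrace_mem i f : [::] :: ftrace i f =i [::] :: fwords i f.
elim: f i=> // c IHc r IHr i w.
have:= eq_mem_map (cons i) (IHc 1%N) w;have:= IHr i.+1 w.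
rewrite /= !inE !mem_cat=> h1 h2;rewrite inE h1 (orbA (w == [:: i]) (w \in map _ (ftrace _ _))) h2.
by case: (w == [::]);case: (w == [:: i]);case: (w \in map _ _);case: (w \in fwords _ _).
Qed.

(** Each step discovers a new vertex or returns to a parent. After [m] steps with [b] discoveries
    the height is b - (m - b), and the visited set consists of the origin and the first [b] words in
    depth-first order. *)
Lemma ftrace_visited i f m : (m <= (fsize f).*2)%N -> exists b, let x := nth [::] ([::] :: ftrace i f) m in
  [/\ (b <= fsize f)%N, (size x + m = b.*2)%N,
      take m.+1 ([::] :: ftrace i f) =i [::] :: take b (fwords i f),
      (size x <= size (nth [::] ([::] :: fwords i f) b))%N &
      (b < fsize f)%N -> (size (nth [::] (fwords i f) b) <= (size x).+1)%N].
elim: f i m=> [|c IHc r IHr] i m;first by case: m=> // _;exists 0%N;split.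
case: m=> [|m];first by move=> _;exists 0%N;split=> // w;rewrite take0.
rewrite [fsize _]/= doubleS ltnS=> mf;have [mc|cm]:= leqP m (fsize c).*2.
 have [b [b1 b2 b3 b4 b5]]:= IHc 1%N m mc;exists b.+1.
 have ->: nth [::] ([::] :: ftrace i (FNode c r)) m.+1 = i :: nth [::] ([::] :: ftrace 1 c) m.
  case: m {mf b2 b3 b4 b5} mc=> [//|m] mc;rewrite /= nth_cat size_map size_ftrace mc.
  by rewrite (nth_map [::])// size_ftrace.
 split=> /=.
 - by rewrite ltnS (leq_trans b1)// leq_addr.
 - by rewrite addSn addnS b2 doubleS.
 - move=> w;rewrite !takel_cat ?size_map ?size_ftrace ?size_fwords// -!map_take.
  by rewrite inE [RHS]inE -!(map_cons (cons i) [::]) (eq_mem_map (cons i) b3).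
 - case: b b1 {b2 b3 b5} b4=> [//|b] b1 b4;rewrite /= nth_cat size_map size_fwords b1.
  by rewrite (nth_map [::]) ?size_fwords//= ltnS.
 - rewrite ltnS=> br;rewrite nth_cat size_map size_fwords;case: ltnP=> bc.
   by rewrite (nth_map [::]) ?size_fwords//= ltnS;exact: b5.
  have ->: (b-fsize c = 0)%N by apply/eqP;rewrite subn_eq0.
  by case: (r).
have mr: (m-(fsize c).*2.+1 <= (fsize r).*2)%N by rewrite leq_subLR addSn -doubleD.
have [b [b1 b2 b3 b4 b5]]:= IHr i.+1 _ mr;exists (fsize c+b).+1.
set m':= (m-_)%N in b2 b3 b4 b5 mr.
have mE: (m = (fsize c).*2.+1+m')%N by rewrite subnKC.
have ->: nth [::] ([::] :: ftrace i (FNode c r)) m.+1 = nth [::] ([::] :: ftrace i.+1 r) m'.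
 by rewrite mE addSn /= nth_cat size_map size_ftrace ltnNge leq_addr /= addKn.
split.
- by rewrite ltnS leq_add2l.
- by rewrite mE addnS addSn addnS addnCA b2 -doubleD doubleS.
- move=> w;have:= eq_mem_map (cons i) (ftrace_mem 1 c) w;have:= b3 w.
 have ->: take m.+2 ([::] :: ftrace i (FNode c r)) =
   [::] :: [:: i] :: map (cons i) (ftrace 1 c) ++ take m'.+1 ([::] :: ftrace i.+1 r).
  by rewrite mE addSn /= take_cat size_map size_ftrace ltnNge leqW ?leq_addr//= subSn ?leq_addr// addKn.
 have ->: take (fsize c+b).+1 (fwords i (FNode c r)) = [:: i] :: map (cons i) (fwords 1 c) ++ take b (fwords i.+1 r).
  by rewrite /= take_cat size_map size_fwords ltnNge leq_addr /= addKn.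
 move: (take m'.+1 _)=> X;rewrite !map_cons !inE !mem_cat=> -> h2;rewrite orbA (orbA (w == [:: i]) (w \in map _ (fwords 1 c))) -h2.
 by case: (w == [::]);case: (w == [:: i]);case: (w \in map _ (ftrace _ _));case: (w \in take _ _).
- case: b b1 {b2 b3 b5} b4=> [|b] b1;first by rewrite leqn0=> /eqP->.
 by move=> b4;rewrite addnS /= nth_cat size_map size_fwords ltnNge leq_addr/= addKn.
- by rewrite ltnS ltn_add2l=> /b5;rewrite /= nth_cat size_map size_fwords ltnNge leq_addr/= addKn.
Qed.

Lemma contour_state (T : {fset word}) c A m : T =i tree_words c -> (m <= (fsize c).*2)%N -> exists b,
  [/\ (0 < b <= (fsize c).+1)%N, (size (contour_vtx T m) + m = (b.-1).*2)%N,
      (size (contour_vtx T m) <= size (nth [::] (tree_words c) b.-1))%N,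
      (b <= fsize c)%N -> (size (nth [::] (tree_words c) b) <= (size (contour_vtx T m)).+1)%N &
      Ncount A T m = count [in A] (take b (tree_degrees c))].
move=> h mc;have [b [b1 b2 b3 b4 b5]]:= ftrace_visited 1 mc;exists b.+1.
suff NE: Ncount A T m = count [in A] (take b.+1 (tree_degrees c)).
 by rewrite !(contour_vtx_forest h mc);split.
rewrite /Ncount (nvert_forest h) mul2n (minn_idPl mc).
have ->: map (contour_vtx T) (iota 0 m.+1) = take m.+1 ([::] :: ftrace 1 c).
 apply: (@eq_from_nth _ [::]);first by rewrite size_map size_iota size_takel// /= size_ftrace ltnS.
 move=> j;rewrite size_map size_iota=> jm.
 rewrite (nth_map 0%N) ?size_iota// nth_iota// add0n nth_take//.
 by apply: (contour_vtx_forest h);rewrite (leq_trans _ mc).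
rewrite -(outdeg_forest h) -map_take count_map -size_filter.
apply: perm_size;apply: uniq_perm;[exact: undup_uniq| |].
 exact/filter_uniq/take_uniq/tree_words_uniq.
by move=> w;rewrite mem_undup !mem_filter b3.
Qed.

Lemma size_tree_degrees c : size (tree_degrees c) = (fsize c).+1.
Proof. by rewrite /= size_degrees. Qed.

Lemma tree_degrees_hits c : hits 1 (tree_degrees c).
Proof. by have:= hits_degrees (FNode c FNil) 0 [::];rewrite !cats0 /= cats0. Qed.

Lemma Kcount_forest (T : {fset word}) c (A : set nat) k : T =i tree_words c -> (k <= (fsize c).+1)%N ->
  Kcount A T k = count [in A] (take k (tree_degrees c)).
move=> h kc;rewrite -(map_nth_iota0 0%N) ?size_tree_degrees// count_map /Kcount.
apply: eq_in_count=> j;rewrite mem_iota=> /= jk.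
by rewrite (outdeg_vtx h)// -ltnS (leq_trans jk kc).
Qed.

Lemma degrees_lex (T : {fset word}) c : T =i tree_words c -> tree_degrees c = map (outdeg T) (lex_vertices T).
Proof. by move=> h;rewrite (lex_vertices_forest h) (outdeg_forest h). Qed.
End PlaneTrees.

(** * Conditioned trees as conditioned degree words *)

Section TreeLaw.
Context {R : realType}.

Lemma luka_forest (T : {fset word}) c k : T =i tree_words c -> (k <= (fsize c).+1)%N ->
  luka T k = \sum_(x <- take k (tree_degrees c)) zeta x :> R.
move=> h kc;rewrite (big_nth 0%N) size_takel ?size_tree_degrees// big_mkord /luka.
apply: eq_bigr=> j _;have jk:= ltn_ord j.
by rewrite (outdeg_vtx h) ?nth_take// -ltnS (leq_trans jk kc).
Qed.

Lemma gw_weight_forest (mu : nat -> R) (T : {fset word}) c : T =i tree_words c ->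
  gw_weight mu T = \prod_(x <- tree_degrees c) mu x.
move=> h;rewrite /gw_weight (perm_big _ (perm_forest h)) /= -(outdeg_forest h).
by rewrite big_map.
Qed.

Fixpoint seqs (N m : nat) : seq (seq nat) :=
  if m is m'.+1 then [seq k :: s | k <- iota 0 N, s <- seqs N m'] else [:: [::]].

Lemma psum_seqs (mu : nat -> R) N m F :
  psum mu N m F = \sum_(s <- seqs N m) (\prod_(x <- s) mu x) * F s.
elim: m F=> [|m IH] F /=;first by rewrite big_seq1 big_nil mul1r.
rewrite big_allpairs_dep -(big_mkord predT (fun k=> mu k * psum mu N m (fun s=> F (k :: s)))) /index_iota subn0;apply: eq_bigr=> k _.
by rewrite IH mulr_sumr;apply: eq_bigr=> s _;rewrite big_cons mulrA.
Qed.

Lemma seqs_uniq N m : uniq (seqs N m).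
elim: m=> //= m IH;apply: allpairs_uniq=> //;first exact: iota_uniq.
by move=> [? ?] [? ?] _ _ /= [-> ->].
Qed.

Lemma mem_seqs N s : all (fun k => k < N)%N s -> s \in seqs N (size s).
elim: s=> [|k s IH] /=;first by rewrite inE.
by case/andP=> kN /IH h;apply/allpairsP;exists (k, s);rewrite mem_iota.
Qed.

Lemma hits_lt n s : hits 1 s -> size s = n -> all (fun k => k < n)%N s.
move=> hs sn;apply/allP=> k ks;have:= hits_sum hs;rewrite sn addn1=> <-;rewrite ltnS.
by rewrite (perm_sumn (perm_to_rem ks)) /= leq_addr.
Qed.

(** A total inverse of [tree_degrees]; its default on other words is hidden by the factor
    [hits 1]. *)
Definition tree_of (s : seq nat) : {fset word} :=
  if pselect (exists c, tree_degrees c = s) is left h then forest_tree (projT1 (cid h)) else forest_tree FNil.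

Lemma tree_ofE c : tree_of (tree_degrees c) = forest_tree c.
rewrite /tree_of;case: pselect=> [h|[]];last by exists c.
case: cid=> c' /= e.
have [[->] //]:= @degrees_inj (FNode c' FNil) (FNode c FNil) [::] [::] (congr1 (fun l=> (l ++ [::]) ++ [::]) e) erefl.
Qed.

Lemma hits_tree s : hits 1 s -> exists2 c, tree_degrees c = s & tree_of s = forest_tree c.
case/hits_forest=> -[//|c [|//]] _;rewrite /= cats0=> e.
by exists c=> //;rewrite -e tree_ofE.
Qed.

Variables (mu : nat -> R) (d1 : measure_display) (Omega1 : measurableType d1) (P1 : probability Omega1 R).

(** Trees correspond to hitting words, and the Galton-Watson weight is the product of the weights of
    the letters. Taking [G] constant equal to 1 determines [c] and shows that [treeP] is not
    zero. *)
Theorem tree_expectation n (T : Omega1 -> {fset word}) (c : R) (G : {fset word} -> R) :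
  (forall w, is_plane_tree (T w) /\ nvert (T w) = n) ->
  (forall t, measurable [set w | T w = t]) ->
  (forall t, is_plane_tree t -> nvert t = n -> P1 [set w | T w = t] = (c * gw_weight mu t)%:E) ->
  bmfun (fun w => G (T w)) /\ treeP mu n != 0 /\
  Ex P1 (fun w => G (T w)) = excsum mu n s (G (tree_of s)) / treeP mu n.
move=> Tp Tm Tl.
pose r:= [seq s <- seqs n.+1 n | hits 1 s].
have GE H w: H (T w) = \sum_(s <- r) H (tree_of s) * \1_[set w' | T w' = tree_of s] w :> R.
 have [/plane_tree_forest[f hf] Tn]:= Tp w.
 have Tf: T w = forest_tree f by apply/fsetP=> u;rewrite hf forest_treeE.
 have sn: size (tree_degrees f) = n by rewrite size_tree_degrees -(nvert_forest hf).
 have hh:= tree_degrees_hits f.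
 have fr: tree_degrees f \in r.
  rewrite mem_filter hh -sn;apply: mem_seqs;apply: sub_all (hits_lt hh erefl)=> k.
  by rewrite ltnS=> /ltnW.
 rewrite (bigD1_seq (tree_degrees f)) //=;last by rewrite filter_uniq// seqs_uniq.
 rewrite tree_ofE -Tf indicE mem_set// mulr1 big1_seq ?addr0// => s /andP[sf].
 rewrite mem_filter=> /andP[/hits_tree[c' e1 e2] _].
 rewrite indicE memNset ?mulr0//= => e3;move/eqP: sf;apply;rewrite -e1.
 have hc': T w =i tree_words c' by move=> u;rewrite e3 e2 forest_treeE.
 by rewrite (degrees_lex hc') (degrees_lex hf).
have term s h: bmfun (fun w=> h * \1_[set w' | T w' = tree_of s] w : R).
 by apply: bmfunZ;apply: bmfun_indic.
have sumE (H : {fset word} -> R) : (fun w=> H (T w)) =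
  (fun w=> \sum_(s <- r) H (tree_of s) * \1_[set w' | T w' = tree_of s] w) by exact/funext.
have bmH (H : {fset word} -> R) : bmfun (fun w=> H (T w)).
 by rewrite sumE;have []:= Ex_sum P1 r (fun s=> term s (H (tree_of s))).
have ExH (H : {fset word} -> R) : Ex P1 (fun w=> H (T w)) = c * excsum mu n s (H (tree_of s)).
 rewrite sumE;have [_ ->]:= Ex_sum P1 r (fun s=> term s (H (tree_of s))).
 rewrite psum_seqs mulr_sumr big_filter [RHS](bigID (hits 1)) /= [X in _ = _+X]big1=> [|s /negbTE->];last by rewrite mul0r !mulr0.
 rewrite addr0;rewrite big_seq_cond [RHS]big_seq_cond;apply: eq_bigr=> s /andP[sr hs].
 rewrite hs mul1r ExZ;last by apply: bmfun_indic.
 have sn: size s = n.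
  elim: (n) (n.+1) (s) sr=> [|m IH] N u /=;first by rewrite inE=> /eqP->.
  by case/allpairsP=> -[k v] /= [_ /IH vs ->] /=;rewrite vs.
 have [f e1 e2]:= hits_tree hs.
 have ET: Ex P1 \1_[set w' | T w' = tree_of s] = c * \prod_(x <- s) mu x.
  apply: EFin_inj;rewrite -ExE;last exact: bmfun_indic.
  rewrite integral_indic// setIT -e1 -(gw_weight_forest mu (forest_treeE f)) e1 e2.
  apply: Tl;first exact: forest_tree_plane.
  by rewrite (nvert_forest (forest_treeE f)) -size_tree_degrees e1.
 by rewrite ET;ring.
have c1: c * treeP mu n = 1.
 have:= ExH (fun=> 1);rewrite Ex_cst=> ->;congr (_ * _).
 by apply: eq_psum=> s _ _;rewrite mulr1.
have t0: treeP mu n != 0 by apply/eqP=> t0;move: c1;rewrite t0 mulr0=> /esym/eqP;rewrite oner_eq0.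
split;first exact: bmH.
split=> //;rewrite ExH;apply: (mulIf t0);rewrite mulfVK// mulrAC c1 mul1r.
by [].
Qed.
End TreeLaw.

(** * Convergence of the coding processes *)

Lemma iota_last k : (0 < k)%N -> iota 1 k = iota 1 k.-1 ++ [:: k].
Proof. by case: k=> // k _;rewrite -{1}(addn1 k) iotaD add1n. Qed.

Section FiniteDimensional.
Context {R : realType}.
Variables (mu : nat -> R) (V1 : R).
Variables (eta : nat -> R) (Ce gam2 sig2 : R).
Hypothesis crit : critical_law mu V1 sig2.
Hypothesis sig2_gt0 : 0 < sig2.
Hypothesis eta_le : forall k, `|eta k| <= Ce * k.+1%:R.
Hypothesis cvg_eta : mlim mu eta (0 : R).
Hypothesis cvg_eta2 : mlim mu (fun k => eta k ^+ 2) gam2.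
Hypothesis cvg_zeta_eta : mlim mu (fun k => (k%:R - 1) * eta k) (0 : R).

Definition treeE n (F : seq nat -> R) : R := excsum mu n s (F s) / treeP mu n.

Lemma treeP_gt0 : \forall n \near \oo, 0 < treeP mu n.
have [c c0 h]:= treeP_lb crit sig2_gt0.
near=> n.
have h1: c <= n%:R * sqn n * treeP mu n by near: n.
have p0: 0 <= n%:R * sqn n :> R by rewrite mulr_ge0// sqrtr_ge0.
by rewrite ltNge;apply/negP=> t0;have:= mulr_ge0_le0 p0 t0;rewrite leNgt (lt_le_trans c0 h1).
Unshelve. all: end_near. Qed.

Lemma treeE_le n F G : 0 < treeP mu n -> (forall s, hits 1 s -> size s = n -> F s <= G s) -> treeE n F <= treeE n G.
move=> t0 h;rewrite ler_pM2r ?invr_gt0//;apply: psum_ler=> // s ss _.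
by case hs : (hits 1 s);rewrite ?mul0r// !mul1r;exact: h.
Qed.

Lemma treeE_eq n F G : (forall s, hits 1 s -> size s = n -> F s = G s) -> treeE n F = treeE n G.
move=> h;congr (_/_);apply: eq_psum=> s ss _.
by case hs : (hits 1 s);rewrite ?mul0r// h.
Qed.

Lemma treeE_average : \forall n \near \oo, average (treeE n).
have h:= treeP_gt0;near=> n;have t0: 0 < treeP mu n by near: n.
split=> [F G|c F|F G FG|].
- by rewrite /treeE -mulrDl -psumD;congr (_/_);apply: eq_psum=> s _ _;rewrite mulrDr.
- by rewrite /treeE mulrA -psumZ;congr (_/_);apply: eq_psum=> s _ _;rewrite mulrCA.
- by apply: treeE_le.
- rewrite /treeE (@eq_psum _ _ _ _ _ (fun s=> (hits 1 s)%:R)) ?divff ?lt0r_neq0// => s _ _.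
 by rewrite mulr1.
Unshelve. all: end_near. Qed.

Lemma treeE_event n (B : seq nat -> bool) (kap : R) : 0 < treeP mu n ->
  excsum mu n s ((B s)%:R) <= kap * treeP mu n -> treeE n (fun s => (B s)%:R) <= kap.
Proof. by move=> t0 h;rewrite /treeE ler_pdivrMr. Qed.

Context {d : measure_display} {Omega : measurableType d}.
Variables (P : probability Omega R) (e B : Omega -> R -> R).
Hypothesis exc : is_norm_excursion P e.
Hypothesis bm : is_std_BM P B.
Hypothesis ind : indep_processes P e B.
Variable gam : R.
Hypothesis gamE : gam ^+ 2 = gam2.

(** The conditional transform is a ratio of two [Zfun], the denominator carrying no test; the common
    factor [kap0 sig2 1 0] of the limits cancels. *)
Lemma treeE_functional beta c D : admissible 1 D ->
  treeE n (fun s => expR (- lamsum n D s) * cos (c + (beta * esum_ eta s + phsum eta n D s) / sqn n)) @[n --> \oo] -->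
  Ex P (fun w => slotprod e (eslots sig2 D) w * cos (c + gam * phase B (bphase 1 beta D) w)).
move=> aD;rewrite (limit_functional exc bm ind sig2_gt0 gamE)//.
have o1: 0 < (1 : R) <= 1 by rewrite ltr01 lexx.
have zc b' c' D': admissible 1 D' -> Zfun mu eta n 1 b' c' D' @[n --> \oo] --> cos c' * Zlim gam2 sig2 1 b' D'.
 exact: (Zfun_cvg crit sig2_gt0 eta_le cvg_eta cvg_eta2 cvg_zeta_eta).
have h1:= zc beta c D aD;have h2:= zc 0 0 [::] I.
have k0:= kap0_gt0 sig2_gt0 (@ltr01 R).
have z0: cos 0*Zlim gam2 sig2 1 0 [::] = kap0 sig2 1 0 :> R.
 by rewrite cos0 mul1r /= expr0n /= !mul0r oppr0 expR0 mul1r.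
rewrite z0 in h2;rewrite (Zlim_factor gam2 sig2_gt0 beta ltr01 aD) in h1.
have h3: Zfun mu eta n 1 beta c D*(Zfun mu eta n 1 0 0 [::])^-1 @[n --> \oo] -->
  cos c*(kap0 sig2 1 0*(Elim sig2 1 D*Blim gam2 1 beta D))/kap0 sig2 1 0.
 by apply: cvgM=> //;apply: cvgV=> //;exact: lt0r_neq0.
have ->: cos c*(Elim sig2 1 D*Blim gam2 1 beta D) =
  cos c*(kap0 sig2 1 0*(Elim sig2 1 D*Blim gam2 1 beta D))/kap0 sig2 1 0.
 by field;rewrite lt0r_neq0.
apply: cvg_trans h3;apply: near_eq_cvg;near=> n.
have n0: (0 < n)%N by near_nat n.
have q0: n%:R * sqn n != 0 :> R by rewrite mulf_neq0 ?lt0r_neq0 ?sqrtr_gt0 ?ltr0n.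
rewrite /= /Zfun mul1r natrK invfM mulrACA mulfV// mul1r /treeE;congr (_ * _^-1).
apply: eq_psum=> s _ _;rewrite /lamsum /phsum !big_nil oppr0 expR0 !mul0r addr0 mul0r addr0 cos0.
by rewrite !mulr1.
Unshelve. all: end_near. Qed.

Variable sg : R.
Hypothesis sgE : sg ^+ 2 = sig2.

(** Discrete counterpart of [sample]. Heights are measured by [pend], the walk plus 1, as in
    [lamsum], and set to 0 at both ends like those of the excursion. *)
Definition coords k n (s : seq nat) (i : nat) : R :=
  let j := i./2 in let u := take (truncn (j%:R / k%:R * n%:R : R)) s in
  (if odd i then (if j == 0%N then 0 else esum_ eta u)
   else (if (j == 0%N) || (j == k) then 0 else (pend 1 u)%:R)) / sqn n.

Let w o t : R := sg * e o t.
Let g o t : R := gam * B o t.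

(** At time 1 only the additive coordinate is tested, hence [k.-1] weights against [k]
    frequencies. *)
Definition testfun k (m al : nat -> R) (c : R) (v : nat -> R) : R :=
  expR (- \sum_(j <- iota 1 k.-1) m j * v j.*2 ^+ 2) * cos (c + \sum_(j <- iota 1 k) al j * v j.*2.+1).

Definition coord_cvg k (Psi : (nat -> R) -> R) : Prop :=
  bmfun (fun o => Psi (sample k (w o) (g o))) /\
  treeE n (fun s => Psi (coords k n s)) @[n --> \oo] --> Ex P (fun o => Psi (sample k (w o) (g o))).

Lemma coord_cvgD k Psi1 Psi2 : coord_cvg k Psi1 -> coord_cvg k Psi2 -> coord_cvg k (fun v => Psi1 v + Psi2 v).
move=> [b1 c1] [b2 c2];split;first exact: bmfunD.
rewrite ExD//;apply: cvg_trans (cvgD c1 c2);apply: near_eq_cvg.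
by move: treeE_average;apply: filterS=> n [ED _ _ _];exact: (esym (ED _ _)).
Qed.

Lemma coord_cvgZ k c Psi : coord_cvg k Psi -> coord_cvg k (fun v => c * Psi v).
move=> [b1 c1];split;first exact: bmfunZ.
have h: c * treeE n (fun s=> Psi (coords k n s)) @[n --> \oo] --> c*Ex P (fun o=> Psi (sample k (w o) (g o))) by apply: cvgMr.
rewrite ExZ//;apply: cvg_trans h;apply: near_eq_cvg.
by move: treeE_average;apply: filterS=> n [_ EZ _ _];exact: (esym (EZ _ _)).
Qed.

Let mB : forall t, mfunT (B ^~ t). Proof. by case: bm. Qed.
Let me : forall t, mfunT (e ^~ t). Proof. by case: exc. Qed.

Definition plan k (m al : nat -> R) (K : nat) : seq (R * R * R) := rev [seq (j%:R / k%:R, m j, al j) | j <- iota 1 K].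

Lemma plan_admissible k m al K : (0 < k)%N -> (forall j, 0 <= m j) -> admissible (K.+1%:R / k%:R) (plan k m al K).
move=> k0 m0;have kk: 0 < k%:R :> R by rewrite ltr0n.
elim: K=> // K IH.
have ->: plan k m al K.+1 = (K.+1%:R/k%:R, m K.+1, al K.+1) :: plan k m al K.
 by rewrite /plan -[in LHS](addn1 K) iotaD map_cat rev_cat /= add1n.
split=> //.
by rewrite divr_gt0//= ltr_pM2r ?invr_gt0// ltr_nat.
Qed.

Lemma testfun_cvg k m al c : (0 < k)%N -> (forall j, 0 <= m j) -> coord_cvg k (testfun k m al c).
move=> k0 m0;have kk: 0 < k%:R :> R by rewrite ltr0n.
have aD: admissible 1 (plan k m al k.-1).
 by have:= plan_admissible al k.-1 k0 m0;rewrite prednK// divff ?lt0r_neq0.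
have h:= @treeE_functional (al k) c _ aD.
have [s1 l1]:= eslots_ok sig2_gt0 aD.
have sampE: (fun o=> testfun k m al c (sample k (w o) (g o))) =
  (fun o=> slotprod e (eslots sig2 (plan k m al k.-1)) o * cos (c+gam * phase B (bphase 1 (al k) (plan k m al k.-1)) o)).
 apply/funext=> o;rewrite /testfun;congr (_ * cos (c+_)).
  rewrite /slotprod /eslots /plan map_rev revK -map_comp big_map -sumrN expR_sum.
  rewrite big_seq [RHS]big_seq;apply: eq_bigr=> j;rewrite mem_iota=> /andP[j0 jk].
  rewrite /= /sample odd_double doubleK /gweight gtn_eqF// ltn_eqF /=;last by lia.
  by rewrite /w -sgE;congr expR;ring.
 rewrite /phase /bphase big_cons /= mulrDr /plan map_rev big_rev -map_comp big_map mulr_sumr.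
 rewrite (iota_last k0) big_cat big_seq1 /= addrC;congr (_+_).
  by rewrite /sample /= odd_double /= uphalf_double gtn_eqF//= divff ?lt0r_neq0// mulrCA.
 rewrite big_seq [RHS]big_seq;apply: eq_bigr=> j;rewrite mem_iota=> /andP[j0 jk].
 by rewrite /sample /= odd_double /= uphalf_double gtn_eqF//= mulrCA.
rewrite /coord_cvg sampE;split.
 apply: bmfunM;first exact: slotprod_bm.
 by apply: cos_bm;apply: measurable_funD=> //;apply: measurable_funM=> //;exact: phase_meas.
apply: cvg_trans h;apply: near_eq_cvg;near=> n.
have n0: (0 < n)%N by near_nat n.
have q0: 0 < sqn n :> R by rewrite sqrtr_gt0 ltr0n.
apply: treeE_eq=> s hs ss;rewrite /testfun;congr (expR (- _) * cos (c+_)).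
 rewrite /lamsum /plan big_rev big_map big_seq [RHS]big_seq;apply: eq_bigr=> j;rewrite mem_iota=> /andP[j0 jk].
 rewrite /= /coords odd_double doubleK gtn_eqF// ltn_eqF /=;last by lia.
 by rewrite exprMn exprVn sqr_sqrtr// [RHS]mulrA.
rewrite /phsum /plan big_rev big_map.
rewrite (iota_last k0) big_cat big_seq1 /= mulrDl [RHS]addrC;congr (_+_);last first.
 rewrite mulr_suml big_seq [RHS]big_seq;apply: eq_bigr=> j;rewrite mem_iota=> /andP[j0 jk].
 by rewrite /coords /= odd_double /= uphalf_double gtn_eqF//= mulrA.
by rewrite /coords /= odd_double /= uphalf_double gtn_eqF//= divff ?lt0r_neq0// mul1r natrK -ss take_size mulrA.
Unshelve. all: end_near. Qed.

(** Chosen so that multiplication by a chart preserves combinations of test functions. The Gaussian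
    chart is injective on nonnegative heights, the sine chart on |x| <= L. *)
Definition chart (L : nat -> R) (i : nat) (x : R) : R :=
  if odd i then (1 + sin (x / L i)) / 2 else expR (- x ^+ 2).

Lemma sin_cosB (x : R) : sin x = cos (x - pi / 2).
Proof. by rewrite cosB cos_pihalf sin_pihalf mulr0 mulr1 add0r. Qed.

(** A Gaussian chart adds 1 to a weight; a sine chart becomes, by product to sum, a combination of
    three test functions with shifted frequencies and phases; a chart at a coordinate frozen at 0 is
    constant. *)
Lemma charts_cvg k m al c L js : (0 < k)%N -> (forall j, 0 <= m j) -> all (fun j => j < k.+1.*2)%N js ->
  coord_cvg k (fun v => testfun k m al c v * \prod_(j <- js) chart L j (v j)).
move=> k0;elim: js m al c=> [|i js IH] m al c m0.
 by move=> _;under [X in coord_cvg k X]eq_fun do rewrite big_nil mulr1;exact: testfun_cvg.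
case/andP=> ik jsk.
suff [Q] : exists2 Q : (nat -> R) -> R, (forall v, v 0%N = 0 -> v 1%N = 0 -> v k.*2 = 0 -> Q v = testfun k m al c v * chart L i (v i)) &
  coord_cvg k (fun v=> Q v * \prod_(j <- js) chart L j (v j)).
 move=> QE cQ;have spE o: sample k (w o) (g o) 0%N = 0 /\ sample k (w o) (g o) 1%N = 0 /\ sample k (w o) (g o) k.*2 = 0.
  by rewrite /sample /= odd_double doubleK eqxx orbT.
 have csE n s: coords k n s 0%N = 0 /\ coords k n s 1%N = 0 /\ coords k n s k.*2 = 0.
  by rewrite /coords /= odd_double doubleK eqxx orbT !mul0r.
 case: cQ=> [bQ cQ];split.
  move: bQ;congr bmfun;apply/funext=> o;have [s1 [s2 s3]]:= spE o.
  by rewrite big_cons QE// mulrA.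
 rewrite (_ : (fun n=> _) = (fun n=> treeE n (fun s=> Q (coords k n s) * \prod_(j <- js) chart L j (coords k n s j))));last first.
  apply/funext=> n;congr (treeE n);apply/funext=> s;have [s1 [s2 s3]]:= csE n s.
  by rewrite big_cons QE// mulrA.
 rewrite (_ : (fun o=> _) = (fun o=> Q (sample k (w o) (g o)) * \prod_(j <- js) chart L j (sample k (w o) (g o) j))) //.
 apply/funext=> o;have [s1 [s2 s3]]:= spE o.
 by rewrite big_cons QE// mulrA.
have iE:= odd_double_half i;case oi : (odd i) iE=> iE.
 have [j0|j0]:= posnP i./2.
  exists (fun v=> 2^-1 * testfun k m al c v).
   move=> v v0 v1 _;rewrite /chart oi -iE j0 /= v1 mul0r sin0 addr0 mulrC;ring.
  under [X in coord_cvg k X]eq_fun do rewrite -mulrA;apply: coord_cvgZ;exact: IH.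
 pose j:= i./2;have jk: (0 < j < k.+1)%N by rewrite j0 /j;lia.
 pose al' (x : R) l:= al l+(if l == j then x else 0).
 have alE x v: \sum_(l <- iota 1 k) al' x l * v l.*2.+1 = \sum_(l <- iota 1 k) al l * v l.*2.+1+x * v i :> R.
  under eq_bigr do rewrite mulrDl;rewrite big_split /=;congr (_+_).
  rewrite (bigD1_seq j) ?iota_uniq ?mem_iota//= eqxx big1 ?addr0=> [|l /negbTE->];last by rewrite mul0r.
  by rewrite -[in RHS]iE.
 exists (fun v=> 2^-1 * testfun k m al c v+(4^-1 * testfun k m (al' (L i)^-1) (c-pi/2) v + - 4^-1 * testfun k m (al' (- (L i)^-1)) (c-pi/2) v)).
  move=> v _ _ _;rewrite /chart oi /testfun !alE.
  move: (\sum_(l <- iota 1 k) _) (expR _)=> th E.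
  have ->: c-pi/2+(th+(L i)^-1 * v i) = (c+th)+v i/L i-pi/2 by ring.
  have ->: c-pi/2+(th + - (L i)^-1 * v i) = (c+th)-v i/L i-pi/2 by ring.
  by rewrite -!sin_cosB sinD sinB;field.
 have rw v: (2^-1 * testfun k m al c v+(4^-1 * testfun k m (al' (L i)^-1) (c-pi/2) v + - 4^-1 * testfun k m (al' (- (L i)^-1)) (c-pi/2) v)) * \prod_(j <- js) chart L j (v j) =
   2^-1*(testfun k m al c v * \prod_(j <- js) chart L j (v j))+(4^-1*(testfun k m (al' (L i)^-1) (c-pi/2) v * \prod_(j <- js) chart L j (v j)) +
   - 4^-1*(testfun k m (al' (- (L i)^-1)) (c-pi/2) v * \prod_(j <- js) chart L j (v j))) by ring.
 under [X in coord_cvg k X]eq_fun do rewrite rw.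
 apply: (coord_cvgD (coord_cvgZ _ (IH _ _ _ m0 jsk)) (coord_cvgD (coord_cvgZ _ (IH _ _ _ m0 jsk)) (coord_cvgZ _ (IH _ _ _ m0 jsk)))).
case: (boolP ((i./2 == 0) || (i./2 == k))%N)=> jk.
 exists (testfun k m al c);last exact: IH.
 move=> v v0 _ vk;rewrite /chart oi -iE add0n.
 by case/orP: jk=> /eqP ->;rewrite ?v0 ?vk expr0n oppr0 expR0 mulr1.
pose j:= i./2;have jk': (0 < j < k)%N by move: jk;rewrite negb_or -/j;lia.
pose m' l:= m l+(if l == j then 1 else 0).
exists (testfun k m' al c);last by apply: IH=> // l;rewrite addr_ge0//;case: eqP.
move=> v _ _ _;rewrite /chart oi /testfun mulrAC -expRD;congr (expR _ * _).
under eq_bigr do rewrite mulrDl;rewrite big_split /= opprD;congr (_-_).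
rewrite (bigD1_seq j) ?iota_uniq ?mem_iota//=;last by lia.
rewrite eqxx mul1r big1 ?addr0=> [|l /negbTE->];last by rewrite mul0r.
by rewrite -[in RHS]iE.
Qed.

Lemma pend_zeta s j : hits 1 s -> (j < size s)%N ->
  (pend 1 (take j s))%:R = 1 + \sum_(x <- take j s) zeta x :> R.
move=> hs js;have [st E <-]:= @hits_stk R s j hs js.
by rewrite (run_pend E) -natr1 addrC.
Qed.

Definition maxev (f : nat -> R) (M : R) (n : nat) (s : seq nat) : bool :=
  has (fun j => M * sqn n < `|\sum_(x <- take j s) f x|) (iota 0 n.+1).

Lemma osc_max (f : nat -> R) (dl : R) n s : 0 < dl -> 1 <= dl * n%:R -> size s = n ->
  ~~ osc f (truncn (dl * n%:R)) (1 * sqn n) s -> ~~ maxev f (2 / dl + 2) n s.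
move=> dl0 dn ss ho;have q0:= sqrtr_ge0 (n%:R : R).
have n0: (0 < n)%N by case: n dn {ss ho q0}=> //;rewrite mulr0 ler10.
have L0: (0 < truncn (dl * n%:R))%N by rewrite truncn_gt0.
have n0': 0 < n%:R :> R by rewrite ltr0n.
have ho':= ho;rewrite mul1r in ho';have small:= osc_walk_le dl0 dn ss ho'.
apply/hasPn=> j;rewrite mem_iota /= add0n ltnS -leNgt leq_eqVlt=> /predU1P[->|jn];last first.
 by apply: (le_trans (small _ jn));rewrite ler_wpM2r// lerD2l -[1]/(1%:R) ler_nat.
have n1: (n.-1 < n)%N by rewrite prednK.
have n1s: (n.-1 < size s)%N by rewrite ss.
have:= osc_window (k:= n.-1) (l:= 1) ho n1s L0;rewrite addn1 prednK// mul1r.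
have:= small _ n1;set x:= \sum_(_ <- take n s) _;set y:= \sum_(_ <- _) _=> h1 h2.
rewrite -[x](subrK y);apply: (le_trans (ler_normD _ _)).
have ->: (2/dl+2) * sqn n = sqn n+(2/dl+1) * sqn n by ring.
exact: lerD.
Qed.

Lemma max_tight (f : nat -> R) (Cf v2 ep : R) : (forall k, `|f k| <= Cf * k.+1%:R) ->
  mlim mu f (0 : R) -> mlim mu (fun k => f k ^+ 2) v2 -> 0 < ep ->
  exists2 M : R, 0 < M & \forall n \near \oo, treeE n (fun s => (maxev f M n s)%:R) <= ep.
move=> fle cf cf2 ep0.
have [dl /andP[dl0 dl1] ho]:= excursion_osc crit sig2_gt0 fle cf cf2 ltr01 ep0.
exists (2/dl+2);first by rewrite addr_gt0// divr_gt0.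
have tg:= treeP_gt0;near=> n.
have t0: 0 < treeP mu n by near: n.
have dn: 1 <= dl * n%:R by rewrite -ler_pdivrMl// mulr1;near: n;exact: nbhs_infty_ger.
have h: excsum mu n s ((osc f (truncn (dl * n%:R)) (1 * sqn n) s)%:R) <= ep * treeP mu n by near: n.
apply: le_trans (treeE_event t0 h);apply: treeE_le=> // s hs ss.
rewrite ler_nat;case o : osc;first by case: maxev.
by rewrite (negbTE (osc_max dl0 dn ss (negbT o))).
Unshelve. all: end_near. Qed.

Lemma zeta_le k : `|zeta k| <= 1 * k.+1%:R :> R.
Proof. by rewrite mul1r /zeta ler_norml -natr1;have : 0 <= k%:R :> R by [];lra. Qed.

Lemma indic_bm (S : set R) (X : Omega -> R) : measurable S -> mfunT X -> bmfun (fun o => \1_S (X o) : R).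
move=> mS mX;rewrite (_ : (fun o=> _) = \1_(X @^-1` S));last by [].
by apply: bmfun_indic;rewrite -[X in measurable X]setTI;exact: mX.
Qed.

Lemma norm_gt_meas (m : R) : measurable [set x : R | m < `|x|].
have ->: [set x : R | m < `|x|] = normr @^-1` `]m, +oo[%classic by apply/seteqP;split=> x /=;rewrite in_itv/= andbT.
by rewrite -[X in measurable X]setTI;apply: normr_measurable.
Qed.

Lemma rv_tight (X : Omega -> R) (ep : R) : mfunT X -> 0 < ep ->
  exists2 M : R, 0 < M & Ex P (fun o => \1_[set x : R | M < `|x|] (X o)) <= ep.
move=> mX ep0;pose f_ (m : nat) o : R:= \1_[set x : R | m%:R < `|x|] (X o).
have bf m: bmfun (f_ m) by apply: indic_bm=> //;exact: norm_gt_meas.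
have h1 m: mfunT (f_ m) by have []:= bf m.
have h2 m o: `|f_ m o| <= 1 by rewrite /f_ indicE;case: (_ \in _);rewrite ?normr1 ?normr0.
have h3 o: f_ m o @[m --> \oo] --> (0 : R).
 apply: cvg_near_cst;near=> m;rewrite /f_ indicE memNset//=;apply/negP;rewrite -leNgt.
 by near: m;exact: nbhs_infty_ger.
have [_ /cvgrPdist_le /(_ _ ep0) [m _ hm]]:= Ex_dominated P h1 h2 h3.
exists m.+1%:R=> //;have:= hm m.+1 (leqnSn m);rewrite /= Ex_cst sub0r normrN.
exact: le_trans (ler_norm _).
Unshelve. all: end_near. Qed.

Lemma neg_meas : measurable [set x : R | x < 0].
have ->: [set x : R | x < 0] = `]-oo, 0[%classic by apply/seteqP;split=> x /=;rewrite in_itv.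
exact: measurable_itv.
Qed.

(** The finite-dimensional laws integrate over (0, oo) only, so negative values have probability 0
    at each fixed time. *)
Lemma exc_ge0 t : 0 < t < 1 -> Ex P (fun o => \1_[set x : R | x < 0] (e o t)) = 0.
move=> t01;have mA:= neg_meas.
have [_ _ _ h]:= exc;have:= h [:: (t, [set x : R | x < 0])];rewrite /= in_itv /= t01=> /(_ (conj mA I) (conj isT I) isT).
rewrite (_ : _ `&` _ = set0) ?integral_set0 ?mule0;last first.
 by apply/seteqP;split=> x //= [h1 h2];move: (lt_trans h1 h2);rewrite ltxx.
move=> pe;have ce: cyl e [:: (t, [set x : R | x < 0])] = (e ^~ t) @^-1` [set x : R | x < 0].
 by apply/seteqP;split=> o;rewrite /cyl /=;tauto.
have mc: measurable ((e ^~ t) @^-1` [set x : R | x < 0]).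
 by rewrite -[X in measurable X]setTI;exact: me.
rewrite (_ : (fun o=> _) = \1_((e ^~ t) @^-1` [set x : R | x < 0]));last by [].
apply: EFin_inj;rewrite -ExE;last exact: bmfun_indic.
by rewrite integral_indic// setIT -ce pe.
Qed.

Lemma sin_lower (a b : R) : `|a| <= 1 -> `|b| <= 1 -> `|a - b| <= 2 * `|sin a - sin b|.
wlog ab: a b/a <= b.
 move=> W;case/orP: (le_total a b)=> ab ha hb;first exact: W.
 by rewrite distrC (distrC (sin a));exact: W.
move=> ha hb;have [c cab hc]:= MVT_segment ab (fun x _=> is_derive_sin x) (continuous_subspaceT (@continuous_sin R)).
have cc: 1/2 <= cos c.
 have:= cosB1_le c;have : c^+2 <= 1.
  move: cab ha hb;rewrite in_itv /= !ler_norml=> /andP[c1 c2] /andP[a1 a2] /andP[b1 b2].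
  rewrite -[leRHS](expr1n _ 2) -[c^+2]real_normK ?num_real// lerXn2r ?nnegrE// ler_norml;apply/andP;split;lra.
 lra.
rewrite distrC (distrC (sin a)) hc normrM !(ger0_norm (_ : 0 <= b-a)) ?subr_ge0//.
rewrite ger0_norm;last lra.
rewrite mulrA ler_peMl ?subr_ge0//;lra.
Qed.

Lemma gauss_lower (M x y : R) : 0 <= x <= M -> 0 <= y <= M ->
  expR (- M ^+ 2) * (x - y) ^+ 2 <= `|expR (- x ^+ 2) - expR (- y ^+ 2)|.
wlog xy: x y/x <= y.
 move=> W;case/orP: (le_total x y)=> h hx hy;first exact: W.
 by rewrite distrC -[(x-y)^+2]sqrrN opprB;exact: W.
move=> /andP[x0 xM] /andP[y0 yM].
have h1: expR (- x^+2) = expR (- y^+2) * expR (y^+2-x^+2) by rewrite -expRD;congr expR;ring.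
have h2:= expR_ge1Dx (y^+2-x^+2).
have h3: (x-y)^+2 <= y^+2-x^+2 by nra.
have h4: expR (- M^+2) <= expR (- y^+2) by rewrite ler_expR lerN2 lerXn2r ?nnegrE ?y0 ?(le_trans y0 yM).
apply: le_trans (ler_norm _);rewrite h1.
have ->: expR (- y^+2) * expR (y^+2-x^+2)-expR (- y^+2) = expR (- y^+2)*(expR (y^+2-x^+2)-1) by ring.
apply: ler_pM;rewrite ?expR_ge0 ?sqr_ge0//;lra.
Qed.

Lemma chart_meas (M : nat -> R) i : mfunT (chart M i) /\
  measurable (if odd i then [set x : R | `|x| <= M i] else [set x : R | 0 <= x <= M i]).
rewrite /chart;case: (odd i);split.
- apply: measurable_funM=> //;apply: measurable_funD=> //.
 apply: (measurableT_comp (continuous_measurable_fun (@continuous_sin R))).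
 exact: measurable_funM.
- rewrite (_ : [set x | _] = `[- M i, M i]%classic);first exact: measurable_itv.
 by apply/seteqP;split=> x /=;rewrite in_itv /= ler_norml.
- have [[h _] _]:= @gweight_slot R 1 ler01.
 by rewrite (_ : (fun x=> _) = gweight 1)//;apply/funext=> x;rewrite /gweight mul1r.
- rewrite (_ : [set x | _] = `[0, M i]%classic);first exact: measurable_itv.
 by apply/seteqP;split=> x /=;rewrite in_itv.
Qed.

Hypothesis sg0 : 0 < sg.

Theorem coords_fdd k L M Phi : (0 < k)%N -> 0 <= L -> 0 <= M -> lipK (k.+1).*2 L Phi -> (forall x, `|Phi x| <= M) ->
  treeE n (fun s => Phi (coords k n s)) @[n --> \oo] --> Ex P (fun o => Phi (sample k (w o) (g o))).
move=> k0 L0 M0 lip bd.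
have mw t: mfunT (w ^~ t) by apply: measurable_funM=> //;exact: me.
have mg t: mfunT (g ^~ t) by apply: measurable_funM=> //;exact: mB.
have kk: 0 < k%:R :> R by rewrite ltr0n.
apply: (moments_cvg (sample_meas mw mg k) treeE_average L0 M0 lip bd)=> ep ep0.
have ep2: 0 < ep/2 by rewrite divr_gt0.
have [Mz Mz0 hz]:= max_tight zeta_le (law_zeta crit) (law_zeta2 crit) ep0.
have [Me Me0 he]:= max_tight eta_le cvg_eta cvg_eta2 ep0.
(* [Mz + 1] and not [Mz], because the height coordinate is the walk plus 1. *)
have hX i: exists M' : R, [/\ 0 < M', Mz+1 <= M', Me <= M' & Ex P (fun o=> \1_[set x : R | M' < `|x|] (sample k (w o) (g o) i)) <= ep].
 have [M1 M10 hM1]:= rv_tight (sample_meas mw mg k i) ep0.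
 have MM: M1 <= maxr M1 (maxr (Mz+1) Me) by rewrite le_max lexx.
 exists (maxr M1 (maxr (Mz+1) Me));split;rewrite ?le_max ?lexx ?orbT ?lt_max ?M10//.
 apply: le_trans hM1;apply: le_Ex=> [||o];try by apply: indic_bm=> //;[exact: norm_gt_meas|exact: sample_meas].
 rewrite !indicE ler_nat;case: (boolP (_ \in _))=> //;rewrite inE /= => h.
 by rewrite mem_set//=;exact: le_lt_trans MM h.
have [Mf hM]:= choice hX.
pose W i:= if odd i then [set x : R | `|x| <= Mf i] else [set x : R | 0 <= x <= Mf i].
exists (chart Mf), W;split.
- move=> i x;rewrite /chart;case: odd;last by rewrite expR_ge0 expR_le1 oppr_le0 sqr_ge0.
 have:= sin_geN1 (x/Mf i);have:= sin_le1 (x/Mf i)=> h1 h2;apply/andP;split;lra.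
- exact: chart_meas.
- move=> i e' e'0;have [Mi0 _ _ _]:= hM i;rewrite /W /chart;case: (odd i).
  exists (e'/(4*Mf i));first by rewrite divr_gt0// mulr_gt0.
  move=> x y /= xM yM h.
  have hx z: `|z| <= Mf i -> `|z/Mf i| <= 1 by move=> hz';rewrite normrM normfV (gtr0_norm Mi0) ler_pdivrMr// mul1r.
  have:= sin_lower (hx _ xM) (hx _ yM).
  rewrite -mulrBl normrM normfV (gtr0_norm Mi0) ler_pdivrMr// => /le_trans;apply.
  have h4: `|sin (x/Mf i)-sin (y/Mf i)| <= 2*(e'/(4*Mf i)).
   have e1: (1+sin (x/Mf i))/2-(1+sin (y/Mf i))/2 = (sin (x/Mf i)-sin (y/Mf i))/2 by field.
   by move: h;rewrite e1 normrM (ger0_norm (_ : 0 <= 2^-1)) ?invr_ge0// ler_pdivrMr// [leRHS]mulrC.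
  apply: (le_via (2*(2*(e'/(4*Mf i)))*Mf i));first by rewrite ler_pM2r// ler_pM2l.
  by apply: eq_le_val;field;rewrite lt0r_neq0.
 exists (expR (- Mf i^+2) * e'^+2);first by rewrite mulr_gt0 ?expR_gt0 ?exprn_gt0.
 move=> x y /= xM yM /(le_trans (gauss_lower xM yM)).
 rewrite ler_pM2l ?expR_gt0// -[(x-y)^+2]real_normK ?num_real// ler_sqr ?nnegrE ?(ltW e'0)//.
- move=> js jsK;have [_ h]:= @charts_cvg k (fun=> 0) (fun=> 0) 0 Mf js k0 (fun=> lexx 0) jsK.
 have t1 v: testfun k (fun=> 0) (fun=> 0) 0 v = 1.
  by rewrite /testfun !big1 ?oppr0 ?expR0 ?addr0 ?cos0 ?mulr1// => j _;rewrite mul0r.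
 by move: h;under eq_fun do under [X in treeE _ X]eq_fun do rewrite t1 mul1r;under [X in _ --> Ex P X]eq_fun do rewrite t1 mul1r.
move=> i iK;have [Mi0 Mi1 Mi2 hMi]:= hM i;split.
 have tg:= treeP_gt0;near=> n;have t0: 0 < treeP mu n by near: n.
 have hz': treeE n (fun s=> (maxev zeta Mz n s)%:R) <= ep by near: n.
 have he': treeE n (fun s=> (maxev eta Me n s)%:R) <= ep by near: n.
 have q1: 1 <= sqn n :> R by near_nat n.
 have q0: 0 < sqn n :> R by exact: lt_le_trans ltr01 q1.
 have tn j: (j <= k)%N -> (truncn (j%:R/k%:R * n%:R : R) <= n)%N.
  move=> jk;rewrite -[leqRHS](@natrK R);apply: le_truncn.
  by rewrite ler_piMl// ler_pdivrMr// mul1r ler_nat.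
 have jk: (i./2 <= k)%N by rewrite -ltnS ltn_half_double.
 case oi : (odd i).
  apply: le_trans he';apply: treeE_le=> // s hs ss;rewrite indicE.
  case: (boolP (_ \in _))=> //;rewrite inE /W oi /= => /negP;rewrite -ltNge /coords oi=> h.
  have -> // : maxev eta Me n s;apply/hasP;exists (truncn (i./2%:R/k%:R * n%:R : R)).
   by rewrite mem_iota /= add0n ltnS tn.
  move: h;case: eqP=> [_|_];first by rewrite mul0r normr0 ltNge (ltW Mi0).
  rewrite normrM normfV (gtr0_norm q0) ltr_pdivlMr// => /(le_lt_trans _);apply.
  by rewrite ler_pM2r.
 apply: le_trans hz';apply: treeE_le=> // s hs ss;rewrite indicE.
 case: (boolP (_ \in _))=> //;rewrite inE /W oi /= => /negP;rewrite /coords oi=> h.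
 have -> // : maxev zeta Mz n s;apply/hasP;exists (truncn (i./2%:R/k%:R * n%:R : R)).
  by rewrite mem_iota /= add0n ltnS tn.
 move: h;case: (boolP ((i./2 == 0) || (i./2 == k))%N)=> [_|];first by rewrite mul0r lexx (ltW Mi0).
 rewrite negb_or=> /andP[_ ik].
 have jn: (truncn (i./2%:R/k%:R * n%:R : R) < size s)%N.
  rewrite ss ltnNge truncn_ge_nat ?mulr_ge0// -ltNge.
  rewrite gtr_pMl ?ltr0n;last by near_nat n.
  by rewrite ltr_pdivrMr// mul1r ltr_nat ltn_neqAle ik.
 rewrite divr_ge0 ?(ltW q0)//= -ltNge ltr_pdivlMr// pend_zeta// => h.
 apply: lt_le_trans (ler_norm _).
 have : (Mz+1) * sqn n <= Mf i * sqn n by rewrite ler_pM2r.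
 rewrite mulrDl mul1r;lra.
have mWs: bmfun (fun o=> \1_(~` W i) (sample k (w o) (g o) i) : R).
 by apply: indic_bm;[apply: measurableC;exact: (chart_meas _ i).2|exact: sample_meas].
case oi : (odd i).
 apply: le_trans hMi;apply: le_Ex=> // [|o];first by apply: indic_bm;[exact: norm_gt_meas|exact: sample_meas].
 rewrite !indicE ler_nat;case: (boolP (_ \in _))=> //;rewrite inE /W oi /= => /negP;rewrite -ltNge=> h.
 by rewrite mem_set.
have [j0|]:= boolP ((i./2 == 0) || (i./2 == k))%N.
 rewrite (_ : (fun o=> _) = (fun=> 0)) ?Ex_cst ?(ltW ep0)//;apply/funext=> o.
 rewrite indicE memNset// /sample oi j0 /W oi /=;apply;rewrite lexx /=;exact: ltW.
rewrite negb_or=> /andP[j0 jk].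
have t01: 0 < (i./2%:R/k%:R : R) < 1.
 apply/andP;split;first by rewrite divr_gt0// ltr0n lt0n.
 by rewrite ltr_pdivrMr// mul1r ltr_nat ltn_neqAle jk -ltnS ltn_half_double.
have b1:= indic_bm (norm_gt_meas (Mf i)) (sample_meas mw mg k i).
have b2:= indic_bm neg_meas (me (i./2%:R/k%:R)).
apply: (le_via (Ex P (fun o=> \1_[set x : R | Mf i < `|x|] (sample k (w o) (g o) i) + \1_[set x : R | x < 0] (e o (i./2%:R/k%:R)))));last first.
 by rewrite ExD// exc_ge0// addr0.
apply: le_Ex=> // [|o];first exact: bmfunD.
rewrite !indicE -natrD ler_nat;case: (boolP (_ \in _))=> //;rewrite inE /W oi /= => /negP h.
set x:= sample k (w o) (g o) i in h *.
have xE: x = sg * e o (i./2%:R/k%:R) by rewrite /x /sample oi (negbTE j0) (negbTE jk).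
case: (ltP (e o (i./2%:R/k%:R)) 0)=> en;first by rewrite [X in (_+nat_of_bool X)%N]mem_set//= addn1.
rewrite mem_set//=;apply: lt_le_trans (ler_norm _);rewrite ltNge;apply/negP=> xM;move/negP: h;apply.
by rewrite xM andbT xE mulr_ge0// ltW.
Unshelve. all: end_near. Qed.
End FiniteDimensional.

Definition psums {R : realType} (f : nat -> R) (s : seq nat) (j : nat) : R := \sum_(x <- take j s) f x.

(** * Deterministic comparison of the coding processes with step paths *)

Section Closeness.
Context {R : realType}.
Variables (A : set nat) (muA a sig2 : R).
Hypothesis sig2_gt0 : 0 < sig2.
Hypothesis muA0 : 0 <= muA.
Notation half := (sig2 / 2).

(** Its sums are the centred A-count minus [a] times the walk; for a = m1/sigma^2 it is uncorrelated
    with [zeta]. *)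
Definition etaA (k : nat) : R := (k \in A)%:R - muA - a * zeta k.

Lemma sum_etaA (u : seq nat) : \sum_(x <- u) etaA x =
  (count [in A] u)%:R - (size u)%:R * muA - a * \sum_(x <- u) zeta x.
elim: u=> [|x u IH];first by rewrite !big_nil /=;ring.
by rewrite !big_cons IH /etaA /= natrD -natr1;ring.
Qed.

Lemma window (f : nat -> R) L lam s i j : ~~ osc f L lam s -> 0 <= lam -> (i <= j)%N -> (j <= size s)%N ->
  (j <= i + L)%N -> `|\sum_(x <- take j s) f x - \sum_(x <- take i s) f x| <= lam.
move=> ho l0 ij js jL;move: ij;rewrite leq_eqVlt=> /predU1P[->|ij];first by rewrite subrr normr0.
have is_: (i < size s)%N by apply: leq_trans js.
have h: (j-i <= L)%N by rewrite leq_subLR.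
by have:= osc_window (k:= i) (l:= j-i) ho is_ h;rewrite subnKC// ltnW.
Qed.

Lemma convex_dist (x y z th r : R) : 0 <= th <= 1 -> `|x - z| <= r -> `|y - z| <= r ->
  `|x + th * (y - x) - z| <= r.
move=> /andP[t0 t1] hx hy.
have ->: x+th*(y-x)-z = (1-th)*(x-z)+th*(y-z) by ring.
apply: (le_trans (ler_normD _ _));rewrite !normrM (ger0_norm t0) ger0_norm ?subr_ge0//.
have ->: r = (1-th) * r+th * r by ring.
by apply: lerD;apply: ler_wpM2l=> //;rewrite subr_ge0.
Qed.

Variables (f : forest) (T : {fset word}).
Hypothesis Tf : T =i tree_words f.
Variables (s : seq nat) (n L k : nat) (e1 M q : R).
Hypothesis sE : tree_degrees f = s.
Hypothesis nE : (fsize f).+1 = n.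
Hypothesis qE : sqn n = q.
Hypothesis k_gt0 : (0 < k)%N.
Hypothesis e1_ge0 : 0 <= e1.
Hypothesis gz : ~~ osc zeta L (e1 * q) s.
Hypothesis ge : ~~ osc etaA L (e1 * q) s.
Hypothesis gd : ~~ dev_ev sig2 e1 n s.
Hypothesis gM : ~~ maxev zeta M n s.
Hypothesis Lc : (M / half + e1) * q / 2 + 3 <= L%:R.
Hypothesis Lk : n%:R / k%:R + 2 <= L%:R :> R.
Notation W := (psums (zeta : nat -> R) s).
Notation G := (psums etaA s).
Notation rho := (e1 * q + 1).

Let half0 : 0 < half. Proof. by rewrite divr_gt0. Qed.
Let n_gt0 : (0 < n)%N. Proof. by rewrite -nE. Qed.
Let q0 : 0 < q. Proof. by rewrite -qE sqrtr_gt0 ltr0n. Qed.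
Let eq0 : 0 <= e1 * q. Proof. by rewrite mulr_ge0// ltW. Qed.
Let ss : size s = n. Proof. by rewrite -sE size_tree_degrees. Qed.
Let hs : hits 1 s. Proof. by rewrite -sE tree_degrees_hits. Qed.
Let kk : 0 < k%:R :> R. Proof. by rewrite ltr0n. Qed.
Let nn : 0 < n%:R :> R. Proof. by rewrite ltr0n. Qed.

Let L1 : (1 <= L)%N.
rewrite -(ler_nat R);apply: le_trans Lk;have : 0 <= n%:R/k%:R :> R by rewrite divr_ge0// ltW.
lra.
Qed.

Let Wn : W n = -1.
rewrite /psums take_oversize ?ss//;have:= hits_sum hs;rewrite ss=> h.
have ->: \sum_(x <- s) zeta x = (sumn s)%:R-(size s)%:R :> R.
 elim: (s)=> [|x u IH];first by rewrite big_nil subr0.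
 by rewrite big_cons IH /zeta /= natrD -natr1;ring.
by rewrite ss -h natrD;ring.
Qed.

Let winW i j : (i <= j)%N -> (j <= n)%N -> (j <= i + L)%N -> `|W j - W i| <= e1 * q.
Proof. by move=> ij jn jL;by apply: window gz _ ij _ jL;rewrite ?ss. Qed.

Let winG i j : (i <= j)%N -> (j <= n)%N -> (j <= i + L)%N -> `|G j - G i| <= e1 * q.
Proof. by move=> ij jn jL;by apply: window ge _ ij _ jL;rewrite ?ss. Qed.

Let H (j : nat) : R := (size (nth [::] (tree_words f) j))%:R.

Let HW j : (j < n)%N -> `|H j - W j / half| <= e1 * q.
move=> jn;have [|st Ek sz]:= @stk_forest f j;first by rewrite -ltnS nE.
have jns: (j < size s)%N by rewrite ss.
have [st' Ek' sW]:= @hits_stk R s j hs jns.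
have:= hasPn gd j;rewrite mem_iota /= add0n jn=> /(_ isT);rewrite sE in Ek.
rewrite Ek /dev /= -leNgt qE /H -sz.
by move: Ek';rewrite Ek=> -[e];rewrite -e in sW;rewrite /psums -sW.
Qed.

(** [contour_state] gives a number [b] of visited vertices with C + m = 2(b - 1), so b - p is about
    C/2 when [m] is near 2p. The contour height C lies between the height of vertex [b], less 1, and
    that of vertex [b.-1]. *)
Let contour_near p m : (p < n)%N -> (p.*2 <= m)%N -> (m <= p.*2.+2)%N -> (m <= n.-1.*2)%N ->
  forall Cm : R, Cm = (size (contour_vtx T m))%:R -> `|Cm - W p / half| <= (1 + half^-1) * rho /\
  exists b, [/\ Ncount A T m = count [in A] (take b s), (p <= b)%N, (b <= n)%N, (b <= p + L)%N & `|b%:R - p%:R - Cm / 2| <= 2].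
move=> pn pm mp mn Cm CmE;have mn': (m <= (fsize f).*2)%N by move: mn;rewrite -nE.
have [b [/andP[b0 bn] bC bH bH2 bN]]:= contour_state A Tf mn'.
rewrite sE in bN;rewrite nE in bn.
have hi0: 0 < half^-1 by rewrite invr_gt0.
have bE: Cm+m%:R = 2*(b%:R-1).
 have ->: b%:R-1 = b.-1%:R :> R by rewrite -{1}(prednK b0) -natr1 addrK.
 by rewrite CmE -natrD bC -muln2 natrM mulrC.
have pm': 2 * p%:R <= m%:R :> R by rewrite -natrM ler_nat mul2n.
have mp': m%:R <= 2 * p%:R+2 :> R by rewrite -natrM -natrD ler_nat mul2n addn2.
have b1n: (b.-1 < n)%N by rewrite prednK//.
have pb1: (p <= b.-1)%N by rewrite -leq_double -bC;apply: leq_trans pm (leq_addl _ _).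
have CH: Cm <= H b.-1 by rewrite CmE ler_nat.
have HW1:= HW b1n.
have WM: W b.-1 <= M * q.
 apply: le_trans (ler_norm _) _;have:= hasPn gM b.-1;rewrite mem_iota /= add0n ltnS (ltnW b1n)=> /(_ isT).
 by rewrite -leNgt qE.
have Cup: Cm <= (M/half+e1) * q.
 have : W b.-1/half <= M * q/half by rewrite ler_pM2r.
 have ->: (M/half+e1) * q = M * q/half+e1 * q by ring.
 by move: HW1;rewrite ler_norml=> /andP[h1 h2] h3;lra.
have bpL: (b <= p+L)%N.
 have Lc':= Lc;move: Lc' Cup;move: ((M/half+e1) * q)=> X Lc' Cup.
 by rewrite -(ler_nat R) natrD;lra.
have pb: (p <= b)%N by apply: leq_trans pb1 (leq_pred _).
split;last by exists b;split=> //;rewrite ler_norml;apply/andP;split;lra.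
have b1pL: (b.-1 <= p+L)%N by apply: leq_trans (leq_pred _) bpL.
have w1:= winW pb1 (ltnW b1n) b1pL.
have w2:= winW pb bn bpL.
have d1 x y: `|x-y| <= e1 * q -> x/half <= y/half+half^-1*(e1 * q).
 rewrite ler_norml=> /andP[_ h];rewrite [half^-1 * _]mulrC -mulrDl ler_pM2r ?invr_gt0//;lra.
have u1:= d1 _ _ w1.
have Wp2: W p/half <= W b/half+half^-1*(e1 * q) by apply: d1;rewrite distrC.
have rr: (1+half^-1) * rho = e1 * q+1+half^-1*(e1 * q)+half^-1 by ring.
have z0: 0 <= half^-1*(e1 * q) by rewrite mulr_ge0// ltW.
have C0: 0 <= Cm by rewrite CmE.
move: HW1;rewrite ler_norml rr=> /andP[h1 h2];rewrite ler_norml;apply/andP;split;last lra.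
(* For b = n there is no vertex [b], but the walk ends at -1 and the lower bound follows from C >=
   0. *)
move: bn;rewrite leq_eqVlt=> /predU1P[bn|bn].
 by move: Wp2;rewrite bn Wn mulN1r;lra.
have:= HW bn;rewrite ler_norml=> /andP[h3 h4].
have : H b <= Cm+1 by rewrite CmE natr1 ler_nat;apply: bH2;rewrite -ltnS nE.
lra.
Qed.

Let npred : n.-1%:R = n%:R - 1 :> R. Proof. by rewrite -{2}(prednK n_gt0) -natr1 addrK. Qed.

Section Time.
Variable t : R.
Hypothesis t01 : 0 <= t <= 1.
Let t0 : 0 <= t. Proof. by case/andP: t01. Qed.
Let t1 : t <= 1. Proof. by case/andP: t01. Qed.

(** [p0] and [m0] cap the vertex index at the last vertex and the contour time at the end of the
    exploration. *)
Variables (p p0 m1 m0 : nat).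
Hypothesis pE : truncn (n%:R * t) = p.
Hypothesis p0E : minn p n.-1 = p0.
Hypothesis m1E : truncn (2 * n%:R * t) = m1.
Hypothesis m0E : minn m1 (n.-1).*2 = m0.
Let nt0 : 0 <= n%:R * t. Proof. by rewrite mulr_ge0. Qed.
Let pitv : p%:R <= n%:R * t < p%:R + 1. Proof. by rewrite natr1 -pE;exact: truncn_itv. Qed.
Let mitv : m1%:R <= 2 * (n%:R * t) < m1%:R + 1. Proof. by rewrite mulrA natr1 -m1E;apply: truncn_itv;rewrite -mulrA mulr_ge0. Qed.
Let ntn : n%:R * t <= n%:R. Proof. by rewrite ler_piMr// ltW. Qed.
Let pn : (p <= n)%N. Proof. by rewrite -(ler_nat R);case/andP: pitv=> h _;exact: le_trans h ntn. Qed.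
Let p0n : (p0 < n)%N. Proof. by rewrite -p0E gtn_min prednK// leqnn orbT. Qed.
Let p0p : (p0 <= p)%N. Proof. by rewrite -p0E geq_minl. Qed.
Let pp0 : (p <= p0.+1)%N.
Proof. by rewrite -p0E -minnSS leq_min leqnSn prednK. Qed.

Let m_lo : (p.*2 <= m1)%N.
Proof. by rewrite -ltnS -(ltr_nat R) -muln2 natrM mulrC -natr1;case/andP: pitv=> h1 h2;case/andP: mitv=> h3 h4;lra. Qed.
Let m_hi : (m1 <= p.*2.+1)%N.
Proof. by rewrite -ltnS -(ltr_nat R) -!natr1 -muln2 natrM mulrC;case/andP: pitv=> h1 h2;case/andP: mitv=> h3 h4;lra. Qed.
Let m0_lo : (p0.*2 <= m0)%N.
Proof. by rewrite -m0E leq_min (leq_trans _ m_lo) ?leq_double// -p0E geq_minr. Qed.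
Let m0_hi : (m0 <= p0.*2.+1)%N.
rewrite -m0E -p0E;case: (leqP p n.-1)=> h;first by apply: leq_trans (geq_minl _ _) m_hi.
by apply: leq_trans (geq_minr _ _) _.
Qed.

Let p0t : `|p0%:R - n%:R * t| <= 1.
have h1: p0%:R <= p%:R :> R by rewrite ler_nat.
have [h|h]:= leqP p n.-1.
 by rewrite -p0E (minn_idPl h) ler_norml;case/andP: pitv=> h2 h3;apply/andP;split;lra.
have pEn: p = n by apply/eqP;rewrite eqn_leq pn -[X in (X <= _)%N]prednK.
rewrite -p0E (minn_idPr (ltnW h));have e:= npred.
by rewrite e ler_norml;case/andP: pitv;rewrite pEn=> h2 h3;have h4:= ntn;apply/andP;split;lra.
Qed.

Notation stw := (stepw k (coords etaA k n s)).
Notation stg := (stepg k (coords etaA k n s)).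

Let step_near : `|W p0 - q * stw t| <= 2 * rho /\ `|G p0 - q * stg t| <= 2 * rho.
have kt0: 0 <= k%:R * t by rewrite mulr_ge0// ltW.
rewrite /stepw /stepg /coords qE;set j:= truncn (k%:R * t).
have /andP[j1 j2]:= truncn_itv kt0;rewrite -/j -natr1 in j1 j2.
rewrite /= odd_double /= uphalf_double doubleK !(mulrC q) !mulfVK ?lt0r_neq0//.
set x:= truncn (j%:R/k%:R * n%:R).
have jk: (j <= k)%N by exact: stepidx.
have jt: j%:R/k%:R <= t by rewrite ler_pdivrMr// mulrC.
have xlo: 0 <= j%:R/k%:R * n%:R :> R by rewrite mulr_ge0// divr_ge0// ltW.
have /andP[x1 x2]:= truncn_itv xlo;rewrite -/x -natr1 in x1 x2.
have rr: 2 * rho = e1 * q+e1 * q+2 by ring.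
have hr0:= eq0;rewrite rr.
have [jk'|jk']:= eqVneq j k.
 have xn: x = n by rewrite /x jk' divff ?lt0r_neq0// mul1r natrK.
 have pn1: p0 = n.-1.
  rewrite -p0E;apply/minn_idPr;rewrite -(ler_nat R) npred;move: jt;rewrite jk' divff ?lt0r_neq0// => t1'.
  have tE: t = 1 by apply/eqP;rewrite eq_le t1.
  by case/andP: pitv;rewrite tE mulr1=> _ ?;lra.
 have bn: (n.-1 <= n)%N by exact: leq_pred.
 have nL: (n <= n.-1+L)%N by rewrite -{1}(prednK n_gt0) -addn1 leq_add2l.
 have:= winW bn (leqnn n) nL;have:= winG bn (leqnn n) nL;rewrite Wn pn1 orbT.
 have jn0: (j == 0%N) = false by rewrite jk' gtn_eqF.
 rewrite jn0 xn /esum_ -/(psums etaA s n)=> h1 h2;split;last by rewrite distrC;apply: (le_trans h1);lra.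
 by move: h2;rewrite subr0 !ler_norml=> /andP[h3 h4];apply/andP;split;lra.
have jlt: (j < k)%N by rewrite ltn_neqAle jk'.
have xn: (x < n)%N.
 by rewrite -(ltr_nat R);apply: le_lt_trans x1 _;rewrite gtr_pMl// ltr_pdivrMr// mul1r ltr_nat.
have xp: (x <= p0)%N.
 rewrite -p0E leq_min;apply/andP;split;last by rewrite -ltnS prednK.
 by rewrite -pE;apply: le_truncn;rewrite mulrC ler_pM2l.
have pxL: (p0 <= x+L)%N.
 rewrite -(ler_nat R) natrD;have h1: p0%:R <= n%:R * t by apply: le_trans (_ : p%:R <= _);[rewrite ler_nat|case/andP: pitv].
 have h2: n%:R * t <= j%:R/k%:R * n%:R+n%:R/k%:R.
  have ->: j%:R/k%:R * n%:R+n%:R/k%:R = n%:R*((j%:R+1)/k%:R) :> R by ring.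
  by rewrite ler_pM2l// ler_pdivlMr// mulrC ltW.
 have h3:= Lk;move: h1 h2 h3 x2;move: (n%:R * t) (j%:R/k%:R * n%:R) (n%:R/k%:R)=> y1 y2 y3;lra.
have wW:= winW xp (ltnW p0n) pxL;have wG:= winG xp (ltnW p0n) pxL.
have [j0|j0]:= eqVneq j 0%N.
 have x0: x = 0%N by rewrite /x j0 mul0r mul0r truncn0.
 by move: wW wG;rewrite x0 /psums take0 !big_nil !subr0=> h1 h2;split;[apply: (le_trans h1)|apply: (le_trans h2)];lra.
rewrite pend_zeta ?ss// /esum_ -/(psums etaA s x) -/(psums zeta s x);split;last by apply: (le_trans wG);lra.
rewrite /=;move: wW;rewrite !ler_norml=> /andP[h1 h2];apply/andP;split;lra.
Qed.

Definition closec : R := 3 + 3 * `|a| + (muA + 1) * (6 + 3 * half^-1).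

Let scale1 (x y : R) c : `|x - q * y| <= c * rho -> `|x / q - y| <= c * (rho / q).
move=> h;have ->: x/q-y = (x-q * y)/q by field;rewrite lt0r_neq0.
by rewrite mulrA normrM normfV (gtr0_norm q0) ler_pM2r ?invr_gt0.
Qed.

Let rho1 : 1 <= rho. Proof. by rewrite lerDr. Qed.
Let hi0 : 0 < half^-1. Proof. by rewrite invr_gt0. Qed.
Let na0 := normr_ge0 a.

Let cK x : x <= 3 + 3 * `|a| + muA * (6 + 3 * half^-1) + (6 + 3 * half^-1) -> x * rho <= closec * rho.
Proof. move=> h;rewrite ler_pM2r ?(lt_le_trans ltr01 rho1)//;apply: (le_trans h).
by rewrite /closec le_eqVlt;apply/orP;left;apply/eqP;ring. Qed.

Lemma WK_close : dist2 (WK_proc A muA n T t) (path1 a stw stg t) <= closec * (rho / q).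
have [h1 h2]:= step_near;rewrite /dist2 /WK_proc /path1 /= pE qE ge_max.
have pL: (p <= p0+L)%N by apply: leq_trans pp0 _;rewrite -addn1 leq_add2l.
have w1:= winW p0p pn pL;have w2:= winG p0p pn pL.
have Wd: `|W p-q * stw t| <= 3 * rho.
 have ->: W p-q * stw t = (W p-W p0)+(W p0-q * stw t) by ring.
 apply: (le_trans (ler_normD _ _));lra.
have Gd: `|G p-q * stg t| <= 3 * rho.
 have ->: G p-q * stg t = (G p-G p0)+(G p0-q * stg t) by ring.
 apply: (le_trans (ler_normD _ _));lra.
have mh: 0 <= muA*(6+3 * half^-1) by rewrite mulr_ge0// addr_ge0// mulr_ge0// ltW.
apply/andP;split;apply: scale1.
 rewrite (luka_forest Tf) ?nE// sE -/(psums zeta s p);apply: (le_trans Wd);apply: cK.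
 have:= hi0;have:= na0;lra.
rewrite (Kcount_forest A Tf) ?nE// sE.
have:= sum_etaA (take p s);rewrite -/(psums etaA s p) -/(psums zeta s p) size_takel ?ss// => GE.
have ->: (count [in A] (take p s))%:R-n%:R * t * muA-q*(a * stw t+stg t) =
 (G p-q * stg t)+(a*(W p-q * stw t)+(p%:R-n%:R * t) * muA) by rewrite GE;ring.
apply: (le_trans (ler_normD _ _));apply: (le_via (3 * rho+(3 * `|a| * rho+muA * rho))).
 apply: lerD=> //;apply: (le_trans (ler_normD _ _));apply: lerD.
  by rewrite normrM mulrAC [3 * _ * _]mulrC ler_wpM2l.
 rewrite normrM (ger0_norm muA0) mulrC ler_wpM2l//;apply: le_trans rho1.
 by case/andP: pitv=> ? ?;rewrite ler_norml;apply/andP;split;lra.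
have ->: 3 * rho+(3 * `|a| * rho+muA * rho) = (3+3 * `|a| + muA) * rho by ring.
apply: cK;have : muA <= muA*(6+3 * half^-1) by rewrite ler_peMr//;have:= hi0;lra.
have:= hi0;lra.
Qed.

Lemma CN_close : dist2 (CN_proc A muA n T t) (path2 (2 / sig2) (a + muA / sig2) stw stg t) <= closec * (rho / q).
have [h1 h2]:= step_near;rewrite /dist2 /CN_proc /path2 /= m1E qE ge_max.
have mh: 0 <= muA*(6+3 * half^-1) by rewrite mulr_ge0// addr_ge0// mulr_ge0// ltW.
have hb: 2/sig2 = half^-1 by rewrite invf_div.
have near1 m: (p0.*2 <= m)%N -> (m <= p0.*2.+2)%N -> (m <= n.-1.*2)%N ->
  `|(size (contour_vtx T m))%:R-W p0/half| <= (1+half^-1) * rho by move=> x1 x2 x3;have []:= contour_near p0n x1 x2 x3 erefl.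
have Wh: `|W p0/half-q*(2/sig2 * stw t)| <= half^-1*(2 * rho).
 have ->: W p0/half-q*(2/sig2 * stw t) = half^-1*(W p0-q * stw t) by rewrite hb;ring.
 by rewrite normrM (gtr0_norm hi0) ler_wpM2l// ltW.
have Cb (x : R) : `|x-W p0/half| <= (1+half^-1) * rho -> `|x-q*(2/sig2 * stw t)| <= (1+3 * half^-1) * rho.
 move=> hx;have ->: x-q*(2/sig2 * stw t) = (x-W p0/half)+(W p0/half-q*(2/sig2 * stw t)) by ring.
 apply: (le_trans (ler_normD _ _)).
 have ->: (1+3 * half^-1) * rho = (1+half^-1) * rho+half^-1*(2 * rho) by ring.
 exact: lerD.
have m0n: (m0 <= n.-1.*2)%N by rewrite -m0E geq_minr.
have m0h: (m0 <= p0.*2.+2)%N by exact: leqW.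
apply/andP;split;apply: scale1.
 apply: (le_via ((1+3 * half^-1) * rho));last by apply: cK;have:= hi0;have:= na0;lra.
 apply: Cb;rewrite /contour (nvert_forest Tf) m1E nE.
 have tE: (2 * n.-1)%:R = 2*(n%:R-1) :> R by rewrite natrM npred.
 case: ifPn=> [le|];last first.
  rewrite -ltNge tE -mulrA=> lt;have pn1: p0 = n.-1.
   rewrite -p0E;apply/minn_idPr;rewrite -ltnS -(ltr_nat R) npred -natr1.
   by case/andP: pitv=> ? ?;lra.
  have bn: (n.-1 <= n)%N by exact: leq_pred.
  have nL: (n <= n.-1+L)%N by rewrite -{1}(prednK n_gt0) -addn1 leq_add2l.
  have:= winW bn (leqnn n) nL;rewrite Wn -pn1=> hW.
  rewrite sub0r normrN normrM (gtr0_norm hi0);apply: (le_via (rho * half^-1)).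
   rewrite ler_wpM2r ?(ltW hi0)//;move: hW;rewrite !ler_norml=> /andP[? ?];apply/andP;split;lra.
  by rewrite mulrC ler_wpM2r ?(le_trans ler01 rho1)// lerDr.
 have m1n: (m1 <= n.-1.*2)%N.
  rewrite -mul2n -(ler_nat R);case/andP: mitv=> h _;apply: le_trans h _;by rewrite mulrA.
 have mm: m0 = m1 by rewrite -m0E;exact/minn_idPl.
 have c1:= near1 _ m0_lo m0h m0n;rewrite mm in c1.
 have th: 0 <= 2 * n%:R * t-m1%:R <= 1 by case/andP: mitv=> ? ?;rewrite -mulrA;apply/andP;split;lra.
 move: m1n;rewrite leq_eqVlt=> /predU1P[mE|mlt].
  have ->: 2 * n%:R * t-m1%:R = 0.
   apply/eqP;rewrite eq_le (proj1 (andP th)) andbT subr_le0 mE -mul2n;exact: le.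
  by rewrite mul0r addr0.
 apply: convex_dist=> //;apply: near1=> //.
 - by apply: leqW;rewrite -mm.
 - by rewrite ltnS -mm.
have [_ [b [bN pb bn bL bC]]]:= contour_near p0n m0_lo m0h m0n erefl.
have c1:= Cb _ (near1 _ m0_lo m0h m0n).
have ->: Ncount A T m1 = Ncount A T m0.
 by rewrite /Ncount -m0E (nvert_forest Tf) nE mul2n -minnA minnn.
rewrite bN;move: (size (contour_vtx T m0))%:R c1 bC=> Cm c1 bC.
have:= sum_etaA (take b s);rewrite -/(psums etaA s b) -/(psums zeta s b) size_takel ?ss// => GE.
have w1:= winW pb bn bL;have w2:= winG pb bn bL.
have Wd: `|W b-q * stw t| <= 3 * rho.
 have ->: W b-q * stw t = (W b-W p0)+(W p0-q * stw t) by ring.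
 apply: (le_trans (ler_normD _ _));lra.
have Gd: `|G b-q * stg t| <= 3 * rho.
 have ->: G b-q * stg t = (G b-G p0)+(G p0-q * stg t) by ring.
 apply: (le_trans (ler_normD _ _));lra.
(* The count of visited A-vertices is G b + a W b + b muA. As b exceeds n t by about half the
   height, that is by W/sigma^2, the slope rises from [a] to a + muA/sigma^2. *)
have ->: (count [in A] (take b s))%:R-n%:R * t * muA-q*((a+muA/sig2) * stw t+stg t) =
 (G b-q * stg t)+(a*(W b-q * stw t)+muA*((b%:R-p0%:R-Cm/2)+(p0%:R-n%:R * t)+(Cm-q*(2/sig2 * stw t))/2)).
 by rewrite GE;field;rewrite lt0r_neq0.
apply: (le_trans (ler_normD _ _));apply: (le_via (3 * rho+(3 * `|a| * rho+muA*((6+3 * half^-1) * rho)))).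
 apply: lerD=> //;apply: (le_trans (ler_normD _ _));apply: lerD.
  by rewrite normrM mulrAC [3 * _ * _]mulrC ler_wpM2l.
 rewrite normrM (ger0_norm muA0) ler_wpM2l//.
 have c2: `|(Cm-q*(2/sig2 * stw t))/2| <= (1+3 * half^-1) * rho.
  rewrite normrM (ger0_norm (_ : 0 <= 2^-1)) ?invr_ge0//;apply: le_trans c1.
  by rewrite ler_piMr//;lra.
 apply: (le_trans (ler_normD _ _));have h3:= ler_normD (b%:R-p0%:R-Cm/2) (p0%:R-n%:R * t).
 have h4:= p0t;have h5:= rho1;have ->: (6+3 * half^-1) * rho = 5 * rho+(1+3 * half^-1) * rho by ring.
 lra.
have ->: 3 * rho+(3 * `|a| * rho+muA*((6+3 * half^-1) * rho)) = (3+3 * `|a| + muA*(6+3 * half^-1)) * rho by ring.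
apply: cK;have:= hi0;lra.
Qed.
End Time.
End Closeness.

(** * Cadlag regularity of the coding processes *)

Section ProcessPaths.
Context {R : realType}.
Implicit Types f g : R -> R.

Lemma cadlag1_ext f g : (forall t, 0 <= t -> f t = g t) -> cadlag1 g -> cadlag1 f.
move=> fg [g1 g2];split=> t /andP[t0 t1].
 rewrite fg//;apply: cvg_trans (g1 t _);last by rewrite t0.
 apply: near_eq_cvg;near=> x;rewrite fg//.
 by apply: (le_trans t0);apply: ltW;near: x;exact: nbhs_right_gt.
have [|l hl]:= g2 t;first by rewrite t0.
exists l;apply: cvg_trans hl;apply: near_eq_cvg;near=> x;rewrite fg//.
by apply: ltW;near: x;exact: nbhs_left_gt.
Unshelve. all: end_near. Qed.

Lemma cadlag1M f g : cadlag1 f -> cadlag1 g -> cadlag1 (fun t => f t * g t).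
move=> [f1 f2] [g1 g2];split=> t ht;first by apply: cvgM;[exact: f1|exact: g1].
have [l hl]:= f2 t ht;have [m hm]:= g2 t ht.
by exists (l * m);exact: cvgM.
Qed.

Lemma cadlag1_id : cadlag1 (fun t : R => t).
Proof. by split=> t _;[|exists t];apply: cvg_within. Qed.

Lemma cadlag1_step (h : nat -> R) (c : R) : 0 <= c -> cadlag1 (fun t => h (truncn (c * t))).
rewrite le_eqVlt=> /predU1P[<-|c0].
 apply: (@cadlag1_ext _ (fun=> h 0%N))=> [t _|];first by rewrite mul0r truncn0.
 by split=> t _;[|exists (h 0%N)];exact: cvg_cst.
split=> t /andP[t0 t1].
 have /andP[m1 m2]:= truncn_itv (mulr_ge0 (ltW c0) t0);set m:= truncn (c * t) in m1 m2 *.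
 apply: cvg_near_cst;near=> x;congr h;apply: truncn_def;apply/andP;split.
  by apply: (le_trans m1);rewrite ler_pM2l//;apply: ltW;near: x;exact: nbhs_right_gt.
 rewrite mulrC -ltr_pdivlMr//;near: x;apply: nbhs_right_lt.
 by rewrite ltr_pdivlMr// mulrC.
have ct: 0 < c * t by rewrite mulr_gt0.
have [m /andP[m1 m2]] : exists m : nat, m%:R < c * t <= m.+1%:R.
 have /andP[h1 h2]:= truncn_itv (ltW ct).
 move: h1;rewrite le_eqVlt=> /predU1P[h1|h1];last by exists (truncn (c * t));rewrite h1 ltW.
 case: (truncn (c * t)) h1=> [h1|m h1];first by rewrite -h1 ltxx in ct.
 by exists m;rewrite -h1 lexx ltr_nat ltnSn.
exists (h m);apply: cvg_near_cst;near=> x;congr h;apply: truncn_def;apply/andP;split.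
 rewrite mulrC -ler_pdivrMr//;apply: ltW;near: x;apply: nbhs_left_gt.
 by rewrite ltr_pdivrMr// mulrC.
apply: lt_le_trans m2;rewrite ltr_pM2l//;near: x;exact: nbhs_left_lt.
Unshelve. all: end_near. Qed.

Variables (A : set nat) (muA : R).

Lemma cadlag_WK n T : cadlag (WK_proc A muA n T : R -> R * R).
apply: cadlag_pair.
 exact: (@cadlag1_step (fun j=> luka T j/sqn n)).
apply: (@cadlag1_ext _ (fun t=> (Kcount A T (truncn (n%:R * t)))%:R/sqn n + - (n%:R * muA/sqn n) * t)).
 by move=> t _;ring.
apply: cadlag1D;first exact: (@cadlag1_step (fun j=> (Kcount A T j)%:R/sqn n)).
exact/cadlag1Z/cadlag1_id.
Qed.

(** Linear interpolation is put in the form u + x v with step functions u and v, so that regularity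
    follows from sums and products. *)
Lemma contour_affine (T : {fset word}) (f : forest) (x : R) (S := (fsize f).*2) : T =i tree_words f -> 0 <= x ->
  let h k : R := contour_ht T k in
  contour T x = (if (truncn x < S)%N then h (truncn x) - (truncn x)%:R * (h (truncn x).+1 - h (truncn x)) else 0) +
    x * (if (truncn x < S)%N then h (truncn x).+1 - h (truncn x) else 0).
move=> Tf x0 h;have /andP[k1 k2]:= truncn_itv x0.
rewrite /contour (nvert_forest Tf) /= mul2n -/S;set k:= truncn x in k1 k2 *.
case: ltnP=> kS.
 have ->: x <= S%:R by apply: (le_trans (ltW k2));rewrite ler_nat.
 rewrite -/h;ring.
rewrite mulr0 addr0;case: ifP=> // xS.
have Sk: S%:R <= k%:R :> R by rewrite ler_nat.
have xE: x = S%:R by apply/eqP;rewrite eq_le xS (le_trans Sk k1).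
have ->: k = S by rewrite /k xE natrK.
rewrite xE subrr mul0r addr0 /contour_ht.
have [b [/andP[b0 bS] bC _ _ _]]:= contour_state A Tf (leqnn S).
have : (b.-1.*2 <= S)%N by rewrite leq_double -ltnS prednK.
by rewrite -bC -[leqRHS]add0n leq_add2r leqn0=> /eqP ->.
Qed.

Lemma cadlag_CN n (f : forest) : cadlag (CN_proc A muA n (forest_tree f) : R -> R * R).
have c0: 0 <= 2 * n%:R :> R by rewrite mulr_ge0.
apply: cadlag_pair.
 pose h k : R:= contour_ht (forest_tree f) k;pose S:= (fsize f).*2.
 pose u k:= if (k < S)%N then h k-k%:R*(h k.+1-h k) else 0.
 pose v k:= if (k < S)%N then h k.+1-h k else 0.
 apply: (@cadlag1_ext _ (fun t=> (sqn n)^-1*(u (truncn (2 * n%:R * t))+(2 * n%:R) * t * v (truncn (2 * n%:R * t))))).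
  by move=> t t0;rewrite (contour_affine (forest_treeE f)) ?mulr_ge0// mulrC.
 apply: cadlag1Z;apply: cadlag1D;first exact: cadlag1_step.
 by apply: cadlag1M;[apply: cadlag1Z;exact: cadlag1_id|exact: cadlag1_step].
apply: (@cadlag1_ext _ (fun t=> (Ncount A (forest_tree f) (truncn (2 * n%:R * t)))%:R/sqn n + - (n%:R * muA/sqn n) * t)).
 by move=> t _;ring.
apply: cadlag1D;first exact: (@cadlag1_step (fun j=> (Ncount A (forest_tree f) j)%:R/sqn n)).
exact/cadlag1Z/cadlag1_id.
Qed.

Lemma tree_of_forest s : exists f : forest, tree_of s = forest_tree f.
Proof. by rewrite /tree_of;case: pselect=> [h|_];[exists (projT1 (cid h))|exists FNil]. Qed.
End ProcessPaths.

Lemma osc_mono {R : realType} (f : nat -> R) L L' lam s : (L <= L')%N -> osc f L lam s -> osc f L' lam s.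
move=> LL /hasP[i is_ /hasP[l lL h]];apply/hasP;exists i=> //;apply/hasP;exists l=> //.
by move: lL;rewrite !mem_iota /= !add0n !ltnS=> /leq_trans;apply.
Qed.

(** * Joint convergence for a given offspring law *)

Section Convergence.
Context {R : realType}.
Variable (mu : nat -> R) (A : set nat) (muA m1 sg V1 : R).
Hypothesis crit : critical_law mu V1 (sg ^+ 2).
Hypothesis muA0 : 0 <= muA.
Hypothesis sg0 : 0 < sg.
Notation sig2 := (sg ^+ 2).
Notation a := (m1 / sig2).
Notation eta := (etaA A muA a).
Notation gam2 := (muA * (1 - muA) - m1 ^+ 2 / sig2).
Hypothesis cvg_A : mlim mu (fun k => (k \in A)%:R) muA.
Hypothesis cvg_Az : mlim mu (fun k => (k \in A)%:R * (k%:R - 1)) m1.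

Let sig2_gt0 : 0 < sig2. Proof. exact: exprn_gt0. Qed.

Lemma msumD f g N : msum mu (fun k => f k + g k) N = msum mu f N + msum mu g N.
Proof. by rewrite /msum -big_split;apply: eq_bigr=> k _;rewrite mulrDr. Qed.

Lemma msumZ c f N : msum mu (fun k => c * f k) N = c * msum mu f N.
Proof. by rewrite /msum mulr_sumr;apply: eq_bigr=> k _;rewrite mulrCA. Qed.

Lemma msum_lin f g c x y : mlim mu f x -> mlim mu g y ->
  msum mu (fun k => f k + c * g k) N @[N --> \oo] --> x + c * y.
move=> h1 h2;have ->: msum mu (fun k=> f k+c * g k) = (fun N=> msum mu f N+c * msum mu g N).
 by apply/funext=> N;rewrite msumD msumZ.
by apply: cvgD=> //;apply: cvgMr.
Qed.

Lemma msum_ext f g (x : R) : mlim mu f x -> f =1 g -> mlim mu g x.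
Proof. by move=> h /funext <-. Qed.

Lemma cvg_etaA : mlim mu eta (0 : R).
have:= @msum_lin _ _ (- a) _ _ (@msum_lin _ _ (- muA) _ _ cvg_A (law_one crit)) (law_zeta crit).
have ->: muA + - muA*1 + - a*0 = 0 by ring.
move/msum_ext;apply=> k;rewrite /etaA /zeta;ring.
Qed.

Lemma cvg_zeta_etaA : mlim mu (fun k => (k%:R - 1) * eta k) (0 : R).
have:= @msum_lin _ _ (- a) _ _ (@msum_lin _ _ (- muA) _ _ cvg_Az (law_zeta crit)) (law_zeta2 crit).
have ->: m1 + - muA*0 + - a * sig2 = 0 by field;rewrite lt0r_neq0.
move/msum_ext;apply=> k;rewrite /etaA /zeta;ring.
Qed.

(** Expand the square, an indicator being its own square; the choice of the slope turns the terms in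
    m1 into - m1^2/sigma^2. *)
Lemma cvg_etaA2 : mlim mu (fun k => eta k ^+ 2) gam2.
have h:= @msum_lin _ _ (- (2 * a)) _ _ (@msum_lin _ _ (1-2 * muA) _ _ (@msum_lin _ _ (muA^+2) _ _
 (@msum_lin _ _ (a^+2) _ _ (@msum_lin _ _ (2 * muA * a-1) _ _ (law_zeta crit) (law_zeta crit)) (law_zeta2 crit)) (law_one crit)) cvg_A) cvg_Az.
have:= h;have ->: 0+(2 * muA * a-1)*0+a^+2 * sig2+muA^+2*1+(1-2 * muA) * muA + - (2 * a) * m1 = gam2.
 by field;rewrite lt0r_neq0.
move/msum_ext;apply=> k;rewrite /etaA /zeta;case: (k \in A)=> /=;ring.
Qed.

Lemma etaA_var_ge0 : 0 <= gam2.
have:= msum_lim_ge (law_ge0 crit) 0 _ cvg_etaA2;rewrite /msum big_ord0;apply=> k;exact: sqr_ge0.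
Qed.

Lemma etaA_le k : `|eta k| <= (1 + `|muA| + `|a|) * k.+1%:R.
have k1: 1 <= k.+1%:R :> R by rewrite -[1]/(1%:R) ler_nat.
apply: (le_trans (ler_normB _ _));rewrite mulrDl;apply: lerD.
 apply: (le_trans (ler_normB _ _));rewrite mulrDl;apply: lerD;last by rewrite ler_peMr.
 by rewrite mul1r normr_nat;apply: le_trans k1;case: (k \in A).
by rewrite normrM ler_wpM2l//;have:= @zeta_le R k;rewrite mul1r.
Qed.

Let X1 n s : R -> R * R := WK_proc A muA n (tree_of s).
Let X2 n s : R -> R * R := CN_proc A muA n (tree_of s).
Notation b := (2 / sig2).
Notation c := (a + muA / sig2).

(** Four bad events share [ep]: oscillation of the walk, oscillation of the additive functional,
    height far from the walk, large maximum of the walk. The mesh [k] only has to exceed a threshold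
    set by the two oscillation windows. *)
Lemma close_event ep : 0 < ep -> exists k0, forall k, (k0 <= k)%N ->
  \forall n \near \oo, treeE mu n (fun s => \1_(~` [set s | stepclose a b c X1 X2 (coords eta) k n ep s]) s) <= ep.
move=> ep0;have K0: 0 < closec muA a sig2.
 have h1: 0 <= (muA+1)*(6+3*(sig2/2)^-1).
  by rewrite mulr_ge0 ?addr_ge0// mulr_ge0// invr_ge0 divr_ge0// ltW.
 by have h2:= normr_ge0 a;rewrite /closec;move: h1;move: ((muA+1) * _)=> x;lra.
pose e1:= ep/(2 * closec muA a sig2);have e10: 0 < e1 by rewrite divr_gt0// mulr_gt0.
have ep4: 0 < ep/4 by rewrite divr_gt0.
have [dz /andP[dz0 dz1] hz]:= excursion_osc crit sig2_gt0 (@zeta_le R) (law_zeta crit) (law_zeta2 crit) e10 ep4.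
have [de /andP[de0 de1] he]:= excursion_osc crit sig2_gt0 etaA_le cvg_etaA cvg_etaA2 e10 ep4.
have [M M0 hM]:= max_tight crit sig2_gt0 (@zeta_le R) (law_zeta crit) (law_zeta2 crit) ep4.
have hw:= height_walk sig2_gt0 crit e10 ep4.
pose d:= Num.min dz de;have d0: 0 < d by rewrite lt_min dz0.
exists (truncn (2/d)).+1=> k kk.
have kd: 2/d <= k%:R.
 have /andP[_ h]:= truncn_itv (ltW (divr_gt0 (ltr0Sn R 1) d0)).
 by apply: (le_trans (ltW h));rewrite ler_nat.
have k0: (0 < k)%N by apply: leq_trans kk.
have tg:= treeP_gt0 crit sig2_gt0.
have av:= treeE_average crit sig2_gt0.
near=> n.
have t0: 0 < treeP mu n by near: n.
have n0: (0 < n)%N by near_nat n.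
have n0': 0 < n%:R :> R by rewrite ltr0n.
have q0: 0 < sqn n :> R by rewrite sqrtr_gt0.
have q1: 1 <= sqn n :> R by near_nat n.
have [ED EZ Ele E1] : average (treeE mu n) by near: n.
set L:= truncn (d * n%:R).
have dn0: 0 <= d * n%:R by rewrite mulr_ge0// ltW.
have Lhi: d * n%:R-1 <= L%:R by have /andP[_]:= truncn_itv dn0;rewrite -/L -natr1;lra.
have bz: treeE mu n (fun s=> (osc zeta (truncn (dz * n%:R)) (e1 * sqn n) s)%:R) <= ep/4.
 by apply: treeE_event=> //;near: n;exact: hz.
have be: treeE mu n (fun s=> (osc eta (truncn (de * n%:R)) (e1 * sqn n) s)%:R) <= ep/4.
 by apply: treeE_event=> //;near: n;exact: he.
have bw: treeE mu n (fun s=> (dev_ev sig2 e1 n s)%:R) <= ep/4.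
 by apply: treeE_event=> //;near: n;exact: hw.
have bM: treeE mu n (fun s=> (maxev zeta M n s)%:R) <= ep/4 by near: n;exact: hM.
have Lz: (L <= truncn (dz * n%:R))%N by apply: le_truncn;rewrite ler_pM2r// ge_min lexx.
have Le: (L <= truncn (de * n%:R))%N by apply: le_truncn;rewrite ler_pM2r// ge_min lexx orbT.
have Lk: n%:R/k%:R+2 <= L%:R :> R.
 have h1: n%:R/k%:R <= d * n%:R/2.
  rewrite ler_pdivrMr ?ltr0n//;have h:= ler_wpM2r (ltW (mulr_gt0 d0 n0')) kd.
  have ->: n%:R = 2/d*(d * n%:R)/2 :> R by field;rewrite lt0r_neq0.
  have ->: d*(2/d*(d * n%:R)/2)/2 * k%:R = k%:R*(d * n%:R)/2 by field;rewrite lt0r_neq0.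
  by rewrite ler_pM2r.
 have h2: 6 <= d * n%:R by rewrite -ler_pdivrMl//;near: n;exact: nbhs_infty_ger.
 move: Lhi h1 h2;move: (d * n%:R) (n%:R/k%:R)=> x y;lra.
have Lc: (M/(sig2/2)+e1) * sqn n/2+3 <= L%:R.
 set X:= M/(sig2/2)+e1.
 have X0: 0 < X by rewrite addr_gt0// divr_gt0// divr_gt0.
 have h: (X/2+4)/d <= sqn n by near_nat n.
 rewrite ler_pdivrMr// in h.
 have h2: (X/2+4) * sqn n <= d * n%:R.
  by rewrite -{2}(@sqr_sqrtr R n%:R)// expr2 mulrA ler_pM2r// [d * _]mulrC.
 clearbody X.
 have h3: X * sqn n/2+4 <= (X/2+4) * sqn n.
  rewrite mulrDl mulrAC lerD2l ler_peMr//;lra.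
 lra.
apply: (le_via (treeE mu n (fun s=> (osc zeta (truncn (dz * n%:R)) (e1 * sqn n) s)%:R +
  ((osc eta (truncn (de * n%:R)) (e1 * sqn n) s)%:R+((dev_ev sig2 e1 n s)%:R+(maxev zeta M n s)%:R)))));last first.
 rewrite !ED;have ->: ep = ep/4+(ep/4+(ep/4+ep/4)) by field.
 by apply: lerD=> //;apply: lerD=> //;apply: lerD.
apply: (treeE_le crit)=> // s hs ss;rewrite indicE;apply: or4_le;rewrite inE /=;apply: contra_notT.
rewrite 3!negb_or=> /and4P[G1 G2 G3 G4].
have [f fs tE]:= hits_tree hs.
have gz: ~~ osc zeta L (e1 * sqn n) s by apply: contra G1;exact: osc_mono.
have ge: ~~ osc eta L (e1 * sqn n) s by apply: contra G2;exact: osc_mono.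
have nE: (fsize f).+1 = n by rewrite -ss -fs size_tree_degrees.
have Tf:= forest_treeE f.
have small: closec muA a sig2*((e1 * sqn n+1)/sqn n) <= ep.
 have ->: ep = closec muA a sig2*(e1+e1) by rewrite /e1;field;rewrite lt0r_neq0.
 rewrite ler_pM2l// mulrDl mulfK ?lt0r_neq0// lerD2l mul1r -[leRHS]invrK lef_pV2 ?posrE ?invr_gt0//.
 by near_nat n.
split=> t t01;apply: le_trans small;rewrite /X1 /X2 tE.
 exact: (WK_close sig2_gt0 muA0 Tf fs nE erefl k0 (ltW e10) gz ge Lk t01 erefl erefl).
have h:= CN_close sig2_gt0 muA0 Tf fs nE erefl k0 (ltW e10) gz ge G3 G4 Lc Lk t01 erefl erefl erefl erefl.
 exact: h.
Unshelve. all: end_near. Qed.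

Context {dd : measure_display} {Omega : measurableType dd}.
Variables (P : probability Omega R) (e B : Omega -> R -> R).
Hypothesis exc : is_norm_excursion P e.
Hypothesis bm : is_std_BM P B.
Hypothesis ind : indep_processes P e B.
Variable gam : R.
Hypothesis gamE : gam ^+ 2 = gam2.

Theorem tree_invariance F : bdd_cont_DD F ->
  let Y1 o := path1 a (fun t => sg * e o t) (fun t => gam * B o t) in
  let Y2 o := path2 b c (fun t => sg * e o t) (fun t => gam * B o t) in
  bmfun (fun o => F (Y1 o) (Y2 o)) /\
  treeE mu n (fun s => F (X1 n s) (X2 n s)) @[n --> \oo] --> Ex P (fun o => F (Y1 o) (Y2 o)).
move=> cF;have [mB B0 cB _ _]:= bm;have [me e01 ce _]:= exc.
apply: (@portmanteau R dd Omega P (fun o t=> sg * e o t) (fun o t=> gam*B o t) a b c _ _ _ _ _ _ _ _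
 (treeE mu) X1 X2 (coords eta))=> //.
- by move=> t;apply: measurable_funM.
- by move=> t;apply: measurable_funM.
- move=> o t;apply: cvgMr;exact: ce.
- move=> o t;apply: cvgMr;have:= continuous_subspaceW _ (cB o);apply.
 by move=> x /=;rewrite !in_itv /= => /andP[->].
- by move=> o;have [-> _]:= e01 o;rewrite mulr0.
- by move=> o;have [_ ->]:= e01 o;rewrite mulr0.
- by move=> o;rewrite B0 mulr0.
- exact: (treeE_average crit sig2_gt0).
- move=> n s;split;first exact: cadlag_WK.
 by rewrite /X2;have [f ->]:= tree_of_forest s;exact: cadlag_CN.
- exact: close_event.
- move=> k L M Phi k0 L0 M0 lip bd.
 exact: (coords_fdd crit sig2_gt0 etaA_le cvg_etaA cvg_etaA2 cvg_zeta_etaA exc bm ind gamE erefl sg0 k0 L0 M0 lip bd).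
Qed.
End Convergence.

Section SeriesForm.
Context {R : realType}.
Variables (mu : nat -> R) (A : set nat).
Hypothesis mu_ge0 : forall k, 0 <= mu k.

Lemma series_msum (g : nat -> R) : series (fun i => g i * mu i) = msum mu g.
apply/funext=> N;rewrite /series /= big_mkord /msum;apply: eq_bigr=> i _;exact: mulrC.
Qed.

Lemma sumA_msum (g : nat -> R) (C x : R) : 0 <= C -> (forall i, `|g i| <= C * i.+1%:R) ->
  mlim mu (fun i => i.+1%:R) x ->
  msum mu (fun i => (i \in A)%:R * g i) N @[N --> \oo] --> sumA A (fun i => g i * mu i).
move=> C0 gC h;rewrite /sumA -series_msum.
rewrite (_ : (fun i=> if i \in A then g i * mu i else 0) = (fun i=> (i \in A)%:R * g i * mu i));last first.
 by apply/funext=> i;case: (i \in A);rewrite ?mul1r ?mul0r.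
apply: normed_cvg;apply: (@series_le_cvg _ _ (fun i=> C * i.+1%:R * mu i))=> [i|i|i|].
- exact: normr_ge0.
- by rewrite mulr_ge0// mulr_ge0.
- rewrite /= normrM (ger0_norm (mu_ge0 i)) ler_wpM2r//;apply: le_trans (gC i).
 by rewrite normrM;case: (i \in A);rewrite ?normr1 ?normr0 ?mul1r// mul0r.
- rewrite series_msum;apply/cvg_ex;exists (C * x).
 by have ->: msum mu (fun i=> C * i.+1%:R) = (fun N=> C * msum mu (fun i=> i.+1%:R) N);[apply/funext=> N;exact: msumZ|apply: cvgMr].
Qed.
End SeriesForm.

Unset Implicit Arguments.
Set Strict Implicit.

Theorem theorem1p1 (R : realType) (mu : nat -> R) (sigma : R) (A : set nat)
  (d1 : measure_display) (Omega1 : measurableType d1) (P1 : probability Omega1 R)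
  (N0 : nat) (Tn : nat -> Omega1 -> {fset word})
  (d2 : measure_display) (Omega2 : measurableType d2) (P2 : probability Omega2 R)
  (e B : Omega2 -> R -> R) :
  (* offspring distribution: critical, finite variance sigma^2 > 0, non-lattice *)
  (forall i, 0 <= mu i) ->
  series mu @ \oo --> (1 : R) ->
  series (fun i => i%:R * mu i) @ \oo --> (1 : R) ->
  0 < sigma ->
  series (fun i => (i%:R - 1) ^+ 2 * mu i) @ \oo --> (sigma ^+ 2 : R) ->
  nonlattice [set i | 0 < mu i] ->
  (* T_n: mu-GW tree conditioned to have n vertices (for n >= N0) *)
  (forall n, (N0 <= n)%N ->
     [/\ (forall w, is_plane_tree (Tn n w) /\ nvert (Tn n w) = n),
         (forall T, measurable [set w | Tn n w = T]) &
         exists c : R, forall T, is_plane_tree T -> nvert T = n ->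
           P1 [set w | Tn n w = T] = (c * gw_weight mu T)%:E]) ->
  (* the set A *)
  0 < sumA A mu ->
  (* e normalized Brownian excursion, B standard BM independent of e *)
  is_norm_excursion P2 e -> is_std_BM P2 B -> indep_processes P2 e B ->
  let muA := sumA A mu in
  let m1 := sumA A (fun i => (i%:R - 1) * mu i) in
  let m2 := sumA A (fun i => i%:R * mu i) in
  let gammaA := Num.sqrt (muA * (1 - muA) - sigma ^- 2 * m1 ^+ 2) in
  let X1 := fun n w => WK_proc A muA n (Tn n w) in
  let X2 := fun n w => CN_proc A muA n (Tn n w) in
  let Y1 := fun w (t : R) => (sigma * e w t, m1 / sigma * e w t + gammaA * B w t) in
  let Y2 := fun w (t : R) => (2 / sigma * e w t, m2 / sigma * e w t + gammaA * B w t) in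
  (* (i) *)
  (forall F, bdd_cont_D F ->
     (fun n => \int[P1]_w (F (X1 n w))%:E)%E @ \oo --> (\int[P2]_w (F (Y1 w))%:E)%E) /\
  (* (ii), jointly with (i) *)
  (forall F, bdd_cont_DD F ->
     (fun n => \int[P1]_w (F (X1 n w) (X2 n w))%:E)%E @ \oo -->
       (\int[P2]_w (F (Y1 w) (Y2 w))%:E)%E).
Proof.
move=> mu_ge0 s0 s1 sg0 s2 nl hT muA0 exc bm ind muA m1 m2 gammaA X1 X2 Y1 Y2.
(* A functional of the first path is a functional of both, so the joint statement contains the first
   one. *)
suff main F: bdd_cont_DD F -> (fun n=> \int[P1]_w (F (X1 n w) (X2 n w))%:E)%E @ \oo -->
    (\int[P2]_w (F (Y1 w) (Y2 w))%:E)%E.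
 split=> // F [[M bF] cF]; apply: (main (fun x1 _=> F x1)); split.
  by exists M=> x1 x2 c1 _; exact: bF.
 move=> x1 x2 c1 _ ep ep0; have [dl dl0 h] := cF x1 c1 ep ep0.
 by exists dl=> // y1 y2 k1 _ j1 _; exact: h.
move=> cF.
have cvg1: mlim mu (fun=> 1) (1 : R).
 have -> // : msum mu (fun=> 1) = series mu by rewrite -series_msum; congr series; apply/funext=> i; rewrite mul1r.
have cvgk: mlim mu (fun i=> i%:R) (1 : R) by rewrite -series_msum.
have cvg_zeta2: msum mu (fun k=> (k%:R - 1)^+2) N @[N --> \oo] --> sigma^+2 by rewrite -series_msum.
have cvg_zeta: mlim mu (fun k=> k%:R - 1) (0 : R).
 have := @msum_lin _ _ _ _ (- 1) _ _ cvgk cvg1; have -> : 1 + -1*1 = 0 :> R by ring.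
 by move/msum_ext; apply=> k; ring.
have cvg_S: mlim mu (fun k=> k.+1%:R) (1 + 1*1 : R).
 by have := @msum_lin _ _ _ _ 1 _ _ cvgk cvg1; move/msum_ext; apply=> k; rewrite -natr1; ring.
(* (k + 1)^2 = (k - 1)^2 + 4k. *)
have cvg_sq: mlim mu (fun k=> k.+1%:R^+2) (sigma^+2 + 4*1).
 by have := @msum_lin _ _ _ _ 4 _ _ cvg_zeta2 cvgk; move/msum_ext; apply=> k; rewrite -natr1; ring.
have one_le (i : nat) : 1 <= i.+1%:R :> R by rewrite -[1]/(1%:R) ler_nat.
have cvg_A: mlim mu (fun k=> (k \in A)%:R) muA.
 have := @sumA_msum _ mu A mu_ge0 (fun=> 1) 1 _ ler01 _ cvg_S; rewrite /muA.
 have -> : (fun i=> 1 * mu i) = mu by apply/funext=> i; rewrite mul1r.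
 have h1 (i : nat) : `|1 : R| <= 1 * i.+1%:R by rewrite normr1 mul1r.
 by move=> h; apply: (msum_ext (h h1))=> k; rewrite mulr1.
have cvg_Az: mlim mu (fun k=> (k \in A)%:R*(k%:R - 1)) m1.
 by apply: (@sumA_msum _ mu A mu_ge0 (fun k=> k%:R - 1) 1 _ ler01 _ cvg_S); exact: zeta_le.
have cvg_Ak: mlim mu (fun k=> (k \in A)%:R * k%:R) m2.
 apply: (@sumA_msum _ mu A mu_ge0 (fun k=> k%:R) 1 _ ler01 _ cvg_S)=> i.
 by rewrite mul1r normr_nat ler_nat.
(* This identity turns the slope found for the contour count, m1/sigma^2 + muA/sigma^2 in terms of
   the walk, into the stated one. *)
have m2E: m2 = m1 + 1 * muA.
 have := @msum_lin _ _ _ _ 1 _ _ cvg_Az cvg_A.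
 move/(@msum_ext _ _ _ (fun k=> (k \in A)%:R * k%:R))=> h.
 apply: (cvg_unique _ cvg_Ak (h _))=> // k; ring.
have ctrl: controlled mu 1 := controlled_unit mu_ge0 cvg1 nl.
have crit := CriticalLaw mu_ge0 cvg1 cvg_sq cvg_zeta cvg_zeta2 ctrl.
have g0 := etaA_var_ge0 crit sg0 cvg_A cvg_Az.
have gamE: gammaA^+2 = muA*(1 - muA) - m1^+2/sigma^+2.
 by rewrite /gammaA [_ ^- 2 * _]mulrC sqr_sqrtr.
have [bY cY] := tree_invariance crit (ltW muA0) sg0 cvg_A cvg_Az exc bm ind gamE cF.
have Y1E w: path1 (m1/sigma^+2) (fun t=> sigma * e w t) (fun t=> gammaA*B w t) = Y1 w.
 by apply/funext=> t; rewrite /path1 /Y1; congr (_, _ + _); field; rewrite lt0r_neq0.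
have Y2E w: path2 (2/sigma^+2) (m1/sigma^+2 + muA/sigma^+2) (fun t=> sigma * e w t) (fun t=> gammaA*B w t) = Y2 w.
 apply/funext=> t; rewrite /path2 /Y2 m2E; congr (_, _ + _); by field; rewrite lt0r_neq0.
have YE: (fun o=> F (path1 (m1/sigma^+2) (fun t=> sigma * e o t) (fun t=> gammaA*B o t))
  (path2 (2/sigma^+2) (m1/sigma^+2 + muA/sigma^+2) (fun t=> sigma * e o t) (fun t=> gammaA*B o t))) = (fun o=> F (Y1 o) (Y2 o)).
 by apply/funext=> o; rewrite Y1E Y2E.
rewrite YE in bY cY; rewrite (ExE P2 bY).
have XE: \forall n \near \oo, (\int[P1]_w (F (X1 n w) (X2 n w))%:E)%E =
  (treeE mu n (fun s=> F (WK_proc A muA n (tree_of s)) (CN_proc A muA n (tree_of s))))%:E.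
 near=> n; have nN: (N0 <= n)%N by near_nat n.
 have [Tp Tm [c Tl]] := hT n nN.
 have [bX [_ EX]] := tree_expectation (fun T=> F (WK_proc A muA n T) (CN_proc A muA n T)) Tp Tm Tl.
 by rewrite (ExE P1 bX) EX.
apply: cvg_EFin.
 by near=> n; have -> : (\int[P1]_w (F (X1 n w) (X2 n w))%:E)%E = (treeE mu n (fun s=> F (WK_proc A muA n (tree_of s)) (CN_proc A muA n (tree_of s))))%:E by near: n.
apply: cvg_trans cY; apply: near_eq_cvg; near=> n=> /=.
by have -> : (\int[P1]_w (F (X1 n w) (X2 n w))%:E)%E = (treeE mu n (fun s=> F (WK_proc A muA n (tree_of s)) (CN_proc A muA n (tree_of s))))%:E by near: n.
Unshelve. all: by end_near. Qed.
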